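(* Let $(T,t,s)$ be a bistrong vertical double monad on a monoidal double category $\mathbb D$ such that the vertical transformations $\alpha,\lambda,\rho$ (of $\mathbb D$), $t,s$ and $\mu,\eta$ (of $T$) are invertible and liftable. Then $\mathcal H(\hat T)$ is a bistrong pseudomonad on $\mathcal H(\mathbb D)$, and the Kleisli bicategory $\mathcal H(\mathbb{K}l(\hat T))=\mathrm{Kl}(\mathcal H(\hat T))$ is premonoidal.
   Context: Double categories are strict: objects, 1h-cells (horizontal), 1v-cells (vertical), squares (2-cells). $[a|b|\cdots]$: horizontal composition (left to right), also for 1h-cells; $a/b$: vertical composition ($a$ on top), also for 1v-cells and transformations. $\mathcal H(\mathbb D)$: the horizontal bicategory of objects, 1h-cells and horizontally globular 2-cells (vertical sides identities); $\mathcal H$ is also applied to functors, horizontal transformations and modifications. Pseudodouble functors preserve vertical structure strictly and horizontal composition up to coherent natural invertible compositors/unitors. A vertical strict transformation $\alpha:F\Rightarrow G$ has 1v-components natural in 1v-cells and squares $\alpha_f$ (top $F(f)$, bottom $G(f)$, left $\alpha(A)$, right $\alpha(B)$) compatible with compositors, unitors, 2-cells; invertible if all $\alpha_f$ are vertically invertible. Companion of $u:A\to B$ (vertical): 1h-cell $\hat u:A\to B$ with 2-cells $\varepsilon_u$ (top $\hat u$, left $u$, other sides identities), $\iota_u$ (bottom $\hat u$, right $u$, other sides identities), $[\iota_u|\varepsilon_u]=\mathrm{Id}$, $\iota_u/\varepsilon_u=\mathrm{Id}$. Liftable: all 1v-components have companions. Companion-lift $\hat\alpha$ of an invertible liftable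 vertical strict $\alpha$: the horizontal transformation with components the companions $\hat\alpha(A)$, invertible globular 2-cells $[\iota_{\alpha(A)}|\alpha_f|\varepsilon_{\alpha(B)}]$ and squares $[\mathrm{Id}^{F(u)}/\iota_{\alpha(\tilde A)}|\varepsilon_{\alpha(A)}/\mathrm{Id}^{G(u)}]$; it restricts to a pseudonatural equivalence on $\mathcal H$. An equality $u=v$ of 1v-composites lifts to $[\iota_u|\mathrm{Id}|\varepsilon_v]:\hat v\Rightarrow\hat u$. Monoidal double category: pseudodouble functors $\otimes,I$ and invertible vertical strict $\alpha:(AB)C\to A(BC)$, $\lambda:IA\to A$, $\rho:AI\to A$ satisfying strictly pentagon and unit triangles; with $\alpha,\lambda,\rho$ liftable, $\mathcal H(\mathbb D)$ is a monoidal bicategory via $\hat\alpha,\hat\lambda,\hat\rho$. Vertical double monad: pseudodouble functor $T$ with vertical strict $\mu:TT\Rightarrow T$, $\eta:\mathrm{Id}\Rightarrow T$ satisfying the monad laws strictly; with $\mu,\eta$ invertible and liftable, $\hat T=(T,\hat\mu,\hat\eta)$ is a horizontal double monad and $\mathcal H(\hat T)$ a pseudomonad. Left vertical strength: vertical strict $t_{A,B}:A\otimes T(B)\to T(A\otimes B)$ with $\lambda_{T(A)}=t_{I,A}/T\lambda_A$, $\alpha_{A,B,T(C)}/(At_{B,C})/t_{A,BC}=t_{AB,C}/T(\alpha_{A,B,C})$, $(A\mu_B)/t_{A,B}=t_{A,T(B)}/T(t_{A,B})/\mu_{AB}$, $\eta_{AB}=(A\eta_B)/t_{A,B}$. Right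 vertical strength: vertical strict $s_{A,B}:T(A)\otimes B\to T(A\otimes B)$ with $\rho_{T(A)}=s_{A,I}/T\rho_A$, $\alpha_{T(A),B,C}/s_{A,BC}=(s_{A,B}C)/s_{AB,C}/T(\alpha_{A,B,C})$, $(\mu_AB)/s_{A,B}=s_{T(A),B}/T(s_{A,B})/\mu_{AB}$, $\eta_{AB}=(\eta_AB)/s_{A,B}$. $(T,t,s)$ is (vertically) bistrong if $(t_{A,B}C)/s_{AB,C}/T(\alpha_{A,B,C})=\alpha_{A,T(B),C}/(A\,s_{B,C})/t_{A,BC}$. Kleisli pseudodouble category $\mathbb{K}l(\hat T)$: objects and 1v-cells of $\mathbb D$; 1h-cells $A\to B$ are 1h-cells $f:A\to T(B)$; 2-cells with right side $v$ are 2-cells of $\mathbb D$ with right side $T(v)$; horizontal composition $[f|T(g)|\hat\mu_C]$, $[\phi|T(\psi)|\hat\mu^w]$; identities $\hat\eta_A,\hat\eta^u$. Its horizontal bicategory is the Kleisli bicategory of the pseudomonad $\mathcal H(\hat T)$. Left strength on a pseudomonad $S$ on a monoidal bicategory (Paquet–Saville): a pseudonatural transformation $t_{A,B}:A\otimes S(B)\to S(A\otimes B)$ with invertible modifications $x:[t_{I,A}|S\lambda_A]\Rightarrow\lambda_{S(A)}$, $y:[t_{AB,C}|S\alpha]\Rightarrow[\alpha|At_{B,C}|t_{A,BC}]$, $w:[t_{A,SB}|S(t_{A,B})|\mu_{AB}]\Rightarrow[A\mu_B|t_{A,B}]$, $z:[A\eta_B|t_{A,B}]\Rightarrow\eta_{AB}$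 satisfying the evident coherence axioms: compatibility of $x,y$ with the unit modifications and pentagonator (three), of $w,z$ with the unit and associativity modifications of $S$ (three), of $z$ and $w$ with $x$ (two) and with $y$ (two). Right strengths are mirror images. $S$ is bistrong if it has a left strength $t$, a right strength $s$ and an invertible modification $q$ between $[t_{A,B}C|s_{AB,C}|S(\alpha)]$ and $[\alpha|A\,s_{B,C}|t_{A,BC}]$ compatible with the $z$'s and with the $w$'s of $t$ and $s$ (two axioms). Premonoidal bicategory: bicategory with pseudofunctors $A\ltimes-,-\rtimes B$ agreeing on objects ($=:A\bowtie B$), a unit object $I$, pseudonatural equivalences $\lambda:I\ltimes-\Rightarrow\mathrm{Id}$, $\rho:-\rtimes I\Rightarrow\mathrm{Id}$, $\alpha_{-,B,C}:(-\rtimes B)\rtimes C\Rightarrow-\rtimes(B\bowtie C)$, $\alpha_{A,-,C}:(A\ltimes-)\rtimes C\Rightarrow A\ltimes(-\rtimes C)$, $\alpha_{A,B,-}:(A\bowtie B)\ltimes-\Rightarrow A\ltimes(B\ltimes-)$ all of whose 1-cell components are central, and invertible 2-cells $p_{A,B,C,D},m_{A,B},l_{A,B},r_{A,B}$ forming modifications in each argument, of the same shape as in a monoidal bicategory and subject to the same equations. A 1-cell $f:A\to A'$ is central if equipped with pseudonatural transformations $f\ltimes-:A\ltimes-\Rightarrow A'\ltimes-$ and $-\rtimes f:-\rtimes A\Rightarrow-\rtimes A'$ with $f\ltimes B=f\rtimes B$ and $B\rtimes f=B\ltimes f$.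
   Formalization: The inverses of the 1v-components of α, λ, ρ are also assumed to have companions; without this the companion-lifts of α, λ, ρ need not be equivalences, and H(D) need not be a monoidal bicategory. *)

(* Defs.v *)
From Stdlib Require Import ProofIrrelevance.

Set Implicit Arguments.
Unset Strict Implicit.
Unset Printing Implicit Defensive.

(** * Bicategories *)

(** Data and axioms are kept apart, so that the bicategories, pseudofunctors
    and transformations obtained from a double category can be named before
    their coherence axioms are known.  [comp1] is written in diagrammatic
    order, [assoc f g h : (f;g);h => f;(g;h)], and primed cells are inverses. *)

Record graph1 := {
  ob :> Type;
  hom : ob -> ob -> Type;
  id1 : forall A, hom A A;
  comp1 : forall A B C, hom A B -> hom B C -> hom A C }.

Record twocells (G : graph1) := {
  cell_ : forall A B : G, hom A B -> hom A B -> Type;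
  id2_ : forall (A B : G) (f : hom A B), cell_ f f;
  comp2_ : forall (A B : G) (f g h : hom A B), cell_ f g -> cell_ g h -> cell_ f h;
  hc2_ : forall (A B C : G) (f f' : hom A B) (g g' : hom B C),
    cell_ f f' -> cell_ g g' -> cell_ (comp1 f g) (comp1 f' g');
  assoc_ : forall (A B C D : G) (f : hom A B) (g : hom B C) (h : hom C D),
    cell_ (comp1 (comp1 f g) h) (comp1 f (comp1 g h));
  assoc'_ : forall (A B C D : G) (f : hom A B) (g : hom B C) (h : hom C D),
    cell_ (comp1 f (comp1 g h)) (comp1 (comp1 f g) h);
  lun_ : forall (A B : G) (f : hom A B), cell_ (comp1 (id1 A) f) f;
  lun'_ : forall (A B : G) (f : hom A B), cell_ f (comp1 (id1 A) f);
  run_ : forall (A B : G) (f : hom A B), cell_ (comp1 f (id1 B)) f;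
  run'_ : forall (A B : G) (f : hom A B), cell_ f (comp1 f (id1 B)) }.

Record bicat := { bicat1 :> graph1; bicat2 : twocells bicat1 }.

Section BicatOps.
Context {B : bicat}.
Definition cell {X Y : B} (f g : hom X Y) := cell_ (bicat2 B) f g.
Definition id2 {X Y : B} (f : hom X Y) : cell f f := id2_ (bicat2 B) f.
Definition comp2 {X Y : B} {f g h : hom X Y} (c : cell f g) (d : cell g h) : cell f h :=
  comp2_ c d.
Definition hc2 {X Y Z : B} {f f' : hom X Y} {g g' : hom Y Z}
  (c : cell f f') (d : cell g g') : cell (comp1 f g) (comp1 f' g') := hc2_ c d.
Definition assoc {X Y Z W : B} (f : hom X Y) (g : hom Y Z) (h : hom Z W) :
  cell (comp1 (comp1 f g) h) (comp1 f (comp1 g h)) := assoc_ (bicat2 B) f g h.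
Definition assoc' {X Y Z W : B} (f : hom X Y) (g : hom Y Z) (h : hom Z W) :
  cell (comp1 f (comp1 g h)) (comp1 (comp1 f g) h) := assoc'_ (bicat2 B) f g h.
Definition lun {X Y : B} (f : hom X Y) : cell (comp1 (id1 X) f) f := lun_ (bicat2 B) f.
Definition lun' {X Y : B} (f : hom X Y) : cell f (comp1 (id1 X) f) := lun'_ (bicat2 B) f.
Definition run {X Y : B} (f : hom X Y) : cell (comp1 f (id1 Y)) f := run_ (bicat2 B) f.
Definition run' {X Y : B} (f : hom X Y) : cell f (comp1 f (id1 Y)) := run'_ (bicat2 B) f.
End BicatOps.

Declare Scope bicat_scope.
Delimit Scope bicat_scope with bicat.
Open Scope bicat_scope.

Notation "c ⊙ d" := (comp2 c d) (at level 50, left associativity) : bicat_scope.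

Record is_bicat (B : bicat) : Prop := {
  bi_lid : forall (X Y : B) (f g : hom X Y) (c : cell f g), id2 f ⊙ c = c;
  bi_rid : forall (X Y : B) (f g : hom X Y) (c : cell f g), c ⊙ id2 g = c;
  bi_ass : forall (X Y : B) (f g h k : hom X Y) (c : cell f g) (d : cell g h) (e : cell h k),
    (c ⊙ d) ⊙ e = c ⊙ (d ⊙ e);
  bi_hid : forall (X Y Z : B) (f : hom X Y) (g : hom Y Z),
    hc2 (id2 f) (id2 g) = id2 (comp1 f g);
  bi_interchange : forall (X Y Z : B) (f f' f'' : hom X Y) (g g' g'' : hom Y Z)
    (c : cell f f') (c' : cell f' f'') (d : cell g g') (d' : cell g' g''),
    hc2 (c ⊙ c') (d ⊙ d') = hc2 c d ⊙ hc2 c' d';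
  bi_assoc_nat : forall (X Y Z W : B) (f f' : hom X Y) (g g' : hom Y Z) (h h' : hom Z W)
    (c : cell f f') (d : cell g g') (e : cell h h'),
    hc2 (hc2 c d) e ⊙ assoc f' g' h' = assoc f g h ⊙ hc2 c (hc2 d e);
  bi_lun_nat : forall (X Y : B) (f g : hom X Y) (c : cell f g),
    hc2 (id2 (id1 X)) c ⊙ lun g = lun f ⊙ c;
  bi_run_nat : forall (X Y : B) (f g : hom X Y) (c : cell f g),
    hc2 c (id2 (id1 Y)) ⊙ run g = run f ⊙ c;
  bi_assocK : forall (X Y Z W : B) (f : hom X Y) (g : hom Y Z) (h : hom Z W),
    assoc f g h ⊙ assoc' f g h = id2 _ /\ assoc' f g h ⊙ assoc f g h = id2 _;
  bi_lunK : forall (X Y : B) (f : hom X Y),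
    lun f ⊙ lun' f = id2 _ /\ lun' f ⊙ lun f = id2 _;
  bi_runK : forall (X Y : B) (f : hom X Y),
    run f ⊙ run' f = id2 _ /\ run' f ⊙ run f = id2 _;
  bi_pentagon : forall (X Y Z W V : B)
    (f : hom X Y) (g : hom Y Z) (h : hom Z W) (k : hom W V),
    hc2 (assoc f g h) (id2 k) ⊙ assoc f (comp1 g h) k ⊙ hc2 (id2 f) (assoc g h k)
    = assoc (comp1 f g) h k ⊙ assoc f g (comp1 h k);
  bi_triangle : forall (X Y Z : B) (f : hom X Y) (g : hom Y Z),
    assoc f (id1 Y) g ⊙ hc2 (id2 f) (lun g) = hc2 (run f) (id2 g) }.

(** ** Pasting diagrams

    Coherence axioms are equations between pastings of 2-cells along paths of
    composable 1-cells.  A path is evaluated by right-nested composition;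
    [p ◁ c ▷ r] applies a 2-cell [c] between [q] and [q'] inside
    [p ++ q ++ r], inserting the associators and unitors of the bicategory.
    Concatenation of explicit paths reduces, so that the source and the target
    of each step of a pasting match definitionally. *)

Inductive path (G : graph1) : G -> G -> Type :=
| pnil (X : G) : path X X
| pcons (X Y Z : G) (f : hom X Y) (p : path Y Z) : path X Z.
Arguments pnil {G X}.

Notation "⟪⟫" := pnil : bicat_scope.
Notation "⟪ f ; .. ; g ⟫" := (pcons f .. (pcons g pnil) ..) : bicat_scope.

Fixpoint papp {G : graph1} {X Y Z : G} (p : path X Y) : path Y Z -> path X Z :=
  match p with
  | pnil => fun q => q
  | pcons f p' => fun q => pcons f (papp p' q)
  end.

Fixpoint peval_from {G : graph1} {Y Z : G} (p : path Y Z) :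
    forall X, hom X Y -> hom X Z :=
  match p with
  | pnil => fun X f => f
  | pcons g p' => fun X f => comp1 f (peval_from p' g)
  end.

Definition peval {G : graph1} {X Y : G} (p : path X Y) : hom X Y :=
  match p with
  | @pnil _ X => id1 X
  | pcons f p' => peval_from p' f
  end.

Section Pasting.
Context {B : bicat}.

Definition pcell {X Y : B} (p q : path X Y) : Type := cell (peval p) (peval q).

Fixpoint psplit_from {Y Z W : B} (p : path Y Z) :
    forall (q : path Z W) X (f : hom X Y),
      cell (peval_from (papp p q) f) (comp1 (peval_from p f) (peval q)) :=
  match p with
  | pnil => fun q =>
      match q with
      | pnil => fun X f => run' f
      | pcons g q' => fun X f => id2 _
      end
  | pcons g p' => fun q X f =>
      hc2 (id2 f) (psplit_from p' q g) ⊙ assoc' f (peval_from p' g) (peval q)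
  end.

Fixpoint pjoin_from {Y Z W : B} (p : path Y Z) :
    forall (q : path Z W) X (f : hom X Y),
      cell (comp1 (peval_from p f) (peval q)) (peval_from (papp p q) f) :=
  match p with
  | pnil => fun q =>
      match q with
      | pnil => fun X f => run f
      | pcons g q' => fun X f => id2 _
      end
  | pcons g p' => fun q X f =>
      assoc f (peval_from p' g) (peval q) ⊙ hc2 (id2 f) (pjoin_from p' q g)
  end.

Definition psplit {X Y Z : B} (p : path X Y) :
    forall q : path Y Z, cell (peval (papp p q)) (comp1 (peval p) (peval q)) :=
  match p with
  | pnil => fun q => lun' (peval q)
  | pcons f p' => fun q => psplit_from p' q f
  end.

Definition pjoin {X Y Z : B} (p : path X Y) :
    forall q : path Y Z, cell (comp1 (peval p) (peval q)) (peval (papp p q)) :=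
  match p with
  | pnil => fun q => lun (peval q)
  | pcons f p' => fun q => pjoin_from p' q f
  end.

Definition pcomp {X Y : B} {p q r : path X Y} (c : pcell p q) (d : pcell q r) : pcell p r :=
  comp2 c d.

Definition pid {X Y : B} (p : path X Y) : pcell p p := id2 (peval p).

Definition pctx {X Y Z W : B} (p : path X Y) {q q' : path Y Z} (c : pcell q q')
    (r : path Z W) : pcell (papp p (papp q r)) (papp p (papp q' r)) :=
  psplit p (papp q r)
    ⊙ hc2 (id2 (peval p)) (psplit q r ⊙ hc2 c (id2 (peval r)) ⊙ pjoin q' r)
    ⊙ pjoin p (papp q' r).

(** A single 2-cell as a cell between one-step paths, and a path versus its
    composite. *)
Definition one {X Y : B} {f g : hom X Y} (c : cell f g) : pcell ⟪f⟫ ⟪g⟫ := c.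
Definition fold {X Y : B} (p : path X Y) : pcell p ⟪peval p⟫ := id2 (peval p).
Definition unfold {X Y : B} (p : path X Y) : pcell ⟪peval p⟫ p := id2 (peval p).

Record iso2 {X Y : B} (p q : path X Y) := { fwd : pcell p q; bwd : pcell q p }.

Definition is_iso2 {X Y : B} {p q : path X Y} (i : iso2 p q) : Prop :=
  comp2 (fwd i) (bwd i) = id2 _ /\ comp2 (bwd i) (fwd i) = id2 _.

Definition is_equivalence {X Y : B} (f : hom X Y) : Prop :=
  exists (g : hom Y X) (i : iso2 ⟪f; g⟫ ⟪⟫) (j : iso2 ⟪g; f⟫ ⟪⟫), is_iso2 i /\ is_iso2 j.

End Pasting.

Notation "p ◁ c ▷ r" := (pctx p c r) (at level 40, c at next level, r at next level)
  : bicat_scope.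
Notation "c ⊚ d" := (pcomp c d) (at level 50, left associativity) : bicat_scope.

(** ** Pseudofunctors *)

Definition map1 {B C : graph1} (F0 : B -> C) : Type :=
  forall X Y, hom X Y -> hom (F0 X) (F0 Y).

(** The action on objects is an index: two pseudofunctors can then agree on
    objects by typing alone. *)
Record psfun (B C : bicat) (F0 : B -> C) := {
  f1 :> map1 F0;
  f2 : forall (X Y : B) (f g : hom X Y), cell f g -> cell (f1 f) (f1 g);
  fcomp : forall (X Y Z : B) (f : hom X Y) (g : hom Y Z),
    iso2 ⟪f1 f; f1 g⟫ ⟪f1 (comp1 f g)⟫;
  funit : forall X : B, iso2 ⟪⟫ ⟪f1 (id1 X)⟫ }.

Notation "F # f" := (f1 F f) (at level 26, right associativity) : bicat_scope.

Section PathImage.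
Context {B C : bicat} {F0 : B -> C} (F : psfun F0).

Fixpoint fpath {X Y : B} (p : path X Y) : path (F0 X) (F0 Y) :=
  match p with
  | pnil => pnil
  | pcons f p' => pcons (F # f) (fpath p')
  end.

Fixpoint ffold_from {Y Z : B} (p : path Y Z) :
    forall X (f : hom X Y), cell (peval_from (fpath p) (F # f)) (F # peval_from p f) :=
  match p with
  | pnil => fun X f => id2 _
  | pcons g p' => fun X f =>
      hc2 (id2 (F # f)) (ffold_from p' g) ⊙ fwd (fcomp F f (peval_from p' g))
  end.

Fixpoint funfold_from {Y Z : B} (p : path Y Z) :
    forall X (f : hom X Y), cell (F # peval_from p f) (peval_from (fpath p) (F # f)) :=
  match p with
  | pnil => fun X f => id2 _
  | pcons g p' => fun X f =>
      bwd (fcomp F f (peval_from p' g)) ⊙ hc2 (id2 (F # f)) (funfold_from p' g)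
  end.

(** Iterated compositors and unitors. *)
Definition ffold {X Y : B} (p : path X Y) : pcell (fpath p) ⟪F # peval p⟫ :=
  match p with
  | @pnil _ X => fwd (funit F X)
  | pcons f p' => ffold_from p' f
  end.

Definition funfold {X Y : B} (p : path X Y) : pcell ⟪F # peval p⟫ (fpath p) :=
  match p with
  | @pnil _ X => bwd (funit F X)
  | pcons f p' => funfold_from p' f
  end.

(** The image of a pasting cell. *)
Definition fcell {X Y : B} {p q : path X Y} (c : pcell p q) : pcell (fpath p) (fpath q) :=
  ffold p ⊚ one (f2 F c) ⊚ funfold q.

Definition fiso {X Y : B} {p q : path X Y} (i : iso2 p q) : iso2 (fpath p) (fpath q) :=
  {| fwd := fcell (fwd i); bwd := fcell (bwd i) |}.

End PathImage.

Record is_psfun {B C : bicat} {F0 : B -> C} (F : psfun F0) : Prop := {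
  pf_id2 : forall (X Y : B) (f : hom X Y), f2 F (id2 f) = id2 (F # f);
  pf_comp2 : forall (X Y : B) (f g h : hom X Y) (c : cell f g) (d : cell g h),
    f2 F (c ⊙ d) = f2 F c ⊙ f2 F d;
  pf_comp_iso : forall (X Y Z : B) (f : hom X Y) (g : hom Y Z), is_iso2 (fcomp F f g);
  pf_unit_iso : forall X : B, is_iso2 (funit F X);
  pf_comp_nat : forall (X Y Z : B) (f f' : hom X Y) (g g' : hom Y Z)
    (c : cell f f') (d : cell g g'),
    hc2 (f2 F c) (f2 F d) ⊙ fwd (fcomp F f' g') = fwd (fcomp F f g) ⊙ f2 F (hc2 c d);
  pf_assoc : forall (X Y Z W : B) (f : hom X Y) (g : hom Y Z) (h : hom Z W),
    ⟪⟫ ◁ fwd (fcomp F f g) ▷ ⟪F # h⟫ ⊚ fwd (fcomp F (comp1 f g) h)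
      ⊚ one (f2 F (assoc f g h))
    = ⟪F # f⟫ ◁ fwd (fcomp F g h) ▷ ⟪⟫ ⊚ fwd (fcomp F f (comp1 g h));
  pf_lun : forall (X Y : B) (f : hom X Y),
    ⟪⟫ ◁ fwd (funit F X) ▷ ⟪F # f⟫ ⊚ fwd (fcomp F (id1 X) f) ⊚ one (f2 F (lun f))
    = pid ⟪F # f⟫;
  pf_run : forall (X Y : B) (f : hom X Y),
    ⟪F # f⟫ ◁ fwd (funit F Y) ▷ ⟪⟫ ⊚ fwd (fcomp F f (id1 Y)) ⊚ one (f2 F (run f))
    = pid ⟪F # f⟫ }.

(** ** Pseudonatural transformations and modifications *)

(** The components are an index, for the same reason as above.  The data only
    involve the action of the two pseudofunctors on 1-cells. *)
Record psnat {B C : bicat} {F0 G0 : B -> C} (F : map1 F0) (G : map1 G0)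
    (s : forall X, hom (F0 X) (G0 X)) := {
  nat2 :> forall (X Y : B) (f : hom X Y), iso2 ⟪F _ _ f; s Y⟫ ⟪s X; G _ _ f⟫ }.

Record is_psnat {B C : bicat} {F0 G0 : B -> C} (F : psfun F0) (G : psfun G0)
    (s : forall X, hom (F0 X) (G0 X)) (n : psnat F G s) : Prop := {
  pn_iso : forall (X Y : B) (f : hom X Y), is_iso2 (n X Y f);
  pn_nat : forall (X Y : B) (f g : hom X Y) (c : cell f g),
    ⟪⟫ ◁ one (f2 F c) ▷ ⟪s Y⟫ ⊚ fwd (n X Y g)
    = fwd (n X Y f) ⊚ ⟪s X⟫ ◁ one (f2 G c) ▷ ⟪⟫;
  pn_comp : forall (X Y Z : B) (f : hom X Y) (g : hom Y Z),
    ⟪⟫ ◁ fwd (fcomp F f g) ▷ ⟪s Z⟫ ⊚ fwd (n X Z (comp1 f g))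
    = ⟪F # f⟫ ◁ fwd (n Y Z g) ▷ ⟪⟫
      ⊚ ⟪⟫ ◁ fwd (n X Y f) ▷ ⟪G # g⟫
      ⊚ ⟪s X⟫ ◁ fwd (fcomp G f g) ▷ ⟪⟫;
  pn_unit : forall X : B,
    ⟪⟫ ◁ fwd (funit F X) ▷ ⟪s X⟫ ⊚ fwd (n X X (id1 X))
    = ⟪s X⟫ ◁ fwd (funit G X) ▷ ⟪⟫ }.

Arguments is_psnat {B C F0 G0} F G {s} n.

Definition is_modif {B C : bicat} {F0 G0 : B -> C} {F : map1 F0} {G : map1 G0}
    {s s' : forall X, hom (F0 X) (G0 X)} (n : psnat F G s) (n' : psnat F G s')
    (m : forall X, pcell ⟪s X⟫ ⟪s' X⟫) : Prop :=
  forall (X Y : B) (f : hom X Y),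
    fwd (n X Y f) ⊚ ⟪⟫ ◁ m X ▷ ⟪G _ _ f⟫
    = ⟪F _ _ f⟫ ◁ m Y ▷ ⟪⟫ ⊚ fwd (n' X Y f).

(** An invertible modification given by its family of components, between
    transformations whose components are composites of paths. *)
Definition is_inv_modif {B C : bicat} {F0 G0 : B -> C} {F : map1 F0} {G : map1 G0}
    {p q : forall X, path (F0 X) (G0 X)} (m : forall X, iso2 (p X) (q X))
    (n : psnat F G (fun X => peval (p X))) (n' : psnat F G (fun X => peval (q X))) : Prop :=
  (forall X, is_iso2 (m X)) /\ is_modif n n' (fun X => fwd (m X)).

(** ** Combinators on pseudofunctors and transformations *)

Definition idf (B : bicat) : psfun (fun X : B => X) :=
  {| f1 := fun X Y (f : hom X Y) => f;
     f2 := fun X Y f g (c : cell f g) => c;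
     fcomp := fun X Y Z f g =>
       {| fwd := fold ⟪f; g⟫; bwd := unfold ⟪f; g⟫ |};
     funit := fun X => {| fwd := fold (@pnil _ X); bwd := unfold (@pnil _ X) |} |}.

Definition compf {B C D : bicat} {F0 : B -> C} {G0 : C -> D} (F : psfun F0) (G : psfun G0) :
    psfun (fun X => G0 (F0 X)) :=
  {| f1 := fun X Y f => G # F # f : hom (G0 (F0 X)) (G0 (F0 Y));
     f2 := fun X Y f g c => f2 G (f2 F c);
     fcomp := fun X Y Z f g =>
       {| fwd := fcell G (fwd (fcomp F f g)); bwd := fcell G (bwd (fcomp F f g)) |};
     funit := fun X => {| fwd := fcell G (fwd (funit F X)); bwd := fcell G (bwd (funit F X)) |} |}.

Definition unitb : bicat :=
  {| bicat1 := {| ob := unit; hom := fun _ _ => unit; id1 := fun _ => tt;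
                  comp1 := fun _ _ _ _ _ => tt |};
     bicat2 := {| cell_ := fun _ _ _ _ => unit; id2_ := fun _ _ _ => tt;
                  comp2_ := fun _ _ _ _ _ _ _ => tt; hc2_ := fun _ _ _ _ _ _ _ _ _ => tt;
                  assoc_ := fun _ _ _ _ _ _ _ => tt; assoc'_ := fun _ _ _ _ _ _ _ => tt;
                  lun_ := fun _ _ _ => tt; lun'_ := fun _ _ _ => tt;
                  run_ := fun _ _ _ => tt; run'_ := fun _ _ _ => tt |} |}.

Definition bangf (B : bicat) : psfun (B := B) (C := unitb) (fun _ => tt) :=
  @Build_psfun B unitb (fun _ => tt) (fun _ _ _ => tt) (fun _ _ _ _ _ => tt)
    (fun _ _ _ _ _ => @Build_iso2 unitb tt tt _ _ tt tt)
    (fun _ => @Build_iso2 unitb tt tt _ _ tt tt).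

Definition prodg (B C : graph1) : graph1 :=
  {| ob := (ob B * ob C)%type;
     hom := fun X Y => (hom (fst X) (fst Y) * hom (snd X) (snd Y))%type;
     id1 := fun X => (id1 (fst X), id1 (snd X));
     comp1 := fun _ _ _ f g => (comp1 (fst f) (fst g), comp1 (snd f) (snd g)) |}.

Definition prodb (B C : bicat) : bicat :=
  {| bicat1 := prodg B C;
     bicat2 := {|
       cell_ := fun (X Y : prodg B C) (f g : hom X Y) =>
         (cell (fst f) (fst g) * cell (snd f) (snd g))%type;
       id2_ := fun (X Y : prodg B C) (f : hom X Y) => (id2 (fst f), id2 (snd f));
       comp2_ := fun (X Y : prodg B C) (f g h : hom X Y) c d =>
         (fst c ⊙ fst d, snd c ⊙ snd d);
       hc2_ := fun (X Y Z : prodg B C) (f f' : hom X Y) (g g' : hom Y Z) c d =>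
         (hc2 (fst c) (fst d), hc2 (snd c) (snd d));
       assoc_ := fun (X Y Z W : prodg B C) (f : hom X Y) (g : hom Y Z) (h : hom Z W) =>
         (assoc (fst f) (fst g) (fst h), assoc (snd f) (snd g) (snd h));
       assoc'_ := fun (X Y Z W : prodg B C) (f : hom X Y) (g : hom Y Z) (h : hom Z W) =>
         (assoc' (fst f) (fst g) (fst h), assoc' (snd f) (snd g) (snd h));
       lun_ := fun (X Y : prodg B C) (f : hom X Y) => (lun (fst f), lun (snd f));
       lun'_ := fun (X Y : prodg B C) (f : hom X Y) => (lun' (fst f), lun' (snd f));
       run_ := fun (X Y : prodg B C) (f : hom X Y) => (run (fst f), run (snd f));
       run'_ := fun (X Y : prodg B C) (f : hom X Y) => (run' (fst f), run' (snd f)) |} |}.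

Definition hpair {B C : bicat} {X Y : B} {X' Y' : C} (f : hom X Y) (f' : hom X' Y') :
  @hom (prodb B C) (X, X') (Y, Y') := (f, f').
Notation "⟨ f , g ⟩" := (hpair f g) : bicat_scope.

Definition fstf (B C : bicat) : psfun (B := prodb B C) (C := B) (fun X => fst X) :=
  @Build_psfun (prodb B C) B (fun X => fst X) (fun X Y (f : @hom (prodb B C) X Y) => fst f)
    (fun _ _ _ _ c => fst c)
    (fun X Y Z (f : @hom (prodb B C) X Y) (g : @hom (prodb B C) Y Z) => @Build_iso2 B _ _ ⟪fst f; fst g⟫ ⟪comp1 (fst f) (fst g)⟫ (id2 _) (id2 _))
    (fun X => @Build_iso2 B _ _ ⟪⟫ ⟪id1 (fst X)⟫ (id2 _) (id2 _)).

Definition sndf (B C : bicat) : psfun (B := prodb B C) (C := C) (fun X => snd X) :=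
  @Build_psfun (prodb B C) C (fun X => snd X) (fun X Y (f : @hom (prodb B C) X Y) => snd f)
    (fun _ _ _ _ c => snd c)
    (fun X Y Z (f : @hom (prodb B C) X Y) (g : @hom (prodb B C) Y Z) => @Build_iso2 C _ _ ⟪snd f; snd g⟫ ⟪comp1 (snd f) (snd g)⟫ (id2 _) (id2 _))
    (fun X => @Build_iso2 C _ _ ⟪⟫ ⟪id1 (snd X)⟫ (id2 _) (id2 _)).

Definition constf (B C : bicat) (A : C) : psfun (B := B) (C := C) (fun _ => A) :=
  @Build_psfun B C (fun _ => A) (fun _ _ _ => id1 A) (fun _ _ _ _ _ => id2 _)
    (fun _ _ _ _ _ => @Build_iso2 C _ _ ⟪id1 A; id1 A⟫ ⟪id1 A⟫ (lun (id1 A)) (lun' (id1 A)))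
    (fun _ => @Build_iso2 C _ _ ⟪⟫ ⟪id1 A⟫ (id2 _) (id2 _)).

Definition pairf {X B C : bicat} {F0 : X -> B} {G0 : X -> C} (F : psfun F0) (G : psfun G0) :
    psfun (B := X) (C := prodb B C) (fun x => (F0 x, G0 x)) :=
  @Build_psfun X (prodb B C) (fun x => (F0 x, G0 x))
    (fun _ _ f => ⟨F # f, G # f⟩) (fun _ _ _ _ c => (f2 F c, f2 G c))
    (fun _ _ _ f g => @Build_iso2 (prodb B C) _ _
       ⟪⟨F # f, G # f⟩; ⟨F # g, G # g⟩⟫ ⟪⟨F # comp1 f g, G # comp1 f g⟩⟫
       (fwd (fcomp F f g), fwd (fcomp G f g)) (bwd (fcomp F f g), bwd (fcomp G f g)))
    (fun x => @Build_iso2 (prodb B C) _ _ ⟪⟫ ⟪⟨F # id1 x, G # id1 x⟩⟫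
       (fwd (funit F x), fwd (funit G x)) (bwd (funit F x), bwd (funit G x))).

Definition idn {B C : bicat} {F0 : B -> C} (F : map1 F0) :
    psnat F F (fun X => id1 (F0 X)) :=
  {| nat2 := fun X Y f => @Build_iso2 C _ _ ⟪F _ _ f; id1 (F0 Y)⟫ ⟪id1 (F0 X); F _ _ f⟫
       (run (F _ _ f) ⊙ lun' (F _ _ f)) (lun (F _ _ f) ⊙ run' (F _ _ f)) |}.

Definition compn {B C : bicat} {F0 G0 H0 : B -> C} {F : map1 F0} {G : map1 G0} {H : map1 H0}
    {s : forall X, hom (F0 X) (G0 X)} {t : forall X, hom (G0 X) (H0 X)}
    (m : psnat F G s) (n : psnat G H t) : psnat F H (fun X => comp1 (s X) (t X)) :=
  {| nat2 := fun X Y f =>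
       {| fwd := ⟪F _ _ f⟫ ◁ unfold ⟪s Y; t Y⟫ ▷ ⟪⟫
                 ⊚ ⟪⟫ ◁ fwd (m X Y f) ▷ ⟪t Y⟫ ⊚ ⟪s X⟫ ◁ fwd (n X Y f) ▷ ⟪⟫
                 ⊚ ⟪⟫ ◁ fold ⟪s X; t X⟫ ▷ ⟪H _ _ f⟫;
          bwd := ⟪⟫ ◁ unfold ⟪s X; t X⟫ ▷ ⟪H _ _ f⟫
                 ⊚ ⟪s X⟫ ◁ bwd (n X Y f) ▷ ⟪⟫ ⊚ ⟪⟫ ◁ bwd (m X Y f) ▷ ⟪t Y⟫
                 ⊚ ⟪F _ _ f⟫ ◁ fold ⟪s Y; t Y⟫ ▷ ⟪⟫ |} |}.

(** Whiskering of a transformation by a pseudofunctor before and after. *)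
Definition pren {A B C : bicat} {K0 : A -> B} {F0 G0 : B -> C} {F : map1 F0} {G : map1 G0}
    {s : forall X, hom (F0 X) (G0 X)} (K : map1 K0) (n : psnat F G s) :
    psnat (F0 := fun X => F0 (K0 X)) (G0 := fun X => G0 (K0 X))
      (fun X Y f => F _ _ (K _ _ f)) (fun X Y f => G _ _ (K _ _ f)) (fun X => s (K0 X)) :=
  {| nat2 := fun X Y f => n _ _ (K _ _ f) |}.

Definition postn {B C D : bicat} {F0 G0 : B -> C} {H0 : C -> D} {F : map1 F0} {G : map1 G0}
    {s : forall X, hom (F0 X) (G0 X)} (n : psnat F G s) (H : psfun H0) :
    psnat (F0 := fun X => H0 (F0 X)) (G0 := fun X => H0 (G0 X))
      (fun X Y f => H # F _ _ f) (fun X Y f => H # G _ _ f) (fun X => H # s X) :=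
  {| nat2 := fun X Y f => fiso H (n X Y f) |}.

Definition pairn {X B C : bicat} {F0 F0' : X -> B} {G0 G0' : X -> C}
    {F : map1 F0} {F' : map1 F0'} {G : map1 G0} {G' : map1 G0'}
    {s : forall x, hom (F0 x) (F0' x)} {t : forall x, hom (G0 x) (G0' x)}
    (m : psnat F F' s) (n : psnat G G' t) :
    psnat (C := prodb B C) (F0 := fun x => (F0 x, G0 x)) (G0 := fun x => (F0' x, G0' x))
      (fun _ _ f => ⟨F _ _ f, G _ _ f⟩) (fun _ _ f => ⟨F' _ _ f, G' _ _ f⟩)
      (fun x => ⟨s x, t x⟩) :=
  {| nat2 := fun x y f => @Build_iso2 (prodb B C) _ _
       ⟪⟨F _ _ f, G _ _ f⟩; ⟨s y, t y⟩⟫ ⟪⟨s x, t x⟩; ⟨F' _ _ f, G' _ _ f⟩⟫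
       (fwd (m x y f), fwd (n x y f)) (bwd (m x y f), bwd (n x y f)) |}.

(** ** Premonoidal and monoidal bicategories *)

Definition cpair {B C : bicat} {X Y : B} {X' Y' : C} {f g : hom X Y} {f' g' : hom X' Y'}
    (c : cell f g) (d : cell f' g') : @cell (prodb B C) _ _ ⟨f, f'⟩ ⟨g, g'⟩ := (c, d).

(** [pL A] is [A ⋉ -] and [pR B] is [- ⋊ B]. The three naturality structures
    [pa1], [pa2], [pa3] share the components [pa]. *)
Record premonoidal_data (B : bicat) (bow : B -> B -> B) (I : B) := {
  pL : forall X : B, psfun (B := B) (C := B) (fun Y => bow X Y);
  pR : forall Y : B, psfun (B := B) (C := B) (fun X => bow X Y);
  pa : forall X Y Z : B, hom (bow (bow X Y) Z) (bow X (bow Y Z));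
  pl : forall X : B, hom (bow I X) X;
  pr : forall X : B, hom (bow X I) X;
  pa1 : forall Y Z : B,
    psnat (compf (pR Y) (pR Z)) (pR (bow Y Z)) (fun X => pa X Y Z);
  pa2 : forall X Z : B,
    psnat (compf (pL X) (pR Z)) (compf (pR Z) (pL X)) (fun Y => pa X Y Z);
  pa3 : forall X Y : B,
    psnat (pL (bow X Y)) (compf (pL Y) (pL X)) (fun Z => pa X Y Z);
  pln : psnat (pL I) (idf B) pl;
  prn : psnat (pR I) (idf B) pr;
  pp : forall X Y Z W : B,
    iso2 ⟪pR W # pa X Y Z; pa X (bow Y Z) W; pL X # pa Y Z W⟫
         ⟪pa (bow X Y) Z W; pa X Y (bow Z W)⟫;
  pm : forall X Y : B, iso2 ⟪pa X I Y; pL X # pl Y⟫ ⟪pR Y # pr X⟫;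
  pll : forall X Y : B, iso2 ⟪pa I X Y; pl (bow X Y)⟫ ⟪pR Y # pl X⟫;
  prr : forall X Y : B, iso2 ⟪pa X Y I; pL X # pr Y⟫ ⟪pr (bow X Y)⟫ }.

Section MonoidalEquations.
Context {B : bicat} {bow : B -> B -> B} {I : B} (P : premonoidal_data bow I).

Local Notation "X ⋈ Y" := (bow X Y) (at level 25, left associativity).
Local Notation "X ⋉ f" := (pL P X # f) (at level 26, right associativity).
Local Notation "f ⋊ Y" := (pR P Y # f) (at level 27, left associativity).
Local Notation a := (pa P).
Local Notation l := (pl P).
Local Notation r := (pr P).

(** The non-abelian 4-cocycle condition on [(((X Y) Z) W) V]. *)
Definition cocycle_axiom : Prop := forall X Y Z W V : B,
  ⟪⟫ ◁ fcell (pR P V) (fwd (pp P X Y Z W))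
     ▷ ⟪a X (Y ⋈ (Z ⋈ W)) V; X ⋉ a Y (Z ⋈ W) V; X ⋉ (Y ⋉ a Z W V)⟫
  ⊚ ⟪a (X ⋈ Y) Z W ⋊ V⟫ ◁ fwd (pp P X Y (Z ⋈ W) V) ▷ ⟪X ⋉ (Y ⋉ a Z W V)⟫
  ⊚ ⟪a (X ⋈ Y) Z W ⋊ V; a (X ⋈ Y) (Z ⋈ W) V⟫
     ◁ bwd (pa3 P X Y _ _ (a Z W V)) ▷ ⟪⟫
  ⊚ ⟪⟫ ◁ fwd (pp P (X ⋈ Y) Z W V) ▷ ⟪a X Y (Z ⋈ (W ⋈ V))⟫
  =
  ⟪(a X Y Z ⋊ W) ⋊ V; a X (Y ⋈ Z) W ⋊ V⟫ ◁ fwd (pa2 P X V _ _ (a Y Z W))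
     ▷ ⟪X ⋉ a Y (Z ⋈ W) V; X ⋉ (Y ⋉ a Z W V)⟫
  ⊚ ⟪(a X Y Z ⋊ W) ⋊ V; a X (Y ⋈ Z) W ⋊ V; a X ((Y ⋈ Z) ⋈ W) V⟫
     ◁ fcell (pL P X) (fwd (pp P Y Z W V)) ▷ ⟪⟫
  ⊚ ⟪(a X Y Z ⋊ W) ⋊ V⟫ ◁ fwd (pp P X (Y ⋈ Z) W V) ▷ ⟪X ⋉ a Y Z (W ⋈ V)⟫
  ⊚ ⟪⟫ ◁ fwd (pa1 P W V _ _ (a X Y Z)) ▷ ⟪a X (Y ⋈ Z) (W ⋈ V); X ⋉ a Y Z (W ⋈ V)⟫
  ⊚ ⟪a (X ⋈ Y ⋈ Z) W V⟫ ◁ fwd (pp P X Y Z (W ⋈ V)) ▷ ⟪⟫.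

(** The two normalization axioms, on [((X I) Y) Z] and [((X Y) I) Z]. *)
Definition normalization_left : Prop := forall X Y Z : B,
  ⟪⟫ ◁ fwd (pp P X I Y Z) ▷ ⟪X ⋉ l (Y ⋈ Z)⟫
  ⊚ ⟪a (X ⋈ I) Y Z⟫ ◁ fwd (pm P X (Y ⋈ Z)) ▷ ⟪⟫
  =
  ⟪a X I Y ⋊ Z; a X (I ⋈ Y) Z⟫ ◁ fcell (pL P X) (fwd (pll P Y Z)) ▷ ⟪⟫
  ⊚ ⟪a X I Y ⋊ Z⟫ ◁ bwd (pa2 P X Z _ _ (l Y)) ▷ ⟪⟫
  ⊚ ⟪⟫ ◁ fcell (pR P Z) (fwd (pm P X Y)) ▷ ⟪a X Y Z⟫
  ⊚ fwd (pa1 P Y Z _ _ (r X)).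

Definition normalization_right : Prop := forall X Y Z : B,
  ⟪⟫ ◁ fwd (pp P X Y I Z) ▷ ⟪X ⋉ (Y ⋉ l Z)⟫
  ⊚ ⟪a (X ⋈ Y) I Z⟫ ◁ bwd (pa3 P X Y _ _ (l Z)) ▷ ⟪⟫
  ⊚ ⟪⟫ ◁ fwd (pm P (X ⋈ Y) Z) ▷ ⟪a X Y Z⟫
  =
  ⟪a X Y I ⋊ Z; a X (Y ⋈ I) Z⟫ ◁ fcell (pL P X) (fwd (pm P Y Z)) ▷ ⟪⟫
  ⊚ ⟪a X Y I ⋊ Z⟫ ◁ bwd (pa2 P X Z _ _ (r Y)) ▷ ⟪⟫
  ⊚ ⟪⟫ ◁ fcell (pR P Z) (fwd (prr P X Y)) ▷ ⟪a X Y Z⟫.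

(** Central structure on a 1-cell; the indexing of [psnat] by components
    enforces [f ⋉ Y = f ⋊ Y] and [Y ⋊ f = Y ⋉ f]. *)
Record central {X X' : B} (f : hom X X') := {
  cen_l : psnat (pL P X) (pL P X') (fun Y => f ⋊ Y);
  cen_r : psnat (pR P X) (pR P X') (fun Y => Y ⋉ f);
  cen_l_psnat : is_psnat (pL P X) (pL P X') cen_l;
  cen_r_psnat : is_psnat (pR P X) (pR P X') cen_r }.

(** The pseudonatural equivalences are the pseudonatural transformations with
    equivalence 1-cells as components.  [pp], [pm], [pll], [prr] are modifications
    in each variable; where a 1-cell component of the constraints is whiskered by
    the variable, its central structure provides the naturality. *)
Record is_premonoidal : Type := {
  pre_bicat : is_bicat B;
  pre_L : forall X, is_psfun (pL P X);
  pre_R : forall X, is_psfun (pR P X);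
  pre_a1 : forall Y Z, is_psnat (compf (pR P Y) (pR P Z)) (pR P (Y ⋈ Z)) (pa1 P Y Z);
  pre_a2 : forall X Z,
    is_psnat (compf (pL P X) (pR P Z)) (compf (pR P Z) (pL P X)) (pa2 P X Z);
  pre_a3 : forall X Y, is_psnat (pL P (X ⋈ Y)) (compf (pL P Y) (pL P X)) (pa3 P X Y);
  pre_l : is_psnat (pL P I) (idf B) (pln P);
  pre_r : is_psnat (pR P I) (idf B) (prn P);
  pre_a_equiv : forall X Y Z, is_equivalence (a X Y Z);
  pre_l_equiv : forall X, is_equivalence (l X);
  pre_r_equiv : forall X, is_equivalence (r X);
  cen_a : forall X Y Z, central (a X Y Z);
  cen_lam : forall X, central (l X);
  cen_rho : forall X, central (r X);
  pre_p1 : forall Y Z W, is_inv_modif (fun X => pp P X Y Z W)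
    (compn (postn (pa1 P Y Z) (pR P W))
       (compn (pa1 P (Y ⋈ Z) W) (cen_r (cen_a Y Z W))))
    (compn (pren (pR P Y) (pa1 P Z W)) (pa1 P Y (Z ⋈ W)));
  pre_p2 : forall X Z W, is_inv_modif (fun Y => pp P X Y Z W)
    (compn (postn (pa2 P X Z) (pR P W))
       (compn (pren (pR P Z) (pa2 P X W)) (postn (pa1 P Z W) (pL P X))))
    (compn (pren (pL P X) (pa1 P Z W)) (pa2 P X (Z ⋈ W)));
  pre_p3 : forall X Y W, is_inv_modif (fun Z => pp P X Y Z W)
    (compn (postn (pa3 P X Y) (pR P W))
       (compn (pren (pL P Y) (pa2 P X W)) (postn (pa2 P Y W) (pL P X))))
    (compn (pa2 P (X ⋈ Y) W) (pren (pR P W) (pa3 P X Y)));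
  pre_p4 : forall X Y Z, is_inv_modif (fun W => pp P X Y Z W)
    (compn (cen_l (cen_a X Y Z))
       (compn (pa3 P X (Y ⋈ Z)) (postn (pa3 P Y Z) (pL P X))))
    (compn (pa3 P (X ⋈ Y) Z) (pren (pL P Z) (pa3 P X Y)));
  pre_m1 : forall Y, is_inv_modif (fun X => pm P X Y)
    (compn (pa1 P I Y) (cen_r (cen_lam Y))) (postn (prn P) (pR P Y));
  pre_m2 : forall X, is_inv_modif (fun Y => pm P X Y)
    (compn (pa3 P X I) (postn (pln P) (pL P X))) (cen_l (cen_rho X));
  pre_ll1 : forall Y, is_inv_modif (fun X => pll P X Y)
    (compn (pa2 P I Y) (pren (pR P Y) (pln P))) (postn (pln P) (pR P Y));
  pre_ll2 : forall X, is_inv_modif (fun Y => pll P X Y)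
    (compn (pa3 P I X) (pren (pL P X) (pln P))) (cen_l (cen_lam X));
  pre_rr1 : forall Y, is_inv_modif (fun X => prr P X Y)
    (compn (pa1 P Y I) (cen_r (cen_rho Y))) (pren (pR P Y) (prn P));
  pre_rr2 : forall X, is_inv_modif (fun Y => prr P X Y)
    (compn (pa2 P X I) (postn (prn P) (pL P X))) (pren (pL P X) (prn P));
  pre_cocycle : cocycle_axiom;
  pre_norm_l : normalization_left;
  pre_norm_r : normalization_right }.

End MonoidalEquations.

Section Tensor.
Context {B : bicat} {t0 : B -> B -> B}
  (t : psfun (B := prodb B B) (C := B) (fun X => t0 (fst X) (snd X))).

Definition tenf {X : bicat} {F0 G0 : X -> B} (F : psfun F0) (G : psfun G0) :
  psfun (fun x => t0 (F0 x) (G0 x)) := compf (pairf F G) t.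

Definition tenn {X : bicat} {F0 F0' G0 G0' : X -> B}
    {F : map1 F0} {F' : map1 F0'} {G : map1 G0} {G' : map1 G0'}
    {s : forall x, hom (F0 x) (F0' x)} {s' : forall x, hom (G0 x) (G0' x)}
    (m : psnat F F' s) (n : psnat G G' s') :
    psnat (F0 := fun x => t0 (F0 x) (G0 x)) (G0 := fun x => t0 (F0' x) (G0' x))
      (fun x y f => t # ⟨F _ _ f, G _ _ f⟩) (fun x y f => t # ⟨F' _ _ f, G' _ _ f⟩)
      (fun x => t # ⟨s x, s' x⟩) :=
  postn (pairn m n) t.

End Tensor.

(** Projections from binary, ternary and quaternary powers. *)
Definition pr21 (B : bicat) := fstf B B.
Definition pr22 (B : bicat) := sndf B B.
Definition pr31 (B : bicat) := compf (fstf (prodb B B) B) (fstf B B).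
Definition pr32 (B : bicat) := compf (fstf (prodb B B) B) (sndf B B).
Definition pr33 (B : bicat) := sndf (prodb B B) B.
Definition pr41 (B : bicat) := compf (fstf (prodb (prodb B B) B) B) (pr31 B).
Definition pr42 (B : bicat) := compf (fstf (prodb (prodb B B) B) B) (pr32 B).
Definition pr43 (B : bicat) := compf (fstf (prodb (prodb B B) B) B) (pr33 B).
Definition pr44 (B : bicat) := sndf (prodb (prodb B B) B) B.

Record monoidal_data (B : bicat) := {
  ten0 : B -> B -> B;
  ten : psfun (B := prodb B B) (C := B) (fun X => ten0 (fst X) (snd X));
  uni0 : B;
  uni : psfun (B := unitb) (C := B) (fun _ => uni0);
  as1 : forall X Y Z : B, hom (ten0 (ten0 X Y) Z) (ten0 X (ten0 Y Z));
  asn : psnat (tenf ten (tenf ten (pr31 B) (pr32 B)) (pr33 B))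
              (tenf ten (pr31 B) (tenf ten (pr32 B) (pr33 B)))
              (fun X => as1 (fst (fst X)) (snd (fst X)) (snd X));
  lu1 : forall X : B, hom (ten0 uni0 X) X;
  lun1 : psnat (tenf ten (compf (bangf B) uni) (idf B)) (idf B) lu1;
  ru1 : forall X : B, hom (ten0 X uni0) X;
  run1 : psnat (tenf ten (idf B) (compf (bangf B) uni)) (idf B) ru1;
  mp : forall X Y Z W : B,
    iso2 ⟪ten # ⟨as1 X Y Z, id1 W⟩; as1 X (ten0 Y Z) W; ten # ⟨id1 X, as1 Y Z W⟩⟫
         ⟪as1 (ten0 X Y) Z W; as1 X Y (ten0 Z W)⟫;
  mmid : forall X Y : B,
    iso2 ⟪as1 X uni0 Y; ten # ⟨id1 X, lu1 Y⟩⟫ ⟪ten # ⟨ru1 X, id1 Y⟩⟫;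
  mleft : forall X Y : B,
    iso2 ⟪as1 uni0 X Y; lu1 (ten0 X Y)⟫ ⟪ten # ⟨lu1 X, id1 Y⟩⟫;
  mright : forall X Y : B,
    iso2 ⟪as1 X Y uni0; ten # ⟨id1 X, ru1 Y⟩⟫ ⟪ru1 (ten0 X Y)⟫ }.

Section Monoidal.
Context {B : bicat} (M : monoidal_data B).
Local Notation T := (ten M).
Local Notation "X ⊗ Y" := (ten0 M X Y) (at level 25, left associativity).

(** The underlying one-variable structure: [X ⋉ f = id ⊗ f], [f ⋊ Y = f ⊗ id]. *)
Definition tenL (X : B) : psfun (fun Y : B => X ⊗ Y) := tenf T (constf B X) (idf B).
Definition tenR (Y : B) : psfun (fun X : B => X ⊗ Y) := tenf T (idf B) (constf B Y).

Definition as_1 (Y Z : B) :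
    psnat (compf (tenR Y) (tenR Z)) (tenR (Y ⊗ Z)) (fun X => as1 M X Y Z) :=
  {| nat2 := fun X X' f =>
       let n := asn M (X, Y, Z) (X', Y, Z) ⟨⟨f, id1 Y⟩, id1 Z⟩ in
       let u := funit T (Y, Z) in
       {| fwd := (fwd n : pcell ⟪T # ⟨T # ⟨f, id1 Y⟩, id1 Z⟩; as1 M X' Y Z⟫
                                ⟪as1 M X Y Z; T # ⟨f, T # ⟨id1 Y, id1 Z⟩⟩⟫)
            ⊚ ⟪as1 M X Y Z⟫ ◁ one (f2 T (cpair (id2 f) (bwd u))) ▷ ⟪⟫;
          bwd := ⟪as1 M X Y Z⟫ ◁ one (f2 T (cpair (id2 f) (fwd u))) ▷ ⟪⟫ ⊚ bwd n |} |}.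

Definition as_2 (X Z : B) :
    psnat (compf (tenL X) (tenR Z)) (compf (tenR Z) (tenL X)) (fun Y => as1 M X Y Z) :=
  {| nat2 := fun Y Y' f => asn M (X, Y, Z) (X, Y', Z) ⟨⟨id1 X, f⟩, id1 Z⟩ |}.

Definition as_3 (X Y : B) :
    psnat (tenL (X ⊗ Y)) (compf (tenL Y) (tenL X)) (fun Z => as1 M X Y Z) :=
  {| nat2 := fun Z Z' f =>
       let n := asn M (X, Y, Z) (X, Y, Z') ⟨⟨id1 X, id1 Y⟩, f⟩ in
       let u := funit T (X, Y) in
       {| fwd := ⟪⟫ ◁ one (f2 T (cpair (fwd u) (id2 f))) ▷ ⟪as1 M X Y Z'⟫ ⊚ fwd n;
          bwd := (bwd n : pcell ⟪as1 M X Y Z; T # ⟨id1 X, T # ⟨id1 Y, f⟩⟩⟫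
                                ⟪T # ⟨T # ⟨id1 X, id1 Y⟩, f⟩; as1 M X Y Z'⟫)
            ⊚ ⟪⟫ ◁ one (f2 T (cpair (bwd u) (id2 f))) ▷ ⟪as1 M X Y Z'⟫ |} |}.

Definition lu_1 : psnat (tenL (uni0 M)) (idf B) (lu1 M) :=
  {| nat2 := fun X X' f =>
       let n := lun1 M X X' f in
       let u := funit (uni M) tt in
       {| fwd := ⟪⟫ ◁ one (f2 T (cpair (fwd u) (id2 f))) ▷ ⟪lu1 M X'⟫ ⊚ fwd n;
          bwd := (bwd n : pcell ⟪lu1 M X; f⟫ ⟪T # ⟨uni M # @id1 unitb tt, f⟩; lu1 M X'⟫)
            ⊚ ⟪⟫ ◁ one (f2 T (cpair (bwd u) (id2 f))) ▷ ⟪lu1 M X'⟫ |} |}.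

Definition ru_1 : psnat (tenR (uni0 M)) (idf B) (ru1 M) :=
  {| nat2 := fun X X' f =>
       let n := run1 M X X' f in
       let u := funit (uni M) tt in
       {| fwd := ⟪⟫ ◁ one (f2 T (cpair (id2 f) (fwd u))) ▷ ⟪ru1 M X'⟫ ⊚ fwd n;
          bwd := (bwd n : pcell ⟪ru1 M X; f⟫ ⟪T # ⟨f, uni M # @id1 unitb tt⟩; ru1 M X'⟫)
            ⊚ ⟪⟫ ◁ one (f2 T (cpair (id2 f) (bwd u))) ▷ ⟪ru1 M X'⟫ |} |}.

Definition premonoidal_of : premonoidal_data (B := B) (ten0 M) (uni0 M) :=
  {| pL := tenL; pR := tenR; pa := as1 M; pl := lu1 M; pr := ru1 M;
     pa1 := as_1; pa2 := as_2; pa3 := as_3; pln := lu_1; prn := ru_1;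
     pp := mp M; pm := mmid M; pll := mleft M; prr := mright M |}.

Definition asnat {X : bicat} {F0 G0 H0 : X -> B}
    (F : psfun F0) (G : psfun G0) (H : psfun H0) :
    psnat (tenf T (tenf T F G) H) (tenf T F (tenf T G H))
      (fun x => as1 M (F0 x) (G0 x) (H0 x)) :=
  pren (pairf (pairf F G) H) (asn M).

Definition unif (X : bicat) : psfun (fun _ : X => uni0 M) := compf (bangf X) (uni M).

Definition lunat {X : bicat} {F0 : X -> B} (F : psfun F0) :
    psnat (tenf T (unif X) F) F (fun x => lu1 M (F0 x)) := pren F (lun1 M).

Definition runat {X : bicat} {F0 : X -> B} (F : psfun F0) :
    psnat (tenf T F (unif X)) F (fun x => ru1 M (F0 x)) := pren F (run1 M).

Record is_monoidal : Prop := {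
  mon_bicat : is_bicat B;
  mon_ten : is_psfun T;
  mon_uni : is_psfun (uni M);
  mon_as : is_psnat _ _ (asn M);
  mon_lu : is_psnat _ _ (lun1 M);
  mon_ru : is_psnat _ _ (run1 M);
  mon_as_equiv : forall X Y Z, is_equivalence (as1 M X Y Z);
  mon_lu_equiv : forall X, is_equivalence (lu1 M X);
  mon_ru_equiv : forall X, is_equivalence (ru1 M X);
  mon_p :
    let a := pr41 B in let b := pr42 B in let c := pr43 B in let d := pr44 B in
    is_inv_modif (fun x : prodb (prodb (prodb B B) B) B =>
      mp M (fst (fst (fst x))) (snd (fst (fst x))) (snd (fst x)) (snd x))
    (compn (tenn T (asnat a b c) (idn d))
         (compn (asnat a (tenf T b c) d) (tenn T (idn a) (asnat b c d))))
      (compn (asnat (tenf T a b) c d) (asnat a b (tenf T c d)));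
  mon_mid :
    let a := pr21 B in let b := pr22 B in
    is_inv_modif (fun x : prodb B B => mmid M (fst x) (snd x))
    (compn (asnat a (unif _) b) (tenn T (idn a) (lunat b)))
      (tenn T (runat a) (idn b));
  mon_left :
    let a := pr21 B in let b := pr22 B in
    is_inv_modif (fun x : prodb B B => mleft M (fst x) (snd x))
    (compn (asnat (unif _) a b) (lunat (tenf T a b)))
      (tenn T (lunat a) (idn b));
  mon_right :
    let a := pr21 B in let b := pr22 B in
    is_inv_modif (fun x : prodb B B => mright M (fst x) (snd x))
    (compn (asnat a b (unif _)) (tenn T (idn a) (runat b)))
      (runat (tenf T a b));
  mon_cocycle : cocycle_axiom premonoidal_of;
  mon_norm_l : normalization_left premonoidal_of;
  mon_norm_r : normalization_right premonoidal_of }.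

End Monoidal.

(** ** Pseudomonads and their Kleisli bicategories *)

Record pseudomonad_data (B : bicat) := {
  S0 : B -> B;
  S :> psfun (B := B) (C := B) S0;
  mu1 : forall X : B, hom (S0 (S0 X)) (S0 X);
  mu : psnat (compf S S) S mu1;
  eta1 : forall X : B, hom X (S0 X);
  eta : psnat (idf B) S eta1;
  mm : forall X : B, iso2 ⟪S # mu1 X; mu1 X⟫ ⟪mu1 (S0 X); mu1 X⟫;
  ml : forall X : B, iso2 ⟪eta1 (S0 X); mu1 X⟫ ⟪⟫;
  mr : forall X : B, iso2 ⟪S # eta1 X; mu1 X⟫ ⟪⟫ }.

Section Pseudomonad.
Context {B : bicat} (T : pseudomonad_data B).

Record is_pseudomonad : Prop := {
  psm_S : is_psfun T;
  psm_mu : is_psnat (compf T T) T (mu T);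
  psm_eta : is_psnat (idf B) T (eta T);
  psm_m : is_inv_modif (mm T)
    (compn (postn (mu T) T) (mu T)) (compn (pren T (mu T)) (mu T));
  psm_l : is_inv_modif (ml T) (compn (pren T (eta T)) (mu T)) (idn T);
  psm_r : is_inv_modif (mr T) (compn (postn (eta T) T) (mu T)) (idn T);
  psm_assoc : forall X : B,
    ⟪⟫ ◁ fcell T (fwd (mm T X)) ▷ ⟪mu1 T X⟫
    ⊚ ⟪T # mu1 T (S0 T X)⟫ ◁ fwd (mm T X) ▷ ⟪⟫
    ⊚ ⟪⟫ ◁ fwd (mm T (S0 T X)) ▷ ⟪mu1 T X⟫
    =
    ⟪T # T # mu1 T X⟫ ◁ fwd (mm T X) ▷ ⟪⟫
    ⊚ ⟪⟫ ◁ fwd (mu T _ _ (mu1 T X)) ▷ ⟪mu1 T X⟫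
    ⊚ ⟪mu1 T (S0 T (S0 T X))⟫ ◁ fwd (mm T X) ▷ ⟪⟫;
  psm_unit : forall X : B,
    ⟪⟫ ◁ fcell T (fwd (ml T X)) ▷ ⟪mu1 T X⟫
    =
    ⟪T # eta1 T (S0 T X)⟫ ◁ fwd (mm T X) ▷ ⟪⟫
    ⊚ ⟪⟫ ◁ fwd (mr T (S0 T X)) ▷ ⟪mu1 T X⟫ }.

Definition kleisli_graph : graph1 :=
  {| ob := ob B;
     hom := fun X Y => hom X (S0 T Y);
     id1 := fun X => eta1 T X;
     comp1 := fun X Y Z f g => peval ⟪f; T # g; mu1 T Z⟫ |}.

Definition kleisli : bicat :=
  {| bicat1 := kleisli_graph;
     bicat2 := {|
       cell_ := fun (X Y : kleisli_graph) (f g : hom X Y) => @cell B X (S0 T Y) f g;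
       id2_ := fun (X Y : kleisli_graph) (f : hom X Y) => @id2 B X (S0 T Y) f;
       comp2_ := fun (X Y : kleisli_graph) (f g h : hom X Y) c d =>
         @comp2 B X (S0 T Y) f g h c d;
       hc2_ := fun (X Y Z : kleisli_graph) (f f' : hom X Y) (g g' : hom Y Z) c d =>
         hc2 (B := B) c (hc2 (f2 T (X := Y) (Y := S0 T Z) d) (id2 (mu1 T Z)));
       assoc_ := fun (X Y Z W : kleisli_graph) (f : hom X Y) (g : hom Y Z) (h : hom Z W) =>
         let f : @hom B X (S0 T Y) := f in let g : @hom B Y (S0 T Z) := g in
         let h : @hom B Z (S0 T W) := h in
         ⟪⟫ ◁ unfold ⟪f; T # g; mu1 T Z⟫ ▷ ⟪T # h; mu1 T W⟫
         ⊚ ⟪f; T # g⟫ ◁ bwd (mu T _ _ h) ▷ ⟪mu1 T W⟫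
         ⊚ ⟪f; T # g; T # T # h⟫ ◁ bwd (mm T W) ▷ ⟪⟫
         ⊚ ⟪f⟫ ◁ ffold T ⟪g; T # h; mu1 T W⟫ ▷ ⟪mu1 T W⟫;
       assoc'_ := fun (X Y Z W : kleisli_graph) (f : hom X Y) (g : hom Y Z) (h : hom Z W) =>
         let f : @hom B X (S0 T Y) := f in let g : @hom B Y (S0 T Z) := g in
         let h : @hom B Z (S0 T W) := h in
         ⟪f⟫ ◁ funfold T ⟪g; T # h; mu1 T W⟫ ▷ ⟪mu1 T W⟫
         ⊚ ⟪f; T # g; T # T # h⟫ ◁ fwd (mm T W) ▷ ⟪⟫
         ⊚ ⟪f; T # g⟫ ◁ fwd (mu T _ _ h) ▷ ⟪mu1 T W⟫
         ⊚ ⟪⟫ ◁ fold ⟪f; T # g; mu1 T Z⟫ ▷ ⟪T # h; mu1 T W⟫;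
       lun_ := fun (X Y : kleisli_graph) (f : hom X Y) =>
         let f : @hom B X (S0 T Y) := f in
         ⟪⟫ ◁ bwd (eta T _ _ f) ▷ ⟪mu1 T Y⟫ ⊚ ⟪f⟫ ◁ fwd (ml T Y) ▷ ⟪⟫;
       lun'_ := fun (X Y : kleisli_graph) (f : hom X Y) =>
         let f : @hom B X (S0 T Y) := f in
         ⟪f⟫ ◁ bwd (ml T Y) ▷ ⟪⟫ ⊚ ⟪⟫ ◁ fwd (eta T _ _ f) ▷ ⟪mu1 T Y⟫;
       run_ := fun (X Y : kleisli_graph) (f : hom X Y) =>
         let f : @hom B X (S0 T Y) := f in ⟪f⟫ ◁ fwd (mr T Y) ▷ ⟪⟫;
       run'_ := fun (X Y : kleisli_graph) (f : hom X Y) =>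
         let f : @hom B X (S0 T Y) := f in ⟪f⟫ ◁ bwd (mr T Y) ▷ ⟪⟫ |} |}.

End Pseudomonad.

(** ** Strengths *)

Section Strength.
Context {B : bicat} (M : monoidal_data B) (T : pseudomonad_data B).

Local Notation P := (premonoidal_of M).
Local Notation "X ⊗ Y" := (ten0 M X Y) (at level 25, left associativity).
Local Notation "X ⋉ f" := (pL P X # f) (at level 26, right associativity).
Local Notation "f ⋊ Y" := (pR P Y # f) (at level 27, left associativity).
Local Notation I := (uni0 M).
Local Notation a := (as1 M).
Local Notation l := (lu1 M).
Local Notation r := (ru1 M).
Local Notation "F ⊗f G" := (tenf (ten M) F G) (at level 25, left associativity).
Local Notation "m ⊗n n" := (tenn (ten M) m n) (at level 25, left associativity).

(** Transformations [X ⊗ T Y -> T (X ⊗ Y)] and [T X ⊗ Y -> T (X ⊗ Y)]. *)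
Definition lstr_data (t1 : forall X Y : B, hom (X ⊗ S0 T Y) (S0 T (X ⊗ Y))) : Type :=
  psnat (pr21 B ⊗f compf (pr22 B) T) (compf (pr21 B ⊗f pr22 B) T) (fun X => t1 (fst X) (snd X)).

Definition rstr_data (s1 : forall X Y : B, hom (S0 T X ⊗ Y) (S0 T (X ⊗ Y))) : Type :=
  psnat (compf (pr21 B) T ⊗f pr22 B) (compf (pr21 B ⊗f pr22 B) T) (fun X => s1 (fst X) (snd X)).

Section LeftStrength.
Context {t1 : forall X Y : B, hom (X ⊗ S0 T Y) (S0 T (X ⊗ Y))} (t : lstr_data t1).

(** Naturality in each variable. *)
Definition t_snd (X : B) {Y Y' : B} (f : hom Y Y') :
    iso2 ⟪X ⋉ T # f; t1 X Y'⟫ ⟪t1 X Y; T # X ⋉ f⟫ :=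
  t (X, Y) (X, Y') ⟨id1 X, f⟩.

Definition t_fst {X X' : B} (f : hom X X') (Y : B) :
    iso2 ⟪f ⋊ S0 T Y; t1 X' Y⟫ ⟪t1 X Y; T # (f ⋊ Y)⟫ :=
  let n : iso2 ⟪ten M # ⟨f, T # id1 Y⟩; t1 X' Y⟫ ⟪t1 X Y; T # (f ⋊ Y)⟫ :=
    t (X, Y) (X', Y) ⟨f, id1 Y⟩ in
  {| fwd := ⟪⟫ ◁ one (f2 (ten M) (cpair (id2 f) (fwd (funit T Y)))) ▷ ⟪t1 X' Y⟫ ⊚ fwd n;
     bwd := bwd n
            ⊚ ⟪⟫ ◁ one (f2 (ten M) (cpair (id2 f) (bwd (funit T Y)))) ▷ ⟪t1 X' Y⟫ |}.

(** The transformation [t] at a pair of pseudofunctors. *)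
Definition tnat {X : bicat} {F0 G0 : X -> B} (F : psfun F0) (G : psfun G0) :
    psnat (F ⊗f compf G T) (compf (F ⊗f G) T) (fun x => t1 (F0 x) (G0 x)) :=
  pren (pairf F G) t.

Record left_strength := {
  ls_psnat : is_psnat (pr21 B ⊗f compf (pr22 B) T) (compf (pr21 B ⊗f pr22 B) T) t;
  ls_x : forall X : B, iso2 ⟪t1 I X; T # l X⟫ ⟪l (S0 T X)⟫;
  ls_y : forall X Y Z : B,
    iso2 ⟪t1 (X ⊗ Y) Z; T # a X Y Z⟫ ⟪a X Y (S0 T Z); X ⋉ t1 Y Z; t1 X (Y ⊗ Z)⟫;
  ls_w : forall X Y : B,
    iso2 ⟪t1 X (S0 T Y); T # t1 X Y; mu1 T (X ⊗ Y)⟫ ⟪X ⋉ mu1 T Y; t1 X Y⟫;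
  ls_z : forall X Y : B, iso2 ⟪X ⋉ eta1 T Y; t1 X Y⟫ ⟪eta1 T (X ⊗ Y)⟫;
  ls_x_modif : is_inv_modif ls_x
    (compn (tnat (unif M B) (idf B)) (postn (lun1 M) T)) (pren T (lun1 M));
  ls_y_modif :
    let p := pr31 B in let q := pr32 B in let s := pr33 B in
    is_inv_modif (fun x : prodb (prodb B B) B => ls_y (fst (fst x)) (snd (fst x)) (snd x))
      (compn (tnat (p ⊗f q) s) (postn (asn M) T))
      (compn (asnat M p q (compf s T)) (compn (idn p ⊗n tnat q s) (tnat p (q ⊗f s))));
  ls_w_modif :
    let p := pr21 B in let q := pr22 B in
    is_inv_modif (fun x : prodb B B => ls_w (fst x) (snd x))
      (compn (tnat p (compf q T)) (compn (postn t T) (pren (p ⊗f q) (mu T))))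
      (compn (idn p ⊗n pren q (mu T)) t);
  ls_z_modif :
    let p := pr21 B in let q := pr22 B in
    is_inv_modif (fun x : prodb B B => ls_z (fst x) (snd x))
      (compn (idn p ⊗n pren q (eta T)) t) (pren (p ⊗f q) (eta T));
  (* x, y and the structure of the monoidal bicategory *)
  ls_pentagonator : forall X Y Z W : B,
    ⟪t1 (X ⊗ Y ⊗ Z) W⟫ ◁ fcell T (fwd (mp M X Y Z W)) ▷ ⟪⟫
    ⊚ ⟪⟫ ◁ fwd (ls_y (X ⊗ Y) Z W) ▷ ⟪T # a X Y (Z ⊗ W)⟫
    ⊚ ⟪a (X ⊗ Y) Z (S0 T W); (X ⊗ Y) ⋉ t1 Z W⟫ ◁ fwd (ls_y X Y (Z ⊗ W)) ▷ ⟪⟫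
    ⊚ ⟪a (X ⊗ Y) Z (S0 T W)⟫ ◁ fwd (pa3 P X Y _ _ (t1 Z W))
       ▷ ⟪X ⋉ t1 Y (Z ⊗ W); t1 X (Y ⊗ (Z ⊗ W))⟫
    =
    ⟪⟫ ◁ bwd (t_fst (a X Y Z) W) ▷ ⟪T # a X (Y ⊗ Z) W; T # X ⋉ a Y Z W⟫
    ⊚ ⟪a X Y Z ⋊ S0 T W⟫ ◁ fwd (ls_y X (Y ⊗ Z) W) ▷ ⟪T # X ⋉ a Y Z W⟫
    ⊚ ⟪a X Y Z ⋊ S0 T W; a X (Y ⊗ Z) (S0 T W); X ⋉ t1 (Y ⊗ Z) W⟫
       ◁ bwd (t_snd X (a Y Z W)) ▷ ⟪⟫
    ⊚ ⟪a X Y Z ⋊ S0 T W; a X (Y ⊗ Z) (S0 T W)⟫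
       ◁ fcell (pL P X) (fwd (ls_y Y Z W)) ▷ ⟪t1 X (Y ⊗ (Z ⊗ W))⟫
    ⊚ ⟪⟫ ◁ fwd (mp M X Y Z (S0 T W))
       ▷ ⟪X ⋉ (Y ⋉ t1 Z W); X ⋉ t1 Y (Z ⊗ W); t1 X (Y ⊗ (Z ⊗ W))⟫;
  ls_left_unit : forall X Y : B,
    ⟪t1 (I ⊗ X) Y⟫ ◁ fcell T (fwd (mleft M X Y)) ▷ ⟪⟫
    ⊚ bwd (t_fst (l X) Y)
    =
    ⟪⟫ ◁ fwd (ls_y I X Y) ▷ ⟪T # l (X ⊗ Y)⟫
    ⊚ ⟪a I X (S0 T Y); I ⋉ t1 X Y⟫ ◁ fwd (ls_x (X ⊗ Y)) ▷ ⟪⟫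
    ⊚ ⟪a I X (S0 T Y)⟫ ◁ fwd (pln P _ _ (t1 X Y)) ▷ ⟪⟫
    ⊚ ⟪⟫ ◁ fwd (mleft M X (S0 T Y)) ▷ ⟪t1 X Y⟫;
  ls_middle_unit : forall X Y : B,
    ⟪t1 (X ⊗ I) Y⟫ ◁ fcell T (fwd (mmid M X Y)) ▷ ⟪⟫
    ⊚ bwd (t_fst (r X) Y)
    =
    ⟪⟫ ◁ fwd (ls_y X I Y) ▷ ⟪T # X ⋉ l Y⟫
    ⊚ ⟪a X I (S0 T Y); X ⋉ t1 I Y⟫ ◁ bwd (t_snd X (l Y)) ▷ ⟪⟫
    ⊚ ⟪a X I (S0 T Y)⟫ ◁ fcell (pL P X) (fwd (ls_x Y)) ▷ ⟪t1 X Y⟫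
    ⊚ ⟪⟫ ◁ fwd (mmid M X (S0 T Y)) ▷ ⟪t1 X Y⟫;
  (* w, z and the structure of the pseudomonad *)
  ls_w_assoc : forall X Y : B,
    ⟪t1 X (S0 T (S0 T Y)); T # t1 X (S0 T Y); T # T # t1 X Y⟫
      ◁ fwd (mm T (X ⊗ Y)) ▷ ⟪⟫
    ⊚ ⟪t1 X (S0 T (S0 T Y)); T # t1 X (S0 T Y)⟫ ◁ fwd (mu T _ _ (t1 X Y)) ▷ ⟪mu1 T (X ⊗ Y)⟫
    ⊚ ⟪⟫ ◁ fwd (ls_w X (S0 T Y)) ▷ ⟪T # t1 X Y; mu1 T (X ⊗ Y)⟫
    ⊚ ⟪X ⋉ mu1 T (S0 T Y)⟫ ◁ fwd (ls_w X Y) ▷ ⟪⟫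
    =
    ⟪t1 X (S0 T (S0 T Y))⟫ ◁ fcell T (fwd (ls_w X Y)) ▷ ⟪mu1 T (X ⊗ Y)⟫
    ⊚ ⟪⟫ ◁ bwd (t_snd X (mu1 T Y)) ▷ ⟪T # t1 X Y; mu1 T (X ⊗ Y)⟫
    ⊚ ⟪X ⋉ T # mu1 T Y⟫ ◁ fwd (ls_w X Y) ▷ ⟪⟫
    ⊚ ⟪⟫ ◁ fcell (pL P X) (fwd (mm T Y)) ▷ ⟪t1 X Y⟫;
  ls_w_left_unit : forall X Y : B,
    ⟪X ⋉ eta1 T (S0 T Y)⟫ ◁ fwd (ls_w X Y) ▷ ⟪⟫
    ⊚ ⟪⟫ ◁ fcell (pL P X) (fwd (ml T Y)) ▷ ⟪t1 X Y⟫
    =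
    ⟪⟫ ◁ fwd (ls_z X (S0 T Y)) ▷ ⟪T # t1 X Y; mu1 T (X ⊗ Y)⟫
    ⊚ ⟪⟫ ◁ bwd (eta T _ _ (t1 X Y)) ▷ ⟪mu1 T (X ⊗ Y)⟫
    ⊚ ⟪t1 X Y⟫ ◁ fwd (ml T (X ⊗ Y)) ▷ ⟪⟫;
  ls_w_right_unit : forall X Y : B,
    ⟪X ⋉ T # eta1 T Y⟫ ◁ fwd (ls_w X Y) ▷ ⟪⟫
    ⊚ ⟪⟫ ◁ fcell (pL P X) (fwd (mr T Y)) ▷ ⟪t1 X Y⟫
    =
    ⟪⟫ ◁ fwd (t_snd X (eta1 T Y)) ▷ ⟪T # t1 X Y; mu1 T (X ⊗ Y)⟫
    ⊚ ⟪t1 X Y⟫ ◁ fcell T (fwd (ls_z X Y)) ▷ ⟪mu1 T (X ⊗ Y)⟫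
    ⊚ ⟪t1 X Y⟫ ◁ fwd (mr T (X ⊗ Y)) ▷ ⟪⟫;
  (* z and w versus x *)
  ls_z_x : forall X : B,
    ⟪⟫ ◁ fwd (ls_z I X) ▷ ⟪T # l X⟫ ⊚ bwd (eta T _ _ (l X))
    = ⟪I ⋉ eta1 T X⟫ ◁ fwd (ls_x X) ▷ ⟪⟫ ⊚ fwd (pln P _ _ (eta1 T X));
  ls_w_x : forall X : B,
    ⟪⟫ ◁ fwd (ls_w I X) ▷ ⟪T # l X⟫
    ⊚ ⟪I ⋉ mu1 T X⟫ ◁ fwd (ls_x X) ▷ ⟪⟫
    ⊚ fwd (pln P _ _ (mu1 T X))
    =
    ⟪t1 I (S0 T X); T # t1 I X⟫ ◁ bwd (mu T _ _ (l X)) ▷ ⟪⟫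
    ⊚ ⟪t1 I (S0 T X)⟫ ◁ fcell T (fwd (ls_x X)) ▷ ⟪mu1 T X⟫
    ⊚ ⟪⟫ ◁ fwd (ls_x (S0 T X)) ▷ ⟪mu1 T X⟫;
  (* z and w versus y *)
  ls_z_y : forall X Y Z : B,
    ⟪⟫ ◁ fwd (ls_z (X ⊗ Y) Z) ▷ ⟪T # a X Y Z⟫ ⊚ bwd (eta T _ _ (a X Y Z))
    =
    ⟪(X ⊗ Y) ⋉ eta1 T Z⟫ ◁ fwd (ls_y X Y Z) ▷ ⟪⟫
    ⊚ ⟪⟫ ◁ fwd (pa3 P X Y _ _ (eta1 T Z)) ▷ ⟪X ⋉ t1 Y Z; t1 X (Y ⊗ Z)⟫
    ⊚ ⟪a X Y Z⟫ ◁ fcell (pL P X) (fwd (ls_z Y Z)) ▷ ⟪t1 X (Y ⊗ Z)⟫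
    ⊚ ⟪a X Y Z⟫ ◁ fwd (ls_z X (Y ⊗ Z)) ▷ ⟪⟫;
  ls_w_y : forall X Y Z : B,
    ⟪⟫ ◁ fwd (ls_w (X ⊗ Y) Z) ▷ ⟪T # a X Y Z⟫
    ⊚ ⟪(X ⊗ Y) ⋉ mu1 T Z⟫ ◁ fwd (ls_y X Y Z) ▷ ⟪⟫
    ⊚ ⟪⟫ ◁ fwd (pa3 P X Y _ _ (mu1 T Z)) ▷ ⟪X ⋉ t1 Y Z; t1 X (Y ⊗ Z)⟫
    =
    ⟪t1 (X ⊗ Y) (S0 T Z); T # t1 (X ⊗ Y) Z⟫ ◁ bwd (mu T _ _ (a X Y Z)) ▷ ⟪⟫
    ⊚ ⟪t1 (X ⊗ Y) (S0 T Z)⟫ ◁ fcell T (fwd (ls_y X Y Z)) ▷ ⟪mu1 T (X ⊗ (Y ⊗ Z))⟫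
    ⊚ ⟪⟫ ◁ fwd (ls_y X Y (S0 T Z))
       ▷ ⟪T # X ⋉ t1 Y Z; T # t1 X (Y ⊗ Z); mu1 T (X ⊗ (Y ⊗ Z))⟫
    ⊚ ⟪a X Y (S0 T (S0 T Z)); X ⋉ t1 Y (S0 T Z)⟫ ◁ bwd (t_snd X (t1 Y Z))
       ▷ ⟪T # t1 X (Y ⊗ Z); mu1 T (X ⊗ (Y ⊗ Z))⟫
    ⊚ ⟪a X Y (S0 T (S0 T Z)); X ⋉ t1 Y (S0 T Z); X ⋉ T # t1 Y Z⟫
       ◁ fwd (ls_w X (Y ⊗ Z)) ▷ ⟪⟫
    ⊚ ⟪a X Y (S0 T (S0 T Z))⟫ ◁ fcell (pL P X) (fwd (ls_w Y Z)) ▷ ⟪t1 X (Y ⊗ Z)⟫ }.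

End LeftStrength.

Section RightStrength.
Context {s1 : forall X Y : B, hom (S0 T X ⊗ Y) (S0 T (X ⊗ Y))} (s : rstr_data s1).

Definition s_fst {X X' : B} (f : hom X X') (Y : B) :
    iso2 ⟪(T # f) ⋊ Y; s1 X' Y⟫ ⟪s1 X Y; T # (f ⋊ Y)⟫ :=
  s (X, Y) (X', Y) ⟨f, id1 Y⟩.

Definition s_snd (X : B) {Y Y' : B} (f : hom Y Y') :
    iso2 ⟪S0 T X ⋉ f; s1 X Y'⟫ ⟪s1 X Y; T # X ⋉ f⟫ :=
  let n : iso2 ⟪ten M # ⟨T # id1 X, f⟩; s1 X Y'⟫ ⟪s1 X Y; T # X ⋉ f⟫ :=
    s (X, Y) (X, Y') ⟨id1 X, f⟩ in
  {| fwd := ⟪⟫ ◁ one (f2 (ten M) (cpair (fwd (funit T X)) (id2 f))) ▷ ⟪s1 X Y'⟫ ⊚ fwd n;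
     bwd := bwd n
            ⊚ ⟪⟫ ◁ one (f2 (ten M) (cpair (bwd (funit T X)) (id2 f))) ▷ ⟪s1 X Y'⟫ |}.

Definition snat {X : bicat} {F0 G0 : X -> B} (F : psfun F0) (G : psfun G0) :
    psnat (compf F T ⊗f G) (compf (F ⊗f G) T) (fun x => s1 (F0 x) (G0 x)) :=
  pren (pairf F G) s.

Record right_strength := {
  rs_psnat : is_psnat (compf (pr21 B) T ⊗f pr22 B) (compf (pr21 B ⊗f pr22 B) T) s;
  rs_x : forall X : B, iso2 ⟪s1 X I; T # r X⟫ ⟪r (S0 T X)⟫;
  rs_y : forall X Y Z : B,
    iso2 ⟪a (S0 T X) Y Z; s1 X (Y ⊗ Z)⟫ ⟪s1 X Y ⋊ Z; s1 (X ⊗ Y) Z; T # a X Y Z⟫;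
  rs_w : forall X Y : B,
    iso2 ⟪s1 (S0 T X) Y; T # s1 X Y; mu1 T (X ⊗ Y)⟫ ⟪mu1 T X ⋊ Y; s1 X Y⟫;
  rs_z : forall X Y : B, iso2 ⟪eta1 T X ⋊ Y; s1 X Y⟫ ⟪eta1 T (X ⊗ Y)⟫;
  rs_x_modif : is_inv_modif rs_x
    (compn (snat (idf B) (unif M B)) (postn (run1 M) T)) (pren T (run1 M));
  rs_y_modif :
    let p := pr31 B in let q := pr32 B in let v := pr33 B in
    is_inv_modif (fun x : prodb (prodb B B) B => rs_y (fst (fst x)) (snd (fst x)) (snd x))
      (compn (asnat M (compf p T) q v) (snat p (q ⊗f v)))
      (compn (snat p q ⊗n idn v) (compn (snat (p ⊗f q) v) (postn (asn M) T)));
  rs_w_modif :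
    let p := pr21 B in let q := pr22 B in
    is_inv_modif (fun x : prodb B B => rs_w (fst x) (snd x))
      (compn (snat (compf p T) q) (compn (postn s T) (pren (p ⊗f q) (mu T))))
      (compn (pren p (mu T) ⊗n idn q) s);
  rs_z_modif :
    let p := pr21 B in let q := pr22 B in
    is_inv_modif (fun x : prodb B B => rs_z (fst x) (snd x))
      (compn (pren p (eta T) ⊗n idn q) s) (pren (p ⊗f q) (eta T));
  (* x, y and the structure of the monoidal bicategory *)
  rs_pentagonator : forall X Y Z W : B,
    ⟪⟫ ◁ fwd (mp M (S0 T X) Y Z W) ▷ ⟪s1 X (Y ⊗ (Z ⊗ W))⟫
    ⊚ ⟪a (S0 T X ⊗ Y) Z W⟫ ◁ fwd (rs_y X Y (Z ⊗ W)) ▷ ⟪⟫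
    ⊚ ⟪⟫ ◁ bwd (pa1 P Z W _ _ (s1 X Y)) ▷ ⟪s1 (X ⊗ Y) (Z ⊗ W); T # a X Y (Z ⊗ W)⟫
    ⊚ ⟪(s1 X Y ⋊ Z) ⋊ W⟫ ◁ fwd (rs_y (X ⊗ Y) Z W) ▷ ⟪T # a X Y (Z ⊗ W)⟫
    =
    ⟪a (S0 T X) Y Z ⋊ W; a (S0 T X) (Y ⊗ Z) W⟫ ◁ fwd (s_snd X (a Y Z W)) ▷ ⟪⟫
    ⊚ ⟪a (S0 T X) Y Z ⋊ W⟫ ◁ fwd (rs_y X (Y ⊗ Z) W) ▷ ⟪T # X ⋉ a Y Z W⟫
    ⊚ ⟪⟫ ◁ fcell (pR P W) (fwd (rs_y X Y Z))
       ▷ ⟪s1 (X ⊗ (Y ⊗ Z)) W; T # a X (Y ⊗ Z) W; T # X ⋉ a Y Z W⟫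
    ⊚ ⟪(s1 X Y ⋊ Z) ⋊ W; s1 (X ⊗ Y) Z ⋊ W⟫ ◁ fwd (s_fst (a X Y Z) W)
       ▷ ⟪T # a X (Y ⊗ Z) W; T # X ⋉ a Y Z W⟫
    ⊚ ⟪(s1 X Y ⋊ Z) ⋊ W; s1 (X ⊗ Y) Z ⋊ W; s1 (X ⊗ Y ⊗ Z) W⟫
       ◁ fcell T (fwd (mp M X Y Z W)) ▷ ⟪⟫;
  rs_right_unit : forall X Y : B,
    ⟪⟫ ◁ fwd (mright M (S0 T X) Y) ▷ ⟪s1 X Y⟫
    =
    ⟪a (S0 T X) Y I⟫ ◁ fwd (s_snd X (r Y)) ▷ ⟪⟫
    ⊚ ⟪⟫ ◁ fwd (rs_y X Y I) ▷ ⟪T # X ⋉ r Y⟫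
    ⊚ ⟪s1 X Y ⋊ I; s1 (X ⊗ Y) I⟫ ◁ fcell T (fwd (mright M X Y)) ▷ ⟪⟫
    ⊚ ⟪s1 X Y ⋊ I⟫ ◁ fwd (rs_x (X ⊗ Y)) ▷ ⟪⟫
    ⊚ fwd (prn P _ _ (s1 X Y));
  rs_middle_unit : forall X Y : B,
    ⟪⟫ ◁ fwd (mmid M (S0 T X) Y) ▷ ⟪s1 X Y⟫
    =
    ⟪a (S0 T X) I Y⟫ ◁ fwd (s_snd X (l Y)) ▷ ⟪⟫
    ⊚ ⟪⟫ ◁ fwd (rs_y X I Y) ▷ ⟪T # X ⋉ l Y⟫
    ⊚ ⟪s1 X I ⋊ Y; s1 (X ⊗ I) Y⟫ ◁ fcell T (fwd (mmid M X Y)) ▷ ⟪⟫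
    ⊚ ⟪s1 X I ⋊ Y⟫ ◁ bwd (s_fst (r X) Y) ▷ ⟪⟫
    ⊚ ⟪⟫ ◁ fcell (pR P Y) (fwd (rs_x X)) ▷ ⟪s1 X Y⟫;
  (* w, z and the structure of the pseudomonad *)
  rs_w_assoc : forall X Y : B,
    ⟪s1 (S0 T (S0 T X)) Y; T # s1 (S0 T X) Y; T # T # s1 X Y⟫
      ◁ fwd (mm T (X ⊗ Y)) ▷ ⟪⟫
    ⊚ ⟪s1 (S0 T (S0 T X)) Y; T # s1 (S0 T X) Y⟫ ◁ fwd (mu T _ _ (s1 X Y)) ▷ ⟪mu1 T (X ⊗ Y)⟫
    ⊚ ⟪⟫ ◁ fwd (rs_w (S0 T X) Y) ▷ ⟪T # s1 X Y; mu1 T (X ⊗ Y)⟫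
    ⊚ ⟪mu1 T (S0 T X) ⋊ Y⟫ ◁ fwd (rs_w X Y) ▷ ⟪⟫
    =
    ⟪s1 (S0 T (S0 T X)) Y⟫ ◁ fcell T (fwd (rs_w X Y)) ▷ ⟪mu1 T (X ⊗ Y)⟫
    ⊚ ⟪⟫ ◁ bwd (s_fst (mu1 T X) Y) ▷ ⟪T # s1 X Y; mu1 T (X ⊗ Y)⟫
    ⊚ ⟪(T # mu1 T X) ⋊ Y⟫ ◁ fwd (rs_w X Y) ▷ ⟪⟫
    ⊚ ⟪⟫ ◁ fcell (pR P Y) (fwd (mm T X)) ▷ ⟪s1 X Y⟫;
  rs_w_left_unit : forall X Y : B,
    ⟪eta1 T (S0 T X) ⋊ Y⟫ ◁ fwd (rs_w X Y) ▷ ⟪⟫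
    ⊚ ⟪⟫ ◁ fcell (pR P Y) (fwd (ml T X)) ▷ ⟪s1 X Y⟫
    =
    ⟪⟫ ◁ fwd (rs_z (S0 T X) Y) ▷ ⟪T # s1 X Y; mu1 T (X ⊗ Y)⟫
    ⊚ ⟪⟫ ◁ bwd (eta T _ _ (s1 X Y)) ▷ ⟪mu1 T (X ⊗ Y)⟫
    ⊚ ⟪s1 X Y⟫ ◁ fwd (ml T (X ⊗ Y)) ▷ ⟪⟫;
  rs_w_right_unit : forall X Y : B,
    ⟪(T # eta1 T X) ⋊ Y⟫ ◁ fwd (rs_w X Y) ▷ ⟪⟫
    ⊚ ⟪⟫ ◁ fcell (pR P Y) (fwd (mr T X)) ▷ ⟪s1 X Y⟫
    =
    ⟪⟫ ◁ fwd (s_fst (eta1 T X) Y) ▷ ⟪T # s1 X Y; mu1 T (X ⊗ Y)⟫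
    ⊚ ⟪s1 X Y⟫ ◁ fcell T (fwd (rs_z X Y)) ▷ ⟪mu1 T (X ⊗ Y)⟫
    ⊚ ⟪s1 X Y⟫ ◁ fwd (mr T (X ⊗ Y)) ▷ ⟪⟫;
  (* z and w versus x *)
  rs_z_x : forall X : B,
    ⟪⟫ ◁ fwd (rs_z X I) ▷ ⟪T # r X⟫ ⊚ bwd (eta T _ _ (r X))
    = ⟪eta1 T X ⋊ I⟫ ◁ fwd (rs_x X) ▷ ⟪⟫ ⊚ fwd (prn P _ _ (eta1 T X));
  rs_w_x : forall X : B,
    ⟪⟫ ◁ fwd (rs_w X I) ▷ ⟪T # r X⟫
    ⊚ ⟪mu1 T X ⋊ I⟫ ◁ fwd (rs_x X) ▷ ⟪⟫
    ⊚ fwd (prn P _ _ (mu1 T X))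
    =
    ⟪s1 (S0 T X) I; T # s1 X I⟫ ◁ bwd (mu T _ _ (r X)) ▷ ⟪⟫
    ⊚ ⟪s1 (S0 T X) I⟫ ◁ fcell T (fwd (rs_x X)) ▷ ⟪mu1 T X⟫
    ⊚ ⟪⟫ ◁ fwd (rs_x (S0 T X)) ▷ ⟪mu1 T X⟫;
  (* z and w versus y *)
  rs_z_y : forall X Y Z : B,
    ⟪⟫ ◁ fwd (pa1 P Y Z _ _ (eta1 T X)) ▷ ⟪s1 X (Y ⊗ Z)⟫
    ⊚ ⟪a X Y Z⟫ ◁ fwd (rs_z X (Y ⊗ Z)) ▷ ⟪⟫
    =
    ⟪(eta1 T X ⋊ Y) ⋊ Z⟫ ◁ fwd (rs_y X Y Z) ▷ ⟪⟫
    ⊚ ⟪⟫ ◁ fcell (pR P Z) (fwd (rs_z X Y)) ▷ ⟪s1 (X ⊗ Y) Z; T # a X Y Z⟫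
    ⊚ ⟪⟫ ◁ fwd (rs_z (X ⊗ Y) Z) ▷ ⟪T # a X Y Z⟫
    ⊚ bwd (eta T _ _ (a X Y Z));
  rs_w_y : forall X Y Z : B,
    ⟪a (S0 T (S0 T X)) Y Z⟫ ◁ fwd (rs_w X (Y ⊗ Z)) ▷ ⟪⟫
    ⊚ ⟪⟫ ◁ bwd (pa1 P Y Z _ _ (mu1 T X)) ▷ ⟪s1 X (Y ⊗ Z)⟫
    ⊚ ⟪(mu1 T X ⋊ Y) ⋊ Z⟫ ◁ fwd (rs_y X Y Z) ▷ ⟪⟫
    =
    ⟪⟫ ◁ fwd (rs_y (S0 T X) Y Z) ▷ ⟪T # s1 X (Y ⊗ Z); mu1 T (X ⊗ (Y ⊗ Z))⟫
    ⊚ ⟪s1 (S0 T X) Y ⋊ Z; s1 (S0 T X ⊗ Y) Z⟫ ◁ fcell T (fwd (rs_y X Y Z))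
       ▷ ⟪mu1 T (X ⊗ (Y ⊗ Z))⟫
    ⊚ ⟪s1 (S0 T X) Y ⋊ Z; s1 (S0 T X ⊗ Y) Z; T # (s1 X Y ⋊ Z); T # s1 (X ⊗ Y) Z⟫
       ◁ fwd (mu T _ _ (a X Y Z)) ▷ ⟪⟫
    ⊚ ⟪s1 (S0 T X) Y ⋊ Z⟫ ◁ bwd (s_fst (s1 X Y) Z)
       ▷ ⟪T # s1 (X ⊗ Y) Z; mu1 T (X ⊗ Y ⊗ Z); T # a X Y Z⟫
    ⊚ ⟪s1 (S0 T X) Y ⋊ Z; (T # s1 X Y) ⋊ Z⟫ ◁ fwd (rs_w (X ⊗ Y) Z) ▷ ⟪T # a X Y Z⟫
    ⊚ ⟪⟫ ◁ fcell (pR P Z) (fwd (rs_w X Y)) ▷ ⟪s1 (X ⊗ Y) Z; T # a X Y Z⟫ }.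

End RightStrength.

Section Bistrong.
Context {t1 : forall X Y : B, hom (X ⊗ S0 T Y) (S0 T (X ⊗ Y))} (t : lstr_data t1).
Context {s1 : forall X Y : B, hom (S0 T X ⊗ Y) (S0 T (X ⊗ Y))} (s : rstr_data s1).

(** Bistrong structure on the pseudomonad [T] with underlying transformations
    [t] and [s]. *)
Record bistrong := {
  bs_left : left_strength t;
  bs_right : right_strength s;
  bs_q : forall X Y Z : B,
    iso2 ⟪t1 X Y ⋊ Z; s1 (X ⊗ Y) Z; T # a X Y Z⟫
         ⟪a X (S0 T Y) Z; X ⋉ s1 Y Z; t1 X (Y ⊗ Z)⟫;
  bs_q_modif :
    let p := pr31 B in let q := pr32 B in let v := pr33 B in
    is_inv_modif (fun x : prodb (prodb B B) B => bs_q (fst (fst x)) (snd (fst x)) (snd x))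
      (compn (tnat t p q ⊗n idn v) (compn (snat s (p ⊗f q) v) (postn (asn M) T)))
      (compn (asnat M p (compf q T) v)
         (compn (idn p ⊗n snat s q v) (tnat t p (q ⊗f v))));
  bs_z : forall X Y Z : B,
    ⟪⟫ ◁ fcell (pR P Z) (fwd (ls_z bs_left X Y)) ▷ ⟪s1 (X ⊗ Y) Z; T # a X Y Z⟫
    ⊚ ⟪⟫ ◁ fwd (rs_z bs_right (X ⊗ Y) Z) ▷ ⟪T # a X Y Z⟫
    ⊚ bwd (eta T _ _ (a X Y Z))
    =
    ⟪(X ⋉ eta1 T Y) ⋊ Z⟫ ◁ fwd (bs_q X Y Z) ▷ ⟪⟫
    ⊚ ⟪⟫ ◁ fwd (pa2 P X Z _ _ (eta1 T Y)) ▷ ⟪X ⋉ s1 Y Z; t1 X (Y ⊗ Z)⟫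
    ⊚ ⟪a X Y Z⟫ ◁ fcell (pL P X) (fwd (rs_z bs_right Y Z)) ▷ ⟪t1 X (Y ⊗ Z)⟫
    ⊚ ⟪a X Y Z⟫ ◁ fwd (ls_z bs_left X (Y ⊗ Z)) ▷ ⟪⟫;
  bs_w : forall X Y Z : B,
    ⟪⟫ ◁ fcell (pR P Z) (fwd (ls_w bs_left X Y)) ▷ ⟪s1 (X ⊗ Y) Z; T # a X Y Z⟫
    ⊚ ⟪(X ⋉ mu1 T Y) ⋊ Z⟫ ◁ fwd (bs_q X Y Z) ▷ ⟪⟫
    ⊚ ⟪⟫ ◁ fwd (pa2 P X Z _ _ (mu1 T Y)) ▷ ⟪X ⋉ s1 Y Z; t1 X (Y ⊗ Z)⟫
    =
    ⟪t1 X (S0 T Y) ⋊ Z; (T # t1 X Y) ⋊ Z⟫ ◁ bwd (rs_w bs_right (X ⊗ Y) Z)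
       ▷ ⟪T # a X Y Z⟫
    ⊚ ⟪t1 X (S0 T Y) ⋊ Z⟫ ◁ fwd (s_fst s (t1 X Y) Z)
       ▷ ⟪T # s1 (X ⊗ Y) Z; mu1 T (X ⊗ Y ⊗ Z); T # a X Y Z⟫
    ⊚ ⟪t1 X (S0 T Y) ⋊ Z; s1 (X ⊗ S0 T Y) Z; T # (t1 X Y ⋊ Z); T # s1 (X ⊗ Y) Z⟫
       ◁ bwd (mu T _ _ (a X Y Z)) ▷ ⟪⟫
    ⊚ ⟪t1 X (S0 T Y) ⋊ Z; s1 (X ⊗ S0 T Y) Z⟫ ◁ fcell T (fwd (bs_q X Y Z))
       ▷ ⟪mu1 T (X ⊗ (Y ⊗ Z))⟫
    ⊚ ⟪⟫ ◁ fwd (bs_q X (S0 T Y) Z)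
       ▷ ⟪T # X ⋉ s1 Y Z; T # t1 X (Y ⊗ Z); mu1 T (X ⊗ (Y ⊗ Z))⟫
    ⊚ ⟪a X (S0 T (S0 T Y)) Z; X ⋉ s1 (S0 T Y) Z⟫ ◁ bwd (t_snd t X (s1 Y Z))
       ▷ ⟪T # t1 X (Y ⊗ Z); mu1 T (X ⊗ (Y ⊗ Z))⟫
    ⊚ ⟪a X (S0 T (S0 T Y)) Z; X ⋉ s1 (S0 T Y) Z; X ⋉ T # s1 Y Z⟫
       ◁ fwd (ls_w bs_left X (Y ⊗ Z)) ▷ ⟪⟫
    ⊚ ⟪a X (S0 T (S0 T Y)) Z⟫ ◁ fcell (pL P X) (fwd (rs_w bs_right Y Z))
       ▷ ⟪t1 X (Y ⊗ Z)⟫ }.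

End Bistrong.
End Strength.

(** * Double categories *)

(** A strict double category is presented with one type for each kind of cell
    and source and target maps, as an internal category in categories; thus
    strict equations between composites need no transport.  Composites are
    total functions which are meaningful, and constrained, only on composable
    arguments.  [hcomp f g] is [[f|g]] and [vcomp u v] is [u/v]; [hidS u] is
    the horizontal identity square [Id^u] and [vidS f] the vertical one
    [Id_f]. *)
Record dcat := {
  dob : Type;
  dh : Type;
  dv : Type;
  dsq : Type;
  hdom : dh -> dob;
  hcod : dh -> dob;
  vdom : dv -> dob;
  vcod : dv -> dob;
  top : dsq -> dh;
  bot : dsq -> dh;
  lft : dsq -> dv;
  rgt : dsq -> dv;
  hid : dob -> dh;
  hcomp : dh -> dh -> dh;
  vid : dob -> dv;
  vcomp : dv -> dv -> dv;
  hidS : dv -> dsq;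
  hcompS : dsq -> dsq -> dsq;
  vidS : dh -> dsq;
  vcompS : dsq -> dsq -> dsq;
  (* corners of squares *)
  dom_top : forall s, hdom (top s) = vdom (lft s);
  cod_top : forall s, hcod (top s) = vdom (rgt s);
  dom_bot : forall s, hdom (bot s) = vcod (lft s);
  cod_bot : forall s, hcod (bot s) = vcod (rgt s);
  (* boundaries of identities and composites *)
  hdom_id : forall A, hdom (hid A) = A;
  hcod_id : forall A, hcod (hid A) = A;
  vdom_id : forall A, vdom (vid A) = A;
  vcod_id : forall A, vcod (vid A) = A;
  hdom_comp : forall f g, hcod f = hdom g -> hdom (hcomp f g) = hdom f;
  hcod_comp : forall f g, hcod f = hdom g -> hcod (hcomp f g) = hcod g;
  vdom_comp : forall u v, vcod u = vdom v -> vdom (vcomp u v) = vdom u;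
  vcod_comp : forall u v, vcod u = vdom v -> vcod (vcomp u v) = vcod v;
  top_hid : forall u, top (hidS u) = hid (vdom u);
  bot_hid : forall u, bot (hidS u) = hid (vcod u);
  lft_hid : forall u, lft (hidS u) = u;
  rgt_hid : forall u, rgt (hidS u) = u;
  top_vid : forall f, top (vidS f) = f;
  bot_vid : forall f, bot (vidS f) = f;
  lft_vid : forall f, lft (vidS f) = vid (hdom f);
  rgt_vid : forall f, rgt (vidS f) = vid (hcod f);
  top_hcomp : forall a b, rgt a = lft b -> top (hcompS a b) = hcomp (top a) (top b);
  bot_hcomp : forall a b, rgt a = lft b -> bot (hcompS a b) = hcomp (bot a) (bot b);
  lft_hcomp : forall a b, rgt a = lft b -> lft (hcompS a b) = lft a;
  rgt_hcomp : forall a b, rgt a = lft b -> rgt (hcompS a b) = rgt b;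
  top_vcomp : forall a b, bot a = top b -> top (vcompS a b) = top a;
  bot_vcomp : forall a b, bot a = top b -> bot (vcompS a b) = bot b;
  lft_vcomp : forall a b, bot a = top b -> lft (vcompS a b) = vcomp (lft a) (lft b);
  rgt_vcomp : forall a b, bot a = top b -> rgt (vcompS a b) = vcomp (rgt a) (rgt b);
  vcomp_id : forall A, vcomp (vid A) (vid A) = vid A }.

Arguments hid {d}.
Arguments vid {d}.

Record is_double (D : dcat) : Prop := {
  hcompA : forall f g h : dh D, hcod f = hdom g -> hcod g = hdom h ->
    hcomp (hcomp f g) h = hcomp f (hcomp g h);
  hcomp1f : forall f : dh D, hcomp (hid (hdom f)) f = f;
  hcompf1 : forall f : dh D, hcomp f (hid (hcod f)) = f;
  vcompA : forall u v w : dv D, vcod u = vdom v -> vcod v = vdom w ->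
    vcomp (vcomp u v) w = vcomp u (vcomp v w);
  vcomp1u : forall u : dv D, vcomp (vid (vdom u)) u = u;
  vcompu1 : forall u : dv D, vcomp u (vid (vcod u)) = u;
  hcompSA : forall a b c : dsq D, rgt a = lft b -> rgt b = lft c ->
    hcompS (hcompS a b) c = hcompS a (hcompS b c);
  hcompS1a : forall a : dsq D, hcompS (hidS (lft a)) a = a;
  hcompSa1 : forall a : dsq D, hcompS a (hidS (rgt a)) = a;
  vcompSA : forall a b c : dsq D, bot a = top b -> bot b = top c ->
    vcompS (vcompS a b) c = vcompS a (vcompS b c);
  vcompS1a : forall a : dsq D, vcompS (vidS (top a)) a = a;
  vcompSa1 : forall a : dsq D, vcompS a (vidS (bot a)) = a;
  interchange : forall a b c d : dsq D,
    rgt a = lft b -> rgt c = lft d -> bot a = top c -> bot b = top d ->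
    vcompS (hcompS a b) (hcompS c d) = hcompS (vcompS a c) (vcompS b d);
  vidS_comp : forall f g : dh D, hcod f = hdom g ->
    vidS (hcomp f g) = hcompS (vidS f) (vidS g);
  hidS_comp : forall u v : dv D, vcod u = vdom v ->
    hidS (vcomp u v) = vcompS (hidS u) (hidS v);
  hidS_vid : forall A : dob D, hidS (vid A) = vidS (hid A) }.

Record double_category := { dc :> dcat; dc_ax : is_double dc }.

Definition dunit : dcat.
Proof.
refine {| dob := unit; dh := unit; dv := unit; dsq := unit;
  hdom := fun x => x; hcod := fun x => x; vdom := fun x => x; vcod := fun x => x;
  top := fun x => x; bot := fun x => x; lft := fun x => x; rgt := fun x => x;
  hid := fun x => x; hcomp := fun x _ => x; vid := fun x => x; vcomp := fun x _ => x;
  hidS := fun x => x; hcompS := fun x _ => x; vidS := fun x => x; vcompS := fun x _ => x |};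
  intros; repeat match goal with x : unit |- _ => destruct x end; reflexivity.
Defined.

Definition dprod (D E : dcat) : dcat.
Proof.
refine {| dob := (dob D * dob E)%type; dh := (dh D * dh E)%type;
  dv := (dv D * dv E)%type; dsq := (dsq D * dsq E)%type;
  hdom := fun f => (hdom (fst f), hdom (snd f));
  hcod := fun f => (hcod (fst f), hcod (snd f));
  vdom := fun u => (vdom (fst u), vdom (snd u));
  vcod := fun u => (vcod (fst u), vcod (snd u));
  top := fun s => (top (fst s), top (snd s));
  bot := fun s => (bot (fst s), bot (snd s));
  lft := fun s => (lft (fst s), lft (snd s));
  rgt := fun s => (rgt (fst s), rgt (snd s));
  hid := fun A => (hid (fst A), hid (snd A));
  hcomp := fun f g => (hcomp (fst f) (fst g), hcomp (snd f) (snd g));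
  vid := fun A => (vid (fst A), vid (snd A));
  vcomp := fun u v => (vcomp (fst u) (fst v), vcomp (snd u) (snd v));
  hidS := fun u => (hidS (fst u), hidS (snd u));
  hcompS := fun a b => (hcompS (fst a) (fst b), hcompS (snd a) (snd b));
  vidS := fun f => (vidS (fst f), vidS (snd f));
  vcompS := fun a b => (vcompS (fst a) (fst b), vcompS (snd a) (snd b)) |};
  intros; repeat match goal with
    | x : (_ * _)%type |- _ => destruct x
    | e : (_, _) = (_, _) |- _ => injection e; clear e; intros
    end; cbn in *; f_equal;
  auto using dom_top, cod_top, dom_bot, cod_bot, hdom_id, hcod_id, vdom_id, vcod_id,
    hdom_comp, hcod_comp, vdom_comp, vcod_comp, top_hid, bot_hid, lft_hid, rgt_hid,
    top_vid, bot_vid, lft_vid, rgt_vid, top_hcomp, bot_hcomp, lft_hcomp, rgt_hcomp,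
    top_vcomp, bot_vcomp, lft_vcomp, rgt_vcomp, vcomp_id.
Defined.

(** ** Pseudodouble functors *)

(** [F2c f g] is the compositor [[F f|F g] => F [f|g]] and [F2u A] the unitor
    [hid (F A) => F (hid A)]; [F2c'] and [F2u'] are their inverses. *)
Record pdfun (C D : dcat) := {
  F0 :> dob C -> dob D;
  FH : dh C -> dh D;
  FV : dv C -> dv D;
  FS : dsq C -> dsq D;
  F2c : dh C -> dh C -> dsq D;
  F2c' : dh C -> dh C -> dsq D;
  F2u : dob C -> dsq D;
  F2u' : dob C -> dsq D;
  FH_dom : forall f, hdom (FH f) = F0 (hdom f);
  FH_cod : forall f, hcod (FH f) = F0 (hcod f);
  FV_dom : forall u, vdom (FV u) = F0 (vdom u);
  FV_cod : forall u, vcod (FV u) = F0 (vcod u);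
  FS_top : forall s, top (FS s) = FH (top s);
  FS_bot : forall s, bot (FS s) = FH (bot s);
  FS_lft : forall s, lft (FS s) = FV (lft s);
  FS_rgt : forall s, rgt (FS s) = FV (rgt s);
  FV_id : forall A, FV (vid A) = vid (F0 A);
  F2c_top : forall f g, hcod f = hdom g -> top (F2c f g) = hcomp (FH f) (FH g);
  F2c_bot : forall f g, hcod f = hdom g -> bot (F2c f g) = FH (hcomp f g);
  F2c_lft : forall f g, hcod f = hdom g -> lft (F2c f g) = vid (F0 (hdom f));
  F2c_rgt : forall f g, hcod f = hdom g -> rgt (F2c f g) = vid (F0 (hcod g));
  F2c'_top : forall f g, hcod f = hdom g -> top (F2c' f g) = FH (hcomp f g);
  F2c'_bot : forall f g, hcod f = hdom g -> bot (F2c' f g) = hcomp (FH f) (FH g);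
  F2c'_lft : forall f g, hcod f = hdom g -> lft (F2c' f g) = vid (F0 (hdom f));
  F2c'_rgt : forall f g, hcod f = hdom g -> rgt (F2c' f g) = vid (F0 (hcod g));
  F2u_top : forall A, top (F2u A) = hid (F0 A);
  F2u_bot : forall A, bot (F2u A) = FH (hid A);
  F2u_lft : forall A, lft (F2u A) = vid (F0 A);
  F2u_rgt : forall A, rgt (F2u A) = vid (F0 A);
  F2u'_top : forall A, top (F2u' A) = FH (hid A);
  F2u'_bot : forall A, bot (F2u' A) = hid (F0 A);
  F2u'_lft : forall A, lft (F2u' A) = vid (F0 A);
  F2u'_rgt : forall A, rgt (F2u' A) = vid (F0 A) }.

Record is_pdfun (C D : dcat) (F : pdfun C D) : Prop := {
  FV_comp : forall u v, vcod u = vdom v -> FV F (vcomp u v) = vcomp (FV F u) (FV F v);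
  FS_vid : forall f, FS F (vidS f) = vidS (FH F f);
  FS_vcomp : forall a b, bot a = top b -> FS F (vcompS a b) = vcompS (FS F a) (FS F b);
  F2c_inv : forall f g, hcod f = hdom g ->
    vcompS (F2c F f g) (F2c' F f g) = vidS (hcomp (FH F f) (FH F g));
  F2c'_inv : forall f g, hcod f = hdom g ->
    vcompS (F2c' F f g) (F2c F f g) = vidS (FH F (hcomp f g));
  F2u_inv : forall A, vcompS (F2u F A) (F2u' F A) = vidS (hid (F A));
  F2u'_inv : forall A, vcompS (F2u' F A) (F2u F A) = vidS (FH F (hid A));
  F2c_nat : forall a b, rgt a = lft b ->
    vcompS (hcompS (FS F a) (FS F b)) (F2c F (bot a) (bot b))
    = vcompS (F2c F (top a) (top b)) (FS F (hcompS a b));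
  F2u_nat : forall u,
    vcompS (hidS (FV F u)) (F2u F (vcod u)) = vcompS (F2u F (vdom u)) (FS F (hidS u));
  F2c_assoc : forall f g h, hcod f = hdom g -> hcod g = hdom h ->
    vcompS (hcompS (F2c F f g) (vidS (FH F h))) (F2c F (hcomp f g) h)
    = vcompS (hcompS (vidS (FH F f)) (F2c F g h)) (F2c F f (hcomp g h));
  F2c_unitl : forall f,
    vcompS (hcompS (F2u F (hdom f)) (vidS (FH F f))) (F2c F (hid (hdom f)) f)
    = vidS (FH F f);
  F2c_unitr : forall f,
    vcompS (hcompS (vidS (FH F f)) (F2u F (hcod f))) (F2c F f (hid (hcod f)))
    = vidS (FH F f) }.

Ltac bdry :=
  intros; cbn;
  repeat first
    [ reflexivity | assumption
    | progress (rewrite ?top_hid, ?bot_hid, ?lft_hid, ?rgt_hid, ?top_vid, ?bot_vid,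
        ?lft_vid, ?rgt_vid, ?hdom_id, ?hcod_id, ?vdom_id, ?vcod_id,
        ?FH_dom, ?FH_cod, ?FV_dom, ?FV_cod, ?FS_top, ?FS_bot, ?FS_lft, ?FS_rgt, ?FV_id, ?vcomp_id,
        ?F2u_top, ?F2u_bot, ?F2u_lft, ?F2u_rgt, ?F2u'_top, ?F2u'_bot, ?F2u'_lft, ?F2u'_rgt)
    | rewrite hdom_comp by (solve [bdry]) | rewrite hcod_comp by (solve [bdry])
    | rewrite vdom_comp by (solve [bdry]) | rewrite vcod_comp by (solve [bdry])
    | rewrite F2c_top by (solve [bdry]) | rewrite F2c_bot by (solve [bdry])
    | rewrite F2c_lft by (solve [bdry]) | rewrite F2c_rgt by (solve [bdry])
    | rewrite F2c'_top by (solve [bdry]) | rewrite F2c'_bot by (solve [bdry])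
    | rewrite F2c'_lft by (solve [bdry]) | rewrite F2c'_rgt by (solve [bdry])
    | rewrite top_hcomp by (solve [bdry]) | rewrite bot_hcomp by (solve [bdry])
    | rewrite lft_hcomp by (solve [bdry]) | rewrite rgt_hcomp by (solve [bdry])
    | rewrite top_vcomp by (solve [bdry]) | rewrite bot_vcomp by (solve [bdry])
    | rewrite lft_vcomp by (solve [bdry]) | rewrite rgt_vcomp by (solve [bdry])
    | congruence ].

Definition did (D : dcat) : pdfun D D.
Proof.
refine {| F0 := fun A : dob D => A; FH := fun f => f; FV := fun u => u; FS := fun s => s;
  F2c := fun f g => vidS (hcomp f g); F2c' := fun f g => vidS (hcomp f g);
  F2u := fun A => vidS (hid A); F2u' := fun A => vidS (hid A) |}; abstract bdry.
Defined.

Definition dcomp (C D E : dcat) (F : pdfun C D) (G : pdfun D E) : pdfun C E.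
Proof.
refine {| F0 := fun A => G (F A); FH := fun f => FH G (FH F f);
  FV := fun u => FV G (FV F u); FS := fun s => FS G (FS F s);
  F2c := fun f g => vcompS (F2c G (FH F f) (FH F g)) (FS G (F2c F f g));
  F2c' := fun f g => vcompS (FS G (F2c' F f g)) (F2c' G (FH F f) (FH F g));
  F2u := fun A => vcompS (F2u G (F A)) (FS G (F2u F A));
  F2u' := fun A => vcompS (FS G (F2u' F A)) (F2u' G (F A)) |}; abstract bdry.
Defined.

Definition dbang (D : dcat) : pdfun D dunit.
Proof.
refine {| F0 := fun _ : dob D => tt : dob dunit; FH := fun _ => tt : dh dunit;
  FV := fun _ => tt : dv dunit; FS := fun _ => tt : dsq dunit;
  F2c := fun _ _ => tt : dsq dunit; F2c' := fun _ _ => tt : dsq dunit;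
  F2u := fun _ => tt : dsq dunit; F2u' := fun _ => tt : dsq dunit |}; reflexivity.
Defined.

Definition dfst (D E : dcat) : pdfun (dprod D E) D.
Proof.
refine {| F0 := fun A : dob (dprod D E) => fst A; FH := fun f : dh (dprod D E) => fst f;
  FV := fun u : dv (dprod D E) => fst u; FS := fun s : dsq (dprod D E) => fst s;
  F2c := fun f g => vidS (hcomp (fst f) (fst g));
  F2c' := fun f g => vidS (hcomp (fst f) (fst g));
  F2u := fun A => vidS (hid (fst A)); F2u' := fun A => vidS (hid (fst A)) |};
  abstract (cbn; intros; repeat match goal with e : (_, _) = (_, _) |- _ =>
    injection e; clear e; intros end; bdry).
Defined.

Definition dsnd (D E : dcat) : pdfun (dprod D E) E.
Proof.
refine {| F0 := fun A : dob (dprod D E) => snd A; FH := fun f : dh (dprod D E) => snd f;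
  FV := fun u : dv (dprod D E) => snd u; FS := fun s : dsq (dprod D E) => snd s;
  F2c := fun f g => vidS (hcomp (snd f) (snd g));
  F2c' := fun f g => vidS (hcomp (snd f) (snd g));
  F2u := fun A => vidS (hid (snd A)); F2u' := fun A => vidS (hid (snd A)) |};
  abstract (cbn; intros; repeat match goal with e : (_, _) = (_, _) |- _ =>
    injection e; clear e; intros end; bdry).
Defined.

Definition dpair (C D E : dcat) (F : pdfun C D) (G : pdfun C E) : pdfun C (dprod D E).
Proof.
refine {| F0 := fun A => (F A, G A) : dob (dprod D E);
  FH := fun f => (FH F f, FH G f) : dh (dprod D E);
  FV := fun u => (FV F u, FV G u) : dv (dprod D E);
  FS := fun s => (FS F s, FS G s) : dsq (dprod D E);
  F2c := fun f g => (F2c F f g, F2c G f g) : dsq (dprod D E);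
  F2c' := fun f g => (F2c' F f g, F2c' G f g) : dsq (dprod D E);
  F2u := fun A => (F2u F A, F2u G A) : dsq (dprod D E);
  F2u' := fun A => (F2u' F A, F2u' G A) : dsq (dprod D E) |};
  abstract (cbn; intros; f_equal; bdry).
Defined.

(** ** Vertical strict transformations and companions *)

(** Bundled with its axioms; [va_h a f] is the square written [a_f]. *)
Record vtrans (C D : dcat) (F G : pdfun C D) := {
  va :> dob C -> dv D;
  va_h : dh C -> dsq D;
  va_dom : forall A, vdom (va A) = F A;
  va_cod : forall A, vcod (va A) = G A;
  va_top : forall f, top (va_h f) = FH F f;
  va_bot : forall f, bot (va_h f) = FH G f;
  va_lft : forall f, lft (va_h f) = va (hdom f);
  va_rgt : forall f, rgt (va_h f) = va (hcod f);
  va_nat : forall u, vcomp (FV F u) (va (vcod u)) = vcomp (va (vdom u)) (FV G u);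
  va_natS : forall s, vcompS (FS F s) (va_h (bot s)) = vcompS (va_h (top s)) (FS G s);
  va_comp : forall f g, hcod f = hdom g ->
    vcompS (F2c F f g) (va_h (hcomp f g)) = vcompS (hcompS (va_h f) (va_h g)) (F2c G f g);
  va_unit : forall A,
    vcompS (F2u F A) (va_h (hid A)) = vcompS (hidS (va A)) (F2u G A) }.

(** Vertical inverse of a square. *)
Record vinverse (D : dcat) (s : dsq D) := {
  vi :> dsq D;
  vi_top : top vi = bot s;
  vi_bot : bot vi = top s;
  vi_l : vcompS s vi = vidS (top s);
  vi_r : vcompS vi s = vidS (bot s) }.

Definition invertible (C D : dcat) (F G : pdfun C D) (a : vtrans F G) : Type :=
  forall f, vinverse (va_h a f).

Record companion_data (D : dcat) (u : dv D) := {
  cmp : dh D;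
  eps : dsq D;
  iot : dsq D;
  cmp_dom : hdom cmp = vdom u;
  cmp_cod : hcod cmp = vcod u;
  eps_top : top eps = cmp;
  eps_bot : bot eps = hid (vcod u);
  eps_lft : lft eps = u;
  eps_rgt : rgt eps = vid (vcod u);
  iot_top : top iot = hid (vdom u);
  iot_bot : bot iot = cmp;
  iot_lft : lft iot = vid (vdom u);
  iot_rgt : rgt iot = u }.

Definition is_companion (D : dcat) (u : dv D) (c : companion_data u) : Prop :=
  hcompS (iot c) (eps c) = vidS (cmp c) /\ vcompS (iot c) (eps c) = hidS u.

Record companion (D : dcat) (u : dv D) := {
  cdata :> companion_data u;
  companion_ax : is_companion cdata }.

(** A choice of companions for the 1v-components. *)
Definition liftable (C D : dcat) (F G : pdfun C D) (a : vtrans F G) : Type :=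
  forall A, companion (a A).

(** Companions for the vertical inverses of the 1v-components.  The companion of
    a vertical isomorphism [u] need not be an equivalence 1-cell; it is one as
    soon as the inverse of [u] has a companion too. *)
Definition inverse_liftable (C D : dcat) (F G : pdfun C D) (a : vtrans F G) : Prop :=
  forall A v, vdom v = G A -> vcod v = F A ->
    vcomp (a A) v = vid (F A) -> vcomp v (a A) = vid (G A) -> inhabited (companion v).

(** ** Monoidal double categories *)

Definition dtens (C D : dcat) (T : pdfun (dprod D D) D) (F G : pdfun C D) : pdfun C D :=
  dcomp (dpair F G) T.

Definition dp21 (D : dcat) := dfst D D.
Definition dp22 (D : dcat) := dsnd D D.
Definition dp31 (D : dcat) := dcomp (dfst (dprod D D) D) (dfst D D).
Definition dp32 (D : dcat) := dcomp (dfst (dprod D D) D) (dsnd D D).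
Definition dp33 (D : dcat) := dsnd (dprod D D) D.

Record monoidal_double (D : dcat) := {
  dt : pdfun (dprod D D) D;
  dI : pdfun dunit D;
  dalpha : vtrans (dtens dt (dtens dt (dp31 D) (dp32 D)) (dp33 D))
                  (dtens dt (dp31 D) (dtens dt (dp32 D) (dp33 D)));
  dlambda : vtrans (dtens dt (dcomp (dbang D) dI) (did D)) (did D);
  drho : vtrans (dtens dt (did D) (dcomp (dbang D) dI)) (did D);
  dt_ax : is_pdfun dt;
  dI_ax : is_pdfun dI;
  dalpha_inv : invertible dalpha;
  dlambda_inv : invertible dlambda;
  drho_inv : invertible drho;
  (* equality of vertical transformations: on objects and on 1h-cells *)
  dpentagon : forall A B C E,
    vcomp (FV dt (dalpha (A, B, C), vid E))
      (vcomp (dalpha (A, dt (B, C), E)) (FV dt (vid A, dalpha (B, C, E))))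
    = vcomp (dalpha (dt (A, B), C, E)) (dalpha (A, B, dt (C, E)));
  dpentagon_h : forall f g h k,
    vcompS (FS dt (va_h dalpha (f, g, h), vidS k))
      (vcompS (va_h dalpha (f, FH dt (g, h), k)) (FS dt (vidS f, va_h dalpha (g, h, k))))
    = vcompS (va_h dalpha (FH dt (f, g), h, k)) (va_h dalpha (f, g, FH dt (h, k)));
  dmiddle : forall A B,
    vcomp (dalpha (A, dI tt, B)) (FV dt (vid A, dlambda B)) = FV dt (drho A, vid B);
  dmiddle_h : forall f g,
    vcompS (va_h dalpha (f, FH dI tt, g)) (FS dt (vidS f, va_h dlambda g))
    = FS dt (va_h drho f, vidS g);
  dleft : forall A B,
    vcomp (dalpha (dI tt, A, B)) (dlambda (dt (A, B))) = FV dt (dlambda A, vid B);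
  dleft_h : forall f g,
    vcompS (va_h dalpha (FH dI tt, f, g)) (va_h dlambda (FH dt (f, g)))
    = FS dt (va_h dlambda f, vidS g);
  dright : forall A B,
    vcomp (dalpha (A, B, dI tt)) (FV dt (vid A, drho B)) = drho (dt (A, B));
  dright_h : forall f g,
    vcompS (va_h dalpha (f, g, FH dI tt)) (FS dt (vidS f, va_h drho g))
    = va_h drho (FH dt (f, g)) }.

(** ** Vertical double monads and strengths *)

Record vertical_monad (D : dcat) := {
  dT :> pdfun D D;
  dmu : vtrans (dcomp dT dT) dT;
  deta : vtrans (did D) dT;
  dT_ax : is_pdfun dT;
  dmu_assoc : forall A, vcomp (FV dT (dmu A)) (dmu A) = vcomp (dmu (dT A)) (dmu A);
  dmu_assoc_h : forall f,
    vcompS (FS dT (va_h dmu f)) (va_h dmu f)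
    = vcompS (va_h dmu (FH dT f)) (va_h dmu f);
  dmu_l : forall A, vcomp (deta (dT A)) (dmu A) = vid (dT A);
  dmu_l_h : forall f, vcompS (va_h deta (FH dT f)) (va_h dmu f) = vidS (FH dT f);
  dmu_r : forall A, vcomp (FV dT (deta A)) (dmu A) = vid (dT A);
  dmu_r_h : forall f, vcompS (FS dT (va_h deta f)) (va_h dmu f) = vidS (FH dT f) }.

Record left_vstrength (D : dcat) (M : monoidal_double D) (T : vertical_monad D) := {
  lt :> vtrans (dtens (dt M) (dp21 D) (dcomp (dp22 D) T))
               (dcomp (dtens (dt M) (dp21 D) (dp22 D)) T);
  lt_lambda : forall A, dlambda M (T A) = vcomp (lt (dI M tt, A)) (FV T (dlambda M A));
  lt_lambda_h : forall f, va_h (dlambda M) (FH T f)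
    = vcompS (va_h lt (FH (dI M) tt, f)) (FS T (va_h (dlambda M) f));
  lt_alpha : forall A B C,
    vcomp (dalpha M (A, B, T C))
      (vcomp (FV (dt M) (vid A, lt (B, C))) (lt (A, dt M (B, C))))
    = vcomp (lt (dt M (A, B), C)) (FV T (dalpha M (A, B, C)));
  lt_alpha_h : forall f g h,
    vcompS (va_h (dalpha M) (f, g, FH T h))
      (vcompS (FS (dt M) (vidS f, va_h lt (g, h))) (va_h lt (f, FH (dt M) (g, h))))
    = vcompS (va_h lt (FH (dt M) (f, g), h)) (FS T (va_h (dalpha M) (f, g, h)));
  lt_mu : forall A B,
    vcomp (FV (dt M) (vid A, dmu T B)) (lt (A, B))
    = vcomp (lt (A, T B)) (vcomp (FV T (lt (A, B))) (dmu T (dt M (A, B))));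
  lt_mu_h : forall f g,
    vcompS (FS (dt M) (vidS f, va_h (dmu T) g)) (va_h lt (f, g))
    = vcompS (va_h lt (f, FH T g))
        (vcompS (FS T (va_h lt (f, g))) (va_h (dmu T) (FH (dt M) (f, g))));
  lt_eta : forall A B,
    deta T (dt M (A, B)) = vcomp (FV (dt M) (vid A, deta T B)) (lt (A, B));
  lt_eta_h : forall f g,
    va_h (deta T) (FH (dt M) (f, g))
    = vcompS (FS (dt M) (vidS f, va_h (deta T) g)) (va_h lt (f, g)) }.

Record right_vstrength (D : dcat) (M : monoidal_double D) (T : vertical_monad D) := {
  rt :> vtrans (dtens (dt M) (dcomp (dp21 D) T) (dp22 D))
               (dcomp (dtens (dt M) (dp21 D) (dp22 D)) T);
  rt_rho : forall A, drho M (T A) = vcomp (rt (A, dI M tt)) (FV T (drho M A));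
  rt_rho_h : forall f, va_h (drho M) (FH T f)
    = vcompS (va_h rt (f, FH (dI M) tt)) (FS T (va_h (drho M) f));
  rt_alpha : forall A B C,
    vcomp (dalpha M (T A, B, C)) (rt (A, dt M (B, C)))
    = vcomp (FV (dt M) (rt (A, B), vid C))
        (vcomp (rt (dt M (A, B), C)) (FV T (dalpha M (A, B, C))));
  rt_alpha_h : forall f g h,
    vcompS (va_h (dalpha M) (FH T f, g, h)) (va_h rt (f, FH (dt M) (g, h)))
    = vcompS (FS (dt M) (va_h rt (f, g), vidS h))
        (vcompS (va_h rt (FH (dt M) (f, g), h)) (FS T (va_h (dalpha M) (f, g, h))));
  rt_mu : forall A B,
    vcomp (FV (dt M) (dmu T A, vid B)) (rt (A, B))
    = vcomp (rt (T A, B)) (vcomp (FV T (rt (A, B))) (dmu T (dt M (A, B))));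
  rt_mu_h : forall f g,
    vcompS (FS (dt M) (va_h (dmu T) f, vidS g)) (va_h rt (f, g))
    = vcompS (va_h rt (FH T f, g))
        (vcompS (FS T (va_h rt (f, g))) (va_h (dmu T) (FH (dt M) (f, g))));
  rt_eta : forall A B,
    deta T (dt M (A, B)) = vcomp (FV (dt M) (deta T A, vid B)) (rt (A, B));
  rt_eta_h : forall f g,
    va_h (deta T) (FH (dt M) (f, g))
    = vcompS (FS (dt M) (va_h (deta T) f, vidS g)) (va_h rt (f, g)) }.

Record vertically_bistrong (D : dcat) (M : monoidal_double D) (T : vertical_monad D)
    (t : left_vstrength M T) (s : right_vstrength M T) : Prop := {
  vbs : forall A B C,
    vcomp (FV (dt M) (t (A, B), vid C))
      (vcomp (s (dt M (A, B), C)) (FV T (dalpha M (A, B, C))))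
    = vcomp (dalpha M (A, T B, C))
        (vcomp (FV (dt M) (vid A, s (B, C))) (t (A, dt M (B, C))));
  vbs_h : forall f g h,
    vcompS (FS (dt M) (va_h t (f, g), vidS h))
      (vcompS (va_h s (FH (dt M) (f, g), h)) (FS T (va_h (dalpha M) (f, g, h))))
    = vcompS (va_h (dalpha M) (f, FH T g, h))
        (vcompS (FS (dt M) (vidS f, va_h s (g, h))) (va_h t (f, FH (dt M) (g, h)))) }.

(** * The horizontal bicategory and companion-lifts *)

Record hcell (D : dcat) (A B : dob D) := {
  hval :> dh D;
  hval_dom : hdom hval = A;
  hval_cod : hcod hval = B }.

(** Horizontally globular squares. *)
Record gcell (D : dcat) (A B : dob D) (f g : hcell A B) := {
  sval :> dsq D;
  s_top : top sval = f;
  s_bot : bot sval = g;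
  s_lft : lft sval = vid A;
  s_rgt : rgt sval = vid B }.

Section Units.
Context (D : double_category).
Lemma hunitl (f : dh D) A : hdom f = A -> hcomp (hid A) f = f.
Proof. intros <-; apply (hcomp1f (dc_ax D)). Qed.
Lemma hunitr (f : dh D) A : hcod f = A -> hcomp f (hid A) = f.
Proof. intros <-; apply (hcompf1 (dc_ax D)). Qed.
Lemma vunitl (u : dv D) A : vdom u = A -> vcomp (vid A) u = u.
Proof. intros <-; apply (vcomp1u (dc_ax D)). Qed.
Lemma vunitr (u : dv D) A : vcod u = A -> vcomp u (vid A) = u.
Proof. intros <-; apply (vcompu1 (dc_ax D)). Qed.
End Units.

Ltac gb :=
  intros; cbn;
  repeat first
    [ reflexivity | assumption | progress cbn
    | progress (rewrite ?s_top, ?s_bot, ?s_lft, ?s_rgt, ?hval_dom, ?hval_cod,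
        ?cmp_dom, ?cmp_cod, ?eps_top, ?eps_bot, ?eps_lft, ?eps_rgt,
        ?iot_top, ?iot_bot, ?iot_lft, ?iot_rgt,
        ?va_dom, ?va_cod, ?va_top, ?va_bot, ?va_lft, ?va_rgt, ?vi_top, ?vi_bot,
        ?top_hid, ?bot_hid, ?lft_hid, ?rgt_hid, ?top_vid, ?bot_vid,
        ?lft_vid, ?rgt_vid, ?hdom_id, ?hcod_id, ?vdom_id, ?vcod_id, ?vcomp_id,
        ?FH_dom, ?FH_cod, ?FV_dom, ?FV_cod, ?FS_top, ?FS_bot, ?FS_lft, ?FS_rgt, ?FV_id,
        ?F2u_top, ?F2u_bot, ?F2u_lft, ?F2u_rgt, ?F2u'_top, ?F2u'_bot, ?F2u'_lft, ?F2u'_rgt)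
    | rewrite hdom_comp by (solve [gb]) | rewrite hcod_comp by (solve [gb])
    | rewrite vdom_comp by (solve [gb]) | rewrite vcod_comp by (solve [gb])
    | rewrite F2c_top by (solve [gb]) | rewrite F2c_bot by (solve [gb])
    | rewrite F2c_lft by (solve [gb]) | rewrite F2c_rgt by (solve [gb])
    | rewrite F2c'_top by (solve [gb]) | rewrite F2c'_bot by (solve [gb])
    | rewrite F2c'_lft by (solve [gb]) | rewrite F2c'_rgt by (solve [gb])
    | rewrite top_hcomp by (solve [gb]) | rewrite bot_hcomp by (solve [gb])
    | rewrite lft_hcomp by (solve [gb]) | rewrite rgt_hcomp by (solve [gb])
    | rewrite top_vcomp by (solve [gb]) | rewrite bot_vcomp by (solve [gb])
    | rewrite lft_vcomp by (solve [gb]) | rewrite rgt_vcomp by (solve [gb])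
    | rewrite hunitl by (solve [gb]) | rewrite hunitr by (solve [gb])
    | rewrite vunitl by (solve [gb]) | rewrite vunitr by (solve [gb])
    | congruence ].

Section Horizontal.
Context (D : double_category).

Definition Hid (A : dob D) : hcell A A.
Proof. refine {| hval := hid A |}; abstract gb. Defined.

Definition Hcomp (A B C : dob D) (f : hcell A B) (g : hcell B C) : hcell A C.
Proof. refine {| hval := hcomp f g |}; abstract gb. Defined.

Definition Hgraph : graph1 :=
  {| ob := dob D; hom := @hcell D; id1 := Hid; comp1 := Hcomp |}.

Definition Hid2 (A B : dob D) (f : hcell A B) : gcell f f.
Proof. refine {| sval := vidS f |}; abstract gb. Defined.

Definition Hcomp2 (A B : dob D) (f g h : hcell A B) (c : gcell f g) (d : gcell g h) :
  gcell f h.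
Proof. refine {| sval := vcompS c d |}; abstract gb. Defined.

Definition Hhc2 (A B C : dob D) (f f' : hcell A B) (g g' : hcell B C)
  (c : gcell f f') (d : gcell g g') : gcell (Hcomp f g) (Hcomp f' g').
Proof. refine {| sval := hcompS c d |}; abstract gb. Defined.

(** Identity squares between 1h-cells with equal underlying cells: horizontal
    composition is strict, so these are the associators and unitors. *)
Definition Hcast (A B : dob D) (f g : hcell A B) (e : hval f = hval g) : gcell f g.
Proof. refine {| sval := vidS f |}; abstract gb. Defined.

Lemma Hassoc (A B C E : dob D) (f : hcell A B) (g : hcell B C) (h : hcell C E) :
  hval (Hcomp (Hcomp f g) h) = hval (Hcomp f (Hcomp g h)).
Proof. apply (hcompA (dc_ax D)); gb. Qed.
Lemma Hlun (A B : dob D) (f : hcell A B) : hval (Hcomp (Hid A) f) = hval f.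
Proof. gb. Qed.
Lemma Hrun (A B : dob D) (f : hcell A B) : hval (Hcomp f (Hid B)) = hval f.
Proof. gb. Qed.

Definition Horiz : bicat :=
  {| bicat1 := Hgraph;
     bicat2 := @Build_twocells Hgraph (@gcell D) Hid2 Hcomp2 Hhc2
       (fun _ _ _ _ f g h => Hcast (Hassoc f g h))
       (fun _ _ _ _ f g h => Hcast (eq_sym (Hassoc f g h)))
       (fun _ _ f => Hcast (Hlun f)) (fun _ _ f => Hcast (eq_sym (Hlun f)))
       (fun _ _ f => Hcast (Hrun f)) (fun _ _ f => Hcast (eq_sym (Hrun f))) |}.

(** The cell [[iota_u|Id|epsilon_v]] lifting an equality [u = v], and its
    inverse. *)
Definition lift_eq_cell {u v : dv D} (c : companion_data u) (d : companion_data v)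
  (e : u = v) (A B : dob D) (p q : hcell A B) (ep : hval p = cmp d) (eq : hval q = cmp c) :
  gcell p q.
Proof.
refine {| sval := hcompS (hcompS (iot c) (hidS u)) (eps d) |};
  abstract (subst v;
    assert (eA : vdom u = A) by (rewrite <- (cmp_dom c), <- eq; apply hval_dom);
    assert (eB : vcod u = B) by (rewrite <- (cmp_cod c), <- eq; apply hval_cod);
    gb).
Defined.

Definition lift_eq {u v : dv D} (c : companion_data u) (d : companion_data v) (e : u = v)
  {A B : Horiz} {p q : path A B} (ep : hval (peval p) = cmp d) (eq : hval (peval q) = cmp c) :
  iso2 p q :=
  {| fwd := (lift_eq_cell e ep eq : @pcell Horiz A B p q);
     bwd := (lift_eq_cell (eq_sym e) eq ep : @pcell Horiz A B q p) |}.

End Horizontal.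

(** ** Companions of identities, composites, images and pairs *)

Definition cmp_id (D : dcat) (A : dob D) : companion_data (vid A).
Proof.
refine {| cmp := hid A; eps := hidS (vid A); iot := hidS (vid A) |}; abstract gb.
Defined.

Definition cmp_comp (D : double_category) (u v : dv D) (e : vcod u = vdom v)
  (c : companion_data u) (d : companion_data v) : companion_data (vcomp u v).
Proof.
refine {| cmp := hcomp (cmp c) (cmp d);
          eps := vcompS (hcompS (eps c) (vidS (cmp d))) (eps d);
          iot := vcompS (iot c) (hcompS (vidS (cmp c)) (iot d)) |}; abstract gb.
Defined.

Definition cmp_map (C : dcat) (D : double_category) (F : pdfun C D) (u : dv C)
  (c : companion_data u) : companion_data (FV F u).
Proof.
refine {| cmp := FH F (cmp c);
          eps := vcompS (FS F (eps c)) (F2u' F (vcod u));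
          iot := vcompS (F2u F (vdom u)) (FS F (iot c)) |}; abstract gb.
Defined.

Definition cmp_pair (D E : dcat) (u : dv D) (v : dv E)
  (c : companion_data u) (d : companion_data v) : @companion_data (dprod D E) (u, v).
Proof.
refine {| cmp := (cmp c, cmp d) : dh (dprod D E); eps := (eps c, eps d) : dsq (dprod D E);
          iot := (iot c, iot d) : dsq (dprod D E) |}; abstract (cbn; f_equal; gb).
Defined.

(** ** Pseudodouble functors and liftable transformations on [Horiz] *)

Section HorizontalFunctors.
Context (D : double_category).
Local Notation HD := (Horiz D).

Definition HF1 (C : dcat) (F : pdfun C D) (A B : dob C) (f : dh C)
  (eA : hdom f = A) (eB : hcod f = B) : hcell (F A) (F B).
Proof. refine {| hval := FH F f |}; abstract (subst; gb). Defined.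

Definition HF2 (C : dcat) (F : pdfun C D) (A B : dob C) (s : dsq C)
  (el : lft s = vid A) (er : rgt s = vid B) (p q : hcell (F A) (F B))
  (ep : FH F (top s) = hval p) (eq : FH F (bot s) = hval q) : gcell p q.
Proof. refine {| sval := FS F s |}; abstract (rewrite <- ?ep, <- ?eq, ?FS_lft, ?FS_rgt, ?el, ?er; gb). Defined.

Definition HFcomp (C : dcat) (F : pdfun C D) (X Y Z : dob C) (f g : dh C)
  (e1 : hdom f = X) (e2 : hcod f = Y) (e3 : hdom g = Y) (e4 : hcod g = Z)
  (p : @hom HD (F X) (F Y)) (q : @hom HD (F Y) (F Z)) (r : @hom HD (F X) (F Z))
  (ep : FH F f = hval p) (eq : FH F g = hval q) (er : FH F (hcomp f g) = hval r) :
  @iso2 HD (F X) (F Z) ⟪p; q⟫ ⟪r⟫.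
Proof.
refine (@Build_iso2 HD _ _ _ _ {| sval := F2c F f g |} {| sval := F2c' F f g |});
  abstract (cbn; rewrite <- ?ep, <- ?eq, <- ?er; subst; gb).
Defined.

Definition HFunit (C : dcat) (F : pdfun C D) (X : dob C) (r : @hom HD (F X) (F X))
  (er : FH F (hid X) = hval r) : @iso2 HD (F X) (F X) ⟪⟫ ⟪r⟫.
Proof.
refine (@Build_iso2 HD _ _ _ _ {| sval := F2u F X |} {| sval := F2u' F X |});
  abstract (cbn; rewrite <- ?er; gb).
Defined.

Definition Hfun (F : pdfun D D) : psfun (B := HD) (C := HD) F :=
  let f1 := fun (A B : HD) (f : hom A B) => HF1 F (hval_dom f) (hval_cod f) in
  @Build_psfun HD HD F f1
    (fun A B f g c => HF2 (F := F) (s_lft c) (s_rgt c) (p := f1 A B f) (q := f1 A B g)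
       (f_equal (FH F) (s_top c)) (f_equal (FH F) (s_bot c)))
    (fun X Y Z f g => HFcomp (F := F) (hval_dom f) (hval_cod f) (hval_dom g) (hval_cod g)
       (p := f1 X Y f) (q := f1 Y Z g) (r := f1 X Z (comp1 f g)) eq_refl eq_refl eq_refl)
    (fun X => HFunit (F := F) (r := f1 X X (id1 X)) eq_refl).

Lemma pair_eq (A B : Type) (a a' : A) (b b' : B) : a = a' -> b = b' -> (a, b) = (a', b').
Proof. congruence. Qed.

Definition Hfun2 (F : pdfun (dprod D D) D) :
    psfun (B := prodb HD HD) (C := HD) (fun X => F (fst X, snd X)) :=
  let f1 := fun (X Y : prodb HD HD) (f : hom X Y) =>
    HF1 F (f := (hval (fst f), hval (snd f)) : dh (dprod D D))
      (pair_eq (hval_dom (fst f)) (hval_dom (snd f)))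
      (pair_eq (hval_cod (fst f)) (hval_cod (snd f))) in
  @Build_psfun (prodb HD HD) HD (fun X => F (fst X, snd X)) f1
    (fun X Y f g c => HF2 (F := F) (s := (sval (fst c), sval (snd c)) : dsq (dprod D D))
       (A := (fst X, snd X)) (B := (fst Y, snd Y))
       (pair_eq (s_lft (fst c)) (s_lft (snd c))) (pair_eq (s_rgt (fst c)) (s_rgt (snd c)))
       (p := f1 X Y f) (q := f1 X Y g)
       (f_equal (FH F) (pair_eq (s_top (fst c)) (s_top (snd c))))
       (f_equal (FH F) (pair_eq (s_bot (fst c)) (s_bot (snd c)))))
    (fun X Y Z f g => HFcomp (F := F)
       (f := (hval (fst f), hval (snd f)) : dh (dprod D D))
       (g := (hval (fst g), hval (snd g)) : dh (dprod D D))
       (X := (fst X, snd X)) (Y := (fst Y, snd Y)) (Z := (fst Z, snd Z))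
       (pair_eq (hval_dom (fst f)) (hval_dom (snd f)))
       (pair_eq (hval_cod (fst f)) (hval_cod (snd f)))
       (pair_eq (hval_dom (fst g)) (hval_dom (snd g)))
       (pair_eq (hval_cod (fst g)) (hval_cod (snd g)))
       (p := f1 X Y f) (q := f1 Y Z g) (r := f1 X Z (comp1 f g))
       eq_refl eq_refl eq_refl)
    (fun X => HFunit (F := F) (X := (fst X, snd X)) (r := f1 X X (id1 X)) eq_refl).

Definition Hfun0 (F : pdfun dunit D) : psfun (B := unitb) (C := HD) (fun _ => F tt) :=
  let f1 := HF1 F (f := tt : dh dunit) (A := tt) (B := tt) eq_refl eq_refl in
  @Build_psfun unitb HD (fun _ => F tt) (fun _ _ _ => f1)
    (fun _ _ _ _ _ => HF2 (F := F) (s := tt : dsq dunit) (A := tt) (B := tt)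
       eq_refl eq_refl (p := f1) (q := f1) eq_refl eq_refl)
    (fun _ _ _ _ _ => HFcomp (F := F) (f := tt : dh dunit) (g := tt : dh dunit)
       (X := tt) (Y := tt) (Z := tt) eq_refl eq_refl eq_refl eq_refl
       (p := f1) (q := f1) (r := f1) eq_refl eq_refl eq_refl)
    (fun _ => HFunit (F := F) (X := tt) (r := f1) eq_refl).

Section Lift.
Context (C : dcat) (F G : pdfun C D) (a : vtrans F G) (i : invertible a) (l : liftable a).

(** The components of the companion-lift. *)
Definition hat (A : dob C) : @hom HD (F A) (G A).
Proof. refine {| hval := cmp (l A) |}; abstract gb. Defined.

Context (A B : dob C) (f : dh C) (eA : hdom f = A) (eB : hcod f = B)
  (p : @hom HD (F A) (F B)) (q : @hom HD (G A) (G B))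
  (ep : hval p = FH F f) (eq : hval q = FH G f).

Lemma lft_vi : vcomp (a A) (lft (i f)) = vid (F A).
Proof.
pose proof (f_equal (@lft D) (vi_l (i f))) as e; subst A B.
rewrite lft_vcomp in e by gb.
rewrite va_lft, lft_vid, va_top, FH_dom in e; exact e.
Qed.

Lemma rgt_vi : vcomp (rgt (i f)) (a B) = vid (G B).
Proof.
pose proof (f_equal (@rgt D) (vi_r (i f))) as e; subst A B.
rewrite rgt_vcomp in e by gb.
rewrite va_rgt, rgt_vid, va_bot, FH_cod in e; exact e.
Qed.

Lemma vdom_vi : vdom (lft (i f)) = G A.
Proof. rewrite <- dom_top; subst A; gb. Qed.
Lemma vcod_vi : vcod (lft (i f)) = F A.
Proof. rewrite <- dom_bot; subst A; gb. Qed.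
Lemma vdom_vi' : vdom (rgt (i f)) = G B.
Proof. rewrite <- cod_top; subst B; gb. Qed.
Lemma vcod_vi' : vcod (rgt (i f)) = F B.
Proof. rewrite <- cod_bot; subst B; gb. Qed.

(** The globular 2-cell [[iota|a_f|epsilon]]. *)
Definition lift_cell : gcell (Hcomp p (hat B)) (Hcomp (hat A) q).
Proof.
refine {| sval := hcompS (hcompS (iot (l A)) (va_h a f)) (eps (l B)) |};
  abstract (cbn; rewrite ?ep, ?eq; clear ep eq p q; subst A B; gb).
Defined.

(** Its inverse is [[epsilon/Id|a_f^-1|Id/iota]]. *)
Definition lift_cell' : gcell (Hcomp (hat A) q) (Hcomp p (hat B)).
Proof.
refine {| sval := hcompS (hcompS (vcompS (eps (l A)) (hidS (lft (i f)))) (i f))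
                    (vcompS (hidS (rgt (i f))) (iot (l B))) |};
  abstract (
    assert (h1 := lft_vi); assert (h2 := rgt_vi);
    assert (h3 := vdom_vi); assert (h4 := vcod_vi);
    assert (h5 := vdom_vi'); assert (h6 := vcod_vi');
    cbn; rewrite ?ep, ?eq; clear ep eq p q; subst A B;
    repeat first [rewrite h3 | rewrite h4 | rewrite h5 | rewrite h6 | rewrite h1
                 | rewrite h2 | progress gb]).
Defined.

Definition lift_iso : @iso2 HD (F A) (G B) ⟪p; hat B⟫ ⟪hat A; q⟫ :=
  {| fwd := (lift_cell : @pcell HD _ _ ⟪p; hat B⟫ ⟪hat A; q⟫);
     bwd := (lift_cell' : @pcell HD _ _ ⟪hat A; q⟫ ⟪p; hat B⟫) |}.
End Lift.

End HorizontalFunctors.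

Tactic Notation "lift_by" uconstr(c) uconstr(d) uconstr(e) :=
  lazymatch goal with
  | |- @iso2 _ _ _ ?p ?q =>
      refine (lift_eq (p := p) (q := q) (c := c) (d := d) e eq_refl eq_refl)
  end; abstract gb.

(** ** [Horiz D] as a monoidal bicategory *)

Section HorizontalMonoidal.
Context (D : double_category) (M : monoidal_double D).
Context (la : liftable (dalpha M)) (ll : liftable (dlambda M)) (lr : liftable (drho M)).
Local Notation HD := (Horiz D).
Definition Hten0 (X Y : HD) : HD := dt M (X, Y).
Definition Hten : psfun (B := prodb HD HD) (C := HD) (fun X => Hten0 (fst X) (snd X)) :=
  Hfun2 (dt M).
Local Notation T := Hten.
Local Notation I := (dI M tt).
Local Notation "X ⊗ Y" := (dt M (X, Y)) (at level 25, left associativity).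

Definition Has1 (X Y Z : HD) : @hom HD (X ⊗ Y ⊗ Z) (X ⊗ (Y ⊗ Z)) := hat la (X, Y, Z).
Definition Hlu1 (X : HD) : @hom HD (I ⊗ X) X := hat ll X.
Definition Hru1 (X : HD) : @hom HD (X ⊗ I) X := hat lr X.

(** Companions of [a ⊗ Y] and [X ⊗ b]. *)
Definition cmp_tenR (u : dv D) (c : companion_data u) (Y : dob D) :=
  cmp_map (dt M) (cmp_pair c (cmp_id Y)).
Definition cmp_tenL (X : dob D) (u : dv D) (c : companion_data u) :=
  cmp_map (dt M) (cmp_pair (cmp_id X) c).

Definition Hasn : psnat (B := prodb (prodb HD HD) HD)
    (tenf T (tenf T (pr31 HD) (pr32 HD)) (pr33 HD))
    (tenf T (pr31 HD) (tenf T (pr32 HD) (pr33 HD)))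
    (fun X => Has1 (fst (fst X)) (snd (fst X)) (snd X)) :=
  {| nat2 := fun (X Y : prodb (prodb HD HD) HD) f =>
       lift_iso (dalpha_inv M) la
         (f := (hval (fst (fst f)), hval (snd (fst f)), hval (snd f)) :
                 dh (dprod (dprod D D) D))
         (A := (fst (fst X), snd (fst X), snd X)) (B := (fst (fst Y), snd (fst Y), snd Y))
         (pair_eq (pair_eq (hval_dom _) (hval_dom _)) (hval_dom _))
         (pair_eq (pair_eq (hval_cod _) (hval_cod _)) (hval_cod _))
         (p := tenf T (tenf T (pr31 HD) (pr32 HD)) (pr33 HD) # f)
         (q := tenf T (pr31 HD) (tenf T (pr32 HD) (pr33 HD)) # f)
         eq_refl eq_refl |}.

Definition Hlun1 :
    psnat (tenf T (compf (bangf HD) (Hfun0 (dI M))) (idf HD)) (idf HD) Hlu1 :=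
  {| nat2 := fun (X Y : HD) (f : hom X Y) =>
       lift_iso (dlambda_inv M) ll (hval_dom f) (hval_cod f)
         (p := tenf T (compf (bangf HD) (Hfun0 (dI M))) (idf HD) # f) (q := f)
         eq_refl eq_refl |}.

Definition Hrun1 :
    psnat (tenf T (idf HD) (compf (bangf HD) (Hfun0 (dI M)))) (idf HD) Hru1 :=
  {| nat2 := fun (X Y : HD) (f : hom X Y) =>
       lift_iso (drho_inv M) lr (hval_dom f) (hval_cod f)
         (p := tenf T (idf HD) (compf (bangf HD) (Hfun0 (dI M))) # f) (q := f)
         eq_refl eq_refl |}.

Definition Hmp (X Y Z W : HD) :
  iso2 ⟪T # ⟨Has1 X Y Z, id1 W⟩; Has1 X (Y ⊗ Z) W; T # ⟨id1 X, Has1 Y Z W⟩⟫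
       ⟪Has1 (X ⊗ Y) Z W; Has1 X Y (Z ⊗ W)⟫.
Proof.
lift_by (cmp_comp _ (la (X ⊗ Y, Z, W)) (la (X, Y, Z ⊗ W))) (cmp_comp _ (cmp_tenR (la (X, Y, Z)) W)
          (cmp_comp _ (la (X, Y ⊗ Z, W)) (cmp_tenL X (la (Y, Z, W))))) (eq_sym (dpentagon M X Y Z W)).
Defined.

Definition Hmid (X Y : HD) :
  iso2 ⟪Has1 X I Y; T # ⟨id1 X, Hlu1 Y⟩⟫ ⟪T # ⟨Hru1 X, id1 Y⟩⟫.
Proof.
lift_by (cmp_tenR (lr X) Y) (cmp_comp _ (la (X, I, Y)) (cmp_tenL X (ll Y))) (eq_sym (dmiddle M X Y)).
Defined.

Definition Hleft (X Y : HD) :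
  iso2 ⟪Has1 I X Y; Hlu1 (X ⊗ Y)⟫ ⟪T # ⟨Hlu1 X, id1 Y⟩⟫.
Proof.
lift_by (cmp_tenR (ll X) Y) (cmp_comp _ (la (I, X, Y)) (ll (X ⊗ Y))) (eq_sym (dleft M X Y)).
Defined.

Definition Hright (X Y : HD) :
  iso2 ⟪Has1 X Y I; T # ⟨id1 X, Hru1 Y⟩⟫ ⟪Hru1 (X ⊗ Y)⟫.
Proof.
lift_by (lr (X ⊗ Y)) (cmp_comp _ (la (X, Y, I)) (cmp_tenL X (lr Y))) (eq_sym (dright M X Y)).
Defined.

Definition Hmonoidal : monoidal_data HD :=
  {| ten0 := Hten0; ten := T; uni0 := I; uni := Hfun0 (dI M);
     as1 := Has1; asn := Hasn; lu1 := Hlu1; lun1 := Hlun1; ru1 := Hru1; run1 := Hrun1;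
     mp := Hmp; mmid := Hmid; mleft := Hleft; mright := Hright |}.

(** ** The pseudomonad and the lifted strengths *)

Context (V : vertical_monad D).
Context (imu : invertible (dmu V)) (ieta : invertible (deta V)).
Context (lmu : liftable (dmu V)) (leta : liftable (deta V)).

Definition Hmu1 (X : HD) : @hom HD (V (V X)) (V X) := hat lmu X.
Definition Heta1 (X : HD) : @hom HD X (V X) := hat leta X.

Definition Hmu : psnat (compf (Hfun V) (Hfun V)) (Hfun V) Hmu1 :=
  {| nat2 := fun (X Y : HD) (f : hom X Y) =>
       lift_iso imu lmu (hval_dom f) (hval_cod f)
         (p := compf (Hfun V) (Hfun V) # f) (q := Hfun V # f) eq_refl eq_refl |}.

Definition Heta : psnat (idf HD) (Hfun V) Heta1 :=
  {| nat2 := fun (X Y : HD) (f : hom X Y) =>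
       lift_iso ieta leta (hval_dom f) (hval_cod f)
         (p := f) (q := Hfun V # f) eq_refl eq_refl |}.

Definition Hmm (X : HD) : iso2 ⟪Hfun V # Hmu1 X; Hmu1 X⟫ ⟪Hmu1 (V X); Hmu1 X⟫.
Proof.
lift_by (cmp_comp _ (lmu (V X)) (lmu X)) (cmp_comp _ (cmp_map V (lmu X)) (lmu X)) (eq_sym (dmu_assoc V X)).
Defined.

Definition Hml (X : HD) : iso2 ⟪Heta1 (V X); Hmu1 X⟫ ⟪⟫.
Proof.
lift_by (cmp_id (V X)) (cmp_comp _ (leta (V X)) (lmu X)) (eq_sym (dmu_l V X)).
Defined.

Definition Hmr (X : HD) : iso2 ⟪Hfun V # Heta1 X; Hmu1 X⟫ ⟪⟫.
Proof.
lift_by (cmp_id (V X)) (cmp_comp _ (cmp_map V (leta X)) (lmu X)) (eq_sym (dmu_r V X)).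
Defined.

Definition Hmonad : pseudomonad_data HD :=
  {| S0 := V : HD -> HD; S := Hfun V; mu1 := Hmu1; mu := Hmu; eta1 := Heta1; eta := Heta;
     mm := Hmm; ml := Hml; mr := Hmr |}.

Definition Hlstr1 (t : left_vstrength M V) (lt : liftable t) (X Y : HD) :
  @hom HD (X ⊗ V Y) (V (X ⊗ Y)) := hat lt (X, Y).

Definition Hrstr1 (s : right_vstrength M V) (ls : liftable s) (X Y : HD) :
  @hom HD (V X ⊗ Y) (V (X ⊗ Y)) := hat ls (X, Y).

Definition Hlstr (t : left_vstrength M V) (it : invertible t) (lt : liftable t) :
    lstr_data (M := Hmonoidal) (T := Hmonad) (Hlstr1 lt) :=
  {| nat2 := fun (X Y : prodb HD HD) f =>
       lift_iso it lt (f := (hval (fst f), hval (snd f)) : dh (dprod D D))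
         (A := (fst X, snd X)) (B := (fst Y, snd Y))
         (pair_eq (hval_dom _) (hval_dom _)) (pair_eq (hval_cod _) (hval_cod _))
         (p := tenf T (pr21 HD) (compf (pr22 HD) (Hfun V)) # f)
         (q := compf (tenf T (pr21 HD) (pr22 HD)) (Hfun V) # f) eq_refl eq_refl |}.

Definition Hrstr (s : right_vstrength M V) (is : invertible s) (ls : liftable s) :
    rstr_data (M := Hmonoidal) (T := Hmonad) (Hrstr1 ls) :=
  {| nat2 := fun (X Y : prodb HD HD) f =>
       lift_iso is ls (f := (hval (fst f), hval (snd f)) : dh (dprod D D))
         (A := (fst X, snd X)) (B := (fst Y, snd Y))
         (pair_eq (hval_dom _) (hval_dom _)) (pair_eq (hval_cod _) (hval_cod _))
         (p := tenf T (compf (pr21 HD) (Hfun V)) (pr22 HD) # f)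
         (q := compf (tenf T (pr21 HD) (pr22 HD)) (Hfun V) # f) eq_refl eq_refl |}.

End HorizontalMonoidal.

(** * The Kleisli pseudodouble category *)

(** Pseudodouble categories, weak in the horizontal direction (data, with the
    strict category of 1v-cells).  Squares [psq f g u v] have top [f], bottom
    [g], left side [u] and right side [v]. *)
Record pseudodouble_data := {
  po : Type;
  ph : po -> po -> Type;
  pv : po -> po -> Type;
  psq : forall A B C E : po, ph A B -> ph C E -> pv A C -> pv B E -> Type;
  pvid : forall A, pv A A;
  pvcomp : forall A B C, pv A B -> pv B C -> pv A C;
  pvcomp1u : forall A B (u : pv A B), pvcomp (pvid A) u = u;
  pvcompu1 : forall A B (u : pv A B), pvcomp u (pvid B) = u;
  pvcompA : forall A B C E (u : pv A B) (v : pv B C) (w : pv C E),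
    pvcomp (pvcomp u v) w = pvcomp u (pvcomp v w);
  pvidS : forall A B (f : ph A B), psq f f (pvid A) (pvid B);
  pvcompS : forall A B A' B' A'' B'' (f : ph A B) (g : ph A' B') (h : ph A'' B'')
    (u : pv A A') (v : pv B B') (u' : pv A' A'') (v' : pv B' B''),
    psq f g u v -> psq g h u' v' -> psq f h (pvcomp u u') (pvcomp v v');
  phid : forall A, ph A A;
  phcomp : forall A B C, ph A B -> ph B C -> ph A C;
  phidS : forall A B (u : pv A B), psq (phid A) (phid B) u u;
  phcompS : forall A B C A' B' C' (f : ph A B) (g : ph B C) (f' : ph A' B') (g' : ph B' C')
    (u : pv A A') (v : pv B B') (w : pv C C'),
    psq f f' u v -> psq g g' v w -> psq (phcomp f g) (phcomp f' g') u w;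
  passoc : forall A B C E (f : ph A B) (g : ph B C) (h : ph C E),
    psq (phcomp (phcomp f g) h) (phcomp f (phcomp g h)) (pvid A) (pvid E);
  passoc' : forall A B C E (f : ph A B) (g : ph B C) (h : ph C E),
    psq (phcomp f (phcomp g h)) (phcomp (phcomp f g) h) (pvid A) (pvid E);
  plun : forall A B (f : ph A B), psq (phcomp (phid A) f) f (pvid A) (pvid B);
  plun' : forall A B (f : ph A B), psq f (phcomp (phid A) f) (pvid A) (pvid B);
  prun : forall A B (f : ph A B), psq (phcomp f (phid B)) f (pvid A) (pvid B);
  prun' : forall A B (f : ph A B), psq f (phcomp f (phid B)) (pvid A) (pvid B) }.

Definition ps_graph (P : pseudodouble_data) : graph1 :=
  {| ob := po P; hom := @ph P; id1 := @phid P; comp1 := @phcomp P |}.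

(** The horizontal bicategory of a pseudodouble category. *)
Definition ps_horiz (P : pseudodouble_data) : bicat :=
  {| bicat1 := ps_graph P;
     bicat2 := @Build_twocells (ps_graph P)
       (fun A B f g => psq f g (pvid A) (pvid B))
       (fun A B f => pvidS f)
       (fun A B f g h c d =>
          eq_rect _ (fun v => psq f h (pvid A) v)
            (eq_rect _ (fun u => psq f h u (pvcomp (pvid B) (pvid B)))
               (pvcompS c d) _ (pvcomp1u (pvid A))) _ (pvcomp1u (pvid B)))
       (fun A B C f f' g g' c d => phcompS c d)
       (@passoc P) (@passoc' P) (@plun P) (@plun' P) (@prun P) (@prun' P) |}.

(** Isomorphism of bicategories that is the identity on objects and 1-cells. *)
Definition twocells_iso (G : graph1) (X Y : twocells G) : Prop :=
  exists th : forall (A B : G) (f g : hom A B), cell_ X f g -> cell_ Y f g,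
    (forall A B (f g : hom A B), exists th' : cell_ Y f g -> cell_ X f g,
       (forall c, th' (th A B f g c) = c) /\ (forall d, th A B f g (th' d) = d)) /\
    (forall A B (f : hom A B), th A B f f (id2_ X f) = id2_ Y f) /\
    (forall A B (f g h : hom A B) (c : cell_ X f g) (d : cell_ X g h),
       th A B f h (comp2_ c d) = comp2_ (th A B f g c) (th A B g h d)) /\
    (forall A B C (f f' : hom A B) (g g' : hom B C) (c : cell_ X f f') (d : cell_ X g g'),
       th A C _ _ (hc2_ c d) = hc2_ (th A B f f' c) (th B C g g' d)) /\
    (forall A B C E (f : hom A B) (g : hom B C) (h : hom C E),
       th A E _ _ (assoc_ X f g h) = assoc_ Y f g h) /\
    (forall A B C E (f : hom A B) (g : hom B C) (h : hom C E),
       th A E _ _ (assoc'_ X f g h) = assoc'_ Y f g h) /\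
    (forall A B (f : hom A B), th A B _ _ (lun_ X f) = lun_ Y f) /\
    (forall A B (f : hom A B), th A B _ _ (lun'_ X f) = lun'_ Y f) /\
    (forall A B (f : hom A B), th A B _ _ (run_ X f) = run_ Y f) /\
    (forall A B (f : hom A B), th A B _ _ (run'_ X f) = run'_ Y f).

Section Kleisli.
Context (D : double_category) (T : vertical_monad D).
Context (imu : invertible (dmu T)) (ieta : invertible (deta T)).
Context (lmu : liftable (dmu T)) (leta : liftable (deta T)).
Local Notation HD := (Horiz D).
Local Notation HT := (Hmonad imu ieta lmu leta).
Local Notation K := (kleisli HT).

Record vcell (A B : dob D) := {
  vval :> dv D;
  vval_dom : vdom vval = A;
  vval_cod : vcod vval = B }.

Lemma vcell_eq (A B : dob D) (u v : vcell A B) : vval u = vval v -> u = v.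
Proof.
destruct u as [u eu eu'], v as [v ev ev']; cbn; intros <-.
f_equal; apply proof_irrelevance.
Qed.

Definition kvid (A : dob D) : vcell A A.
Proof. refine {| vval := vid A |}; abstract gb. Defined.

Definition kvcomp (A B C : dob D) (u : vcell A B) (v : vcell B C) : vcell A C.
Proof.
refine {| vval := vcomp u v |}; abstract (destruct u, v; subst; gb).
Defined.

(** Squares of the Kleisli pseudodouble category with right side [v] are squares
    of [D] with right side [T v]. *)
Record ksq (A B C E : dob D) (f : @hom K A B) (g : @hom K C E) (u : vcell A C)
    (v : vcell B E) := {
  kval :> dsq D;
  k_top : top kval = hval f;
  k_bot : bot kval = hval g;
  k_lft : lft kval = u;
  k_rgt : rgt kval = FV T v }.

Definition kvidS (A B : dob D) (f : @hom K A B) : ksq f f (kvid A) (kvid B).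
Proof. refine {| kval := vidS (hval f) |}; abstract gb. Defined.

Definition kvcompS (A B A' B' A'' B'' : dob D)
  (f : @hom K A B) (g : @hom K A' B') (h : @hom K A'' B'')
  (u : vcell A A') (v : vcell B B') (u' : vcell A' A'') (v' : vcell B' B'')
  (c : ksq f g u v) (d : ksq g h u' v') : ksq f h (kvcomp u u') (kvcomp v v').
Proof.
refine {| kval := vcompS c d |};
  assert (e : bot c = top d) by (rewrite k_bot, k_top; reflexivity);
  abstract (rewrite ?top_vcomp, ?bot_vcomp, ?lft_vcomp, ?rgt_vcomp by exact e;
    rewrite ?k_top, ?k_bot, ?k_lft, ?k_rgt; cbn;
    rewrite ?(FV_comp (dT_ax T)) by (destruct v, v'; cbn; congruence); reflexivity).
Defined.

(** The squares [[Id^{F u}/iota|epsilon/Id^{G u}]] of a companion-lift. *)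
Definition hat_sq (F G : pdfun D D) (a : vtrans F G) (l : liftable a) (A B : dob D) (u : dv D)
    : dsq D :=
  hcompS (vcompS (hidS (FV F u)) (iot (l B))) (vcompS (eps (l A)) (hidS (FV G u))).

Lemma hat_sq_bdry (F G : pdfun D D) (a : vtrans F G) (l : liftable a) (A B : dob D)
    (u : dv D) (eA : vdom u = A) (eB : vcod u = B) :
  (top (hat_sq l A B u) = cmp (l A) /\ bot (hat_sq l A B u) = cmp (l B)) /\
  (lft (hat_sq l A B u) = FV F u /\ rgt (hat_sq l A B u) = FV G u).
Proof.
subst; unfold hat_sq.
assert (e : rgt (vcompS (hidS (FV F u)) (iot (l (vcod u))))
            = lft (vcompS (eps (l (vdom u))) (hidS (FV G u)))).
{ rewrite rgt_vcomp by gb; rewrite lft_vcomp by gb.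
  rewrite rgt_hid, iot_rgt, eps_lft, lft_hid; apply va_nat. }
rewrite top_hcomp, bot_hcomp, lft_hcomp, rgt_hcomp by exact e.
repeat split; gb.
Qed.

Definition khidS (A B : dob D) (u : vcell A B) : ksq (@id1 K A) (@id1 K B) u u.
Proof.
refine {| kval := hat_sq leta A B u |};
  abstract (apply (hat_sq_bdry leta (vval_dom u) (vval_cod u))).
Defined.

Definition khcompS (A B C A' B' C' : dob D)
  (f : @hom K A B) (g : @hom K B C) (f' : @hom K A' B') (g' : @hom K B' C')
  (u : vcell A A') (v : vcell B B') (w : vcell C C')
  (c : ksq f f' u v) (d : ksq g g' v w) :
  ksq (@comp1 K _ _ _ f g) (@comp1 K _ _ _ f' g') u w.
Proof.
refine {| kval := hcompS c (hcompS (FS T d) (hat_sq lmu C C' w)) |};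
  abstract (
    destruct (hat_sq_bdry lmu (vval_dom w) (vval_cod w)) as [[h1 h2] [h3 h4]];
    assert (e : rgt (FS T d) = lft (hat_sq lmu C C' w))
      by (rewrite h3, FS_rgt, k_rgt; reflexivity);
    assert (e' : rgt c = lft (hcompS (FS T d) (hat_sq lmu C C' w)))
      by (rewrite lft_hcomp by exact e; rewrite k_rgt, FS_lft, k_lft; reflexivity);
    rewrite ?top_hcomp, ?bot_hcomp, ?lft_hcomp, ?rgt_hcomp by (exact e || exact e');
    rewrite ?h1, ?h2, ?h4, ?FS_top, ?FS_bot, ?k_top, ?k_bot, ?k_lft; reflexivity).
Defined.

Definition ksq_of (A B : dob D) (f g : @hom K A B) (c : cell f g) :
  ksq f g (kvid A) (kvid B).
Proof.
refine {| kval := sval (c : gcell f g) |}; abstract (rewrite ?s_top, ?s_bot, ?s_lft, ?s_rgt;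
  cbn; rewrite ?FV_id; reflexivity).
Defined.

Definition kleisli_double : pseudodouble_data.
Proof.
refine {| po := dob D; ph := @hom K; pv := vcell; psq := ksq;
  pvid := kvid; pvcomp := kvcomp; pvidS := kvidS; pvcompS := kvcompS;
  phid := @id1 K; phcomp := @comp1 K; phidS := khidS; phcompS := khcompS;
  passoc := fun _ _ _ _ f g h => ksq_of (assoc f g h);
  passoc' := fun _ _ _ _ f g h => ksq_of (assoc' f g h);
  plun := fun _ _ f => ksq_of (lun f); plun' := fun _ _ f => ksq_of (lun' f);
  prun := fun _ _ f => ksq_of (run f); prun' := fun _ _ f => ksq_of (run' f) |};
  abstract (intros; apply vcell_eq; cbn;
    first [apply vunitl; apply vval_dom | apply vunitr; apply vval_cod
          | apply (vcompA (dc_ax D)); rewrite vval_dom, vval_cod; reflexivity]).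
Defined.

(** [H (Kl T) = Kl (H T)]: the two bicategories share objects and 1-cells, while
    their 2-cells differ by the equality [T (vid B) = vid (T B)]. *)
Definition kleisli_agree : Prop :=
  twocells_iso (bicat2 (ps_horiz kleisli_double) : twocells (kleisli_graph HT)) (bicat2 K).

End Kleisli.

(* Submission.v *)
(** Every structural 2-cell of the statement is transported along vertically
    invertible squares.  Call a square [π] with top [f] a frame of the 1-cell
    [f].  A 2-cell [c : f => g] of the horizontal bicategory is a square, hence
    is determined by the frame [c / π] of [f], for any one invertible frame [π]
    of [g].  The companion square [ε] of a vertical cell is such a frame, a
    composite of companions is framed by the corresponding staircase of squares
    [ε], and every lifted equality carries one staircase to the other.  Equations
    between pastings of lifted cells therefore hold as soon as the vertical
    composites agree, and naturality of a modification becomes an equation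
    between squares of the double category, which holds strictly there.

    Since [η] is invertible, the Kleisli bicategory can be framed over the same
    double category: with [e = η^-1] and [θ_g = η_g^-1], a frame of
    [f : X -> T Y] has right side [e_Y / b], and frames [π], [π'] of [f], [g]
    compose to [[π | [θ_g | ε_μ] / π']].  The functors [A ⋉ f = [A ⊗ f | t]] and
    [f ⋊ B = [f ⊗ B | s]] act on frames by tensoring and correcting the right side
    by the unit law of the strength; their compositors and the remaining data of
    the premonoidal structure are the 2-cells with the prescribed action on
    frames. *)

Require Import Defs.
From Stdlib Require Import List ProofIrrelevance IndefiniteDescription.
Import ListNotations.

Set Implicit Arguments.
Unset Strict Implicit.
Unset Printing Implicit Defensive.

(** The axioms to be checked are pastings along paths, cluttered with associators, unitors and
    compositors, in several bicategories: the horizontal one, its powers, the unit bicategory and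
    the Kleisli bicategory. The record [framing] isolates what a calculus of frames needs, so that
    every coherence argument is made once. Two mismatches shape it. First, pseudofunctors preserve
    identity 1-cells only up to unitors, so the image of a companion frame ends in [F (id)] and has
    to be straightened by an inverse unitor ([img]). Secondly, consecutive 1-cells can be framed
    together only if the sides of their frames fit; hence the predicate [good], which ensures enough
    invertible frames with a prescribed left side. In the Kleisli case the calculus closes up
    because an invertible unit makes the monad idempotent: [μ] at [Z] is the inverse of [η] at
    [T Z]. Then [θ_f / π] frames [T f] with the same bottom as [π], and applications of [T] to
    frames do not accumulate. *)

Notation "s ÷ t" := (vcompS s t) (at level 40, left associativity).
Notation "s ∥ t" := (hcompS s t) (at level 38, left associativity).
Notation "u ∙ v" := (vcomp u v) (at level 40, left associativity).

(** * Vertical isomorphisms *)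

(** Composites are total functions, so equations between them carry information only together with
    matching boundaries; these are therefore part of the notion. Inverses are unique by [viso_inj],
    and a mere existence statement is enough. *)
Definition viso {D : dcat} (u : dv D) : Prop := exists v : dv D,
  vdom v = vcod u /\ vcod v = vdom u /\ u ∙ v = vid (vdom u) /\ v ∙ u = vid (vcod u).

Definition visoS {D : dcat} (s : dsq D) : Prop := exists t : dsq D,
  top t = bot s /\ bot t = top s /\ s ÷ t = vidS (top s) /\ t ÷ s = vidS (bot s).

Section Raw.
Context {D : double_category}.
Implicit Types (s t : dsq D) (u v w : dv D) (f g : dh D).

Lemma vA s1 s2 s3 : bot s1 = top s2 -> bot s2 = top s3 -> s1 ÷ s2 ÷ s3 = s1 ÷ (s2 ÷ s3).
Proof. apply (vcompSA (dc_ax D)). Qed.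
Lemma v1 s f : top s = f -> vidS f ÷ s = s.
Proof. intros <-; apply (vcompS1a (dc_ax D)). Qed.
Lemma vr s f : bot s = f -> s ÷ vidS f = s.
Proof. intros <-; apply (vcompSa1 (dc_ax D)). Qed.
Lemma hA s1 s2 s3 : rgt s1 = lft s2 -> rgt s2 = lft s3 -> s1 ∥ s2 ∥ s3 = s1 ∥ (s2 ∥ s3).
Proof. apply (hcompSA (dc_ax D)). Qed.
Lemma h1 s u : lft s = u -> hidS u ∥ s = s.
Proof. intros <-; apply (hcompS1a (dc_ax D)). Qed.
Lemma hr s u : rgt s = u -> s ∥ hidS u = s.
Proof. intros <-; apply (hcompSa1 (dc_ax D)). Qed.
Lemma uA u v w : vcod u = vdom v -> vcod v = vdom w -> u ∙ v ∙ w = u ∙ (v ∙ w).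
Proof. apply (vcompA (dc_ax D)). Qed.
Lemma u1 u A : vdom u = A -> vid A ∙ u = u.
Proof. apply vunitl. Qed.
Lemma ur u A : vcod u = A -> u ∙ vid A = u.
Proof. apply vunitr. Qed.
Lemma exch s1 s2 t1 t2 : rgt s1 = lft s2 -> rgt t1 = lft t2 ->
  bot s1 = top t1 -> bot s2 = top t2 -> (s1 ∥ s2) ÷ (t1 ∥ t2) = (s1 ÷ t1) ∥ (s2 ÷ t2).
Proof. apply (interchange (dc_ax D)). Qed.
Lemma hidS_v u v : vcod u = vdom v -> hidS (u ∙ v) = hidS u ÷ hidS v.
Proof. apply (hidS_comp (dc_ax D)). Qed.
Lemma vidS_h f g : hcod f = hdom g -> vidS (hcomp f g) = vidS f ∥ vidS g.
Proof. apply (vidS_comp (dc_ax D)). Qed.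
Lemma hidS_id A : hidS (vid A) = vidS (hid (d:=D) A).
Proof. apply (hidS_vid (dc_ax D)). Qed.

Lemma bot_lr s s' : bot s = top s' -> vcod (lft s) = vdom (lft s') /\ vcod (rgt s) = vdom (rgt s').
Proof. intros e; rewrite <- dom_bot, <- cod_bot, e, dom_top, cod_top; auto. Qed.
Lemma rgt_tb s s' : rgt s = lft s' -> hcod (top s) = hdom (top s') /\ hcod (bot s) = hdom (bot s').
Proof. intros e; rewrite cod_top, cod_bot, e, dom_top, dom_bot; auto. Qed.

Lemma viso_inj u v v' : viso u -> vdom v = vcod u -> vdom v' = vcod u -> u ∙ v = u ∙ v' -> v = v'.
Proof.
intros (w & w1 & w2 & w3 & w4) e e' E.
rewrite <- (u1 e), <- (u1 e'), <- w4, !uA, E; congruence.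
Qed.
Lemma viso_id A : viso (D:=D) (vid A).
Proof. exists (vid A); rewrite !vdom_id, !vcod_id, vcomp_id; auto. Qed.
Lemma viso_comp u v : vcod u = vdom v -> viso u -> viso v -> viso (u ∙ v).
Proof.
intros e (u' & a1 & a2 & a3 & a4) (v' & b1 & b2 & b3 & b4).
exists (v' ∙ u'); rewrite !vdom_comp, !vcod_comp by congruence.
repeat split; auto.
- rewrite uA by (rewrite ?vdom_comp; congruence).
  rewrite <- (@uA v v' u') by congruence.
  rewrite b3, u1 by congruence; auto.
- rewrite uA by (rewrite ?vdom_comp; congruence).
  rewrite <- (@uA u' u v) by congruence.
  rewrite a4, u1 by congruence; auto.
Qed.

Lemma visoS_inj s a b : visoS s -> bot a = top s -> bot b = top s -> a ÷ s = b ÷ s -> a = b.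
Proof.
intros (t & w1 & w2 & w3 & w4) e e' E.
rewrite <- (vr e), <- (vr e'), <- w3, <- !vA, E; congruence.
Qed.
Lemma visoS_injl s a b : visoS s -> top a = bot s -> top b = bot s -> s ÷ a = s ÷ b -> a = b.
Proof.
intros (t & w1 & w2 & w3 & w4) e e' E.
rewrite <- (v1 e), <- (v1 e'), <- w4, !vA, E; congruence.
Qed.
Lemma visoS_id f : visoS (vidS f).
Proof. exists (vidS f); rewrite !top_vid, !bot_vid, v1 by apply top_vid; auto. Qed.
Lemma visoS_comp s s' : bot s = top s' -> visoS s -> visoS s' -> visoS (s ÷ s').
Proof.
intros e (u' & a1 & a2 & a3 & a4) (v' & b1 & b2 & b3 & b4).
exists (v' ÷ u'); rewrite !top_vcomp, !bot_vcomp by congruence.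
repeat split; auto.
- rewrite vA by (rewrite ?top_vcomp; congruence).
  rewrite <- (@vA s' v' u') by congruence.
  rewrite b3, v1 by congruence; auto.
- rewrite vA by (rewrite ?top_vcomp; congruence).
  rewrite <- (@vA u' s s') by congruence.
  rewrite a4, v1 by congruence; auto.
Qed.
Lemma visoS_sides s t : top t = bot s -> bot t = top s -> s ÷ t = vidS (top s) ->
  t ÷ s = vidS (bot s) ->
  (lft s ∙ lft t = vid (vdom (lft s)) /\ lft t ∙ lft s = vid (vcod (lft s))) /\
  (rgt s ∙ rgt t = vid (vdom (rgt s)) /\ rgt t ∙ rgt s = vid (vcod (rgt s))).
Proof.
intros e1 e2 e3 e4.
rewrite <- !lft_vcomp, <- !rgt_vcomp, e3, e4 by congruence.
rewrite !lft_vid, !rgt_vid, dom_top, cod_top, dom_bot, cod_bot; auto.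
Qed.
Lemma visoS_lft s : visoS s -> viso (lft s).
Proof.
intros (t & w1 & w2 & w3 & w4); exists (lft t).
destruct (visoS_sides w1 w2 w3 w4) as [[] []], (bot_lr w2), (bot_lr (eq_sym w1)); auto.
Qed.
Lemma visoS_rgt s : visoS s -> viso (rgt s).
Proof.
intros (t & w1 & w2 & w3 & w4); exists (rgt t).
destruct (visoS_sides w1 w2 w3 w4) as [[] []], (bot_lr w2), (bot_lr (eq_sym w1)); auto.
Qed.
Lemma visoS_hcomp s s' : rgt s = lft s' -> visoS s -> visoS s' -> visoS (s ∥ s').
Proof.
intros e I (t' & b1 & b2 & b3 & b4).
assert (V := visoS_rgt I).
destruct I as (t & a1 & a2 & a3 & a4).
destruct (visoS_sides a1 a2 a3 a4) as [[] [r1 r2]],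
  (visoS_sides b1 b2 b3 b4) as [[l1 l2] []].
destruct (bot_lr (eq_sym a1)), (bot_lr (eq_sym b1)).
(* The two inverses can be placed side by side because [rgt t] and [lft t'] both invert [rgt s]. *)
assert (E : rgt t = lft t').
{ apply (viso_inj V); congruence. }
exists (t ∥ t'); rewrite !top_hcomp, !bot_hcomp by congruence.
destruct (rgt_tb e).
repeat split; try congruence.
- rewrite exch, a3, b3, vidS_h by congruence; auto.
- rewrite exch, a4, b4, vidS_h by congruence; auto.
Qed.
Lemma visoS_hid u : viso u -> visoS (hidS u).
Proof.
intros (v & a1 & a2 & a3 & a4); exists (hidS v).
rewrite !top_hid, !bot_hid, a1, a2, <- !hidS_v, a3, a4, !hidS_id by congruence; auto.
Qed.
(** Interchange applied to [s = [Id^{lft s} | s] / [iota | eps]]. Consequently ([eps_inj]) a square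
    ending in a companion is determined by its left side and its composite with [eps]. *)
Lemma eps_iota_expand u (c : companion u) s : bot s = cmp c ->
  s = (hidS (lft s) ÷ iot c) ∥ (s ÷ eps c).
Proof.
intros e; destruct (companion_ax c) as [k1 k2]; cbn in *.
rewrite <- exch; try rewrite ?rgt_hid, ?bot_hid, ?iot_top, ?eps_top, ?iot_rgt, ?eps_lft; auto.
- rewrite h1, k1, vr by auto; auto.
- rewrite <- dom_bot, e, cmp_dom; auto.
Qed.

Lemma eps_inj u (c : companion u) a b : bot a = cmp c -> bot b = cmp c -> lft a = lft b ->
  a ÷ eps c = b ÷ eps c -> a = b.
Proof.
intros e1 e2 e3 E; rewrite (eps_iota_expand e1), (eps_iota_expand e2), e3, E; auto.
Qed.

(* The inverse of [eps] is [Id^{u^-1}/iota]. *)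
Lemma visoS_eps u (c : companion u) : viso u -> visoS (eps c).
Proof.
intros (w & w1 & w2 & w3 & w4).
destruct (companion_ax c) as [k1 k2]; cbn in *.
assert (H : top (hidS w ÷ iot c) = hid (vcod u) /\ bot (hidS w ÷ iot c) = cmp c
  /\ lft (hidS w ÷ iot c) = w /\ rgt (hidS w ÷ iot c) = vid (vcod u)).
{ rewrite top_vcomp, bot_vcomp, lft_vcomp, rgt_vcomp by (rewrite bot_hid, iot_top; congruence).
  rewrite top_hid, lft_hid, rgt_hid, iot_rgt, iot_lft, iot_bot, ur, w1, w4 by auto; auto. }
destruct H as (H1 & H2 & H3 & H4).
assert (E : (hidS w ÷ iot c) ÷ eps c = vidS (hid (vcod u))).
{ rewrite vA by (rewrite ?bot_hid, ?iot_top, ?iot_bot, ?eps_top; congruence).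
  rewrite k2, <- hidS_v, w4, hidS_id by auto; auto. }
exists (hidS w ÷ iot c); rewrite H1, H2, eps_top, eps_bot.
refine (conj eq_refl (conj eq_refl (conj _ E))).
apply (eps_inj (c := c)).
- rewrite bot_vcomp by (rewrite eps_bot; auto); auto.
- apply bot_vid.
- rewrite lft_vcomp, H3, eps_lft, lft_vid, cmp_dom by (rewrite eps_bot; auto); auto.
- rewrite vA, E, vr, v1 by (rewrite ?H1, ?H2, ?eps_top, ?eps_bot; auto); auto.
Qed.

Lemma visoS_vi s (i : vinverse s) : visoS s.
Proof. exists i; rewrite (vi_top i), (vi_bot i), (vi_l i), (vi_r i); auto. Qed.

End Raw.

Lemma viso_map (C D : dcat) (F : pdfun C D) (P : is_pdfun F) (u : dv C) :
  viso u -> viso (FV F u).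
Proof.
intros (v & a1 & a2 & a3 & a4); exists (FV F v).
rewrite !FV_dom, !FV_cod, <- !(FV_comp P), a3, a4, !FV_id, a1, a2 by congruence; auto.
Qed.

Lemma visoS_map (C D : dcat) (F : pdfun C D) (P : is_pdfun F) (s : dsq C) :
  visoS s -> visoS (FS F s).
Proof.
intros (v & a1 & a2 & a3 & a4); exists (FS F v).
rewrite !FS_top, !FS_bot, <- !(FS_vcomp P), a3, a4, !(FS_vid P), a1, a2 by congruence; auto.
Qed.

Lemma visoS_pair (C D : dcat) (s : dsq C) (t : dsq D) :
  visoS s -> visoS t -> visoS (D := dprod C D) (s, t).
Proof.
intros (v & a1 & a2 & a3 & a4) (w & b1 & b2 & b3 & b4); exists (v, w); cbn; repeat split; congruence.
Qed.

Lemma viso_pair (C D : dcat) (s : dv C) (t : dv D) :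
  viso s -> viso t -> viso (D := dprod C D) (s, t).
Proof.
intros (v & a1 & a2 & a3 & a4) (w & b1 & b2 & b3 & b4); exists (v, w); cbn; repeat split; congruence.
Qed.

(** * Pseudodouble functors *)

Lemma dprod_double (D E : double_category) : is_double (dprod D E).
Proof.
split; cbn; intros; repeat match goal with
  | x : (_ * _)%type |- _ => destruct x
  | e : (_, _) = (_, _) |- _ => injection e; clear e; intros
  end; cbn in *; f_equal;
  solve [ apply (dc_ax D); assumption | apply (dc_ax E); assumption ].
Qed.

Definition dprodD (D E : double_category) : double_category :=
  {| dc := dprod D E; dc_ax := dprod_double D E |}.

Lemma dunit_double : is_double dunit.
Proof. split; cbn; intros; repeat match goal with x : unit |- _ => destruct x end; reflexivity. Qed.
Definition dunitD : double_category := {| dc := dunit; dc_ax := dunit_double |}.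

Section Closure.
Context (C D E : double_category).

(** Squares go to [hidS (vid A)], the form in which the identity frame [fu] of the horizontal
    bicategory appears; [hidS_id] converts it to [vidS (hid A)]. *)
Definition dconst (A : dob D) : pdfun C D.
Proof.
refine {| F0 := fun _ : dob C => A; FH := fun _ => hid A; FV := fun _ => vid A;
  FS := fun _ => hidS (vid A); F2c := fun _ _ => hidS (vid A); F2c' := fun _ _ => hidS (vid A);
  F2u := fun _ => hidS (vid A); F2u' := fun _ => hidS (vid A) |}; abstract gb.
Defined.

Ltac fin := repeat first [rewrite hidS_id | rewrite v1 by gb | rewrite vr by gb
  | rewrite h1 by gb | rewrite hr by gb
  | rewrite <- hidS_v by gb | rewrite vcomp_id | reflexivity].

Lemma dconst_ax (A : dob D) : is_pdfun (dconst A).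
Proof. split; cbn; intros; rewrite ?hidS_id, ?vcomp_id, <- ?vidS_h by gb; fin; rewrite hunitl by gb; fin. Qed.

Lemma did_ax : is_pdfun (did C).
Proof.
split; cbn; intros; try (fin; fail).
- rewrite <- !vidS_h, v1, ?bot_vid by gb. fin. apply f_equal, hcompA, H0; [apply (dc_ax C)|auto].
- rewrite <- !vidS_h, v1, hunitl by gb; auto.
- rewrite <- !vidS_h, v1, hunitr by gb; auto.
Qed.

Lemma dcomp_ax (F : pdfun C D) (G : pdfun D E) (P : is_pdfun F) (Q : is_pdfun G) :
  is_pdfun (dcomp F G).
Proof.
split; cbn; intros.
- rewrite (FV_comp P), (FV_comp Q) by gb; auto.
- rewrite (FS_vid P), (FS_vid Q); auto.
- rewrite (FS_vcomp P), (FS_vcomp Q) by gb; auto.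
- rewrite vA, <- (@vA _ (FS G (F2c F f g))), <- (FS_vcomp Q), (F2c_inv P), (FS_vid Q), v1 by gb.
  apply (F2c_inv Q); gb.
- rewrite vA, <- (@vA _ (F2c' G _ _)), (F2c'_inv Q), v1, <- (FS_vcomp Q), (F2c'_inv P) by gb.
  apply (FS_vid Q).
- rewrite vA, <- (@vA _ (FS G (F2u F A))), <- (FS_vcomp Q), (F2u_inv P), (FS_vid Q), v1 by gb.
  apply (F2u_inv Q).
- rewrite vA, <- (@vA _ (F2u' G _)), (F2u'_inv Q), v1, <- (FS_vcomp Q), (F2u'_inv P) by gb.
  apply (FS_vid Q).
- destruct (rgt_tb H).
  pose proof (F2c_nat Q (a:=FS F a) (b:=FS F b)) as N; rewrite !FS_bot, !FS_top in N.
  rewrite <- vA, N, !vA, <- !(FS_vcomp Q), (F2c_nat P) by gb; auto.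
- pose proof (F2u_nat Q (FV F u)) as N; rewrite FV_dom, FV_cod in N.
  rewrite <- vA, N, !vA, <- !(FS_vcomp Q), (F2u_nat P) by gb; auto.
- assert (N1 := F2c_nat Q (a:=F2c F f g) (b:=vidS (FH F h))).
  assert (N2 := F2c_nat Q (b:=F2c F g h) (a:=vidS (FH F f))).
  rewrite F2c_top, F2c_bot, top_vid, bot_vid, (FS_vid Q) in N1, N2 by auto.
  specialize (N1 ltac:(gb)); specialize (N2 ltac:(gb)).
  rewrite <- (@vr _ (vidS (FH G (FH F h))) _ eq_refl), <- (@vr _ (vidS (FH G (FH F f))) _ eq_refl).
  rewrite !bot_vid, <- !exch, !vA by gb.
  rewrite <- (@vA _ (FS G _ ∥ _)), N1 by gb.
  rewrite <- (@vA _ (_ ∥ FS G _)), N2 by gb.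
  rewrite !vA, <- !(FS_vcomp Q) by gb.
  rewrite <- !vA, (F2c_assoc Q), (F2c_assoc P) by gb; auto.
- assert (N1 := F2c_nat Q (a:=F2u F (hdom f)) (b:=vidS (FH F f))).
  rewrite F2u_top, F2u_bot, top_vid, bot_vid, (FS_vid Q) in N1 by auto.
  specialize (N1 ltac:(gb)).
  rewrite <- (@vr _ (vidS (FH G (FH F f))) _ eq_refl), bot_vid, <- exch, !vA by gb.
  rewrite <- (@vA _ (FS G _ ∥ _)), N1 by gb.
  rewrite !vA, <- !(FS_vcomp Q), (F2c_unitl P), (FS_vid Q) by gb.
  rewrite vr by gb. rewrite <- (FH_dom F), (F2c_unitl Q), v1 by gb; auto.
- assert (N1 := F2c_nat Q (b:=F2u F (hcod f)) (a:=vidS (FH F f))).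
  rewrite F2u_top, F2u_bot, top_vid, bot_vid, (FS_vid Q) in N1 by auto.
  specialize (N1 ltac:(gb)).
  rewrite <- (@vr _ (vidS (FH G (FH F f))) _ eq_refl), bot_vid, <- exch, !vA by gb.
  rewrite <- (@vA _ (_ ∥ FS G _)), N1 by gb.
  rewrite !vA, <- !(FS_vcomp Q), (F2c_unitr P), (FS_vid Q) by gb.
  rewrite vr by gb. rewrite <- (FH_cod F), (F2c_unitr Q), v1 by gb; auto.
Qed.

Lemma dpair_ax (F : pdfun C D) (G : pdfun C E) (P : is_pdfun F) (Q : is_pdfun G) :
  is_pdfun (dpair F G).
Proof. split; cbn; intros; f_equal; solve [ apply P; assumption | apply Q; assumption ]. Qed.

End Closure.

Lemma dfst_ax (D E : double_category) : is_pdfun (dfst D E).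
Proof.
assert (P := did_ax D).
split; cbn; intros; repeat match goal with
  | x : (_ * _)%type |- _ => destruct x
  | e : (_, _) = (_, _) |- _ => injection e; clear e; intros
  end; cbn in *; solve [ apply P; assumption ].
Qed.
Lemma dsnd_ax (D E : double_category) : is_pdfun (dsnd D E).
Proof.
assert (P := did_ax E).
split; cbn; intros; repeat match goal with
  | x : (_ * _)%type |- _ => destruct x
  | e : (_, _) = (_, _) |- _ => injection e; clear e; intros
  end; cbn in *; solve [ apply P; assumption ].
Qed.
(** * Framed bicategories *)

(** [fo], [fh], [cs] send 0-, 1- and 2-cells to [D].  A frame of [f : X -> Y]
    with sides [a], [b] has left side [a] and right side [fw Y b]; it can be
    continued by a frame with left side [b].  [fc] and [fu] are composite and
    identity frames, and any 1-cell has an invertible frame whose left side is a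
    given [good] vertical cell. *)
Record framing (B : bicat) (D : double_category) := {
  fo : B -> dob D;
  fh : forall X Y : B, hom X Y -> dh D;
  cs : forall (X Y : B) (f g : hom X Y), cell f g -> dsq D;
  fw : B -> dv D -> dv D;
  fc : forall X Y Z : B, hom X Y -> hom Y Z -> dsq D -> dsq D -> dsq D;
  fu : B -> dv D -> dsq D;
  good : B -> dv D -> Prop }.

Record fr {B D} (φ : framing B D) {X Y : B} (f : hom X Y) (a b : dv D) (π : dsq D) : Prop := {
  fr_top : top π = fh φ f;
  fr_lft : lft π = a;
  fr_rgt : rgt π = fw φ Y b;
  fr_dom : vdom b = fo φ Y }.

(** [cs_inj] and [cs_full] identify 2-cells with globular squares. The laws whose names begin with
    [fi] say that associators and unitors merely regroup a composite frame; [fc_post] and [fu_post]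
    say that frames can be continued below. [good_fr] runs along a composable sequence: starting
    from an identity, each 1-cell receives an invertible frame that fits the preceding one. *)
Record is_framing {B D} (φ : framing B D) : Prop := {
  fh_dom : forall (X Y : B) (f : hom X Y), hdom (fh φ f) = fo φ X;
  fh_cod : forall (X Y : B) (f : hom X Y) b, vdom b = fo φ Y -> hcod (fh φ f) = vdom (fw φ Y b);
  fw_cod : forall (Y : B) b, vdom b = fo φ Y -> vcod (fw φ Y b) = vcod b;
  fw_comp : forall (Y : B) b v, vdom b = fo φ Y -> vcod b = vdom v ->
    fw φ Y b ∙ v = fw φ Y (b ∙ v);
  fw_iso : forall (Y : B) b, vdom b = fo φ Y -> viso b -> viso (fw φ Y b);
  cs_top : forall (X Y : B) (f g : hom X Y) (c : cell f g), top (cs φ c) = fh φ f;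
  cs_bot : forall (X Y : B) (f g : hom X Y) (c : cell f g), bot (cs φ c) = fh φ g;
  cs_lft : forall (X Y : B) (f g : hom X Y) (c : cell f g), lft (cs φ c) = vid (fo φ X);
  cs_rgt : forall (X Y : B) (f g : hom X Y) (c : cell f g),
    rgt (cs φ c) = vid (hcod (fh φ f));
  cs_comp : forall (X Y : B) (f g h : hom X Y) (c : cell f g) (d : cell g h),
    cs φ (c ⊙ d) = cs φ c ÷ cs φ d;
  cs_id : forall (X Y : B) (f : hom X Y), cs φ (id2 f) = vidS (fh φ f);
  cs_inj : forall (X Y : B) (f g : hom X Y) (c d : cell f g), cs φ c = cs φ d -> c = d;
  cs_full : forall (X Y : B) (f g : hom X Y) s, top s = fh φ f -> bot s = fh φ g ->
    lft s = vid (fo φ X) -> rgt s = vid (hcod (fh φ f)) -> exists c : cell f g, cs φ c = s;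
  fc_fr : forall (X Y Z : B) (f : hom X Y) (g : hom Y Z) a b c π π',
    fr φ f a b π -> fr φ g b c π' -> fr φ (comp1 f g) a c (fc φ f g π π');
  fc_bot : forall (X Y Z : B) (f : hom X Y) (g : hom Y Z) a b c π π',
    fr φ f a b π -> fr φ g b c π' -> bot (fc φ f g π π') = hcomp (bot π) (bot π');
  fc_post : forall (X Y Z : B) (f : hom X Y) (g : hom Y Z) a b c π π' s s',
    fr φ f a b π -> fr φ g b c π' -> top s = bot π -> top s' = bot π' -> rgt s = lft s' ->
    fc φ f g (π ÷ s) (π' ÷ s') = fc φ f g π π' ÷ (s ∥ s');
  fc_iso : forall (X Y Z : B) (f : hom X Y) (g : hom Y Z) a b c π π',
    fr φ f a b π -> fr φ g b c π' -> visoS π -> visoS π' -> visoS (fc φ f g π π');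
  fc_hc2 : forall (X Y Z : B) (f f' : hom X Y) (g g' : hom Y Z) (x : cell f f') (y : cell g g')
    a b c π π', fr φ f' a b π -> fr φ g' b c π' ->
    cs φ (hc2 x y) ÷ fc φ f' g' π π' = fc φ f g (cs φ x ÷ π) (cs φ y ÷ π');
  fu_fr : forall (X : B) a, vdom a = fo φ X -> fr φ (id1 X) a a (fu φ X a);
  fu_bot : forall (X : B) a, vdom a = fo φ X -> bot (fu φ X a) = hid (vcod a);
  fu_post : forall (X : B) a v, vdom a = fo φ X -> vcod a = vdom v ->
    fu φ X a ÷ hidS v = fu φ X (a ∙ v);
  fu_iso : forall (X : B) a, vdom a = fo φ X -> viso a -> visoS (fu φ X a);
  fi_assoc : forall (X Y Z W : B) (f : hom X Y) (g : hom Y Z) (h : hom Z W) a b c d π1 π2 π3,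
    fr φ f a b π1 -> fr φ g b c π2 -> fr φ h c d π3 ->
    cs φ (assoc f g h) ÷ fc φ f (comp1 g h) π1 (fc φ g h π2 π3)
    = fc φ (comp1 f g) h (fc φ f g π1 π2) π3;
  fi_assoc' : forall (X Y Z W : B) (f : hom X Y) (g : hom Y Z) (h : hom Z W) a b c d π1 π2 π3,
    fr φ f a b π1 -> fr φ g b c π2 -> fr φ h c d π3 ->
    cs φ (assoc' f g h) ÷ fc φ (comp1 f g) h (fc φ f g π1 π2) π3
    = fc φ f (comp1 g h) π1 (fc φ g h π2 π3);
  fi_lun : forall (X Y : B) (f : hom X Y) a b π, fr φ f a b π ->
    cs φ (lun f) ÷ π = fc φ (id1 X) f (fu φ X a) π;
  fi_lun' : forall (X Y : B) (f : hom X Y) a b π, fr φ f a b π ->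
    cs φ (lun' f) ÷ fc φ (id1 X) f (fu φ X a) π = π;
  fi_run : forall (X Y : B) (f : hom X Y) a b π, fr φ f a b π ->
    cs φ (run f) ÷ π = fc φ f (id1 Y) π (fu φ Y b);
  fi_run' : forall (X Y : B) (f : hom X Y) a b π, fr φ f a b π ->
    cs φ (run' f) ÷ fc φ f (id1 Y) π (fu φ Y b) = π;
  good_id : forall X : B, good φ X (vid (fo φ X));
  good_dom : forall (X : B) a, good φ X a -> vdom a = fo φ X /\ viso a;
  good_fr : forall (X Y : B) (f : hom X Y) a, good φ X a ->
    exists b π, good φ Y b /\ fr φ f a b π /\ visoS π }.

Section Framed.
Context {B : bicat} {D : double_category} {φ : framing B D} (H : is_framing φ).
Local Notation fo := (fo φ).
Local Notation cs := (cs φ).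
Local Notation fw := (fw φ).
Local Notation fc := (fc φ).
Local Notation fu := (fu φ).
Local Notation fr := (fr φ).

Lemma fr_left (X Y : B) (f : hom X Y) a b π : fr f a b π -> vdom a = fo X.
Proof. intros h; rewrite <- (fr_lft h), <- dom_top, (fr_top h); apply (fh_dom H). Qed.
Lemma fr_hbot (X Y : B) (f : hom X Y) a b π : fr f a b π ->
  hdom (bot π) = vcod a /\ hcod (bot π) = vcod b.
Proof.
intros h; rewrite dom_bot, cod_bot, (fr_lft h), (fr_rgt h); split; auto.
apply (fw_cod H), (fr_dom h).
Qed.

Lemma act_top (X Y : B) (f g : hom X Y) (c : cell f g) a b π : fr g a b π -> bot (cs c) = top π.
Proof. intros h; rewrite (fr_top h); apply (cs_bot H). Qed.
Lemma act_bot (X Y : B) (f g : hom X Y) (c : cell f g) a b π : fr g a b π ->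
  bot (cs c ÷ π) = bot π.
Proof. intros h; apply bot_vcomp, (act_top c h). Qed.
Lemma act_comp (X Y : B) (f g h : hom X Y) (c : cell f g) (d : cell g h) a b π :
  fr h a b π -> cs (c ⊙ d) ÷ π = cs c ÷ (cs d ÷ π).
Proof.
intros e; rewrite (cs_comp H); apply vA; rewrite ?(act_top _ e), ?(cs_top H), ?(cs_bot H); auto.
Qed.
Lemma act_id (X Y : B) (f : hom X Y) a b π : fr f a b π -> cs (id2 f) ÷ π = π.
Proof. intros e; rewrite (cs_id H); apply v1, e. Qed.
Lemma fr_act (X Y : B) (f g : hom X Y) (c : cell f g) a b π : fr g a b π -> fr f a b (cs c ÷ π).
Proof.
intros e; assert (E := act_top c e); split.
- rewrite top_vcomp by auto; apply (cs_top H).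
- rewrite lft_vcomp, (cs_lft H), (fr_lft e) by auto. apply u1, (fr_left e).
- rewrite rgt_vcomp, (cs_rgt H), (fr_rgt e) by auto; apply u1.
  rewrite <- (fh_cod H f) by apply e; auto.
- apply e.
Qed.
Lemma fr_post (X Y : B) (f : hom X Y) a b π s : fr f a b π -> top s = bot π ->
  fr f (a ∙ lft s) (b ∙ rgt s) (π ÷ s).
Proof.
intros e E; destruct (fr_hbot e).
assert (vcod b = vdom (rgt s)) by (rewrite <- cod_top; congruence).
split.
- rewrite top_vcomp by auto; apply e.
- rewrite lft_vcomp, (fr_lft e) by auto; auto.
- rewrite rgt_vcomp, (fr_rgt e) by auto. apply (fw_comp H); auto; apply e.
- rewrite vdom_comp; auto; apply e.
Qed.

Lemma cell_eq (X Y : B) (f g : hom X Y) (c d : cell f g) a b π : fr g a b π -> visoS π ->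
  cs c ÷ π = cs d ÷ π -> c = d.
Proof.
intros e I E; apply (cs_inj H), (visoS_inj I); auto; apply (act_top _ e).
Qed.

Lemma good_frame (X Y : B) (f : hom X Y) : exists b π, fr f (vid (fo X)) b π /\ visoS π.
Proof. destruct (good_fr H f (good_id H X)) as (b & π & _ & h); eauto. Qed.

(** Each law is tested on a composite of invertible frames chosen from left to right by [good_fr].
    On such a frame the structural cells only rebracket, so both sides act in the same way, and
    [cell_eq] cancels the frame. *)
Lemma framed_bicat : is_bicat B.
Proof.
assert (act_id' := act_id); assert (act_comp' := act_comp).
assert (fr_act' := fr_act); assert (fc_fr' := fc_fr H); assert (fc_iso' := fc_iso H).
split; intros.
- destruct (good_frame g) as (b & π & e & I). apply (cell_eq e I).
  rewrite (act_comp _ _ e); eapply act_id; eauto.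
- destruct (good_frame g) as (b & π & e & I). apply (cell_eq e I).
  rewrite (act_comp _ _ e), (act_id e); auto.
- destruct (good_frame k) as (b & π & e' & I). apply (cell_eq e' I).
  repeat erewrite act_comp by eauto; auto.
- destruct (good_fr H f (good_id H X)) as (b & π & G & h & I).
  destruct (good_fr H g G) as (b' & π' & G' & h' & I').
  apply (cell_eq (fc_fr H h h')); eauto. rewrite (fc_hc2 H _ _ h h').
  erewrite !act_id; eauto.
- destruct (good_fr H f'' (good_id H X)) as (b & π & G & h & I).
  destruct (good_fr H g'' G) as (b' & π' & G' & h' & I').
  apply (cell_eq (fc_fr H h h')); eauto.
  rewrite (fc_hc2 H _ _ h h'), (act_comp _ _ h), (act_comp _ _ h'), (act_comp _ _ (fc_fr H h h')).
  rewrite (fc_hc2 H _ _ h h'); symmetry; apply (fc_hc2 H _ _ (fr_act _ h) (fr_act _ h')).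
- destruct (good_fr H f' (good_id H X)) as (a1 & π1 & G1 & x1 & I1).
  destruct (good_fr H g' G1) as (a2 & π2 & G2 & x2 & I2).
  destruct (good_fr H h' G2) as (a3 & π3 & G3 & x3 & I3).
  eapply cell_eq; [ apply (fc_fr H x1 (fc_fr H x2 x3)) | eauto | ].
  rewrite !(act_comp _ _ (fc_fr H x1 (fc_fr H x2 x3))), (fi_assoc H x1 x2 x3).
  rewrite (fc_hc2 H _ _ (fc_fr H x1 x2) x3), (fc_hc2 H _ _ x1 x2).
  rewrite (fc_hc2 H _ _ x1 (fc_fr H x2 x3)), (fc_hc2 H _ _ x2 x3).
  symmetry; eapply (fi_assoc H); eauto.
- destruct (good_fr H g (good_id H X)) as (a1 & π1 & G1 & x1 & I1).
  eapply cell_eq; [ apply x1 | eauto | ].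
  rewrite !(act_comp _ _ x1), (fi_lun H x1), (fc_hc2 H _ _ (fu_fr H (vdom_id _)) x1).
  rewrite (act_id (fu_fr H (vdom_id _))); symmetry; eapply (fi_lun H); eauto.
- destruct (good_fr H g (good_id H X)) as (a1 & π1 & G1 & x1 & I1).
  destruct (good_dom H G1) as [d _].
  eapply cell_eq; [ apply x1 | eauto | ].
  rewrite !(act_comp _ _ x1), (fi_run H x1), (fc_hc2 H _ _ x1 (fu_fr H d)).
  rewrite (act_id (fu_fr H d)); symmetry; eapply (fi_run H); eauto.
- destruct (good_fr H f (good_id H X)) as (a1 & π1 & G1 & x1 & I1).
  destruct (good_fr H g G1) as (a2 & π2 & G2 & x2 & I2).
  destruct (good_fr H h G2) as (a3 & π3 & G3 & x3 & I3).
  assert (y := fc_fr H x1 (fc_fr H x2 x3)); assert (y' := fc_fr H (fc_fr H x1 x2) x3).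
  split; [eapply (cell_eq y') | eapply (cell_eq y)]; eauto.
  + rewrite (act_comp _ _ y'), (fi_assoc' H x1 x2 x3), (fi_assoc H x1 x2 x3), (act_id y'); auto.
  + rewrite (act_comp _ _ y), (fi_assoc H x1 x2 x3), (fi_assoc' H x1 x2 x3), (act_id y); auto.
- destruct (good_fr H f (good_id H X)) as (a1 & π1 & G1 & x1 & I1).
  assert (x := fu_fr H (vdom_id (fo X))); assert (i := fu_iso H (vdom_id (fo X)) (viso_id _)).
  assert (y := fc_fr H x x1).
  split; [eapply (cell_eq y) | eapply (cell_eq x1)]; eauto.
  + rewrite (act_comp _ _ y), (fi_lun' H x1), (fi_lun H x1), (act_id y); auto.
  + rewrite (act_comp _ _ x1), (fi_lun H x1), (fi_lun' H x1), (act_id x1); auto.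
- destruct (good_fr H f (good_id H X)) as (a1 & π1 & G1 & x1 & I1).
  destruct (good_dom H G1) as [d d'].
  assert (x := fu_fr H d); assert (i := fu_iso H d d').
  assert (y := fc_fr H x1 x).
  split; [eapply (cell_eq y) | eapply (cell_eq x1)]; eauto.
  + rewrite (act_comp _ _ y), (fi_run' H x1), (fi_run H x1), (act_id y); auto.
  + rewrite (act_comp _ _ x1), (fi_run H x1), (fi_run' H x1), (act_id x1); auto.
- destruct (good_fr H f (good_id H X)) as (a1 & π1 & G1 & x1 & I1).
  destruct (good_fr H g G1) as (a2 & π2 & G2 & x2 & I2).
  destruct (good_fr H h G2) as (a3 & π3 & G3 & x3 & I3).
  destruct (good_fr H k G3) as (a4 & π4 & G4 & x4 & I4).
  assert (y := fc_fr H x1 (fc_fr H x2 (fc_fr H x3 x4))).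
  eapply cell_eq; [ exact y | eauto 8 | ].
  rewrite !(act_comp _ _ y), (fc_hc2 H _ _ x1 (fc_fr H x2 (fc_fr H x3 x4))).
  rewrite (act_id x1), (fi_assoc H x2 x3 x4).
  rewrite (act_comp _ _ (fc_fr H x1 (fc_fr H (fc_fr H x2 x3) x4))).
  rewrite (fi_assoc H x1 (fc_fr H x2 x3) x4), (fc_hc2 H _ _ (fc_fr H x1 (fc_fr H x2 x3)) x4).
  rewrite (act_id x4), (fi_assoc H x1 x2 x3).
  rewrite (fi_assoc H x1 x2 (fc_fr H x3 x4)).
  rewrite (fi_assoc H (fc_fr H x1 x2) x3 x4); auto.
- destruct (good_fr H f (good_id H X)) as (a1 & π1 & G1 & x1 & I1).
  destruct (good_fr H g G1) as (a2 & π2 & G2 & x2 & I2).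
  destruct (good_dom H G1) as [d d'].
  eapply cell_eq; [ apply (fc_fr H x1 x2) | eauto | ].
  rewrite (act_comp _ _ (fc_fr H x1 x2)), !(fc_hc2 H _ _ x1 x2).
  rewrite (act_id x1), (act_id x2), (fi_lun H x2), (fi_run H x1).
  apply (fi_assoc H x1 (fu_fr H d) x2).
Qed.

(** ** Frames of paths *)

(** The nesting copies [peval_from], so that a list of squares along a path becomes a frame of its
    evaluation. Lists of the wrong length give a junk square; [okf] excludes them. *)
Fixpoint evf {Y Z : B} (p : path Y Z) : forall X, hom X Y -> dsq D -> list (dsq D) -> dsq D :=
  match p with
  | pnil => fun X f π l => π
  | pcons g p' => fun X f π l =>
      match l with
      | [] => π
      | π' :: l' => fc f (peval_from p' g) π (evf p' g π' l')
      end
  end.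

(** The final vertical cell [b] is an argument because the empty path is framed by [fu X b] and has
    no square from which [b] could be read. *)
Definition ev {X Y : B} (p : path X Y) (l : list (dsq D)) (b : dv D) : dsq D :=
  match p with
  | @pnil _ X => fu X b
  | @pcons _ X _ _ f p' => match l with [] => fu X b | π :: l' => evf p' f π l' end
  end.

Fixpoint okf {X Y : B} (p : path X Y) (l : list (dsq D)) (a b : dv D) : Prop :=
  match p with
  | @pnil _ X => l = [] /\ a = b /\ vdom a = fo X
  | pcons f p' =>
      match l with [] => False | π :: l' => exists m, fr f a m π /\ okf p' l' m b end
  end.

Lemma evf_fr (Y Z : B) (p : path Y Z) : forall (X : B) (f : hom X Y) π l a m b,
  fr f a m π -> okf p l m b -> fr (peval_from p f) a b (evf p f π l).
Proof.
induction p as [A0|Y' W0 Z g p IH]; cbn; intros X f π l a m b h o.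
- destruct o as (_ & <- & _); auto.
- destruct l as [|π' l]; [tauto|]; destruct o as (m' & h' & o).
  eapply (fc_fr H); eauto.
Qed.
Lemma ev_fr (X Y : B) (p : path X Y) l a b : okf p l a b -> fr (peval p) a b (ev p l b).
Proof.
destruct p as [|X0 W Z g p]; cbn; intros o.
- destruct o as (_ & -> & h); apply (fu_fr H h).
- destruct l as [|π' l]; [tauto|]; destruct o as (m' & h' & o); eapply evf_fr; eauto.
Qed.
Lemma okf_app (X Y Z : B) (p : path X Y) (q : path Y Z) l l' a m b :
  okf p l a m -> okf q l' m b -> okf (papp p q) (l ++ l') a b.
Proof.
revert l a; induction p as [A0|X0 W Y0 g p IH]; cbn; intros l a o o'.
- destruct o as (-> & -> & _); auto.
- destruct l as [|π l]; [tauto|]; cbn; destruct o as (n & h & o); eauto.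
Qed.
Lemma okf_left (X Y : B) (p : path X Y) l a b : okf p l a b -> vdom a = fo X.
Proof. intros o; apply (fr_left (ev_fr o)). Qed.
Lemma okf_right (X Y : B) (p : path X Y) l a b : okf p l a b -> vdom b = fo Y.
Proof. intros o; apply (fr_dom (ev_fr o)). Qed.

(** Splitting acts only by rebracketing: by induction on the first path, each associator in
    [psplit_from] moves one square across the bracket, and for an empty second path the unitor
    removes an identity frame. *)
Lemma split_from (Y Z W : B) (p : path Y Z) (q : path Z W) : forall (X : B) (f : hom X Y) π l l' a n m b,
  fr f a n π -> okf p l n m -> okf q l' m b ->
  cs (psplit_from p q f) ÷ fc (peval_from p f) (peval q) (evf p f π l) (ev q l' b)
  = evf (papp p q) f π (l ++ l').
Proof.
revert W q; induction p as [A0|Y' Z' Z g p IH]; intros W q X f π l l' a n m b h o o'; cbn in o |- *.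
- destruct o as (-> & -> & _); destruct q as [|Z' V W g q]; cbn in o' |- *.
  + destruct o' as (-> & -> & _); apply (fi_run' H h).
  + destruct l' as [|π' l']; [tauto|]; destruct o' as (m' & h' & o'); cbn.
    eapply act_id, (fc_fr H); eauto. eapply evf_fr; eauto.
- destruct l as [|π' l]; [tauto|]; destruct o as (m' & h' & o); cbn.
  assert (k := evf_fr h' o); assert (k' := ev_fr o').
  erewrite act_comp by (apply (fc_fr H (fc_fr H h k) k')).
  rewrite (fi_assoc' H h k k'), (fc_hc2 H _ _ h (fc_fr H k k')), (act_id h).
  erewrite IH; eauto.
Qed.
Lemma join_from (Y Z W : B) (p : path Y Z) (q : path Z W) : forall (X : B) (f : hom X Y) π l l' a n m b,
  fr f a n π -> okf p l n m -> okf q l' m b ->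
  cs (pjoin_from p q f) ÷ evf (papp p q) f π (l ++ l')
  = fc (peval_from p f) (peval q) (evf p f π l) (ev q l' b).
Proof.
revert W q; induction p as [A0|Y' Z' Z g p IH]; intros W q X f π l l' a n m b h o o'; cbn in o |- *.
- destruct o as (-> & -> & _); destruct q as [|Z' V W g q]; cbn in o' |- *.
  + destruct o' as (-> & -> & _); apply (fi_run H h).
  + destruct l' as [|π' l']; [tauto|]; destruct o' as (m' & h' & o'); cbn.
    eapply act_id, (fc_fr H); eauto. eapply evf_fr; eauto.
- destruct l as [|π' l]; [tauto|]; destruct o as (m' & h' & o); cbn.
  assert (k := evf_fr h' o); assert (k' := ev_fr o').
  assert (k2 := evf_fr h' (okf_app o o')).
  rewrite (act_comp _ _ (fc_fr H h k2)).
  rewrite (fc_hc2 H _ _ h k2), (act_id h).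
  erewrite IH, (fi_assoc H); eauto.
Qed.
Lemma split_ev (X Y Z : B) (p : path X Y) (q : path Y Z) l l' a m b :
  okf p l a m -> okf q l' m b ->
  cs (psplit p q) ÷ fc (peval p) (peval q) (ev p l m) (ev q l' b) = ev (papp p q) (l ++ l') b.
Proof.
destruct p as [|X0 Y' Y f p]; cbn; intros o o'.
- destruct o as (-> & -> & _); apply (fi_lun' H (ev_fr o')).
- destruct l as [|π' l]; [tauto|]; destruct o as (m' & h' & o); eapply split_from; eauto.
Qed.
Lemma join_ev (X Y Z : B) (p : path X Y) (q : path Y Z) l l' a m b :
  okf p l a m -> okf q l' m b ->
  cs (pjoin p q) ÷ ev (papp p q) (l ++ l') b = fc (peval p) (peval q) (ev p l m) (ev q l' b).
Proof.
destruct p as [|X0 Y' Y f p]; cbn; intros o o'.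
- destruct o as (-> & -> & _); apply (fi_lun H (ev_fr o')).
- destruct l as [|π' l]; [tauto|]; destruct o as (m' & h' & o); eapply join_from; eauto.
Qed.

(** Whiskering is invisible to frames: [p ◁ c ▷ r] replaces only the squares along the segment of
    [c]. The evaluation of every pasting rests on this locality and on its variant
    [act_ctx_post]. *)
Lemma act_ctx (X Y Z W : B) (p : path X Y) (q q' : path Y Z) (r : path Z W) (c : pcell q q')
    l k k' t a m n b :
  okf p l a m -> okf q k m n -> okf q' k' m n -> okf r t n b ->
  cs c ÷ ev q' k' n = ev q k n ->
  cs (p ◁ c ▷ r) ÷ ev (papp p (papp q' r)) (l ++ (k' ++ t)) b
  = ev (papp p (papp q r)) (l ++ (k ++ t)) b.
Proof.
intros o1 o2 o3 o4 E; unfold pctx.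
assert (h1 := ev_fr o1); assert (h2 := ev_fr o2); assert (h3 := ev_fr o3); assert (h4 := ev_fr o4).
assert (h5 := ev_fr (okf_app o3 o4)).
rewrite (act_comp _ _ (ev_fr (okf_app o1 (okf_app o3 o4)))).
rewrite (join_ev o1 (okf_app o3 o4)).
rewrite (act_comp _ _ (fc_fr H h1 h5)), (fc_hc2 H _ _ h1 h5), (act_id h1).
rewrite (act_comp _ _ h5), (join_ev o3 o4), (act_comp _ _ (fc_fr H h3 h4)), (fc_hc2 H _ _ h3 h4), (act_id h4), E.
rewrite (split_ev o2 o4), (split_ev o1 (okf_app o2 o4)); auto.
Qed.

(** ** Cells determined by frames *)

(** The cell is [π] followed by the inverse of [π']; it is globular since the two frames have the
    same sides. *)
Lemma ex_cell (X Y : B) (f g : hom X Y) a b π π' : fr f a b π -> fr g a b π' ->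
  bot π = bot π' -> visoS π' -> exists c : cell f g, cs c ÷ π' = π.
Proof.
intros e e' E (t & w1 & w2 & w3 & w4).
destruct (visoS_sides w1 w2 w3 w4) as [[l1 _] [r1 _]].
destruct (bot_lr (eq_sym w1)) as [b1 b2].
destruct (cs_full H (f:=f) (g:=g) (s := π ÷ t)) as (c & Ec).
- rewrite top_vcomp by congruence; apply e.
- rewrite bot_vcomp by congruence; rewrite w2; apply e'.
- rewrite lft_vcomp, (fr_lft e), <- (fr_lft e'), l1, (fr_lft e'), (fr_left e') by congruence; auto.
- rewrite rgt_vcomp, (fr_rgt e), <- (fr_rgt e'), r1, (fr_rgt e') by congruence.
  rewrite (fh_cod H f (fr_dom e)); auto.
- exists c; rewrite Ec, vA, w4 by congruence; apply vr; congruence.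
Qed.

Lemma ex_iso (X Y : B) (p q : path X Y) a b π π' : fr (peval p) a b π -> fr (peval q) a b π' ->
  bot π = bot π' -> visoS π -> visoS π' ->
  exists i : iso2 p q, is_iso2 i /\ cs (fwd i) ÷ π' = π.
Proof.
intros e e' E I I'.
destruct (ex_cell e e' E I') as (c & Ec).
destruct (ex_cell e' e (eq_sym E) I) as (d & Ed).
exists {| fwd := (c : pcell p q); bwd := (d : pcell q p) |}; split; auto; split; cbn.
- apply (cell_eq e I). rewrite (act_comp _ _ e), Ed, Ec, (act_id e); auto.
- apply (cell_eq e' I'). rewrite (act_comp _ _ e'), Ec, Ed, (act_id e'); auto.
Qed.

Lemma act_inv (X Y : B) (f g : hom X Y) (c : cell f g) (d : cell g f) a b π π' :
  fr g a b π' -> d ⊙ c = id2 g -> cs c ÷ π' = π -> cs d ÷ π = π'.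
Proof. intros h E <-; rewrite <- (act_comp _ _ h), E; apply (act_id h). Qed.

(** An arbitrary frame is an invertible one continued by the square [π0^-1 / π]. An equation stable
    under continuation therefore has to be checked on one invertible frame only; this is how cells
    constructed from a single frame get their action on all frames. *)
Lemma fr_factor (X Y : B) (f : hom X Y) a b π a0 b0 π0 : fr f a b π -> fr f a0 b0 π0 ->
  visoS π0 -> viso b0 -> exists s v w, π = π0 ÷ s /\ top s = bot π0 /\ lft s = v /\ rgt s = w /\
    a0 ∙ v = a /\ b0 ∙ w = b.
Proof.
intros e e0 I (b' & w1 & w2 & w3 & w4).
destruct I as (t & t1 & t2 & t3 & t4).
assert (E : bot t = top π) by (rewrite t2, (fr_top e0), (fr_top e); auto).
exists (t ÷ π), (lft (t ÷ π)), (b' ∙ b).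
assert (E1 : top (t ÷ π) = bot π0) by (rewrite top_vcomp; auto).
assert (E2 : π0 ÷ (t ÷ π) = π).
{ rewrite <- vA, t3 by congruence; apply v1; congruence. }
assert (d := fr_dom e); assert (d0 := fr_dom e0).
assert (E3 : b0 ∙ (b' ∙ b) = b).
{ rewrite <- uA, w3 by congruence; apply u1; congruence. }
repeat split; auto.
- destruct (fr_hbot e0) as [_ F].
  (* The right side of the quotient is found by cancelling [fw Y b0], which is invertible together
     with [b0]. *)
  apply (viso_inj (u := fw Y b0)).
  + apply (fw_iso H); auto. exists b'; auto.
  + rewrite <- cod_top, E1, F, (fw_cod H d0); auto.
  + rewrite (fw_cod H d0), vdom_comp by congruence; auto.
  + rewrite (@fw_comp _ _ _ H Y b0 (b' ∙ b)), E3 by (rewrite ?vdom_comp; congruence).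
    rewrite <- (fr_rgt e), <- (fr_rgt e0), <- rgt_vcomp, E2; auto.
- rewrite <- (fr_lft e0), <- lft_vcomp, E2 by auto; apply e.
Qed.

End Framed.

Section Framed2.
Context {B : bicat} {D : double_category} {φ : framing B D} (H : is_framing φ).
Local Notation fo := (fo φ).
Local Notation cs := (cs φ).
Local Notation fc := (fc φ).
Local Notation fu := (fu φ).
Local Notation fr := (fr φ).
Local Notation ev := (ev (φ := φ)).
Local Notation okf := (okf (φ := φ)).

Lemma act_post (X Y : B) (f g : hom X Y) (c : cell f g) a b π s : fr g a b π -> top s = bot π ->
  cs c ÷ (π ÷ s) = cs c ÷ π ÷ s.
Proof. intros h e; symmetry; apply vA; auto. apply (act_top H _ h). Qed.

Lemma post_id (X Y : B) (f : hom X Y) a b π : fr f a b π -> π ÷ vidS (bot π) = π.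
Proof. intros h; apply vr; auto. Qed.

Lemma act2c (X Y : B) (f g h : hom X Y) (c : cell f g) (d : cell g h) a b π1 π2 π3 :
  fr h a b π3 -> cs d ÷ π3 = π2 -> cs c ÷ π2 = π1 -> cs (c ⊙ d) ÷ π3 = π1.
Proof. intros e <- <-; apply (act_comp H _ _ e). Qed.

(** A compositor does not carry frames to frames on the nose: it leaves a globular square [s] below
    them. Whiskering surrounds that square by identities. *)
Lemma act_ctx_post (X Y Z W : B) (p : path X Y) (q q' : path Y Z) (r : path Z W) (c : pcell q q')
    l k k' t a m n b s :
  okf p l a m -> okf q k m n -> okf q' k' m n -> okf r t n b ->
  top s = bot (ev q k n) ->
  lft s = vid (vcod m) -> rgt s = vid (vcod n) ->
  cs c ÷ ev q' k' n = ev q k n ÷ s ->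
  cs (p ◁ c ▷ r) ÷ ev (papp p (papp q' r)) (l ++ (k' ++ t)) b
  = ev (papp p (papp q r)) (l ++ (k ++ t)) b
      ÷ (vidS (bot (ev p l m)) ∥ (s ∥ vidS (bot (ev r t b)))).
Proof.
intros o1 o2 o3 o4 Es El Er' E; unfold pctx.
assert (h1 := ev_fr H o1); assert (h2 := ev_fr H o2); assert (h3 := ev_fr H o3);
assert (h4 := ev_fr H o4).
assert (h5 := ev_fr H (okf_app o3 o4)); assert (h6 := ev_fr H (okf_app o2 o4)).
assert (h7 := ev_fr H (okf_app o1 (okf_app o2 o4))).
rewrite (act_comp H _ _ (ev_fr H (okf_app o1 (okf_app o3 o4)))).
rewrite (join_ev H o1 (okf_app o3 o4)).
rewrite (act_comp H _ _ (fc_fr H h1 h5)), (fc_hc2 H _ _ h1 h5), (act_id H h1).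
rewrite (act_comp H _ _ h5), (join_ev H o3 o4), (act_comp H _ _ (fc_fr H h3 h4)),
  (fc_hc2 H _ _ h3 h4), (act_id H h4), E.
destruct (fr_hbot H h1), (fr_hbot H h2), (fr_hbot H h4).
rewrite <- (post_id h4) at 1.
rewrite (fc_post H h2 h4) by (rewrite ?top_vid, ?lft_vid; congruence).
assert (T : top (s ∥ vidS (bot (ev r t b))) = bot (fc (peval q) (peval r) (ev q k n) (ev r t b))).
{ rewrite top_hcomp, top_vid, (fc_bot H h2 h4) by (rewrite lft_vid; congruence); congruence. }
rewrite (act_post _ (fc_fr H h2 h4) T).
rewrite (split_ev H o2 o4).
assert (T' : bot (ev (papp q r) (k ++ t) b) = top (s ∥ vidS (bot (ev r t b)))).
{ rewrite T, <- (split_ev H o2 o4). apply (act_bot H _ (fc_fr H h2 h4)). }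
rewrite <- (post_id h1) at 1.
rewrite (fc_post H h1 h6) by (rewrite ?top_vid, ?rgt_vid, ?lft_hcomp by (rewrite ?lft_vid; congruence); congruence).
rewrite (act_post _ (fc_fr H h1 h6)).
- rewrite (split_ev H o1 (okf_app o2 o4)); auto.
- rewrite top_hcomp, top_vid, (fc_bot H h1 h6), T'; auto.
  rewrite rgt_vid, lft_hcomp; rewrite ?lft_vid; congruence.
Qed.

Lemma act_ctx_l (Y Z W : B) (q q' : path Y Z) (r : path Z W) (c : pcell q q')
    k k' t m n b s :
  okf q k m n -> okf q' k' m n -> okf r t n b ->
  top s = bot (ev q k n) -> lft s = vid (vcod m) -> rgt s = vid (vcod n) ->
  cs c ÷ ev q' k' n = ev q k n ÷ s ->
  cs (⟪⟫ ◁ c ▷ r) ÷ ev (papp q' r) (k' ++ t) b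
  = ev (papp q r) (k ++ t) b ÷ (s ∥ vidS (bot (ev r t b))).
Proof.
intros o2 o3 o4 Es El Er E.
assert (o1 : okf ⟪⟫ [] m m) by (repeat split; apply (okf_left H o2)).
refine (eq_trans (act_ctx_post o1 o2 o3 o4 Es El Er E) _); cbn.
rewrite (fu_bot H) by apply (okf_left H o2).
rewrite <- hidS_id, h1; auto.
rewrite lft_hcomp; auto. rewrite Er, lft_vid.
rewrite (proj1 (fr_hbot H (ev_fr H o4))); auto.
Qed.

Lemma act_ctx_r (X Y Z : B) (p : path X Y) (q q' : path Y Z) (c : pcell q q')
    l k k' a m n s :
  okf p l a m -> okf q k m n -> okf q' k' m n ->
  top s = bot (ev q k n) -> lft s = vid (vcod m) -> rgt s = vid (vcod n) ->
  cs c ÷ ev q' k' n = ev q k n ÷ s ->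
  cs (p ◁ c ▷ ⟪⟫) ÷ ev (papp p (papp q' ⟪⟫)) (l ++ (k' ++ [])) n
  = ev (papp p (papp q ⟪⟫)) (l ++ (k ++ [])) n ÷ (vidS (bot (ev p l m)) ∥ s).
Proof.
intros o1 o2 o3 Es El Er E.
assert (o4 : okf ⟪⟫ [] n n) by (repeat split; apply (okf_right H o2)).
refine (eq_trans (act_ctx_post o1 o2 o3 o4 Es El Er E) _); cbn.
rewrite (fu_bot H) by apply (okf_right H o2).
rewrite <- hidS_id, hr; auto.
Qed.

(** ** Companions *)

(** A frame with trivial bottom and right side, like [ε] of a companion. *)
Record cf {X Y : B} (s : hom X Y) (e : dsq D) : Prop := {
  cf_fr : fr s (lft e) (vid (fo Y)) e;
  cf_bot : bot e = hid (fo Y);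
  cf_iso : visoS e }.

Lemma cf_cod (X Y : B) (s : hom X Y) e : cf s e -> vcod (lft e) = fo Y.
Proof. intros h; rewrite <- dom_bot, (cf_bot h); apply hdom_id. Qed.
Lemma cf_dom (X Y : B) (s : hom X Y) e : cf s e -> vdom (lft e) = fo X.
Proof. intros h; apply (fr_left H (cf_fr h)). Qed.
Lemma cf_post (X Y : B) (s : hom X Y) e a : cf s e -> vdom a = fo Y ->
  fr s (lft e ∙ a) a (e ÷ hidS a).
Proof.
intros h E.
assert (P := fr_post H (s := hidS a) (cf_fr h)).
rewrite top_hid, lft_hid, rgt_hid, u1 in P by auto; apply P.
rewrite E, (cf_bot h); auto.
Qed.
Lemma cf_post_bot (X Y : B) (s : hom X Y) e a : cf s e -> vdom a = fo Y ->
  bot (e ÷ hidS a) = hid (vcod a).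
Proof. intros h E; rewrite bot_vcomp, bot_hid; auto. rewrite top_hid, E, (cf_bot h); auto. Qed.
Lemma cf_post_iso (X Y : B) (s : hom X Y) e a : cf s e -> vdom a = fo Y -> viso a ->
  visoS (e ÷ hidS a).
Proof.
intros h E I; apply visoS_comp.
- rewrite top_hid, E, (cf_bot h); auto.
- apply h.
- apply visoS_hid, I.
Qed.
Lemma cf_post_id (X Y : B) (s : hom X Y) e : cf s e -> e ÷ hidS (vid (fo Y)) = e.
Proof. intros h; rewrite hidS_id; apply vr, h. Qed.
Lemma cf_post2 (X Y : B) (s : hom X Y) e a b : cf s e -> vdom a = fo Y -> vcod a = vdom b ->
  e ÷ hidS a ÷ hidS b = e ÷ hidS (a ∙ b).
Proof.
intros h E E'; rewrite hidS_v, vA; auto; rewrite ?top_hid, ?bot_hid, ?E, ?E', ?(cf_bot h); auto.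
Qed.

Lemma cf_id (X : B) : cf (id1 X) (fu X (vid (fo X))).
Proof.
assert (h := fu_fr H (vdom_id (fo X))).
split.
- rewrite (fr_lft h); auto.
- rewrite (fu_bot H) by apply vdom_id; rewrite vcod_id; auto.
- apply (fu_iso H); [apply vdom_id | apply viso_id].
Qed.

Lemma fc_cf (X Y Z : B) (f : hom X Y) (g : hom Y Z) e e' : cf f e -> cf g e' ->
  cf (comp1 f g) (fc f g (e ÷ hidS (lft e')) e').
Proof.
intros h h'.
assert (k := cf_post h (cf_dom h')); assert (k' := cf_fr h').
assert (K := fc_fr H k k').
split.
- rewrite (fr_lft K); auto.
- rewrite (fc_bot H k k'), (cf_post_bot h (cf_dom h')), (cf_bot h'), (cf_cod h').
  apply hunitl, hdom_id.
- apply (fc_iso H k k'); [apply (cf_post_iso h (cf_dom h')) | apply h'].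
  apply visoS_lft, h'.
Qed.

Lemma fc_cf_post (X Y Z : B) (f : hom X Y) (g : hom Y Z) e e' a : cf f e -> cf g e' ->
  vdom a = fo Z -> fc f g (e ÷ hidS (lft e')) e' ÷ hidS a
  = fc f g (e ÷ hidS (lft e' ∙ a)) (e' ÷ hidS a).
Proof.
intros h h' E.
assert (k := cf_post h (cf_dom h')); assert (k' := cf_fr h').
assert (c := cf_cod h').
rewrite <- (cf_post2 h) by (rewrite ?(cf_dom h'); congruence).
rewrite (fc_post H k k'); rewrite ?top_hid, ?lft_hid, ?rgt_hid, ?E, ?(cf_bot h'); auto.
- rewrite h1; auto. apply lft_hid.
- rewrite (cf_post_bot h (cf_dom h')), c; auto.
Qed.

End Framed2.

(** * Framed pseudofunctors *)

Section FramedMaps.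
Context {B C : bicat} {D E : double_category} (φ : framing B D) (ψ : framing C E).

(** [Fr] transports frames along [F] and lies over the pseudodouble functor [Fh], which maps their
    sides and bottoms. By [fm_post] and [fr_factor] it is governed by its values on invertible
    frames. *)
Record fmap {F0 : B -> C} (F : map1 F0) (Fh : pdfun D E)
    (Fr : forall X Y : B, hom X Y -> dsq D -> dsq E) : Prop := {
  fm_o : forall X, fo ψ (F0 X) = Fh (fo φ X);
  fm_fr : forall (X Y : B) (f : hom X Y) a b π, fr φ f a b π ->
    fr ψ (F _ _ f) (FV Fh a) (FV Fh b) (Fr X Y f π);
  fm_bot : forall (X Y : B) (f : hom X Y) a b π, fr φ f a b π ->
    bot (Fr X Y f π) = FH Fh (bot π);
  fm_post : forall (X Y : B) (f : hom X Y) a b π s, fr φ f a b π -> top s = bot π ->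
    Fr X Y f (π ÷ s) = Fr X Y f π ÷ FS Fh s;
  fm_iso : forall (X Y : B) (f : hom X Y) a b π, fr φ f a b π -> visoS π ->
    visoS (Fr X Y f π) }.

(** The compositor and the unitor of [F] act as those of [Fh] placed below the frame; the coherence
    of [F] is thereby reduced to that of [Fh]. *)
Record ffun {F0 : B -> C} (F : psfun F0) (Fh : pdfun D E)
    (Fr : forall X Y : B, hom X Y -> dsq D -> dsq E) : Prop := {
  ff_map : fmap F Fh Fr;
  ff_ax : is_pdfun Fh;
  ff_cell : forall (X Y : B) (f g : hom X Y) (c : cell f g) a b π, fr φ g a b π ->
    cs ψ (f2 F c) ÷ Fr X Y g π = Fr X Y f (cs φ c ÷ π);
  ff_comp : forall (X Y Z : B) (f : hom X Y) (g : hom Y Z) a b c π π',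
    fr φ f a b π -> fr φ g b c π' ->
    cs ψ (fwd (fcomp F f g)) ÷ Fr X Z (comp1 f g) (fc φ f g π π')
    = fc ψ (F # f) (F # g) (Fr X Y f π) (Fr Y Z g π') ÷ F2c Fh (bot π) (bot π');
  ff_unit : forall (X : B) a, vdom a = fo φ X ->
    cs ψ (fwd (funit F X)) ÷ Fr X X (id1 X) (fu φ X a)
    = fu ψ (F0 X) (FV Fh a) ÷ F2u Fh (vcod a);
  ff_ciso : forall (X Y Z : B) (f : hom X Y) (g : hom Y Z), is_iso2 (fcomp F f g);
  ff_uiso : forall X : B, is_iso2 (funit F X) }.

(** [av] and [ah] are the components of a strict vertical transformation, and [e X] is a companion
    frame of [s X]. By [fn_eq] the naturality cell turns the frame that begins with the companion
    into the one that ends with it, at the price of [ah] below the frame of [F f]. The actions on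
    vertical cells and 1h-cells are plain functions, so that tensors, images and composites of
    transformations need no names for the pseudodouble functors between which they run. *)
Record fnat {F0 G0 : B -> C} (F : map1 F0) (G : map1 G0) (fv gv : dv D -> dv E) (fk gk : dh D -> dh E)
    (Fr Gr : forall X Y : B, hom X Y -> dsq D -> dsq E)
    {s : forall X, hom (F0 X) (G0 X)} (n : psnat F G s)
    (av : dob D -> dv E) (ah : dh D -> dsq E) (e : B -> dsq E) : Prop := {
  fn_F : forall (X Y : B) (f : hom X Y) a b π, fr φ f a b π ->
    fr ψ (F _ _ f) (fv a) (fv b) (Fr X Y f π) /\ bot (Fr X Y f π) = fk (bot π);
  fn_G : forall (X Y : B) (f : hom X Y) a b π, fr φ f a b π ->
    fr ψ (G _ _ f) (gv a) (gv b) (Gr X Y f π) /\ bot (Gr X Y f π) = gk (bot π);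
  fn_Giso : forall (X Y : B) (f : hom X Y) a b π, fr φ f a b π -> visoS π -> visoS (Gr X Y f π);
  fn_Fiso : forall (X Y : B) (f : hom X Y) a b π, fr φ f a b π -> visoS π -> visoS (Fr X Y f π);
  fn_aiso : forall k, visoS (ah k);
  fn_gv : forall a, viso a -> viso (gv a);
  fn_cf : forall X : B, cf (φ := ψ) (s X) (e X);
  fn_lft : forall X : B, lft (e X) = av (fo φ X);
  fn_atop : forall k, top (ah k) = fk k;
  fn_abot : forall k, bot (ah k) = gk k;
  fn_alft : forall k, lft (ah k) = av (hdom k);
  fn_argt : forall k, rgt (ah k) = av (hcod k);
  fn_fcod : forall v, vcod (fv v) = vdom (av (vcod v));
  fn_gdom' : forall v, vdom (gv v) = vcod (av (vdom v));
  fn_nat : forall v, fv v ∙ av (vcod v) = av (vdom v) ∙ gv v;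
  fn_iso : forall (X Y : B) (f : hom X Y), is_iso2 (n X Y f);
  fn_eq : forall (X Y : B) (f : hom X Y) a b π, fr φ f a b π ->
    cs ψ (fwd (n X Y f)) ÷ fc ψ (s X) (G _ _ f) (e X ÷ hidS (gv a)) (Gr X Y f π)
    = fc ψ (F _ _ f) (s Y) (Fr X Y f π ÷ ah (bot π)) (e Y ÷ hidS (gv b)) }.

Record vnat (Fh Gh : pdfun D E) (av : dob D -> dv E) (ah : dh D -> dsq E) : Prop := {
  vn_comp : forall f g, hcod f = hdom g ->
    F2c Fh f g ÷ ah (hcomp f g) = (ah f ∥ ah g) ÷ F2c Gh f g;
  vn_unit : forall A, F2u Fh A ÷ ah (hid A) = hidS (av A) ÷ F2u Gh A }.

End FramedMaps.

(* Pastings are evaluated from the target: the last 2-cell acts first, on the frame of the target,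
   and the remaining pasting acts on the result. *)
Tactic Notation "stp" constr(K) uconstr(y) uconstr(e) :=
  eapply (act2c K); [ refine y | refine e | ].

(** * Coherence of framed pseudofunctors *)

Section Theory.
Context {B C : bicat} {D E : double_category} {φ : framing B D} {ψ : framing C E}.
Context (H : is_framing φ) (K : is_framing ψ).

Section Psfun.
Context {F0 : B -> C} {F : psfun F0} {Fh : pdfun D E}
  {Fr : forall X Y : B, hom X Y -> dsq D -> dsq E} (P : ffun φ ψ F Fh Fr).

(** Every axiom is evaluated on the image of an invertible frame. There compositors and unitors
    become [F2c] and [F2u] below the frame, and the two sides are matched by the corresponding axiom
    of [Fh]. *)
Lemma framed_psfun : is_psfun F.
Proof.
assert (M := ff_map P); assert (Q := ff_ax P).
split; intros.
- destruct (good_frame H f) as (b & π & h & I).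
  apply (cell_eq K (fm_fr M h) (fm_iso M h I)).
  rewrite (ff_cell P _ h), (act_id H h), (act_id K (fm_fr M h)); auto.
- destruct (good_frame H h) as (b & π & e & I).
  apply (cell_eq K (fm_fr M e) (fm_iso M e I)).
  rewrite (act_comp K _ _ (fm_fr M e)), !(ff_cell P _ e), (act_comp H _ _ e).
  rewrite (ff_cell P _ (fr_act H _ e)); auto.
- apply (ff_ciso P).
- apply (ff_uiso P).
- destruct (good_fr H f' (good_id H X)) as (a1 & π1 & G1 & x1 & I1).
  destruct (good_fr H g' G1) as (a2 & π2 & G2 & x2 & I2).
  assert (y1 := fm_fr M x1); assert (y2 := fm_fr M x2).
  assert (x := fc_fr H x1 x2); assert (y := fm_fr M x).
  apply (cell_eq K y (fm_iso M x (fc_iso H x1 x2 I1 I2))).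
  assert (z := fc_fr K y1 y2).
  destruct (fr_hbot H x1), (fr_hbot H x2).
  transitivity (fc ψ (F # f) (F # g) (Fr f (cs φ c ÷ π1)) (Fr g (cs φ d ÷ π2)) ÷ F2c Fh (bot π1) (bot π2)).
  + refine (act2c K y (ff_comp P x1 x2) _).
    rewrite (act_post K _ z).
    * f_equal; rewrite <- (ff_cell P _ x1), <- (ff_cell P _ x2); apply (fc_hc2 K _ _ y1 y2).
    * rewrite (fc_bot K y1 y2), (fm_bot M x1), (fm_bot M x2), F2c_top; congruence.
  + symmetry; refine (act2c K y (ff_cell P _ x) _).
    rewrite (fc_hc2 H _ _ x1 x2), <- (act_bot H c x1), <- (act_bot H d x2).
    apply (ff_comp P (fr_act H c x1) (fr_act H d x2)).
- destruct (good_fr H f (good_id H X)) as (a1 & π1 & G1 & x1 & I1).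
  destruct (good_fr H g G1) as (a2 & π2 & G2 & x2 & I2).
  destruct (good_fr H h G2) as (a3 & π3 & G3 & x3 & I3).
  assert (y1 := fm_fr M x1); assert (y2 := fm_fr M x2); assert (y3 := fm_fr M x3).
  assert (x23 := fc_fr H x2 x3); assert (x12 := fc_fr H x1 x2).
  assert (x := fc_fr H x1 x23); assert (y := fm_fr M x).
  assert (y12 := fm_fr M x12); assert (y23 := fm_fr M x23).
  destruct (fr_hbot H x1) as [d1 c1], (fr_hbot H x2) as [d2 c2], (fr_hbot H x3) as [d3 c3]. rewrite ?vcod_id in d1.
  assert (b1 := fm_bot M x1); assert (b2 := fm_bot M x2); assert (b3 := fm_bot M x3).
  assert (C12 : hcod (bot π1) = hdom (bot π2)) by congruence.
  assert (C23 : hcod (bot π2) = hdom (bot π3)) by congruence.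
  assert (B12 : bot (fc ψ (F # f) (F # g) (Fr f π1) (Fr g π2)) = hcomp (FH Fh (bot π1)) (FH Fh (bot π2)))
    by (rewrite (fc_bot K y1 y2); congruence).
  assert (B23 : bot (fc ψ (F # g) (F # h) (Fr g π2) (Fr h π3)) = hcomp (FH Fh (bot π2)) (FH Fh (bot π3)))
    by (rewrite (fc_bot K y2 y3); congruence).
  assert (z23 := fc_fr K y2 y3); assert (z12 := fc_fr K y1 y2).
  assert (z := fc_fr K y1 z23).
  assert (O2 : okf (φ := ψ) ⟪F # f; F # g⟫ [Fr f π1; Fr g π2] (FV Fh (vid (fo φ X))) (FV Fh a2)).
  { eexists; split; [exact y1|]; eexists; split; [exact y2|]; repeat split; apply y2. }
  assert (O23 : okf (φ := ψ) ⟪F # g; F # h⟫ [Fr g π2; Fr h π3] (FV Fh a1) (FV Fh a3)).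
  { eexists; split; [exact y2|]; eexists; split; [exact y3|]; repeat split; apply y3. }
  assert (S : forall (X Y : C) (f : hom X Y) a b π, fr ψ f a b π -> okf (φ := ψ) ⟪f⟫ [π] a b).
  { intros; eexists; split; [eassumption|]; repeat split; eapply fr_dom; eassumption. }
  apply (cell_eq K y (fm_iso M x (fc_iso H x1 x23 I1 (fc_iso H x2 x3 I2 I3)))).
  (* The common value of both sides: the composite frame above two compositors, for which
     [F2c_assoc] allows either bracketing. *)
  transitivity (fc ψ (F # f) (comp1 (F # g) (F # h)) (Fr f π1) (fc ψ (F # g) (F # h) (Fr g π2) (Fr h π3))
    ÷ ((F2c Fh (bot π1) (bot π2) ∥ vidS (FH Fh (bot π3))) ÷ F2c Fh (hcomp (bot π1) (bot π2)) (bot π3)));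
    [ | rewrite (F2c_assoc Q C12 C23); symmetry ].
  + stp K y (ff_cell P _ x).
    rewrite (fi_assoc H x1 x2 x3).
    stp K (fm_fr M (fc_fr H x12 x3)) (ff_comp P x12 x3).
    rewrite (act_post K _ (fc_fr K y12 y3)), (fc_bot H x1 x2).
    * rewrite <- vA.
      -- f_equal; rewrite <- b3.
         refine (act_ctx_l K (q := ⟪F # f; F # g⟫) (q' := ⟪F # comp1 f g⟫) (r := ⟪F # h⟫)
          (k' := [_]) (k := [_; _]) (t := [_]) O2 (S _ _ _ _ _ _ y12) (S _ _ _ _ _ _ y3) _ _ _ (ff_comp P x1 x2));
         cbn; rewrite ?B12; gb.
      -- rewrite (fc_bot K y1 z23), B23, b1, top_hcomp; gb.
         symmetry; apply (hcompA (dc_ax E)); gb.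
      -- gb.
    * rewrite (fc_bot K y12 y3), (fm_bot M x12), (fc_bot H x1 x2), b3, F2c_top; gb.
  + stp K y (ff_comp P x1 x23).
    rewrite (act_post K _ (fc_fr K y1 y23)), (fc_bot H x2 x3).
    * rewrite <- vA.
      -- f_equal; rewrite <- b1.
         refine (act_ctx_r K (p := ⟪F # f⟫) (q := ⟪F # g; F # h⟫) (q' := ⟪F # comp1 g h⟫)
          (k' := [_]) (k := [_; _]) (l := [_]) (S _ _ _ _ _ _ y1) O23 (S _ _ _ _ _ _ y23) _ _ _ (ff_comp P x2 x3));
         cbn; rewrite ?B23; gb.
      -- rewrite (fc_bot K y1 z23), B23, b1, top_hcomp; gb.
      -- gb.
    * rewrite (fc_bot K y1 y23), (fm_bot M x23), (fc_bot H x2 x3), b1, F2c_top; gb.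
- destruct (good_fr H f (good_id H X)) as (a1 & π1 & G1 & x1 & I1).
  assert (y1 := fm_fr M x1).
  assert (b1 := fm_bot M x1).
  assert (d := vdom_id (fo φ X)).
  assert (xu := fu_fr H d); assert (yu := fm_fr M xu).
  assert (d' := fr_left K yu). assert (zu := fu_fr K d').
  destruct (fr_hbot H x1) as [d1 c1]. rewrite ?vcod_id in d1.
  apply (cell_eq K y1 (fm_iso M x1 I1)).
  refine (eq_trans _ (eq_sym (act_id K y1))).
  stp K y1 (ff_cell P _ x1); rewrite (fi_lun H x1).
  stp K (fm_fr M (fc_fr H xu x1)) (ff_comp P xu x1).
  rewrite (fu_bot H d), (act_post K _ (fc_fr K yu y1)).
  + transitivity (Fr f π1 ÷ ((F2u Fh (hdom (bot π1)) ∥ vidS (FH Fh (bot π1)))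
        ÷ F2c Fh (hid (hdom (bot π1))) (bot π1))).
    2:{ rewrite (F2c_unitl Q); rewrite <- b1; apply (post_id (φ := ψ) y1). }
    assert (U := ff_unit P d); rewrite vcod_id in U |- *.
    rewrite d1, <- vA.
    * f_equal; rewrite <- b1.
      refine (act_ctx_l K (q := ⟪⟫) (q' := ⟪F # id1 X⟫) (r := ⟪F # f⟫)
          (k' := [_]) (k := []) (t := [_]) _ _ _ _ _ _ U).
      -- repeat split; auto.
      -- eexists; split; [exact yu|]; repeat split; auto.
      -- eexists; split; [exact y1|]; repeat split; apply y1.
      -- cbn; rewrite (fu_bot K d'); gb.
      -- gb.
      -- gb.
    * rewrite b1; gb.
    * gb.
  + rewrite (fc_bot K yu y1), (fm_bot M xu), (fu_bot H d), b1, F2c_top; gb.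
- destruct (good_fr H f (good_id H X)) as (a1 & π1 & G1 & x1 & I1).
  assert (y1 := fm_fr M x1).
  assert (b1 := fm_bot M x1).
  assert (d := fr_dom x1).
  assert (xu := fu_fr H d); assert (yu := fm_fr M xu).
  assert (d' := fr_left K yu). assert (zu := fu_fr K d').
  destruct (fr_hbot H x1) as [d1 c1]. rewrite ?vcod_id in d1.
  apply (cell_eq K y1 (fm_iso M x1 I1)).
  refine (eq_trans _ (eq_sym (act_id K y1))).
  stp K y1 (ff_cell P _ x1); rewrite (fi_run H x1).
  stp K (fm_fr M (fc_fr H x1 xu)) (ff_comp P x1 xu).
  rewrite (fu_bot H d), (act_post K _ (fc_fr K y1 yu)).
  + transitivity (Fr f π1 ÷ ((vidS (FH Fh (bot π1)) ∥ F2u Fh (hcod (bot π1)))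
        ÷ F2c Fh (bot π1) (hid (hcod (bot π1))))).
    2:{ rewrite (F2c_unitr Q); rewrite <- b1; apply (post_id (φ := ψ) y1). }
    rewrite c1, <- vA.
    * f_equal; rewrite <- b1.
      refine (act_ctx_r K (p := ⟪F # f⟫) (q := ⟪⟫) (q' := ⟪F # id1 Y⟫)
          (k' := [_]) (k := []) (l := [_]) _ _ _ _ _ _ (ff_unit P d)).
      -- eexists; split; [exact y1|]; repeat split; apply y1.
      -- repeat split; auto.
      -- eexists; split; [exact yu|]; repeat split; auto.
      -- cbn; rewrite (fu_bot K d'); gb.
      -- gb.
      -- gb.
    * rewrite b1; gb.
    * gb.
  + rewrite (fc_bot K y1 yu), (fm_bot M xu), (fu_bot H d), b1, F2c_top; gb.
Qed.
End Psfun.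
End Theory.

Section Framed3.
Context {B : bicat} {D : double_category} {φ : framing B D} (H : is_framing φ).
Local Notation fo := (fo φ).
Local Notation cs := (cs φ).
Local Notation fr := (fr φ).
Local Notation ev := (ev (φ := φ)).
Local Notation okf := (okf (φ := φ)).

Lemma okf0 (X : B) a : vdom a = fo X -> okf (@pnil B X) [] a a.
Proof. repeat split; auto. Qed.
Lemma okf_cons (X Y Z : B) (f : hom X Y) (p : path Y Z) l a m b π :
  fr f a m π -> okf p l m b -> okf (pcons f p) (π :: l) a b.
Proof. intros; eexists; eauto. Qed.
Lemma okf1 (X Y : B) (f : hom X Y) a b π : fr f a b π -> okf ⟪f⟫ [π] a b.
Proof. intros h; eapply okf_cons; eauto. apply okf0, h. Qed.
Lemma okf2 (X Y Z : B) (f : hom X Y) (g : hom Y Z) a m b π π' :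
  fr f a m π -> fr g m b π' -> okf ⟪f; g⟫ [π; π'] a b.
Proof. intros; eapply okf_cons, okf1; eauto. Qed.
Lemma okf3 (X Y Z W : B) (f : hom X Y) (g : hom Y Z) (h : hom Z W) a m n b π π' π'' :
  fr f a m π -> fr g m n π' -> fr h n b π'' -> okf ⟪f; g; h⟫ [π; π'; π''] a b.
Proof. intros; eapply okf_cons, okf2; eauto. Qed.

Lemma actl (Y Z W : B) (q q' : path Y Z) (r : path Z W) (c : pcell q q') k k' t m n b :
  okf q k m n -> okf q' k' m n -> okf r t n b -> cs c ÷ ev q' k' n = ev q k n ->
  cs (⟪⟫ ◁ c ▷ r) ÷ ev (papp q' r) (k' ++ t) b = ev (papp q r) (k ++ t) b.
Proof.
intros o2 o3 o4 E; refine (act_ctx H (p := ⟪⟫) (l := []) _ o2 o3 o4 E).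
apply okf0, (okf_left H o2).
Qed.

Lemma actr (X Y Z : B) (p : path X Y) (q q' : path Y Z) (c : pcell q q') l k k' a m n :
  okf p l a m -> okf q k m n -> okf q' k' m n -> cs c ÷ ev q' k' n = ev q k n ->
  cs (p ◁ c ▷ ⟪⟫) ÷ ev (papp p (papp q' ⟪⟫)) (l ++ (k' ++ [])) n
  = ev (papp p (papp q ⟪⟫)) (l ++ (k ++ [])) n.
Proof.
intros o1 o2 o3 E; refine (act_ctx H (r := ⟪⟫) (t := []) o1 o2 o3 _ E).
apply okf0, (okf_right H o2).
Qed.

End Framed3.

(** * Coherence of framed transformations *)

Section Psnat.
Context {B C : bicat} {D E : double_category} {φ : framing B D} {ψ : framing C E}.
Context (H : is_framing φ) (K : is_framing ψ).
Context {F0 G0 : B -> C} {F : map1 F0} {G : map1 G0} {fv gv : dv D -> dv E} {fk gk : dh D -> dh E}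
    {Fr Gr : forall X Y : B, hom X Y -> dsq D -> dsq E}
    {s : forall X, hom (F0 X) (G0 X)} {n : psnat F G s}
    {av : dob D -> dv E} {ah : dh D -> dsq E} {e : B -> dsq E}
    (N : fnat φ ψ fv gv fk gk Fr Gr n av ah e).

Lemma fn_gdom (X : B) a : vdom a = fo φ X -> vdom (gv a) = fo ψ (G0 X).
Proof. intros h; apply (fr_left K (proj1 (fn_G N (fu_fr H h)))). Qed.
Lemma fn_cods (X Y : B) (f : hom X Y) a b π : fr φ f a b π ->
  vcod (fv a) = hdom (fk (bot π)) /\ vcod (fv b) = hcod (fk (bot π)) /\
  vcod (gv a) = hdom (gk (bot π)) /\ vcod (gv b) = hcod (gk (bot π)).
Proof.
intros h; destruct (fn_F N h) as [x <-], (fn_G N h) as [y <-].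
destruct (fr_hbot K x), (fr_hbot K y); auto.
Qed.

Lemma fn_fr1 (X Y : B) (f : hom X Y) a b π : fr φ f a b π ->
  fr ψ (F f) (fv a ∙ av (vcod a)) (fv b ∙ av (vcod b)) (Fr f π ÷ ah (bot π)).
Proof.
intros h; destruct (fn_F N h) as [x y].
assert (P := fr_post K (s := ah (bot π)) x (eq_trans (fn_atop N _) (eq_sym y))).
rewrite (fn_alft N), (fn_argt N) in P. destruct (fr_hbot H h) as [<- <-]; exact P.
Qed.
Lemma fn_fr2 (X : B) a : vdom a = fo φ X ->
  fr ψ (s X) (fv a ∙ av (vcod a)) (gv a) (e X ÷ hidS (gv a)).
Proof.
intros h; assert (P := cf_post K (fn_cf N X) (fn_gdom h)).
rewrite (fn_lft N), <- h, <- (fn_nat N) in P; exact P.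
Qed.
Lemma fn_bot2 (X : B) a : vdom a = fo φ X -> bot (e X ÷ hidS (gv a)) = hid (vcod (gv a)).
Proof. intros h; apply (cf_post_bot (fn_cf N X) (fn_gdom h)). Qed.
Lemma fn_iso2 (X : B) a : vdom a = fo φ X -> viso a -> visoS (e X ÷ hidS (gv a)).
Proof. intros h I; apply (cf_post_iso (fn_cf N X) (fn_gdom h)), (fn_gv N I). Qed.
Lemma fn_target (X Y : B) (f : hom X Y) a b π : fr φ f a b π ->
  fr ψ (comp1 (s X) (G f)) (fv a ∙ av (vcod a)) (gv b)
    (fc ψ (s X) (G f) (e X ÷ hidS (gv a)) (Gr f π)).
Proof. intros h; apply (fc_fr K (fn_fr2 (fr_left H h)) (proj1 (fn_G N h))). Qed.
Lemma fn_target_iso (X Y : B) (f : hom X Y) a b π : fr φ f a b π -> viso a -> visoS π ->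
  visoS (fc ψ (s X) (G f) (e X ÷ hidS (gv a)) (Gr f π)).
Proof.
intros h I I'; apply (fc_iso K (fn_fr2 (fr_left H h)) (proj1 (fn_G N h))).
- apply (fn_iso2 (fr_left H h) I).
- apply (fn_Giso N h I').
Qed.

Lemma fn_eq' (X Y : B) (f : hom X Y) a b π : fr φ f a b π ->
  cs ψ (bwd (n X Y f)) ÷ fc ψ (F f) (s Y) (Fr f π ÷ ah (bot π)) (e Y ÷ hidS (gv b))
  = fc ψ (s X) (G f) (e X ÷ hidS (gv a)) (Gr f π).
Proof.
intros h.
refine (act_inv K (f := comp1 (F f) (s Y)) (c := fwd (n X Y f)) (fn_target h) _ (fn_eq N h)).
apply (fn_iso N f).
Qed.

End Psnat.

Section Psnat2.
Context {B C : bicat} {D E : double_category} {φ : framing B D} {ψ : framing C E}.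
Context (H : is_framing φ) (K : is_framing ψ).
Context {F0 G0 : B -> C} {F : psfun F0} {G : psfun G0} {Fh Gh : pdfun D E}
    {Fr Gr : forall X Y : B, hom X Y -> dsq D -> dsq E}
    {s : forall X, hom (F0 X) (G0 X)} {n : psnat F G s}
    {av : dob D -> dv E} {ah : dh D -> dsq E} {e : B -> dsq E}
    (P : ffun φ ψ F Fh Fr) (Q : ffun φ ψ G Gh Gr)
    (N : fnat φ ψ (FV Fh) (FV Gh) (FH Fh) (FH Gh) Fr Gr n av ah e) (V : vnat Fh Gh av ah).

(** For composites and identities both sides reduce to a frame with the compositor or unitor of [Gh]
    at the bottom. On one side it arises by sliding that of [Fh] through [ah] ([vnat]), on the other
    it comes from [G] directly. *)
Lemma framed_psnat : is_psnat F G n.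
Proof.
split; intros.
- apply (fn_iso N).
- destruct (good_frame H g) as (b & π & h & I).
  assert (h' := fr_act H c h); assert (Eb := act_bot H c h).
  assert (y := fn_target H K N h); assert (x := fn_fr2 H K N (fr_left H h)).
  assert (x' := fn_fr2 H K N (fr_dom h)); assert (z := fn_fr1 H K N h).
  destruct (fn_G N h) as [g1 g2], (fn_F N h) as [f1 f2].
  apply (cell_eq K y (fn_target_iso H K N h (viso_id _) I)).
  transitivity (fc ψ (F # f) (s Y) (Fr f (cs φ c ÷ π) ÷ ah (bot π)) (e Y ÷ hidS (FV Gh b))).
  + stp K y (fn_eq N h).
    refine (actl K (q := ⟪F # f⟫) (q' := ⟪F # g⟫) (r := ⟪s Y⟫) (k := [_]) (k' := [_]) (t := [_])
      (okf1 _) (okf1 z) (okf1 x') _).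
    * rewrite <- Eb; apply (fn_fr1 H K N h').
    * cbn; unfold one. rewrite (act_post K _ f1), (ff_cell P _ h); auto. rewrite f2; apply (fn_atop N).
  + symmetry.
    refine (act2c K y (actr K (p := ⟪s X⟫) (q := ⟪G # f⟫) (q' := ⟪G # g⟫) (l := [_]) (k := [_]) (k' := [_])
      (okf1 x) (okf1 (fm_fr (ff_map Q) h')) (okf1 g1) _) _).
    * cbn; unfold one; apply (ff_cell Q _ h).
    * rewrite <- Eb; apply (fn_eq N h').
- destruct (good_fr H f (good_id H X)) as (a1 & π1 & G1 & x1 & I1).
  destruct (good_fr H g G1) as (a2 & π2 & G2 & x2 & I2).
  assert (x := fc_fr H x1 x2). assert (bx := fc_bot H x1 x2).
  assert (y := fn_target H K N x).
  assert (sX := fn_fr2 H K N (fr_left H x1)); assert (sY := fn_fr2 H K N (fr_dom x1));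
  assert (sZ := fn_fr2 H K N (fr_dom x2)).
  assert (F1 := fn_fr1 H K N x1); assert (F2 := fn_fr1 H K N x2); assert (F3 := fn_fr1 H K N x).
  destruct (fn_G N x1) as [g1 g1'], (fn_G N x2) as [g2 g2'], (fn_G N x) as [g3 g3'].
  destruct (fn_F N x1) as [f1 f1'], (fn_F N x2) as [f2 f2'], (fn_F N x) as [f3 f3'].
  assert (CC : hcod (bot π1) = hdom (bot π2)).
  { destruct (fr_hbot H x1), (fr_hbot H x2); congruence. }
  assert (C1 : vcod (FV Gh (vid (fo φ X))) = Gh (hdom (bot π1))).
  { destruct (fr_hbot H x1); rewrite FV_cod; congruence. }
  assert (C2 : vcod (FV Gh a2) = Gh (hcod (bot π2))).
  { destruct (fr_hbot H x2); rewrite FV_cod; congruence. }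
  assert (Bz : bot (fc ψ (G # f) (G # g) (Gr f π1) (Gr g π2)) = hcomp (FH Gh (bot π1)) (FH Gh (bot π2))).
  { rewrite (fc_bot K g1 g2); congruence. }
  assert (Bf : bot (fc ψ (F # f) (F # g) (Fr f π1) (Fr g π2)) = hcomp (FH Fh (bot π1)) (FH Fh (bot π2))).
  { rewrite (fc_bot K f1 f2); congruence. }
  assert (B1 : bot (Fr f π1 ÷ ah (bot π1)) = FH Gh (bot π1)).
  { rewrite bot_vcomp; [apply (fn_abot N)|]. rewrite (fn_atop N); auto. }
  assert (B2 : bot (Fr g π2 ÷ ah (bot π2)) = FH Gh (bot π2)).
  { rewrite bot_vcomp; [apply (fn_abot N)|]. rewrite (fn_atop N); auto. }
  destruct (fr_hbot K F1) as [D1 D1'], (fr_hbot K F2) as [D2 D2'].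
  rewrite B1, FH_dom in D1; rewrite B1, FH_cod in D1'; rewrite B2, FH_dom in D2; rewrite B2, FH_cod in D2'.
  assert (R12 : rgt (ah (bot π1)) = lft (ah (bot π2))).
  { rewrite (fn_alft N), (fn_argt N); congruence. }
  apply (cell_eq K y (fn_target_iso H K N x (viso_id _) (fc_iso H x1 x2 I1 I2))).
  (* The common value: both frames of [F] are continued by [ah], the companion at [Z] comes last,
     and the compositor of [Gh] is at the bottom. *)
  transitivity (fc ψ (F # f) (comp1 (F # g) (s Z)) (Fr f π1 ÷ ah (bot π1))
     (fc ψ (F # g) (s Z) (Fr g π2 ÷ ah (bot π2)) (e Z ÷ hidS (FV Gh a2))) ÷ F2c Gh (bot π1) (bot π2)).
  + stp K y (fn_eq N x).
    refine (eq_trans (act_ctx_l K (q := ⟪F # f; F # g⟫) (q' := ⟪F # comp1 f g⟫) (r := ⟪s Z⟫)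
      (k := [_; _]) (k' := [_]) (t := [_]) (s := F2c Gh (bot π1) (bot π2)) (okf2 F1 F2) (okf1 F3) (okf1 sZ) _ _ _ _) _).
    * cbn; rewrite (fc_bot K F1 F2), B1, B2, F2c_top; auto.
    * rewrite F2c_lft, D1; auto.
    * rewrite F2c_rgt, D2'; auto.
    * cbn. rewrite bx in F3 |- *.
      assert (z1 := fc_fr K f1 f2).
      rewrite (act_post K _ f3) by (rewrite (fn_atop N), f3'; congruence).
      refine (eq_trans (f_equal (fun z => z ÷ _) (ff_comp P x1 x2)) _).
      rewrite vA, (vn_comp V CC), <- vA.
      -- f_equal; symmetry; apply (fc_post K f1 f2); rewrite ?(fn_atop N); auto.
      -- rewrite Bf, top_hcomp, !(fn_atop N); auto.
      -- rewrite bot_hcomp, !(fn_abot N), F2c_top; auto.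
      -- rewrite Bf, F2c_top; auto.
      -- rewrite F2c_bot, (fn_atop N); auto.
    * cbn. rewrite (fn_bot2 H K N (fr_dom x2)), <- hidS_id, hr; auto.
      rewrite F2c_rgt, C2; auto.
  + symmetry.
    assert (y2 := fc_fr K sX (fc_fr K g1 g2)).
    transitivity (cs ψ (⟪F # f⟫ ◁ fwd (n Y Z g) ▷ ⟪⟫ ⊚ ⟪⟫ ◁ fwd (n X Y f) ▷ ⟪G # g⟫)
      ÷ fc ψ (s X) (comp1 (G # f) (G # g)) (e X ÷ hidS (FV Gh (vid (fo φ X)))) (fc ψ (G # f) (G # g) (Gr f π1) (Gr g π2))
      ÷ F2c Gh (bot π1) (bot π2)).
    * stp K y (act_ctx_r K (p := ⟪s X⟫) (q := ⟪G # f; G # g⟫) (q' := ⟪G # comp1 f g⟫) (l := [_]) (k := [_; _]) (k' := [_])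
        (okf1 sX) (okf2 g1 g2) (okf1 g3) _ _ _ (ff_comp Q x1 x2)).
      -- cbn; rewrite Bz, F2c_top; auto.
      -- rewrite F2c_lft, C1; auto.
      -- rewrite F2c_rgt, C2; auto.
      -- cbn. rewrite (fn_bot2 H K N (fr_left H x1)), <- hidS_id, h1; [|rewrite F2c_lft, C1; auto].
         apply (act_post K _ y2).
         rewrite (fc_bot K sX (fc_fr K g1 g2)), Bz, (fn_bot2 H K N (fr_left H x1)), F2c_top; auto.
         symmetry; apply hunitl. rewrite hdom_comp, FH_dom, C1; auto. rewrite FH_cod, FH_dom; congruence.
    * f_equal.
      stp K y2 (actl K (q := ⟪F # f; s Y⟫) (q' := ⟪s X; G # f⟫) (r := ⟪G # g⟫) (k := [_; _]) (k' := [_; _]) (t := [_])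
        (okf2 F1 sY) (okf2 sX g1) (okf1 g2) (fn_eq N x1)).
      refine (actr K (p := ⟪F # f⟫) (q := ⟪F # g; s Z⟫) (q' := ⟪s Y; G # g⟫) (l := [_]) (k := [_; _]) (k' := [_; _])
        (okf1 F1) (okf2 F2 sZ) (okf2 sY g2) (fn_eq N x2)).
- assert (d := vdom_id (fo φ X)). assert (xu := fu_fr H d).
  assert (y := fn_target H K N xu). assert (sX := fn_fr2 H K N d).
  destruct (fn_G N xu) as [g1 g1'], (fn_F N xu) as [f1 f1'].
  assert (F1 := fn_fr1 H K N xu).
  assert (I := viso_id (fo φ X)).
  assert (bu : bot (fu φ X (vid (fo φ X))) = hid (fo φ X)) by (rewrite (fu_bot H d), vcod_id; auto).
  rewrite bu in F1, f1', g1'.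
  assert (U := ff_unit P d); assert (U' := ff_unit Q d); rewrite vcod_id in U, U', F1, sX.
  assert (Ef := fn_eq N xu); rewrite bu in Ef.
  assert (dg := fr_left K g1); assert (df := fr_left K f1).
  assert (cg : vcod (FV Gh (vid (fo φ X))) = Gh (fo φ X)) by (rewrite FV_cod, vcod_id; auto).
  assert (cf0 : vcod (FV Fh (vid (fo φ X))) = Fh (fo φ X)) by (rewrite FV_cod, vcod_id; auto).
  assert (al : lft (ah (hid (fo φ X))) = av (fo φ X)) by (rewrite (fn_alft N), hdom_id; auto).
  assert (ad : vdom (av (fo φ X)) = Fh (fo φ X)).
  { rewrite <- al, <- dom_top, (fn_atop N), FH_dom, hdom_id; auto. }
  assert (ac : vcod (av (fo φ X)) = Gh (fo φ X)).
  { rewrite <- al, <- dom_bot, (fn_abot N), FH_dom, hdom_id; auto. }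
  apply (cell_eq K y (fn_target_iso H K N xu I (fu_iso H d I))).
  transitivity (e X ÷ hidS (FV Gh (vid (fo φ X))) ÷ F2u Gh (fo φ X)).
  + stp K y Ef.
    refine (eq_trans (act_ctx_l K (q := ⟪⟫) (q' := ⟪F # id1 X⟫) (r := ⟪s X⟫) (k := []) (k' := [_]) (t := [_])
      (s := F2u Gh (fo φ X)) (okf0 _) (okf1 F1) (okf1 sX) _ _ _ _) _).
    * apply (fr_left K F1).
    * cbn. rewrite (fu_bot K (fr_left K F1)), F2u_top, vcod_comp, ac; congruence.
    * rewrite F2u_lft, vcod_comp, ac; congruence.
    * rewrite F2u_rgt, vcod_comp, ac; congruence.
    * cbn. rewrite (act_post K _ f1) by (rewrite (fn_atop N); auto).
      refine (eq_trans (f_equal (fun z => z ÷ _) U) _).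
      rewrite <- (fu_post K df) by congruence.
      rewrite vA, (vn_unit V), <- vA; auto.
      -- rewrite (fu_bot K df), top_hid; congruence.
      -- rewrite F2u_top, bot_hid; congruence.
      -- rewrite (fu_bot K df), F2u_top; congruence.
      -- rewrite F2u_bot, (fn_atop N); congruence.
    * cbn. rewrite (fn_bot2 H K N d), <- hidS_id, hr; auto. rewrite F2u_rgt, cg; auto.
  + symmetry; refine (eq_trans (act_ctx_r K (p := ⟪s X⟫) (q := ⟪⟫) (q' := ⟪G # id1 X⟫) (l := [_]) (k := []) (k' := [_])
      (s := F2u Gh (fo φ X)) (okf1 sX) (okf0 _) (okf1 g1) _ _ _ _) _).
    * exact dg.
    * cbn; rewrite (fu_bot K dg), F2u_top; congruence.
    * rewrite F2u_lft; congruence.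
    * rewrite F2u_rgt; congruence.
    * exact U'.
    * cbn. rewrite (fn_bot2 H K N d), <- hidS_id, h1; auto. rewrite F2u_lft; congruence.
Qed.

End Psnat2.

(** * Inverses of images of pasting cells *)

Section Images.
Context {B C : bicat} {F0 : B -> C} {F : psfun F0} (HC : is_bicat C) (P : is_psfun F).

Lemma whisk_inv (X Y Z : C) (f : hom X Y) (g h : hom Y Z) (c : cell g h) (d : cell h g) :
  c ⊙ d = id2 g -> hc2 (id2 f) c ⊙ hc2 (id2 f) d = id2 _.
Proof.
intros E; rewrite <- (bi_interchange HC), (bi_lid HC), E; apply (bi_hid HC).
Qed.

Lemma cancel_mid (X Y : C) (f g h : hom X Y) (c : cell f g) (d : cell g h) (d' : cell h g)
  (c' : cell g f) : d ⊙ d' = id2 g -> c ⊙ c' = id2 f -> (c ⊙ d) ⊙ (d' ⊙ c') = id2 f.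
Proof.
intros E E'; rewrite (bi_ass HC), <- (bi_ass HC d), E, (bi_lid HC); exact E'.
Qed.

Lemma ffold_from_inv (Y Z : B) (p : path Y Z) : forall (X : B) (f : hom X Y),
  ffold_from F p f ⊙ funfold_from F p f = id2 _ /\ funfold_from F p f ⊙ ffold_from F p f = id2 _.
Proof.
induction p as [A0|A0 Y0 Z0 g p IH]; cbn; intros X f.
- rewrite (bi_lid HC); auto.
- destruct (IH _ g) as [e1 e2]; destruct (pf_comp_iso P f (peval_from p g)) as [i1 i2].
  split; apply cancel_mid; auto; apply whisk_inv; auto.
Qed.

Lemma ffold_inv (X Y : B) (p : path X Y) :
  comp2 (ffold F p) (funfold F p) = id2 _ /\ comp2 (funfold F p) (ffold F p) = id2 _.
Proof.
destruct p as [X|X Y0 Z0 f p]; cbn.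
- apply (pf_unit_iso P).
- apply ffold_from_inv.
Qed.

(** [fcell] conjugates the action on 2-cells by iterated compositors, which are invertible by
    [ffold_inv]. *)
Lemma fcell_inv (X Y : B) (p q : path X Y) (c : pcell p q) (d : pcell q p) :
  comp2 c d = id2 _ -> comp2 (fcell F c) (fcell F d) = id2 _.
Proof.
intros E; unfold fcell, pcomp.
destruct (ffold_inv p), (ffold_inv q).
rewrite (bi_ass HC (ffold F q)).
apply cancel_mid; auto.
unfold one; apply cancel_mid; auto.
refine (eq_trans (eq_sym (pf_comp2 P c d)) (eq_trans (f_equal (fun x => f2 F x) E) (pf_id2 P _))).
Qed.

Lemma fiso_iso (X Y : B) (p q : path X Y) (i : iso2 p q) : is_iso2 i -> is_iso2 (fiso F i).
Proof. intros [e e']; split; cbn; apply fcell_inv; auto. Qed.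
End Images.

(** * Compositors at identities and inverse unitors *)

Section Cmp.
Context {D E : double_category} {F : pdfun D E} (P : is_pdfun F).

Lemma visoS_F2u A : visoS (F2u F A).
Proof. exists (F2u' F A); rewrite (F2u_inv P), (F2u'_inv P); repeat split; gb. Qed.
Lemma visoS_F2u' A : visoS (F2u' F A).
Proof. exists (F2u F A); rewrite (F2u_inv P), (F2u'_inv P); repeat split; gb. Qed.

Lemma F2c_hidr (k : dh D) A : hcod k = A ->
  F2c F k (hid A) ÷ (vidS (FH F k) ∥ F2u F A) = vidS (hcomp (FH F k) (FH F (hid A))).
Proof.
intros <-.
assert (E1 := F2c_unitr P k).
assert (V : visoS (vidS (FH F k) ∥ F2u F (hcod k))).
{ apply visoS_hcomp; [gb|apply visoS_id|].
  apply visoS_F2u. }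
apply (visoS_injl V); try (gb; fail).
rewrite <- vA, E1; try (gb; fail).
rewrite v1, vr; gb.
Qed.

Lemma F2c_hidl (k : dh D) A : hdom k = A ->
  F2c F (hid A) k ÷ (F2u F A ∥ vidS (FH F k)) = vidS (hcomp (FH F (hid A)) (FH F k)).
Proof.
intros <-.
assert (E1 := F2c_unitl P k).
assert (V : visoS (F2u F (hdom k) ∥ vidS (FH F k))).
{ apply visoS_hcomp; [gb| |apply visoS_id].
  apply visoS_F2u. }
apply (visoS_injl V); try (gb; fail).
rewrite <- vA, E1; try (gb; fail).
rewrite v1, vr; gb.
Qed.

(** The right unit law exhibits the compositor as inverse to the whiskered unitor. In this form a
    compositor beside a frame with identity bottom can be absorbed into that frame. *)
Lemma F2c_hidr' (k : dh D) A : hcod k = A -> F2c F k (hid A) = vidS (FH F k) ∥ F2u' F A.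
Proof.
intros <-.
rewrite <- (@vr _ (F2c F k (hid (hcod k))) (FH F k)) by gb.
assert (E0 : vidS (FH F k) = (vidS (FH F k) ∥ F2u F (hcod k)) ÷ (vidS (FH F k) ∥ F2u' F (hcod k))).
{ rewrite exch, (F2u_inv P), v1, <- vidS_h by gb. rewrite hunitr by gb; auto. }
rewrite E0 at 1; rewrite <- vA by gb; rewrite F2c_hidr, v1 by gb; auto.
Qed.

Lemma F2c_hidl' (k : dh D) A : hdom k = A -> F2c F (hid A) k = F2u' F A ∥ vidS (FH F k).
Proof.
intros <-.
rewrite <- (@vr _ (F2c F (hid (hdom k)) k) (FH F k)) by gb.
assert (E0 : vidS (FH F k) = (F2u F (hdom k) ∥ vidS (FH F k)) ÷ (F2u' F (hdom k) ∥ vidS (FH F k))).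
{ rewrite exch, (F2u_inv P), v1, <- vidS_h by gb. rewrite hunitl by gb; auto. }
rewrite E0 at 1; rewrite <- vA by gb; rewrite F2c_hidl, v1 by gb; auto.
Qed.

Lemma F2u'_nat (u : dv D) : F2u' F (vdom u) ÷ hidS (FV F u) = FS F (hidS u) ÷ F2u' F (vcod u).
Proof.
apply (visoS_injl (visoS_F2u (vdom u))); try (gb; fail).
rewrite <- !vA, <- (F2u_nat P), (F2u_inv P), v1, vA, (F2u_inv P), vr by gb; auto.
Qed.

End Cmp.

(** * Images of companion frames *)

Section Image.
Context {B C : bicat} {D E : double_category} {φ : framing B D} {ψ : framing C E}.
Context (H : is_framing φ) (K : is_framing ψ).
Context {F0 : B -> C} {F : psfun F0} {Fh : pdfun D E}
  {Fr : forall X Y : B, hom X Y -> dsq D -> dsq E} (P : ffun φ ψ F Fh Fr).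

(** A frame with bottom [hid A] is mapped to one with bottom [FH Fh (hid A)], which need not be an
    identity; the inverse unitor restores the shape of a companion frame. *)
Definition img (Fh : pdfun D E) (A : dob D) (π : dsq E) : dsq E := π ÷ F2u' Fh A.

Lemma fr_img (X Y : B) (f : hom X Y) a b π A : fr φ f a b π -> bot π = hid A ->
  fr ψ (F # f) (FV Fh a) (FV Fh b) (img Fh A (Fr f π)).
Proof.
intros h e; assert (M := ff_map P).
assert (x := fr_post K (s := F2u' Fh A) (fm_fr M h)).
destruct (fr_hbot H h) as [c1 c2]; rewrite e, hdom_id in c1; rewrite e, hcod_id in c2.
rewrite F2u'_top, F2u'_lft, F2u'_rgt, !ur in x; try (rewrite FV_cod; congruence).
apply x; rewrite (fm_bot M h), e; auto.
Qed.

Lemma img_top (X Y : B) (f : hom X Y) a b π A : fr φ f a b π -> bot π = hid A ->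
  bot (Fr f π) = top (F2u' Fh A).
Proof. intros h e; rewrite F2u'_top, (fm_bot (ff_map P) h), e; auto. Qed.

Lemma img_post (X Y : B) (f : hom X Y) a b π A u : fr φ f a b π -> bot π = hid A ->
  vdom u = A -> img Fh A (Fr f π) ÷ hidS (FV Fh u) = img Fh (vcod u) (Fr f (π ÷ hidS u)).
Proof.
intros h e <-; unfold img; assert (t := img_top h e).
rewrite (fm_post (ff_map P) h) by (rewrite top_hid; auto).
rewrite !vA, (F2u'_nat (ff_ax P)); auto.
- rewrite FS_top, top_hid, <- e; apply (fm_bot (ff_map P) h).
- rewrite FS_bot, F2u'_top, bot_hid; auto.
- rewrite F2u'_bot, top_hid, FV_dom; auto.
Qed.

Lemma img_cf (X Y : B) (s : hom X Y) e : cf (φ := φ) s e ->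
  cf (φ := ψ) (F # s) (img Fh (fo φ Y) (Fr s e)) /\
  lft (img Fh (fo φ Y) (Fr s e)) = FV Fh (lft e).
Proof.
intros h; assert (x := fr_img (cf_fr h) (cf_bot h)); assert (t := img_top (cf_fr h) (cf_bot h)).
assert (l := fr_lft x).
split; auto; split.
- rewrite l, (fm_o (ff_map P)). rewrite FV_id in x; exact x.
- unfold img; rewrite bot_vcomp, F2u'_bot, (fm_o (ff_map P)); auto.
- apply visoS_comp; auto; [apply (fm_iso (ff_map P) (cf_fr h)), h | apply (visoS_F2u' (ff_ax P))].
Qed.

(** Beside an identity the compositor is a whiskered inverse unitor, which is just what [img] adds:
    on such frames the compositor of [F] acts without residue. *)
Lemma fwd_comp_l (X Y Z : B) (f : hom X Y) (g : hom Y Z) a b c π π' A :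
  fr φ f a b π -> fr φ g b c π' -> bot π = hid A ->
  cs ψ (fwd (fcomp F f g)) ÷ Fr (comp1 f g) (fc φ f g π π')
  = fc ψ (F # f) (F # g) (img Fh A (Fr f π)) (Fr g π').
Proof.
intros h h' e.
assert (x := fm_fr (ff_map P) h); assert (x' := fm_fr (ff_map P) h').
assert (b' := fm_bot (ff_map P) h').
destruct (fr_hbot H h) as [c1 c2], (fr_hbot H h') as [c3 c4]; rewrite e, hcod_id in c2.
refine (eq_trans (ff_comp P h h') _).
rewrite e, (F2c_hidl' (ff_ax P)) by congruence.
rewrite <- (vr b') at 2; unfold img; symmetry; apply (fc_post K x x').
- rewrite (img_top h e); auto.
- rewrite top_vid; auto.
- rewrite F2u'_rgt, lft_vid, FH_dom; congruence.
Qed.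

Lemma fwd_comp_r (X Y Z : B) (f : hom X Y) (g : hom Y Z) a b c π π' A :
  fr φ f a b π -> fr φ g b c π' -> bot π' = hid A ->
  cs ψ (fwd (fcomp F f g)) ÷ Fr (comp1 f g) (fc φ f g π π')
  = fc ψ (F # f) (F # g) (Fr f π) (img Fh A (Fr g π')).
Proof.
intros h h' e.
assert (x := fm_fr (ff_map P) h); assert (x' := fm_fr (ff_map P) h').
assert (b' := fm_bot (ff_map P) h).
destruct (fr_hbot H h) as [c1 c2], (fr_hbot H h') as [c3 c4]; rewrite e, hdom_id in c3.
refine (eq_trans (ff_comp P h h') _).
rewrite e, (F2c_hidr' (ff_ax P)) by congruence.
rewrite <- (vr b') at 2; unfold img; symmetry; apply (fc_post K x x').
- rewrite top_vid; auto.
- rewrite (img_top h' e); auto.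
- rewrite F2u'_lft, rgt_vid, FH_cod; congruence.
Qed.

Lemma bwd_comp_l (X Y Z : B) (f : hom X Y) (g : hom Y Z) a b c π π' A :
  fr φ f a b π -> fr φ g b c π' -> bot π = hid A ->
  cs ψ (bwd (fcomp F f g)) ÷ fc ψ (F # f) (F # g) (img Fh A (Fr f π)) (Fr g π')
  = Fr (comp1 f g) (fc φ f g π π').
Proof.
intros h h' e.
refine (act_inv K (f := comp1 (F # f) (F # g)) (c := fwd (fcomp F f g))
  (fm_fr (ff_map P) (fc_fr H h h')) _ (fwd_comp_l h h' e)).
apply (ff_ciso P).
Qed.

End Image.

(** * Products and the unit *)

Section Products.
Context {B C : bicat} {D E : double_category} {φ : framing B D} {ψ : framing C E}.

Definition prodfr (φ : framing B D) (ψ : framing C E) : framing (prodb B C) (dprodD D E) :=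
  @Build_framing (prodb B C) (dprodD D E)
    (fun X => (fo φ (fst X), fo ψ (snd X)))
    (fun X Y (f : @hom (prodb B C) X Y) => (fh φ (fst f), fh ψ (snd f)))
    (fun X Y (f g : @hom (prodb B C) X Y) c => (cs φ (fst c), cs ψ (snd c)))
    (fun X a => (fw φ (fst X) (fst a), fw ψ (snd X) (snd a)))
    (fun X Y Z (f : @hom (prodb B C) X Y) (g : @hom (prodb B C) Y Z) π π' =>
      (fc φ (fst f) (fst g) (fst π) (fst π'), fc ψ (snd f) (snd g) (snd π) (snd π')))
    (fun X a => (fu φ (fst X) (fst a), fu ψ (snd X) (snd a)))
    (fun X a => good φ (fst X) (fst a) /\ good ψ (snd X) (snd a)).

Lemma fr_fst (X Y : prodb B C) (f : hom X Y) a b π : fr (prodfr φ ψ) f a b π ->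
  fr φ (fst f) (fst a) (fst b) (fst π).
Proof.
intros [e1 e2 e3 e4]; cbn in *; split;
[exact (f_equal fst e1)|exact (f_equal fst e2)|exact (f_equal fst e3)|exact (f_equal fst e4)].
Qed.
Lemma fr_snd (X Y : prodb B C) (f : hom X Y) a b π : fr (prodfr φ ψ) f a b π ->
  fr ψ (snd f) (snd a) (snd b) (snd π).
Proof.
intros [e1 e2 e3 e4]; cbn in *; split;
[exact (f_equal snd e1)|exact (f_equal snd e2)|exact (f_equal snd e3)|exact (f_equal snd e4)].
Qed.

Lemma fr_both (X Y : prodb B C) (f : hom X Y) a b π : fr φ (fst f) (fst a) (fst b) (fst π) ->
  fr ψ (snd f) (snd a) (snd b) (snd π) -> fr (prodfr φ ψ) f a b π.
Proof. intros [] []; split; apply injective_projections; assumption. Qed.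

Lemma viso_fst (u : dv (dprod D E)) : viso u -> viso (fst u) /\ viso (snd u).
Proof.
intros (v & a1 & a2 & a3 & a4); cbn in *; split; [exists (fst v)|exists (snd v)];
repeat split; solve [exact (f_equal fst a1)|exact (f_equal fst a2)|exact (f_equal fst a3)|exact (f_equal fst a4)
|exact (f_equal snd a1)|exact (f_equal snd a2)|exact (f_equal snd a3)|exact (f_equal snd a4)].
Qed.
Lemma visoS_fst (u : dsq (dprod D E)) : visoS u -> visoS (fst u) /\ visoS (snd u).
Proof.
intros (v & a1 & a2 & a3 & a4); cbn in *; split; [exists (fst v)|exists (snd v)];
repeat split; solve [exact (f_equal fst a1)|exact (f_equal fst a2)|exact (f_equal fst a3)|exact (f_equal fst a4)
|exact (f_equal snd a1)|exact (f_equal snd a2)|exact (f_equal snd a3)|exact (f_equal snd a4)].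
Qed.

Lemma prodfr_ax (H : is_framing φ) (K : is_framing ψ) : is_framing (prodfr φ ψ).
Proof.
assert (pe := fun A B (p q : A * B) (x : fst p = fst q) (y : snd p = snd q) =>
  injective_projections p q x y).
split; intros;
  repeat match goal with
  | h : fr (prodfr _ _) _ _ _ _ |- _ =>
      let a := fresh in let b := fresh in
      assert (a := fr_fst h); assert (b := fr_snd h); clear h
  | h : viso _ |- _ => apply viso_fst in h; destruct h
  | h : visoS _ |- _ => apply visoS_fst in h; destruct h
  | h : @eq (dob _) _ _ |- _ =>
      let a := fresh in let b := fresh in
      assert (a := f_equal fst h); assert (b := f_equal snd h); clear h
  | h : @eq (dh _) _ _ |- _ =>
      let a := fresh in let b := fresh in
      assert (a := f_equal fst h); assert (b := f_equal snd h); clear h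
  | h : @eq (dv _) _ _ |- _ =>
      let a := fresh in let b := fresh in
      assert (a := f_equal fst h); assert (b := f_equal snd h); clear h
  end.
all: try (apply pe; cbn in *; [solve [eapply H; eauto] | solve [eapply K; eauto]]).
all: try (split; cbn in *; [solve [eapply H; eauto] | solve [eapply K; eauto]]).
- apply viso_pair; cbn in *; [eapply (fw_iso H) | eapply (fw_iso K)]; eauto.
- apply pe; cbn; [apply (cs_inj H)|apply (cs_inj K)];
  [exact (f_equal fst H0) | exact (f_equal snd H0)].
- cbn in *.
  destruct (cs_full H (f := fst f) (g := fst g) (s := fst s)) as [c ec]; auto.
  destruct (cs_full K (f := snd f) (g := snd g) (s := snd s)) as [d ed]; auto.
  exists (c, d); cbn; rewrite ec, ed; destruct s; auto.
- apply fr_both; cbn; [eapply (fc_fr H)|eapply (fc_fr K)]; eauto.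
- apply visoS_pair; cbn in *; [eapply (fc_iso H)|eapply (fc_iso K)]; eauto.
- apply fr_both; cbn; [eapply (fu_fr H)|eapply (fu_fr K)]; eauto.
- apply visoS_pair; cbn in *; [eapply (fu_iso H)|eapply (fu_iso K)]; eauto.
- destruct H0; cbn in *. destruct (good_dom H H0), (good_dom K H1). split; [congruence|].
  destruct a; apply viso_pair; auto.
- destruct H0, (good_fr H (fst f) H0) as (b & π & G & h & I), (good_fr K (snd f) H1) as (b' & π' & G' & h' & I').
  exists (b, b'), (π, π'); split; [split; auto | split]; [|apply visoS_pair; auto].
  apply fr_both; auto.
Qed.
End Products.

Definition unitfr : framing unitb dunitD :=
  @Build_framing unitb dunitD (fun _ => tt) (fun _ _ _ => tt) (fun _ _ _ _ _ => tt)
    (fun _ a => a) (fun _ _ _ _ _ _ _ => tt) (fun _ _ => tt) (fun _ _ => True).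

Lemma unitfr_ax : is_framing unitfr.
Proof.
assert (ue : forall x y : unit, x = y) by (intros [] []; auto).
assert (V : forall u : dv dunitD, viso u) by (exists tt; repeat split; apply ue).
assert (VS : forall u : dsq dunitD, visoS u) by (exists tt; repeat split; apply ue).
split; intros; auto; try (apply ue).
- exists tt; apply ue.
- split; apply ue.
- split; apply ue.
- exact I.
- exists tt, tt; split; [exact I|]; split; [split; apply ue | apply VS].
Qed.

(** * The framing of [Horiz D] *)

Section HorizFraming.
Context (D : double_category).
Local Notation HD := (Horiz D).

(** Horizontal composition in [D] is strict, so frames compose by juxtaposition and right sides need
    no correction. Identities suffice as good vertical cells, because [vidS f] is an invertible
    frame of [f] with identity sides. *)
Definition horizfr : framing HD D :=
  @Build_framing HD D (fun X => X) (fun X Y f => hval f) (fun X Y f g c => sval c)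
    (fun _ a => a) (fun _ _ _ _ _ π π' => π ∥ π') (fun _ a => hidS a)
    (fun X a => a = vid X).

Lemma gcell_eq (A B : dob D) (f g : hcell A B) (c d : gcell f g) : sval c = sval d -> c = d.
Proof.
destruct c, d; cbn; intros <-; f_equal; apply proof_irrelevance.
Qed.

Lemma frH (X Y : HD) (f : hom X Y) a b π : top π = hval f -> lft π = a -> rgt π = b ->
  fr horizfr f a b π.
Proof.
intros e1 e2 e3; split; auto; cbn.
rewrite <- e3, <- cod_top, e1; apply hval_cod.
Qed.

Lemma horizfr_ax : is_framing horizfr.
Proof.
split; cbn; intros;
 repeat match goal with h : fr _ _ _ _ _ |- _ => let t := fresh "ft" in let l := fresh "fl" in let r := fresh "fg" in destruct h as [t l r ?] end; cbn in *;
 rewrite ?s_top, ?s_bot, ?s_lft, ?s_rgt, ?hval_dom, ?hval_cod; auto.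
- apply gcell_eq; auto.
- assert (E1 : lft s = vid X) by auto. assert (E2 : rgt s = vid Y) by (rewrite H2, hval_cod; auto).
  exists {| sval := s; s_top := H; s_bot := H0; s_lft := E1; s_rgt := E2 |}; auto.
- split; cbn; auto; gb.
- gb.
- symmetry; apply exch; congruence.
- apply visoS_hcomp; auto; congruence.
- rewrite exch; auto; gb.
- split; cbn; gb.
- gb.
- rewrite hidS_v; auto.
- apply visoS_hid; auto.
- rewrite v1, hA; gb. rewrite ft1, ft0, ft; symmetry; apply (hcompA (dc_ax D)); gb.
- rewrite v1, hA; gb. rewrite ft1, ft0, ft; apply (hcompA (dc_ax D)); gb.
- rewrite v1, h1; gb.
- rewrite v1, h1; gb. rewrite ft; apply hunitl; rewrite <- fl, <- dom_top, ft; auto.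
- rewrite v1, hr; gb.
- rewrite v1, hr; gb. rewrite ft; apply hunitr; rewrite <- fg, <- cod_top, ft; auto.
- subst a; rewrite vdom_id; split; auto. apply viso_id.
- subst a; exists (vid Y), (vidS (hval f)); repeat split; cbn; auto; try gb. apply visoS_id.
Qed.
End HorizFraming.

(** * Combinators of framed pseudofunctors *)

Lemma pid_iso {B : bicat} {D : double_category} {φ : framing B D} (H : is_framing φ)
  (X Y : B) (p q : path X Y) (i : iso2 p q) a b π π' : fr φ (peval p) a b π -> fr φ (peval q) a b π' ->
  visoS π -> visoS π' -> cs φ (fwd i) ÷ π' = π -> cs φ (bwd i) ÷ π = π' -> is_iso2 i.
Proof.
intros h h' I I' e e'; split.
- apply (cell_eq H h I); rewrite (act_comp H _ _ h), e', e, (act_id H h); auto.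
- apply (cell_eq H h' I'); rewrite (act_comp H _ _ h'), e, e', (act_id H h'); auto.
Qed.

Section Combinators.
Context {A B C : bicat} {L D E : double_category}.
Context {χ : framing A L} {φ : framing B D} {ψ : framing C E}.
Context (G : is_framing χ) (H : is_framing φ) (K : is_framing ψ).

Lemma idf_ff : ffun φ φ (idf B) (did D) (fun _ _ _ π => π).
Proof.
split.
- split; intros; cbn; auto.
- apply did_ax.
- auto.
- intros; cbn; unfold fold. refine (eq_trans (act_id H (f := comp1 f g) (fc_fr H H0 H1)) _).
  symmetry; apply vr, (fc_bot H H0 H1).
- intros; cbn; unfold fold. refine (eq_trans (act_id H (f := id1 X) (fu_fr H H0)) _).
  symmetry; apply vr, (fu_bot H H0).
- intros; split; apply (bi_lid (framed_bicat H)).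
- intros; split; apply (bi_lid (framed_bicat H)).
Qed.

Lemma fstf_ff : ffun (prodfr φ ψ) φ (fstf B C) (dfst D E) (fun _ _ _ π => fst π).
Proof.
split.
- split; intros; cbn; auto; try apply (fr_fst H0). apply visoS_fst; auto.
- apply dfst_ax.
- auto.
- intros; cbn.
  refine (eq_trans (act_id H (f := comp1 (fst f) (fst g)) (fc_fr H (fr_fst H0) (fr_fst H1))) _).
  symmetry; apply vr, (fc_bot H (fr_fst H0) (fr_fst H1)).
- intros; cbn. assert (e := f_equal fst H0); cbn in e.
  refine (eq_trans (act_id H (f := id1 (fst X)) (fu_fr H e)) _).
  symmetry; apply vr, (fu_bot H e).
- intros; split; apply (bi_lid (framed_bicat H)).
- intros; split; apply (bi_lid (framed_bicat H)).
Qed.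

Lemma sndf_ff : ffun (prodfr φ ψ) ψ (sndf B C) (dsnd D E) (fun _ _ _ π => snd π).
Proof.
split.
- split; intros; cbn; auto; try apply (fr_snd H0). apply visoS_fst; auto.
- apply dsnd_ax.
- auto.
- intros; cbn.
  refine (eq_trans (act_id K (f := comp1 (snd f) (snd g)) (fc_fr K (fr_snd H0) (fr_snd H1))) _).
  symmetry; apply vr, (fc_bot K (fr_snd H0) (fr_snd H1)).
- intros; cbn. assert (e := f_equal snd H0); cbn in e.
  refine (eq_trans (act_id K (f := id1 (snd X)) (fu_fr K e)) _).
  symmetry; apply vr, (fu_bot K e).
- intros; split; apply (bi_lid (framed_bicat K)).
- intros; split; apply (bi_lid (framed_bicat K)).
Qed.

Lemma bangf_ff : ffun φ unitfr (bangf B) (dbang D) (fun _ _ _ _ => tt).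
Proof.
split; try (intros; split; intros; cbn; auto; fail).
split; intros; cbn; auto.
- split; cbn; auto; intros; destruct (FV (dbang D) b); auto.
- exists tt; cbn; auto.
Qed.

Lemma constf_ff (Z : C) : ffun φ ψ (constf B Z) (dconst D (fo ψ Z))
  (fun _ _ _ _ => fu ψ Z (vid (fo ψ Z))).
Proof.
assert (d := vdom_id (fo ψ Z)); assert (u := fu_fr K d); assert (bu := fu_bot K d).
rewrite vcod_id in bu.
assert (up : fu ψ Z (vid (fo ψ Z)) ÷ hidS (vid (fo ψ Z)) = fu ψ Z (vid (fo ψ Z))).
{ rewrite hidS_id; apply vr; auto. }
split.
- split; intros; cbn; auto. apply (fu_iso K d), viso_id.
- apply dconst_ax.
- intros; cbn; apply (act_id K u).
- intros; cbn. refine (eq_trans (fi_lun K u) _).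
  rewrite hidS_id; symmetry; apply vr; rewrite (fc_bot K u u), bu; gb.
- intros; cbn. rewrite up. apply (act_id K u).
- intros; apply (bi_lunK (framed_bicat K)).
- intros; split; apply (bi_lid (framed_bicat K)).
Qed.

Lemma pairf_ff {F0 : A -> B} {G0 : A -> C} {F : psfun F0} {F' : psfun G0} {Fh : pdfun L D}
  {Gh : pdfun L E} {Fr : forall X Y : A, hom X Y -> dsq L -> dsq D}
  {Gr : forall X Y : A, hom X Y -> dsq L -> dsq E} (P : ffun χ φ F Fh Fr) (Q : ffun χ ψ F' Gh Gr) :
  ffun χ (prodfr φ ψ) (pairf F F') (dpair Fh Gh) (fun _ _ f π => (Fr _ _ f π, Gr _ _ f π)).
Proof.
assert (M := ff_map P); assert (N := ff_map Q).
split.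
- split; intros; cbn.
  + f_equal; [apply (fm_o M)|apply (fm_o N)].
  + apply fr_both; cbn; [apply (fm_fr M H0)|apply (fm_fr N H0)].
  + f_equal; [apply (fm_bot M H0)|apply (fm_bot N H0)].
  + f_equal; [apply (fm_post M H0)|apply (fm_post N H0)]; auto.
  + apply visoS_pair; [apply (fm_iso M H0)|apply (fm_iso N H0)]; auto.
- apply dpair_ax; [apply (ff_ax P)|apply (ff_ax Q)].
- intros; cbn; f_equal; [apply (ff_cell P _ H0)|apply (ff_cell Q _ H0)].
- intros; cbn; f_equal; [apply (ff_comp P H0 H1)|apply (ff_comp Q H0 H1)].
- intros; cbn; f_equal; [apply (ff_unit P H0)|apply (ff_unit Q H0)].
- intros; destruct (ff_ciso P f g), (ff_ciso Q f g); split; apply injective_projections; auto.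
- intros; destruct (ff_uiso P X), (ff_uiso Q X); split; apply injective_projections; auto.
Qed.

(** The compositor of a composite is the image of the first compositor, conjugated by those of the
    second functor. Its factors act as the compositor of [Gh] followed by the image of that of [Fh],
    which together form the compositor of [dcomp Fh Gh]. *)
Lemma compf_ff {F0 : A -> B} {G0 : B -> C} {F : psfun F0} {F' : psfun G0} {Fh : pdfun L D}
  {Gh : pdfun D E} {Fr : forall X Y : A, hom X Y -> dsq L -> dsq D}
  {Gr : forall X Y : B, hom X Y -> dsq D -> dsq E} (P : ffun χ φ F Fh Fr) (Q : ffun φ ψ F' Gh Gr) :
  ffun χ ψ (compf F F') (dcomp Fh Gh) (fun _ _ f π => Gr _ _ (F # f) (Fr _ _ f π)).
Proof.
assert (M := ff_map P); assert (N := ff_map Q).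
assert (pQ := framed_psfun H K Q); assert (bK := framed_bicat K).
split.
- split; intros; cbn.
  + rewrite (fm_o N), (fm_o M); auto.
  + apply (fm_fr N (fm_fr M H0)).
  + rewrite (fm_bot N (fm_fr M H0)), (fm_bot M H0); auto.
  + rewrite (fm_post M H0 H1). apply (fm_post N (fm_fr M H0)).
    rewrite FS_top, H1, (fm_bot M H0); auto.
  + apply (fm_iso N (fm_fr M H0)), (fm_iso M H0), H1.
- apply dcomp_ax; [apply (ff_ax P)|apply (ff_ax Q)].
- intros; cbn; rewrite (ff_cell Q _ (fm_fr M H0)), (ff_cell P _ H0); auto.
- intros X Y Z f g a b c π π' h h'; cbn [compf fcomp fwd].
  assert (x := fm_fr M h); assert (x' := fm_fr M h'); assert (y := fc_fr G h h').
  assert (T : top (F2c Fh (bot π) (bot π')) = bot (fc φ (F # f) (F # g) (Fr _ _ f π) (Fr _ _ g π'))).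
  { destruct (fr_hbot G h), (fr_hbot G h').
    rewrite (fc_bot H x x'), (fm_bot M h), (fm_bot M h'), F2c_top; congruence. }
  unfold fcell.
  stp K (fm_fr N (fm_fr M y)) (act_id K (f := F' # F # comp1 f g) (fm_fr N (fm_fr M y))).
  stp K (fm_fr N (fm_fr M y)) (ff_cell Q _ (fm_fr M y)).
  assert (E1 := ff_comp P h h').
  refine (eq_trans (f_equal (fun z => cs ψ (ffold F' ⟪F # f; F # g⟫) ÷ Gr _ _ _ z) E1) _).
  assert (z := fc_fr H x x').
  refine (eq_trans (f_equal (fun z => cs ψ (ffold F' ⟪F # f; F # g⟫) ÷ z) (fm_post N z T)) _).
  assert (w := fc_fr K (fm_fr N x) (fm_fr N x')).
  assert (zz := fm_fr N z).
  cbn [ffold ffold_from peval peval_from fpath].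
  assert (T2 : top (FS Gh (F2c Fh (bot π) (bot π'))) = bot (Gr _ _ (comp1 (F # f) (F # g)) (fc φ (F # f) (F # g) (Fr _ _ f π) (Fr _ _ g π')))).
  { rewrite FS_top, T, (fm_bot N z); auto. }
  refine (eq_trans (act_post K _ zz T2) _).
  cbn [dcomp F2c].
  transitivity (fc ψ (F' # F # f) (F' # F # g) (Gr _ _ (F # f) (Fr _ _ f π)) (Gr _ _ (F # g) (Fr _ _ g π'))
    ÷ F2c Gh (FH Fh (bot π)) (FH Fh (bot π')) ÷ FS Gh (F2c Fh (bot π) (bot π'))).
  + f_equal.
    assert (E2 := ff_comp Q x x'); rewrite (fm_bot M h), (fm_bot M h') in E2.
    refine (act2c K zz E2 _).
    rewrite (bi_hid bK), (cs_id K); apply v1.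
    rewrite top_vcomp; [apply w|].
    rewrite (fc_bot K (fm_fr N x) (fm_fr N x')), (fm_bot N x), (fm_bot N x'), (fm_bot M h), (fm_bot M h'), F2c_top; auto.
    destruct (fr_hbot G h), (fr_hbot G h'); rewrite FH_dom, FH_cod; congruence.
  + destruct (fr_hbot G h), (fr_hbot G h'). apply vA.
    * refine (eq_trans (fc_bot K (fm_fr N x) (fm_fr N x')) _); rewrite (fm_bot N x), (fm_bot N x'), (fm_bot M h), (fm_bot M h'), F2c_top; auto.
      rewrite FH_dom, FH_cod; congruence.
    * rewrite FS_top, F2c_bot, F2c_top; auto; rewrite ?FH_dom, ?FH_cod; congruence.
- intros X a h; cbn [compf funit fwd].
  assert (y := fu_fr G h). assert (U := ff_unit P h).
  assert (dF := fr_left H (fm_fr M y)).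
  assert (x := fu_fr H dF). assert (U2 := ff_unit Q dF).
  assert (dG := fr_left K (fm_fr N x)).
  rewrite FV_cod in U2.
  unfold fcell.
  stp K (fm_fr N (fm_fr M y)) (act_id K (f := F' # F # id1 X) (fm_fr N (fm_fr M y))).
  stp K (fm_fr N (fm_fr M y)) (ff_cell Q _ (fm_fr M y)).
  refine (eq_trans (f_equal (fun z => cs ψ (ffold F' ⟪⟫) ÷ Gr _ _ _ z) U) _).
  assert (T : top (F2u Fh (vcod a)) = bot (fu φ (F0 X) (FV Fh a))).
  { rewrite F2u_top, (fu_bot H dF), FV_cod; auto. }
  refine (eq_trans (f_equal (fun z => cs ψ (ffold F' (@pnil _ _)) ÷ z) (fm_post N x T)) _).
  refine (eq_trans (act_post K _ (fm_fr N x) _) _).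
  { rewrite FS_top, T, (fm_bot N x); auto. }
  refine (eq_trans (f_equal (fun z => z ÷ _) U2) _).
  cbn [dcomp F2u]; apply vA.
  + refine (eq_trans (fu_bot K dG) _); rewrite F2u_top, !FV_cod; auto.
  + rewrite F2u_bot, FS_top, F2u_top; auto.
- intros; apply (fiso_iso bK pQ (ff_ciso P f g)).
- intros; apply (fiso_iso bK pQ (ff_uiso P X)).
Qed.

End Combinators.

(** * Pseudofunctors induced by pseudodouble functors *)

Section Strict.
Context {B : bicat} {C D : double_category} {φ : framing B C} (H : is_framing φ).
Local Notation HD := (Horiz D).

(** The property shared by [Horiz D], its products and the unit: frames compose as squares do. Under
    it, a pseudofunctor read off from a pseudodouble functor [Fh] transports frames by [FS Fh]
    ([strict_ff]). *)
Record strict_framing : Prop := {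
  sf_w : forall Y b, fw φ Y b = b;
  sf_c : forall (X Y Z : B) (f : hom X Y) (g : hom Y Z) π π', fc φ f g π π' = π ∥ π';
  sf_u : forall X a, fu φ X a = hidS a }.
Context (S : strict_framing).

Lemma sf_comp (X Y Z : B) (f : hom X Y) (g : hom Y Z) :
  fh φ (comp1 f g) = hcomp (fh φ f) (fh φ g) /\ hcod (fh φ f) = fo φ Y /\ hdom (fh φ g) = fo φ Y.
Proof.
destruct (good_fr H f (good_id H X)) as (b & π & G & h & I).
destruct (good_fr H g G) as (b' & π' & G' & h' & I').
assert (e := fr_top (fc_fr H h h')).
assert (l : rgt π = lft π') by (rewrite (fr_rgt h), (fr_lft h'); apply (sf_w S)).
rewrite (sf_c S), top_hcomp, (fr_top h), (fr_top h') in e by auto.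
repeat split; auto.
- rewrite (fh_cod H f (fr_dom h)), (sf_w S); apply h.
- apply (fh_dom H).
Qed.

Lemma strict_ff {F0 : B -> HD} (F : psfun F0) (Fh : pdfun C D) (P : is_pdfun Fh) :
  (forall X, F0 X = Fh (fo φ X)) ->
  (forall (X Y : B) (f : hom X Y), hval (F # f) = FH Fh (fh φ f)) ->
  (forall (X Y : B) (f g : hom X Y) (c : cell f g), sval (f2 F c : gcell _ _) = FS Fh (cs φ c)) ->
  (forall (X Y Z : B) (f : hom X Y) (g : hom Y Z),
    sval (fwd (fcomp F f g) : gcell _ _) = F2c Fh (fh φ f) (fh φ g) /\
    sval (bwd (fcomp F f g) : gcell _ _) = F2c' Fh (fh φ f) (fh φ g)) ->
  (forall X, sval (fwd (funit F X) : gcell _ _) = F2u Fh (fo φ X) /\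
    sval (bwd (funit F X) : gcell _ _) = F2u' Fh (fo φ X)) ->
  ffun φ (horizfr D) F Fh (fun _ _ _ π => FS Fh π).
Proof.
intros e0 e1 e2 e3 e4; split; auto.
- split; cbn; intros; auto.
  + destruct H0 as [q1 q2 q3 q4]; apply frH; rewrite ?FS_top, ?FS_lft, ?FS_rgt; try congruence.
    rewrite q3, (sf_w S); auto.
  + apply FS_bot.
  + apply (FS_vcomp P); auto.
  + apply (visoS_map P); auto.
- intros; cbn; rewrite e2, <- (FS_vcomp P); auto. apply (act_top H _ H0).
- intros; refine (eq_trans (f_equal (fun z => z ÷ _) (proj1 (e3 _ _ _ f g))) _); cbn; rewrite (sf_c S), <- (fr_top H0), <- (fr_top H1).
  symmetry; apply (F2c_nat P). rewrite (fr_rgt H0), (fr_lft H1); apply (sf_w S).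
- intros; refine (eq_trans (f_equal (fun z => z ÷ _) (proj1 (e4 X))) _); cbn; rewrite (sf_u S), <- H0; symmetry; apply (F2u_nat P).
- intros; destruct (sf_comp f g) as (_ & c1 & c2), (e3 _ _ _ f g) as [a1 a2].
  split; apply gcell_eq.
  + refine (eq_trans (f_equal2 (fun y z => y ÷ z) a1 a2) _); cbn.
    rewrite (F2c_inv P), !e1; congruence.
  + refine (eq_trans (f_equal2 (fun y z => y ÷ z) a2 a1) _); cbn.
    rewrite (F2c'_inv P), !e1, (proj1 (sf_comp f g)); congruence.
- intros; destruct (e4 X) as [a1 a2].
  assert (U := fr_top (fu_fr H (vdom_id (fo φ X)))).
  rewrite (sf_u S), top_hid, vdom_id in U.
  split; apply gcell_eq.
  + refine (eq_trans (f_equal2 (fun y z => y ÷ z) a1 a2) _); cbn.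
    rewrite (F2u_inv P), e0; auto.
  + refine (eq_trans (f_equal2 (fun y z => y ÷ z) a2 a1) _); cbn.
    rewrite (F2u'_inv P), e1, U; auto.
Qed.
End Strict.

(** * Companion-lifts acting on frames *)

Section Lift.
Context {C D : double_category}.
Context {F G : pdfun C D} (a : vtrans F G) (i : invertible a) (l : liftable a).

Lemma va_iso A : viso (a A).
Proof.
assert (V := visoS_lft (visoS_vi (i (hid A)))); rewrite va_lft, hdom_id in V; exact V.
Qed.

(** Interchange pairs the columns of [[iota | a_f | eps]] with those below: [iota / eps] is an
    identity, naturality moves [s] through [a_f], and the last [eps] is continued by a horizontal
    identity. *)
Lemma lift_act (A B : dob C) f s x y : top s = f -> lft s = x -> rgt s = y ->
  hdom f = A -> hcod f = B ->
  hcompS (hcompS (iot (l A)) (va_h a f)) (eps (l B)) ÷ ((eps (l A) ÷ hidS (FV G x)) ∥ FS G s)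
  = (FS F s ÷ va_h a (bot s)) ∥ (eps (l B) ÷ hidS (FV G y)).
Proof.
intros <- <- <- <- <-.
destruct (companion_ax (l (hdom (top s)))) as [k1 k2]; cbn in k1, k2.
rewrite va_natS.
assert (c1 := va_cod a (hdom (top s))); assert (c2 := va_cod a (hcod (top s))).
assert (d1 := va_dom a (hdom (top s))); assert (d2 := va_dom a (hcod (top s))).
assert (e1 := dom_top s); assert (e2 := cod_top s).
rewrite hA by gb.
rewrite <- (@hr _ (FS G s) (FV G (rgt s))) by gb.
rewrite exch; try (gb; fail).
rewrite <- vA, k2, <- hidS_v by gb.
rewrite exch by gb.
rewrite <- hA, h1, hr by gb; auto.
Qed.

(** The computation for the inverse cell: the vertical cells inserted beside [a_f^-1] cancel against
    the sides of [a_f], and [a_f^-1 / a_f] disappears. *)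
Lemma lift_act' (A B : dob C) f : hdom f = A -> hcod f = B ->
  hcompS (hcompS (vcompS (eps (l A)) (hidS (lft (i f)))) (i f)) (vcompS (hidS (rgt (i f))) (iot (l B)))
   ÷ (va_h a f ∥ eps (l B)) = eps (l A) ∥ vidS (FH G f).
Proof.
intros <- <-.
destruct (companion_ax (l (hcod f))) as [k1 k2]; cbn in k1, k2.
assert (t1 := vi_top (i f)); assert (t2 := vi_bot (i f)).
assert (R := vi_r (i f)); assert (R' := vi_l (i f)).
set (t := vi (i f)) in *; clearbody t.
destruct (visoS_sides t1 t2 R' R) as [[s1 s2] [s3 s4]].
destruct (bot_lr t2) as [b1 b2]; destruct (bot_lr (eq_sym t1)) as [b3 b4].
rewrite va_lft in s1, s2, b1, b3; rewrite va_rgt in s3, s4, b2, b4.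
rewrite va_bot in t1; rewrite va_top in t2; rewrite va_dom in b1, b2, s1, s3.
rewrite va_cod in b3, b4, s2, s4.
assert (E1 : (eps (l (hdom f)) ÷ hidS (lft t)) ÷ hidS (a (hdom f)) = eps (l (hdom f))).
{ rewrite vA, <- hidS_v, s2, hidS_id, vr by gb; auto. }
assert (E2 : (hidS (rgt t) ÷ iot (l (hcod f))) ÷ eps (l (hcod f)) = hidS (vid (G (hcod f)))).
{ rewrite vA, k2, <- hidS_v, s4 by gb; auto. }
rewrite <- (@Submission.h1 _ (va_h a f) (a (hdom f))) by gb.
assert (m1 : rgt (eps (l (hdom f)) ÷ hidS (lft t)) = lft t).
{ rewrite rgt_vcomp, eps_rgt, rgt_hid, va_cod, u1 by gb; auto. }
assert (m2 : rgt t = lft (hidS (rgt t) ÷ iot (l (hcod f)))).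
{ rewrite lft_vcomp, iot_lft, lft_hid, va_dom, ur by gb; auto. }
rewrite exch.
- rewrite E2, exch, E1, R, va_bot by gb. rewrite hr by gb; auto.
- rewrite rgt_hcomp; auto.
- gb.
- rewrite !bot_hcomp by gb. rewrite bot_vcomp by gb. gb.
- rewrite bot_vcomp by gb; gb.
Qed.

End Lift.

(** * Combinators of framed transformations *)

Section Nat.
Context {B C : bicat} {D E : double_category} {φ : framing B D} {ψ : framing C E}.
Context (H : is_framing φ) (K : is_framing ψ).
Context {F0 G0 : B -> C} {F : map1 F0} {G : map1 G0} {fv gv : dv D -> dv E} {fk gk : dh D -> dh E}
    {Fr Gr : forall X Y : B, hom X Y -> dsq D -> dsq E}
    {s : forall X, hom (F0 X) (G0 X)} {n : psnat F G s}
    {av : dob D -> dv E} {ah : dh D -> dsq E} {e : B -> dsq E}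
    (N : fnat φ ψ fv gv fk gk Fr Gr n av ah e).

(** In a composite the second transformation adds its square below that of the first, so the
    naturality equation is needed with an arbitrary continuation [t] of the target frame. *)
Lemma fn_eq_post (X Y : B) (f : hom X Y) a b π t : fr φ f a b π -> top t = gk (bot π) ->
  cs ψ (fwd (n X Y f)) ÷ fc ψ (s X) (G f) (e X ÷ hidS (gv a ∙ lft t)) (Gr f π ÷ t)
  = fc ψ (F f) (s Y) (Fr f π ÷ ah (bot π) ÷ t) (e Y ÷ hidS (gv b ∙ rgt t)).
Proof.
intros h et.
destruct (fn_G N h) as [g bg], (fn_F N h) as [x bx].
assert (c := fn_cods K N h); destruct c as (c1 & c2 & c3 & c4).
assert (sX := fn_fr2 H K N (fr_left H h)); assert (sY := fn_fr2 H K N (fr_dom h)).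
assert (y := fn_fr1 H K N h); assert (tg := fn_target H K N h).
assert (gX := fn_gdom H K N (fr_left H h)); assert (gY := fn_gdom H K N (fr_dom h)).
assert (bX := fn_bot2 H K N (fr_left H h)); assert (bY := fn_bot2 H K N (fr_dom h)).
assert (l1 : vcod (gv a) = vdom (lft t)) by (rewrite <- dom_top, et; auto).
assert (l2 : vcod (gv b) = vdom (rgt t)) by (rewrite <- cod_top, et; auto).
rewrite <- (cf_post2 (fn_cf N X) gX l1), <- (cf_post2 (fn_cf N Y) gY l2).
assert (bF : bot (Fr f π ÷ ah (bot π)) = top t).
{ rewrite bot_vcomp, (fn_abot N); auto. rewrite (fn_atop N); auto. }
transitivity (cs ψ (fwd (n X Y f)) ÷ (fc ψ (s X) (G f) (e X ÷ hidS (gv a)) (Gr f π) ÷ t)).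
- f_equal; rewrite (fc_post K sX g); rewrite ?top_hid, ?rgt_hid; try congruence.
  rewrite h1; auto.
- refine (eq_trans (act_post K (f := comp1 (F f) (s Y)) (fwd (n X Y f)) tg _) _).
  { rewrite (fc_bot K sX g), bX, et, bg; symmetry; apply hunitl; auto. }
  refine (eq_trans (f_equal (fun z => z ÷ t) (fn_eq N h)) _).
  rewrite (fc_post K y sY); rewrite ?top_hid, ?lft_hid; try congruence.
  rewrite hr; auto.
Qed.

Lemma fn_eq_post' (X Y : B) (f : hom X Y) a b π t : fr φ f a b π -> top t = gk (bot π) ->
  cs ψ (bwd (n X Y f)) ÷ fc ψ (F f) (s Y) (Fr f π ÷ ah (bot π) ÷ t) (e Y ÷ hidS (gv b ∙ rgt t))
  = fc ψ (s X) (G f) (e X ÷ hidS (gv a ∙ lft t)) (Gr f π ÷ t).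
Proof.
intros h et.
destruct (fn_G N h) as [g bg].
destruct (fn_cods K N h) as (c1 & c2 & c3 & c4).
assert (l1 : vcod (gv a) = vdom (lft t)) by (rewrite <- dom_top, et; auto).
assert (gX := fn_gdom H K N (fr_left H h)).
assert (x := cf_post K (fn_cf N X) (a := gv a ∙ lft t)).
assert (y := fr_post K (s := t) g); rewrite et, bg in y.
eapply (act_inv K (f := comp1 (F f) (s Y)) (c := fwd (n X Y f))).
- apply (fc_fr K (x ltac:(rewrite vdom_comp; auto)) (y eq_refl)).
- apply (fn_iso N f).
- apply fn_eq_post; auto.
Qed.

Context {B' : bicat} {D' : double_category} {φ' : framing B' D'}.

Lemma fn_pre {K0 : B' -> B} {k : map1 K0} {Kh : pdfun D' D} {Kr : forall X Y : B', hom X Y -> dsq D' -> dsq D}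
  (M : fmap φ' φ k Kh Kr) (H' : is_framing φ') (Q : is_pdfun Kh) :
  fnat φ' ψ (fun v => fv (FV Kh v)) (fun v => gv (FV Kh v)) (fun x => fk (FH Kh x)) (fun x => gk (FH Kh x))
    (fun X Y f π => Fr (k X Y f) (Kr X Y f π)) (fun X Y f π => Gr (k X Y f) (Kr X Y f π))
    (pren k n) (fun A => av (Kh A)) (fun x => ah (FH Kh x)) (fun X => e (K0 X)).
Proof.
split; cbn; intros.
- destruct (fn_F N (fm_fr M H0)); rewrite (fm_bot M H0) in *; auto.
- destruct (fn_G N (fm_fr M H0)); rewrite (fm_bot M H0) in *; auto.
- apply (fn_Giso N (fm_fr M H0) (fm_iso M H0 H1)).
- apply (fn_Fiso N (fm_fr M H0) (fm_iso M H0 H1)).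
- apply (fn_aiso N).
- apply (fn_gv N), (viso_map Q); auto.
- apply (fn_cf N).
- rewrite (fn_lft N), (fm_o M); auto.
- apply (fn_atop N).
- apply (fn_abot N).
- rewrite (fn_alft N), FH_dom; auto.
- rewrite (fn_argt N), FH_cod; auto.
- rewrite <- FV_cod; apply (fn_fcod N).
- rewrite <- FV_dom; apply (fn_gdom' N).
- rewrite <- FV_cod, <- FV_dom; apply (fn_nat N).
- apply (fn_iso N).
- rewrite <- (fm_bot M H0); apply (fn_eq N (fm_fr M H0)).
Qed.

Context {G0' : B -> C} {G' : map1 G0'} {gv' : dv D -> dv E} {gk' : dh D -> dh E}
    {Gr' : forall X Y : B, hom X Y -> dsq D -> dsq E}
    {s' : forall X, hom (G0 X) (G0' X)} {n' : psnat G G' s'}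
    {av' : dob D -> dv E} {ah' : dh D -> dsq E} {e' : B -> dsq E}
    (N' : fnat φ ψ gv gv' gk gk' Gr Gr' n' av' ah' e').

Lemma fn_comp : fnat φ ψ fv gv' fk gk' Fr Gr' (compn n n') (fun A => av A ∙ av' A)
  (fun k => ah k ÷ ah' k) (fun X => fc ψ (s X) (s' X) (e X ÷ hidS (lft (e' X))) (e' X)).
Proof.
assert (cc : forall X : B, vcod (av (fo φ X)) = vdom (av' (fo φ X))).
{ intros X; rewrite <- (fn_lft N), <- (fn_lft N'), (cf_cod (fn_cf N X)), (cf_dom K (fn_cf N' X)); auto. }
assert (ch : forall k, bot (ah k) = top (ah' k)) by (intros; rewrite (fn_abot N), (fn_atop N'); auto).
assert (cA : forall A, vcod (av A) = vdom (av' A)).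
{ intros A; assert (Z := f_equal (@hdom E) (ch (hid A))).
  rewrite dom_bot, dom_top, (fn_alft N), (fn_alft N'), hdom_id in Z; auto. }
(* Both directions of the composite naturality cell are evaluated together with their frames:
   [pid_iso] then reads its invertibility off the two actions. *)
assert (W : forall (X Y : B) (f : hom X Y) a b π, fr φ f a b π ->
  cs ψ (fwd (compn n n' X Y f)) ÷
    fc ψ (comp1 (s X) (s' X)) (G' f) (fc ψ (s X) (s' X) (e X ÷ hidS (lft (e' X))) (e' X) ÷ hidS (gv' a)) (Gr' f π)
  = fc ψ (F f) (comp1 (s Y) (s' Y)) (Fr f π ÷ (ah (bot π) ÷ ah' (bot π)))
     (fc ψ (s Y) (s' Y) (e Y ÷ hidS (lft (e' Y))) (e' Y) ÷ hidS (gv' b)) /\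
  cs ψ (bwd (compn n n' X Y f)) ÷
    fc ψ (F f) (comp1 (s Y) (s' Y)) (Fr f π ÷ (ah (bot π) ÷ ah' (bot π)))
     (fc ψ (s Y) (s' Y) (e Y ÷ hidS (lft (e' Y))) (e' Y) ÷ hidS (gv' b))
  = fc ψ (comp1 (s X) (s' X)) (G' f) (fc ψ (s X) (s' X) (e X ÷ hidS (lft (e' X))) (e' X) ÷ hidS (gv' a)) (Gr' f π)
  /\ fr ψ (comp1 (F f) (comp1 (s Y) (s' Y))) (fv a ∙ av (vcod a) ∙ av' (vcod a)) (gv' b)
    (fc ψ (F f) (comp1 (s Y) (s' Y)) (Fr f π ÷ (ah (bot π) ÷ ah' (bot π)))
     (fc ψ (s Y) (s' Y) (e Y ÷ hidS (lft (e' Y))) (e' Y) ÷ hidS (gv' b))) /\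
    fr ψ (comp1 (comp1 (s X) (s' X)) (G' f)) (fv a ∙ av (vcod a) ∙ av' (vcod a)) (gv' b)
    (fc ψ (comp1 (s X) (s' X)) (G' f) (fc ψ (s X) (s' X) (e X ÷ hidS (lft (e' X))) (e' X) ÷ hidS (gv' a)) (Gr' f π))).
{ intros X Y f a b π h.
  assert (dX := fr_left H h); assert (dY := fr_dom h).
  destruct (fr_hbot H h) as [hb1 hb2].
  destruct (fn_G N' h) as [g bg], (fn_F N h) as [x bx], (fn_G N h) as [x' bx'].
  rewrite !(fc_cf_post K (fn_cf N _) (fn_cf N' _)) by (apply (fn_gdom H K N'); auto).
  assert (gX := fn_gdom H K N dX); assert (gY := fn_gdom H K N dY).
  assert (gX' := fn_gdom H K N' dX); assert (gY' := fn_gdom H K N' dY).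
  assert (vX : lft (e' X) ∙ gv' a = gv a ∙ av' (vcod a)).
  { rewrite (fn_lft N'), <- dX; symmetry; apply (fn_nat N'). }
  assert (vY : lft (e' Y) ∙ gv' b = gv b ∙ av' (vcod b)).
  { rewrite (fn_lft N'), <- dY; symmetry; apply (fn_nat N'). }
  assert (cX : vdom (gv a ∙ av' (vcod a)) = fo ψ (G0 X)).
  { rewrite <- vX, vdom_comp; [apply (cf_dom K (fn_cf N' X))|]. rewrite (cf_cod (fn_cf N' X)); auto. }
  assert (cY : vdom (gv b ∙ av' (vcod b)) = fo ψ (G0 Y)).
  { rewrite <- vY, vdom_comp; [apply (cf_dom K (fn_cf N' Y))|]. rewrite (cf_cod (fn_cf N' Y)); auto. }
  rewrite vX, vY.
  assert (q1 := fn_fr2 H K N' dX); assert (q2 := fn_fr2 H K N' dY).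
  assert (q3 := fn_fr1 H K N' h).
  assert (q4 := fr_post K (s := ah' (bot π)) (fn_fr1 H K N h)).
  rewrite (fn_alft N'), (fn_argt N'), hb1, hb2, vA in q4; auto.
  2:{ rewrite (fn_atop N); auto. }
  specialize (q4 ltac:(rewrite bot_vcomp, ch; auto; rewrite (fn_atop N); auto)).
  assert (q5 := cf_post K (fn_cf N X) cX); assert (q6 := cf_post K (fn_cf N Y) cY).
  assert (E1 : lft (e X) ∙ (gv a ∙ av' (vcod a)) = fv a ∙ av (vcod a) ∙ av' (vcod a)).
  { rewrite (fn_lft N), <- dX, (fn_nat N), uA; auto.
    - rewrite dX, <- (fn_lft N), (cf_cod (fn_cf N X)), gX; auto.
    - rewrite <- (fr_lft x'), <- dom_bot, bx', <- (fn_atop N'), dom_top, (fn_alft N'), hb1; auto. }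
  assert (E2 : lft (e Y) ∙ (gv b ∙ av' (vcod b)) = fv b ∙ av (vcod b) ∙ av' (vcod b)).
  { rewrite (fn_lft N), <- dY, (fn_nat N), uA; auto.
    - rewrite dY, <- (fn_lft N), (cf_cod (fn_cf N Y)), gY; auto.
    - destruct (fr_hbot K x') as [_ z]; rewrite <- z, bx', <- (fn_atop N'), cod_top, (fn_argt N'), hb2; auto. }
  rewrite E1 in q5; rewrite E2 in q6.
  assert (eq1 := fn_eq N' h); assert (eq2 := fn_eq_post h (fn_atop N' (bot π))).
  assert (eq1' := fn_eq' H K N' h); assert (eq2' := fn_eq_post' h (fn_atop N' (bot π))).
  rewrite (fn_alft N'), (fn_argt N'), hb1, hb2, vA in eq2, eq2'; auto;
    try (rewrite (fn_atop N); auto).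
  assert (p1 := fc_fr K q5 q1); assert (p2 := fc_fr K q6 q2).
  assert (T1 := fc_fr K p1 g); assert (T4 := fc_fr K q4 p2).
  assert (T2 := fc_fr K q5 (fc_fr K q1 g)).
  assert (T3 := fc_fr K q4 (fc_fr K q6 q2)).
  assert (T25 := fc_fr K q5 (fc_fr K q3 q2)).
  repeat split; [| |apply T4|apply T4|apply T4|apply T4|apply T1|apply T1|apply T1|apply T1].
  - stp K T1 (actl K (q := ⟪s X; s' X⟫) (q' := ⟪comp1 (s X) (s' X)⟫) (r := ⟪G' f⟫) (k := [_; _]) (k' := [_]) (t := [_])
      (okf2 q5 q1) (okf1 p1) (okf1 g) (act_id K (f := comp1 (s X) (s' X)) p1)).
    stp K T2 (actr K (p := ⟪s X⟫) (q := ⟪G f; s' Y⟫) (q' := ⟪s' X; G' f⟫) (l := [_]) (k := [_; _]) (k' := [_; _])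
      (okf1 q5) (okf2 q3 q2) (okf2 q1 g) eq1).
    stp K T25 (actl K (q := ⟪F f; s Y⟫) (q' := ⟪s X; G f⟫) (r := ⟪s' Y⟫) (k := [_; _]) (k' := [_; _]) (t := [_])
      (okf2 q4 q6) (okf2 q5 q3) (okf1 q2) eq2).
    refine (actr K (p := ⟪F f⟫) (q := ⟪comp1 (s Y) (s' Y)⟫) (q' := ⟪s Y; s' Y⟫) (l := [_]) (k := [_]) (k' := [_; _])
      (okf1 q4) (okf1 p2) (okf2 q6 q2) (act_id K (f := comp1 (s Y) (s' Y)) p2)).
  - stp K T4 (actr K (p := ⟪F f⟫) (q := ⟪s Y; s' Y⟫) (q' := ⟪comp1 (s Y) (s' Y)⟫) (l := [_]) (k := [_; _]) (k' := [_])
      (okf1 q4) (okf2 q6 q2) (okf1 p2) (act_id K (f := comp1 (s Y) (s' Y)) p2)).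
    stp K T3 (actl K (q := ⟪s X; G f⟫) (q' := ⟪F f; s Y⟫) (r := ⟪s' Y⟫) (k := [_; _]) (k' := [_; _]) (t := [_])
      (okf2 q5 q3) (okf2 q4 q6) (okf1 q2) eq2').
    stp K T25 (actr K (p := ⟪s X⟫) (q := ⟪s' X; G' f⟫) (q' := ⟪G f; s' Y⟫) (l := [_]) (k := [_; _]) (k' := [_; _])
      (okf1 q5) (okf2 q1 g) (okf2 q3 q2) eq1').
    refine (actl K (q := ⟪comp1 (s X) (s' X)⟫) (q' := ⟪s X; s' X⟫) (r := ⟪G' f⟫) (k := [_]) (k' := [_; _]) (t := [_])
      (okf1 p1) (okf2 q5 q1) (okf1 g) (act_id K (f := comp1 (s X) (s' X)) p1)). }
split; intros.
- apply (fn_F N H0).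
- apply (fn_G N' H0).
- apply (fn_Giso N' H0 H1).
- apply (fn_Fiso N H0 H1).
- apply visoS_comp; [apply ch|apply (fn_aiso N)|apply (fn_aiso N')].
- apply (fn_gv N' H0).
- apply (fc_cf K (fn_cf N X) (fn_cf N' X)).
- rewrite (fr_lft (fc_fr K (cf_post K (fn_cf N X) (cf_dom K (fn_cf N' X))) (cf_fr (fn_cf N' X)))).
  rewrite (fn_lft N), (fn_lft N'); auto.
- rewrite top_vcomp; auto; apply (fn_atop N).
- rewrite bot_vcomp; auto; apply (fn_abot N').
- rewrite lft_vcomp, (fn_alft N), (fn_alft N'); auto.
- rewrite rgt_vcomp, (fn_argt N), (fn_argt N'); auto.
- rewrite vdom_comp; auto; apply (fn_fcod N).
- rewrite vcod_comp; auto; apply (fn_gdom' N').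
- rewrite <- uA, (fn_nat N), uA, (fn_nat N'), uA; auto; try apply (fn_fcod N); try apply (fn_fcod N').
  + symmetry; apply (fn_gdom' N').
  + symmetry; apply (fn_gdom' N).
- destruct (good_fr H f (good_id H X)) as (b & π & Gb & h & I).
  destruct (good_dom H Gb) as [db Ib].
  destruct (W _ _ _ _ _ _ h) as (w1 & w2 & w3 & w4).
  assert (dX := fr_left H h).
  destruct (fn_G N' h) as [g bg].
  assert (V : visoS (fc ψ (comp1 (s X) (s' X)) (G' f)
    (fc ψ (s X) (s' X) (e X ÷ hidS (lft (e' X))) (e' X) ÷ hidS (gv' (vid (fo φ X)))) (Gr' f π))).
  { assert (c := fc_cf K (fn_cf N X) (fn_cf N' X)).
    apply (fc_iso K (cf_post K c (fn_gdom H K N' dX)) g).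
    - apply (cf_post_iso c (fn_gdom H K N' dX)), (fn_gv N'), viso_id.
    - apply (fn_Giso N' h I). }
  assert (V' : visoS (fc ψ (F f) (comp1 (s Y) (s' Y)) (Fr f π ÷ (ah (bot π) ÷ ah' (bot π)))
     (fc ψ (s Y) (s' Y) (e Y ÷ hidS (lft (e' Y))) (e' Y) ÷ hidS (gv' b)))).
  { assert (c := fc_cf K (fn_cf N Y) (fn_cf N' Y)).
    assert (x1 := cf_post K c (fn_gdom H K N' (fr_dom h))).
    rewrite (fr_lft (fc_fr K (cf_post K (fn_cf N Y) (cf_dom K (fn_cf N' Y))) (cf_fr (fn_cf N' Y)))) in x1.
    destruct (fn_F N h) as [x bx].
    assert (x2 := fr_post K (s := ah (bot π) ÷ ah' (bot π)) x
      ltac:(rewrite top_vcomp, (fn_atop N); auto)).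
    assert (Z : lft (e Y) ∙ lft (e' Y) ∙ gv' b = fv b ∙ rgt (ah (bot π) ÷ ah' (bot π))).
    { destruct (fr_hbot H h) as [_ hb2].
      rewrite rgt_vcomp, (fn_argt N), (fn_argt N'), hb2, (fn_lft N), (fn_lft N'), <- (fr_dom h) by auto.
      symmetry; rewrite <- uA, (fn_nat N), uA, (fn_nat N'), uA; auto; try apply (fn_fcod N); try apply (fn_fcod N').
      + symmetry; apply (fn_gdom' N').
      + symmetry; apply (fn_gdom' N). }
    rewrite Z in x1.
    apply (fc_iso K x2 x1).
    - apply visoS_comp; [rewrite top_vcomp, (fn_atop N); auto|apply (fn_Fiso N h I)|].
      apply visoS_comp; [apply ch|apply (fn_aiso N)|apply (fn_aiso N')].
    - apply (cf_post_iso c (fn_gdom H K N' (fr_dom h))), (fn_gv N'), Ib. }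
  apply (pid_iso K (p := ⟪F f; comp1 (s Y) (s' Y)⟫) (q := ⟪comp1 (s X) (s' X); G' f⟫) w3 w4 V' V w1 w2).
- apply (W _ _ _ _ _ _ H0).
Qed.
End Nat.

Lemma act_hid {B : bicat} {D : double_category} {φ : framing B D} (H : is_framing φ)
  (X Y Z : B) (f : hom X Y) (g : hom Y Z) a b π : fr φ (comp1 f g) a b π ->
  cs φ (hc2 (id2 f) (id2 g)) ÷ π = π.
Proof. intros h; rewrite (bi_hid (framed_bicat H)); apply (act_id H h). Qed.

Section Post.
Context {B C C' : bicat} {D E E' : double_category} {φ : framing B D} {ψ : framing C E}
  {ψ' : framing C' E'}.
Context (H : is_framing φ) (K : is_framing ψ) (K' : is_framing ψ').
Context {F0 G0 : B -> C} {F : map1 F0} {G : map1 G0} {fv gv : dv D -> dv E} {fk gk : dh D -> dh E}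
    {Fr Gr : forall X Y : B, hom X Y -> dsq D -> dsq E}
    {s : forall X, hom (F0 X) (G0 X)} {n : psnat F G s}
    {av : dob D -> dv E} {ah : dh D -> dsq E} {e : B -> dsq E}
    (N : fnat φ ψ fv gv fk gk Fr Gr n av ah e).
Context {H0 : C -> C'} {Hf : psfun H0} {Hh : pdfun E E'}
  {Hr : forall X Y : C, hom X Y -> dsq E -> dsq E'} (Q : ffun ψ ψ' Hf Hh Hr).

(** The naturality cell of the image is conjugated by compositors. Each of them meets a companion,
    whose frame has an identity bottom; so [img] absorbs it and the original equation remains. *)
Lemma fn_post : fnat φ ψ' (fun v => FV Hh (fv v)) (fun v => FV Hh (gv v))
  (fun k => FH Hh (fk k)) (fun k => FH Hh (gk k))
  (fun X Y f π => Hr (F f) (Fr f π)) (fun X Y f π => Hr (G f) (Gr f π))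
  (postn n Hf) (fun A => FV Hh (av A)) (fun k => FS Hh (ah k))
  (fun X => img Hh (fo ψ (G0 X)) (Hr (s X) (e X))).
Proof.
assert (M := ff_map Q); assert (P := ff_ax Q).
split; intros.
- destruct (fn_F N H1) as [x bx]; rewrite (fm_bot M x), bx; split; auto; apply (fm_fr M x).
- destruct (fn_G N H1) as [x bx]; rewrite (fm_bot M x), bx; split; auto; apply (fm_fr M x).
- apply (fm_iso M (proj1 (fn_G N H1))), (fn_Giso N H1 H2).
- apply (fm_iso M (proj1 (fn_F N H1))), (fn_Fiso N H1 H2).
- apply (visoS_map P), (fn_aiso N).
- apply (viso_map P), (fn_gv N), H1.
- apply (img_cf K K' Q (fn_cf N X)).
- rewrite (proj2 (img_cf K K' Q (fn_cf N X))), (fn_lft N); auto.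
- rewrite FS_top, (fn_atop N); auto.
- rewrite FS_bot, (fn_abot N); auto.
- rewrite FS_lft, (fn_alft N); auto.
- rewrite FS_rgt, (fn_argt N); auto.
- rewrite FV_cod, FV_dom, (fn_fcod N); auto.
- rewrite FV_cod, FV_dom, (fn_gdom' N); auto.
- rewrite <- !(FV_comp P), (fn_nat N); auto.
  + symmetry; apply (fn_gdom' N).
  + apply (fn_fcod N).
- apply (fiso_iso (framed_bicat K') (framed_psfun K K' Q) (fn_iso N f)).
- rename H1 into h.
  assert (gX := fn_gdom H K N (fr_left H h)); assert (gY := fn_gdom H K N (fr_dom h)).
  assert (bX := fn_bot2 H K N (fr_left H h)); assert (bY := fn_bot2 H K N (fr_dom h)).
  assert (sX := fn_fr2 H K N (fr_left H h)); assert (sY := fn_fr2 H K N (fr_dom h)).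
  assert (tg := fn_target H K N h); assert (y := fn_fr1 H K N h).
  destruct (fn_G N h) as [g bg]; destruct (fn_F N h) as [x bx].
  rewrite (img_post Q (cf_fr (fn_cf N X)) (cf_bot (fn_cf N X)) gX).
  rewrite (img_post Q (cf_fr (fn_cf N Y)) (cf_bot (fn_cf N Y)) gY).
  assert (TG := fc_fr K' (fr_img K K' Q sX bX) (fm_fr M g)).
  stp K' TG (act2c K' TG (act_hid K' TG) (bwd_comp_l K K' Q sX g bX)).
  stp K' (fm_fr M tg) (ff_cell Q (fwd (n X Y f)) tg).
  assert (E1 := fn_eq N h).
  refine (eq_trans (f_equal (fun z => cs ψ' (ffold Hf ⟪F f; s Y⟫) ÷ Hr _ z) E1) _).
  refine (act2c K' (fm_fr M (fc_fr K y sY)) (fwd_comp_r K K' Q y sY bY) _).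
  refine (eq_trans (act_hid K' (fc_fr K' (fm_fr M y) (fr_img K K' Q sY bY))) _).
  rewrite (fm_post M x); auto. rewrite (fn_atop N); auto.
Qed.

End Post.

Section PairIdn.
Context {A B C : bicat} {L D E : double_category}.
Context {χ : framing A L} {φ : framing B D} {ψ : framing C E}.
Context (G : is_framing χ) (H : is_framing φ) (K : is_framing ψ).

Lemma fn_pair
  {F0 G0 : A -> B} {F1 : map1 F0} {G1 : map1 G0} {fv gv : dv L -> dv D} {fk gk : dh L -> dh D}
  {Fr Gr : forall X Y : A, hom X Y -> dsq L -> dsq D}
  {s : forall X, hom (F0 X) (G0 X)} {n : psnat F1 G1 s}
  {av : dob L -> dv D} {ah : dh L -> dsq D} {e : A -> dsq D}
  (N : fnat χ φ fv gv fk gk Fr Gr n av ah e)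
  {F0' G0' : A -> C} {F1' : map1 F0'} {G1' : map1 G0'} {fv' gv' : dv L -> dv E} {fk' gk' : dh L -> dh E}
  {Fr' Gr' : forall X Y : A, hom X Y -> dsq L -> dsq E}
  {s' : forall X, hom (F0' X) (G0' X)} {n' : psnat F1' G1' s'}
  {av' : dob L -> dv E} {ah' : dh L -> dsq E} {e' : A -> dsq E}
  (N' : fnat χ ψ fv' gv' fk' gk' Fr' Gr' n' av' ah' e') :
  fnat χ (prodfr φ ψ) (fun v => (fv v, fv' v)) (fun v => (gv v, gv' v))
   (fun v => (fk v, fk' v)) (fun v => (gk v, gk' v))
   (fun X Y f π => (Fr _ _ f π, Fr' _ _ f π)) (fun X Y f π => (Gr _ _ f π, Gr' _ _ f π))
   (pairn n n') (fun X => (av X, av' X)) (fun k => (ah k, ah' k)) (fun X => (e X, e' X)).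
Proof.
split; intros; cbn.
- destruct (fn_F N H0), (fn_F N' H0); split; [apply fr_both; auto|f_equal; auto].
- destruct (fn_G N H0), (fn_G N' H0); split; [apply fr_both; auto|f_equal; auto].
- apply visoS_pair; [apply (fn_Giso N H0 H1)|apply (fn_Giso N' H0 H1)].
- apply visoS_pair; [apply (fn_Fiso N H0 H1)|apply (fn_Fiso N' H0 H1)].
- apply visoS_pair; [apply (fn_aiso N)|apply (fn_aiso N')].
- apply viso_pair; [apply (fn_gv N H0)|apply (fn_gv N' H0)].
- destruct (fn_cf N X), (fn_cf N' X); split; cbn.
  + apply fr_both; auto.
  + f_equal; auto.
  + apply visoS_pair; auto.
- f_equal; [apply (fn_lft N)|apply (fn_lft N')].
- f_equal; [apply (fn_atop N)|apply (fn_atop N')].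
- f_equal; [apply (fn_abot N)|apply (fn_abot N')].
- f_equal; [apply (fn_alft N)|apply (fn_alft N')].
- f_equal; [apply (fn_argt N)|apply (fn_argt N')].
- f_equal; [apply (fn_fcod N)|apply (fn_fcod N')].
- f_equal; [apply (fn_gdom' N)|apply (fn_gdom' N')].
- f_equal; [apply (fn_nat N)|apply (fn_nat N')].
- destruct (fn_iso N f), (fn_iso N' f); split; apply injective_projections; auto.
- f_equal; [apply (fn_eq N H0)|apply (fn_eq N' H0)].
Qed.

Lemma fn_idn {F0 : A -> B} {F : map1 F0} {Fh : pdfun L D} {Fr : forall X Y : A, hom X Y -> dsq L -> dsq D}
  (M : fmap χ φ F Fh Fr) (P : is_pdfun Fh) :
  fnat χ φ (FV Fh) (FV Fh) (FH Fh) (FH Fh) Fr Fr (idn F) (fun X => vid (Fh X)) (fun k => vidS (FH Fh k))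
    (fun X => fu φ (F0 X) (vid (fo φ (F0 X)))).
Proof.
assert (bB := framed_bicat H).
split; intros.
- split; [apply (fm_fr M H0)|apply (fm_bot M H0)].
- split; [apply (fm_fr M H0)|apply (fm_bot M H0)].
- apply (fm_iso M H0 H1).
- apply (fm_iso M H0 H1).
- apply visoS_id.
- apply (viso_map P H0).
- apply (cf_id H).
- rewrite (fr_lft (fu_fr H (vdom_id _))), (fm_o M); auto.
- apply top_vid.
- apply bot_vid.
- rewrite lft_vid, FH_dom; auto.
- rewrite rgt_vid, FH_cod; auto.
- rewrite FV_cod, vdom_id; auto.
- rewrite FV_dom, vcod_id; auto.
- rewrite ur, u1; auto; [apply FV_dom|apply FV_cod].
- destruct (bi_lunK bB (F _ _ f)) as [l1 l2], (bi_runK bB (F _ _ f)) as [r1 r2].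
  split; apply cancel_mid; auto.
- assert (x := fm_fr M H0).
  assert (dX := fr_left H x); assert (dY := fr_dom x).
  rewrite !(fu_post H) by (rewrite ?vdom_id, ?vcod_id; auto).
  rewrite !u1 by auto.
  assert (zX := fu_fr H dX); assert (zY := fu_fr H dY).
  refine (act2c H (fc_fr H zX x) (fi_lun' H x) _).
  refine (eq_trans (fi_run H x) _).
  f_equal; symmetry; apply vr, (fm_bot M H0).
Qed.
End PairIdn.

(** * Modifications between framed transformations *)

Section Modif.
Context {B C : bicat} {D E : double_category} {φ : framing B D} {ψ : framing C E}.
Context (H : is_framing φ) (K : is_framing ψ).
Context {F0 G0 : B -> C} {F : map1 F0} {G : map1 G0} {fv gv : dv D -> dv E} {fk gk : dh D -> dh E}
    {Fr Gr : forall X Y : B, hom X Y -> dsq D -> dsq E}.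

(** The components of [m] turn [e'] into [e] and leave the frames of [F f] and [G f] alone. The
    modification axiom then compares two frames that differ only in [ah] and [ah']. *)
Lemma framed_modif {p q : forall X, path (F0 X) (G0 X)}
  {n : psnat F G (fun X => peval (p X))} {n' : psnat F G (fun X => peval (q X))}
  {av av' : dob D -> dv E} {ah ah' : dh D -> dsq E} {e e' : B -> dsq E}
  (N : fnat φ ψ fv gv fk gk Fr Gr n av ah e) (N' : fnat φ ψ fv gv fk gk Fr Gr n' av' ah' e')
  (m : forall X, iso2 (p X) (q X)) :
  (forall X, is_iso2 (m X)) -> (forall X, cs ψ (fwd (m X)) ÷ e' X = e X) ->
  (forall k, ah k = ah' k) -> is_inv_modif m n n'.
Proof.
intros I Em Eh; split; auto; intros X Y f.
destruct (good_frame H f) as (b & π & h & V).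
assert (dX := fr_left H h); assert (dY := fr_dom h).
assert (tg := fn_target H K N' h).
destruct (fn_G N h) as [g bg].
assert (gX := fn_gdom H K N dX); assert (gY := fn_gdom H K N dY).
assert (s1 := cf_post K (fn_cf N X) gX); assert (s2 := cf_post K (fn_cf N' X) gX).
assert (s3 := cf_post K (fn_cf N Y) gY); assert (s4 := cf_post K (fn_cf N' Y) gY).
assert (Em' : forall X a, vdom a = fo ψ (G0 X) -> cs ψ (fwd (m X)) ÷ (e' X ÷ hidS a) = e X ÷ hidS a).
{ intros Z a d; rewrite <- Em; apply (act_post K _ (cf_fr (fn_cf N' Z))).
  rewrite (cf_bot (fn_cf N' Z)), top_hid, d; auto. }
assert (L : forall X, lft (e X) = lft (e' X)).
{ intros Z; rewrite <- Em. apply (fr_lft (fr_act K (fwd (m Z)) (cf_fr (fn_cf N' Z)))). }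
assert (s1' := fn_fr2 H K N dX); assert (s2' := fn_fr2 H K N' dX).
assert (s3' := fn_fr2 H K N dY); assert (s4' := fn_fr2 H K N' dY).
assert (y := fn_fr1 H K N h); assert (y' := fn_fr1 H K N' h).
assert (A1 : fv (vid (fo φ X)) ∙ av' (vcod (vid (fo φ X))) = fv (vid (fo φ X)) ∙ av (vcod (vid (fo φ X)))).
{ rewrite <- (fr_lft s1'), <- (fr_lft s2'), (fr_lft s1), (fr_lft s2), L; auto. }
assert (A2 : fv b ∙ av' (vcod b) = fv b ∙ av (vcod b)).
{ rewrite <- (fr_lft s3'), <- (fr_lft s4'), (fr_lft s3), (fr_lft s4), L; auto. }
rewrite A1 in y', s2'; rewrite A2 in y', s4'.
apply (cell_eq K tg (fn_target_iso H K N' h (viso_id _) V)).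
transitivity (fc ψ (F f) (peval (p Y)) (Fr f π ÷ ah (bot π)) (e Y ÷ hidS (gv b))).
- stp K tg (actl K (q := ⟪peval (p X)⟫) (q' := ⟪peval (q X)⟫) (r := ⟪G f⟫) (k := [_]) (k' := [_]) (t := [_])
    (okf1 s1') (okf1 s2') (okf1 g) (Em' X _ gX)).
  apply (fn_eq N h).
- symmetry; stp K tg (fn_eq N' h).
  rewrite <- Eh in y' |- *.
  refine (actr K (p := ⟪F f⟫) (q := ⟪peval (p Y)⟫) (q' := ⟪peval (q Y)⟫) (l := [_]) (k := [_]) (k' := [_])
   (okf1 y') (okf1 s3') (okf1 s4') (Em' Y _ gY)).
Qed.
End Modif.

Section LiftNat.
Context {B : bicat} {C D : double_category} {φ : framing B C} (H : is_framing φ) (S : strict_framing (φ := φ)).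
Local Notation HD := (Horiz D).
Context {F0 G0 : B -> HD} {F : map1 F0} {G : map1 G0} {Fh Gh : pdfun C D}
  {s : forall X, hom (F0 X) (G0 X)} {n : psnat F G s}.
Context (a : vtrans Fh Gh) (i : invertible a) (l : liftable a).
Context (MF : fmap φ (horizfr D) F Fh (fun _ _ _ π => FS Fh π))
  (MG : fmap φ (horizfr D) G Gh (fun _ _ _ π => FS Gh π)) (P : is_pdfun Fh) (Q : is_pdfun Gh).

Lemma hdom_fh (X Y : B) (f : hom X Y) : hdom (fh φ f) = fo φ X /\ hcod (fh φ f) = fo φ Y.
Proof. split; [apply (fh_dom H)|apply (sf_comp H S f (id1 Y))]. Qed.

(** The hypotheses speak of underlying squares only, so that each concrete companion-lift satisfies
    them by reduction; [lift_act] and [lift_act'] supply the two actions. *)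
Lemma lift_fn :
  (forall X, hval (s X) = cmp (l (fo φ X))) ->
  (forall (X Y : B) (f : hom X Y), sval (fwd (n X Y f) : gcell _ _)
     = hcompS (hcompS (iot (l (fo φ X))) (va_h a (fh φ f))) (eps (l (fo φ Y)))) ->
  (forall (X Y : B) (f : hom X Y), sval (bwd (n X Y f) : gcell _ _)
     = hcompS (hcompS (vcompS (eps (l (fo φ X))) (hidS (lft (i (fh φ f))))) (i (fh φ f)))
         (vcompS (hidS (rgt (i (fh φ f)))) (iot (l (fo φ Y))))) ->
  fnat φ (horizfr D) (FV Fh) (FV Gh) (FH Fh) (FH Gh) (fun _ _ _ π => FS Fh π) (fun _ _ _ π => FS Gh π)
    n a (va_h a) (fun X => eps (l (fo φ X))).
Proof.
intros es ef eb.
assert (cl : forall X, cf (φ := horizfr D) (s X) (eps (l (fo φ X)))).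
{ intros X; split.
  - apply frH; auto; [rewrite es; apply eps_top|]. rewrite eps_rgt, va_cod; f_equal. symmetry; apply (fm_o MG).
  - rewrite eps_bot, va_cod, <- (fm_o MG); auto.
  - apply visoS_eps, (va_iso i). }
assert (W : forall (X Y : B) (f : hom X Y) x y π, fr φ f x y π ->
  sval (fwd (n X Y f) : gcell _ _) ÷ ((eps (l (fo φ X)) ÷ hidS (FV Gh x)) ∥ FS Gh π)
  = (FS Fh π ÷ va_h a (bot π)) ∥ (eps (l (fo φ Y)) ÷ hidS (FV Gh y))).
{ intros X Y f x y π h; rewrite ef; destruct (hdom_fh f).
  apply lift_act; auto; try apply h. rewrite (fr_rgt h); apply (sf_w S). }
split; intros; auto.
- split; [apply (fm_fr MF H0)|apply (fm_bot MF H0)].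
- split; [apply (fm_fr MG H0)|apply (fm_bot MG H0)].
- apply (visoS_map Q); auto.
- apply (visoS_map P); auto.
- apply (visoS_vi (i k)).
- apply (viso_map Q); auto.
- apply eps_lft.
- apply va_top.
- apply va_bot.
- apply va_lft.
- apply va_rgt.
- rewrite FV_cod, va_dom; auto.
- rewrite FV_dom, va_cod; auto.
- apply va_nat.
- destruct (hdom_fh f) as [d c].
  assert (h : fr φ f (vid (fo φ X)) (vid (fo φ Y)) (vidS (fh φ f))).
  { split; [apply top_vid|rewrite lft_vid, d; auto|rewrite rgt_vid, (sf_w S), c; auto|apply vdom_id]. }
  assert (w := W _ _ _ _ _ _ h).
  rewrite !FV_id, (FS_vid P), (FS_vid Q), !bot_vid in w.
  assert (rX := cl X); assert (rY := cl Y).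
  assert (z : forall A, eps (l A) ÷ hidS (vid (Gh A)) = eps (l A)).
  { intros A; rewrite hidS_id; apply vr; rewrite eps_bot, va_cod; auto. }
  rewrite !z, v1 in w by apply va_top.
  assert (bX : lft (vidS (FH Gh (fh φ f))) = rgt (eps (l (fo φ X)))) by (rewrite lft_vid, eps_rgt, FH_dom, va_cod, d; auto).
  assert (bY : lft (eps (l (fo φ Y))) = rgt (va_h a (fh φ f))) by (rewrite eps_lft, va_rgt, c; auto).
  assert (tF : hval (F f) = FH Fh (fh φ f)).
  { refine (eq_trans (eq_sym (fr_top (fm_fr MF h))) _). rewrite FS_top, top_vid; auto. }
  assert (tG : hval (G f) = FH Gh (fh φ f)).
  { refine (eq_trans (eq_sym (fr_top (fm_fr MG h))) _). rewrite FS_top, top_vid; auto. }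
  assert (f1 : fr (horizfr D) (peval ⟪s X; G f⟫) (a (fo φ X)) (vid (fo (horizfr D) (G0 Y))) (eps (l (fo φ X)) ∥ vidS (FH Gh (fh φ f)))).
  { apply frH; [rewrite top_hcomp by auto|rewrite lft_hcomp by auto|rewrite rgt_hcomp by auto].
    - rewrite eps_top, top_vid; cbn; rewrite es, tG; auto.
    - apply eps_lft.
    - rewrite rgt_vid, FH_cod, c, <- (fm_o MG); auto. }
  assert (f2 : fr (horizfr D) (peval ⟪F f; s Y⟫) (a (fo φ X)) (vid (fo (horizfr D) (G0 Y))) (va_h a (fh φ f) ∥ eps (l (fo φ Y)))).
  { apply frH; [rewrite top_hcomp by auto|rewrite lft_hcomp by auto|rewrite rgt_hcomp by auto].
    - rewrite eps_top, va_top; cbn; rewrite es, tF; auto.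
    - rewrite va_lft, d; auto.
    - rewrite eps_rgt, va_cod, <- (fm_o MG); auto. }
  apply (pid_iso (horizfr_ax D) f2 f1).
  + apply visoS_hcomp; auto; [apply (visoS_vi (i _))|apply rY].
  + apply visoS_hcomp; auto; [apply rX|apply visoS_id].
  + exact w.
  + refine (eq_trans (f_equal (fun z => z ÷ _) (eb _ _ f)) _).
    apply lift_act'; auto.
- apply (W _ _ _ _ _ _ H0).
Qed.
End LiftNat.

(** * Canonical cells between composites of companions *)

Section Canonical.
Context {B : bicat} {D : double_category} {φ : framing B D} (H : is_framing φ).
Local Notation fo := (fo φ).
Local Notation cs := (cs φ).
Local Notation fc := (fc φ).
Local Notation fr := (fr φ).
Local Notation ev := (ev (φ := φ)).
Local Notation okf := (okf (φ := φ)).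
Local Notation cf := (cf (φ := φ)).

(** The vertical composite whose companion the path represents, followed by [a]; the vertical cells
    are recovered as left sides of companion frames. *)
Fixpoint tot (l : list (dsq D)) (a : dv D) : dv D :=
  match l with [] => a | e :: l' => lft e ∙ tot l' a end.

(** The squares of a path of companions, each continued downwards by the
    vertical cells that follow it. *)
Fixpoint stair (l : list (dsq D)) (a : dv D) : list (dsq D) :=
  match l with [] => [] | e :: l' => (e ÷ hidS (tot l' a)) :: stair l' a end.

Fixpoint okc {X Y : B} (p : path X Y) (l : list (dsq D)) : Prop :=
  match p with
  | pnil => l = []
  | pcons f p' => match l with [] => False | e :: l' => cf f e /\ okc p' l' end
  end.

Definition cev {X Y : B} (p : path X Y) (l : list (dsq D)) : dsq D :=
  ev p (stair l (vid (fo Y))) (vid (fo Y)).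

Lemma tot_dom (X Y : B) (p : path X Y) l a : okc p l -> vdom a = fo Y -> vdom (tot l a) = fo X.
Proof.
revert l; induction p as [A0|A0 Y0 Z0 f p IH]; cbn; intros l o d.
- subst l; auto.
- destruct l as [|e l]; [tauto|]; destruct o as [h o]; cbn.
  rewrite vdom_comp; [apply (cf_dom H h)|]. rewrite (cf_cod h), (IH l); auto.
Qed.
Lemma tot_cod (X Y : B) (p : path X Y) l a : okc p l -> vdom a = fo Y -> vcod (tot l a) = vcod a.
Proof.
revert l; induction p as [A0|A0 Y0 Z0 f p IH]; cbn; intros l o d.
- subst l; auto.
- destruct l as [|e l]; [tauto|]; destruct o as [h o]; cbn.
  rewrite vcod_comp; [apply IH; auto|]. rewrite (cf_cod h), (tot_dom o d); auto.
Qed.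
Lemma tot_iso (X Y : B) (p : path X Y) l a : okc p l -> vdom a = fo Y -> viso a -> viso (tot l a).
Proof.
revert l; induction p as [A0|A0 Y0 Z0 f p IH]; cbn; intros l o d I.
- subst l; auto.
- destruct l as [|e l]; [tauto|]; destruct o as [h o]; cbn.
  apply viso_comp; [rewrite (cf_cod h), (tot_dom o d); auto|apply visoS_lft, h|apply IH; auto].
Qed.
Lemma okc_okf (X Y : B) (p : path X Y) l a : okc p l -> vdom a = fo Y ->
  okf p (stair l a) (tot l a) a.
Proof.
revert l; induction p as [A0|A0 Y0 Z0 f p IH]; cbn; intros l o d.
- subst l; auto.
- destruct l as [|e l]; [tauto|]; destruct o as [h o]; cbn.
  exists (tot l a); split; [|apply IH; auto].
  apply (cf_post H h), (tot_dom o d).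
Qed.
Lemma tot_app l l' a : tot (l ++ l') a = tot l (tot l' a).
Proof. induction l as [|e l IH]; cbn; congruence. Qed.
Lemma stair_app l l' a : stair (l ++ l') a = stair l (tot l' a) ++ stair l' a.
Proof. induction l as [|e l IH]; cbn; auto. rewrite IH, tot_app; auto. Qed.

Lemma okc_app (X Y Z : B) (p : path X Y) (q : path Y Z) l l' : okc p l -> okc q l' ->
  okc (papp p q) (l ++ l').
Proof.
revert l; induction p as [A0|A0 Y0 Z0 f p IH]; cbn; intros l o o'.
- subst l; auto.
- destruct l as [|e l]; [tauto|]; destruct o; cbn; auto.
Qed.

Fixpoint plen {X Y : B} (p : path X Y) : nat := match p with pnil => 0 | pcons f p' => Datatypes.S (plen p') end.

Lemma okc_split (X Y Z : B) (p : path X Y) (q : path Y Z) l : okc (papp p q) l ->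
  okc p (firstn (plen p) l) /\ okc q (skipn (plen p) l).
Proof.
revert l; induction p as [A0|A0 Y0 Z0 f p IH]; cbn; intros l o; auto.
destruct l as [|e l]; [tauto|]; destruct o as [h o]; destruct (IH q l o); auto.
Qed.

(** Continuing the bottom of a staircase by [a] continues every step, because the vertical cell
    below a step is the composite of all that follow. *)
Lemma stair_post (X Y : B) (p : path X Y) l a : okc p l -> vdom a = fo Y ->
  cev p l ÷ hidS a = ev p (stair l a) a.
Proof.
unfold cev; intros o d.
(* Generalized to a staircase that already ends in [b], so that the induction on the path goes
   through; [b] is the identity in the conclusion. *)
assert (G : forall b c, vdom b = fo Y -> vcod b = vdom c ->
  ev p (stair l b) b ÷ hidS c = ev p (stair l (b ∙ c)) (b ∙ c)).
{ clear a d; intros b c d d'; destruct p as [X|X Y1 Y f p]; cbn in o |- *.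
  - subst l; cbn. apply (fu_post H); auto.
  - destruct l as [|e l]; [tauto|]; destruct o as [h o]; cbn.
    revert X f e h l o; induction p as [A0|A0 Y0 Z0 g p IH]; cbn; intros X f e h l o.
    + subst l; cbn. apply (cf_post2 h); auto.
    + destruct l as [|e' l]; [tauto|]; destruct o as [h' o]; cbn.
      rewrite <- (IH d _ g e' h' l o).
      assert (t := tot_dom o d); assert (t' := tot_cod o d).
      assert (x : vdom (lft e' ∙ tot l b) = fo A0).
      { rewrite vdom_comp; [apply (cf_dom H h')|rewrite (cf_cod h'); auto]. }
      assert (y : vcod (lft e' ∙ tot l b) = vdom c).
      { rewrite vcod_comp; [congruence|rewrite (cf_cod h'); auto]. }
      assert (E : lft e' ∙ tot l (b ∙ c) = lft e' ∙ tot l b ∙ c).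
      { assert (E' : tot l (b ∙ c) = tot l b ∙ c).
        { clear -H o d d'. revert l o; induction p as [B0|B0 Y0 Z0 f p IH]; cbn; intros l o.
          - subst l; auto.
          - destruct l as [|e l]; [tauto|]; destruct o as [h o]; cbn.
            rewrite IH; auto. rewrite uA; auto;
            [rewrite (cf_cod h), (tot_dom o d); auto|rewrite (tot_cod o d); auto]. }
        rewrite E', uA; auto; [rewrite (cf_cod h'); auto|rewrite t'; auto]. }
      rewrite E, <- (cf_post2 h x y).
      assert (f1 := cf_post H h x).
      assert (f2 := evf_fr H (cf_post H h' t) (okc_okf o d)).
      symmetry; rewrite (fc_post H f1 f2).
      * rewrite h1; auto. apply lft_hid.
      * rewrite top_hid, (cf_post_bot h x), y; auto.
      * rewrite top_hid.
        destruct (fr_hbot H f2) as [_ z]. destruct (fr_hbot H f2) as [z' _].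
        assert (Z : bot (evf (φ := φ) p g (e' ÷ hidS (tot l b)) (stair l b)) = hid (vcod b)).
        { clear -H h' o d t. revert A0 g e' h' l o t; induction p as [B0|B0 Y0 Z0 f p IH]; cbn; intros A0 g e' h' l o t.
          - subst l; cbn in *; apply (cf_post_bot h'); auto.
          - destruct l as [|e l]; [tauto|]; destruct o as [h o]; cbn in *.
            assert (tt := tot_dom o d).
            assert (f1 := cf_post H h' t).
            assert (f2 := evf_fr H (cf_post H h tt) (okc_okf o d)).
            rewrite (fc_bot H f1 f2), (IH d _ f e h l o tt), (cf_post_bot h' t).
            apply hunitl; rewrite hdom_id.
            rewrite vcod_comp; [rewrite (tot_cod o d); auto|rewrite (cf_cod h); auto]. }
        rewrite Z, d'; auto.
      * rewrite rgt_hid, lft_hid; auto. }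
rewrite G; rewrite ?vdom_id, ?vcod_id, ?u1; auto.
Qed.

Lemma cev_bot (X Y : B) (p : path X Y) l : okc p l -> bot (cev p l) = hid (fo Y).
Proof.
intros o; unfold cev.
assert (d := vdom_id (fo Y)).
destruct p as [X|X Y1 Y f p]; cbn in o |- *.
- subst l; cbn. rewrite (fu_bot H d), vcod_id; auto.
- destruct l as [|e l]; [tauto|]; destruct o as [h o]; cbn.
  revert X f e h l o; induction p as [A0|A0 Y0 Z0 g p IH]; cbn; intros X f e h l o.
  + subst l; cbn. rewrite (cf_post_bot h), vcod_id; auto.
  + destruct l as [|e' l]; [tauto|]; destruct o as [h' o]; cbn.
    assert (t := tot_dom o d).
    assert (t' : vdom (lft e' ∙ tot l (vid (fo Z0))) = fo A0).
    { rewrite vdom_comp; [apply (cf_dom H h')|rewrite (cf_cod h'); auto]. }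
    assert (f2 := evf_fr H (cf_post H h' t) (okc_okf o d)).
    rewrite (fc_bot H (cf_post H h t') f2), (IH d _ g e' h' l o), (cf_post_bot h t').
    apply hunitl; rewrite hdom_id.
    rewrite vcod_comp; [rewrite (tot_cod o d), vcod_id; auto|rewrite (cf_cod h'); auto].
Qed.

Lemma cev_fr (X Y : B) (p : path X Y) l : okc p l ->
  fr (peval p) (tot l (vid (fo Y))) (vid (fo Y)) (cev p l).
Proof. intros o; apply (ev_fr H), okc_okf; auto. apply vdom_id. Qed.

Lemma cev_iso (X Y : B) (p : path X Y) l : okc p l -> visoS (cev p l).
Proof.
intros o; unfold cev.
assert (d := vdom_id (fo Y)); assert (I := viso_id (fo Y)).
destruct p as [X|X Y1 Y f p]; cbn in o |- *.
- subst l; cbn. apply (fu_iso H); auto.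
- destruct l as [|e l]; [tauto|]; destruct o as [h o]; cbn.
  revert X f e h l o; induction p as [A0|A0 Y0 Z0 g p IH]; cbn; intros X f e h l o.
  + subst l; cbn. apply (cf_post_iso h); auto.
  + destruct l as [|e' l]; [tauto|]; destruct o as [h' o]; cbn.
    assert (t := tot_dom o d).
    assert (t' : vdom (lft e' ∙ tot l (vid (fo Z0))) = fo A0).
    { rewrite vdom_comp; [apply (cf_dom H h')|rewrite (cf_cod h'); auto]. }
    assert (f2 := evf_fr H (cf_post H h' t) (okc_okf o d)).
    apply (fc_iso H (cf_post H h t') f2); [|apply IH; auto].
    apply (cf_post_iso h t'), viso_comp; [rewrite (cf_cod h'); auto|apply visoS_lft, h'|apply (tot_iso o); auto].
Qed.

Lemma cev_cf (X Y : B) (p : path X Y) l : okc p l -> cf (peval p) (cev p l).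
Proof.
intros o; split; [|apply cev_bot; auto|apply cev_iso; auto].
rewrite (fr_lft (cev_fr o)); apply cev_fr, o.
Qed.

Lemma cev_one (X Y : B) (f : hom X Y) e : cf f e -> cev ⟪f⟫ [e] = e.
Proof. intros h; apply (cf_post_id h). Qed.

Lemma cev_cons (X Y Z W : B) (f : hom X Y) (g : hom Y Z) (p : path Z W) e l :
  cev (pcons f (pcons g p)) (e :: l) = match l with [] => e ÷ hidS (vid (fo W)) | _ =>
   fc f (peval (pcons g p)) (e ÷ hidS (tot l (vid (fo W)))) (cev (pcons g p) l) end.
Proof. destruct l; auto. Qed.

(** Phrased as an implication so that well-formedness travels along a chain of cells: [can_pcomp]
    has no intermediate list to check, and [can_eq] asks for the source list alone. *)
Definition can {X Y : B} {p q : path X Y} (c : pcell p q) (l l' : list (dsq D)) : Prop :=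
  okc p l -> okc q l' /\ cs c ÷ cev q l' = cev p l.

(** Coherence in its usable form: once the source and target staircases agree, no comparison of the
    pastings themselves is left, since the target staircase is an invertible frame. *)
Lemma can_eq (X Y : B) (p q : path X Y) (c d : pcell p q) l l' : okc p l -> can c l l' ->
  can d l l' -> c = d.
Proof.
intros o h h'; destruct (h o) as [o' e], (h' o) as [_ e'].
apply (cell_eq H (cev_fr o') (cev_iso o')); congruence.
Qed.

Lemma can_pcomp (X Y : B) (p q r : path X Y) (c : pcell p q) (d : pcell q r) l l' l'' :
  can c l l' -> can d l' l'' -> can (c ⊚ d) l l''.
Proof.
intros h h' o; destruct (h o) as [o' e]; destruct (h' o') as [o'' e']; split; auto.
rewrite <- e, <- e'; apply (act_comp H _ _ (cev_fr o'')).
Qed.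

Lemma can_inv (X Y : B) (p q : path X Y) (i : iso2 p q) l l' : is_iso2 i -> okc p l ->
  can (fwd i) l l' -> can (bwd i) l' l.
Proof.
intros I o h o'; split; auto; destruct (h o) as [_ e].
eapply (act_inv H); [apply (cev_fr o')| |exact e]. apply I.
Qed.

(** The source list is cut according to the lengths of the paths, so that for explicit paths the
    target list is obtained by computation. *)
Lemma can_ctx (X Y Z W : B) (p : path X Y) (q q' : path Y Z) (r : path Z W) (c : pcell q q') L lq' :
  can c (firstn (plen q) (skipn (plen p) L)) lq' ->
  can (p ◁ c ▷ r) L (firstn (plen p) L ++ (lq' ++ skipn (plen q) (skipn (plen p) L))).
Proof.
intros h o.
destruct (okc_split o) as [o1 o2]; destruct (okc_split o2) as [o3 o4].
destruct (h o3) as [o5 e].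
assert (E : L = firstn (plen p) L ++ (firstn (plen q) (skipn (plen p) L) ++ skipn (plen q) (skipn (plen p) L))).
{ rewrite !firstn_skipn; auto. }
set (l := firstn (plen p) L) in *; set (lq := firstn (plen q) (skipn (plen p) L)) in *;
set (t := skipn (plen q) (skipn (plen p) L)) in *; clearbody l lq t; subst L.
split; [apply okc_app; auto; apply okc_app; auto|].
assert (d := vdom_id (fo W)).
assert (d4 := tot_dom o4 d).
(* Since [c] is globular, the two staircases for its segment have the same total; hence the steps
   before the segment do not change. *)
assert (T : tot lq' (tot t (vid (fo W))) = tot lq (tot t (vid (fo W)))).
{ rewrite <- (fr_lft (ev_fr H (okc_okf o3 d4))), <- (fr_lft (ev_fr H (okc_okf o5 d4))).
  rewrite <- (stair_post o3 d4), <- (stair_post o5 d4), <- e.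
  assert (f5 := fr_post H (s := hidS (tot t (vid (fo W)))) (cev_fr o5)).
  rewrite top_hid, (cev_bot o5), d4 in f5; specialize (f5 eq_refl).
  rewrite <- (act_post H c (cev_fr o5)) by (rewrite top_hid, (cev_bot o5), d4; auto).
  rewrite (fr_lft f5), (fr_lft (fr_act H c f5)); auto. }
unfold cev. rewrite !stair_app, !tot_app, T.
apply (act_ctx H (okc_okf o1 (tot_dom o3 d4)) (okc_okf o3 d4)); [|apply (okc_okf o4 d)|].
- rewrite <- T; apply (okc_okf o5 d4).
- rewrite <- (stair_post o3 d4), <- (stair_post o5 d4), <- e.
  apply (act_post H c (cev_fr o5)). rewrite top_hid, (cev_bot o5), d4; auto.
Qed.

(** Staircases with equal totals are frames with the same sides and with identity bottoms. An
    equation between vertical composites is thus enough to produce a structural 2-cell together with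
    its action. *)
Lemma ex_can (X Y : B) (p q : path X Y) l l' : okc p l -> okc q l' ->
  tot l (vid (fo Y)) = tot l' (vid (fo Y)) ->
  exists i : iso2 p q, is_iso2 i /\ can (fwd i) l l'.
Proof.
intros o o' E.
assert (f1 := cev_fr o); assert (f2 := cev_fr o'); rewrite <- E in f2.
destruct (ex_iso H f1 f2) as (i & I & e).
- rewrite !cev_bot; auto.
- apply cev_iso; auto.
- apply cev_iso; auto.
- exists i; split; auto. intros _; auto.
Qed.

(** Unit and counit are canonical cells to the empty path, whose total is an identity. *)
Lemma can_equiv (X Y : B) (f : hom X Y) (g : hom Y X) e e' : cf f e -> cf g e' ->
  lft e ∙ lft e' = vid (fo X) -> lft e' ∙ lft e = vid (fo Y) -> is_equivalence f.
Proof.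
intros h h' E E'.
exists g.
destruct (ex_can (p := ⟪f; g⟫) (q := ⟪⟫) (l := [e; e']) (l' := [])) as (i & I & _); cbn; auto.
{ rewrite (ur (u := lft e')); auto; apply (cf_cod h'). }
destruct (ex_can (p := ⟪g; f⟫) (q := ⟪⟫) (l := [e'; e]) (l' := [])) as (j & J & _); cbn; auto.
{ rewrite (ur (u := lft e)); auto; apply (cf_cod h). }
exists i, j; auto.
Qed.

End Canonical.

(** * Canonical cells under pseudofunctors and transformations *)

Section CanFun.
Context {B C : bicat} {D E : double_category} {φ : framing B D} {ψ : framing C E}.
Context (H : is_framing φ) (K : is_framing ψ).
Context {F0 : B -> C} {F : psfun F0} {Fh : pdfun D E}
  {Fr : forall X Y : B, hom X Y -> dsq D -> dsq E} (P : ffun φ ψ F Fh Fr).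

Fixpoint imgs {X Y : B} (p : path X Y) (l : list (dsq D)) : list (dsq E) :=
  match p with
  | pnil => []
  | @pcons _ X Y _ f p' =>
      match l with [] => [] | e :: l' => img Fh (fo φ Y) (Fr f e) :: imgs p' l' end
  end.

Lemma imgs_okc (X Y : B) (p : path X Y) l : okc (φ := φ) p l -> okc (φ := ψ) (fpath F p) (imgs p l).
Proof.
revert l; induction p as [A0|A0 Y0 Z0 f p IH]; cbn; intros l o; auto.
destruct l as [|e l]; [tauto|]; destruct o as [h o]; cbn; split; auto.
apply (img_cf H K P h).
Qed.

Lemma imgs_tot (X Y : B) (p : path X Y) l a : okc (φ := φ) p l -> vdom a = fo φ Y ->
  tot (imgs p l) (FV Fh a) = FV Fh (tot l a).
Proof.
revert l; induction p as [A0|A0 Y0 Z0 f p IH]; cbn; intros l o d.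
- subst l; auto.
- destruct l as [|e l]; [tauto|]; destruct o as [h o]; cbn.
  rewrite IH, (proj2 (img_cf H K P h)), (FV_comp (ff_ax P)); auto.
  rewrite (cf_cod h), (tot_dom H o d); auto.
Qed.

Lemma imgs_tot_id (X Y : B) (p : path X Y) l : okc (φ := φ) p l ->
  tot (imgs p l) (vid (fo ψ (F0 Y))) = FV Fh (tot l (vid (fo φ Y))).
Proof.
intros o; rewrite <- (imgs_tot o) by apply vdom_id.
rewrite FV_id, (fm_o (ff_map P)); auto.
Qed.

(** One compositor is absorbed per step: the tail of the staircase has an identity bottom, so
    [fwd_comp_r] applies, and the remaining inverse unitor straightens the image of the first
    step. *)
Lemma ffold_from_cev (Y Z : B) (p : path Y Z) : forall (X : B) (f : hom X Y) e l,
  okc (φ := φ) (pcons f p) (e :: l) ->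
  cs ψ (ffold_from F p f) ÷ img Fh (fo φ Z) (Fr (peval_from p f) (cev (φ := φ) (pcons f p) (e :: l)))
  = cev (φ := ψ) (pcons (F # f) (fpath F p)) (img Fh (fo φ Y) (Fr f e) :: imgs p l).
Proof.
induction p as [A0|A0 Y0 Z0 g p IH]; intros X f e l o.
- destruct o as [h o]; cbn in o; subst l.
  cbn [ffold_from peval_from fpath imgs]; rewrite (cev_one h).
  rewrite (cev_one (proj1 (img_cf H K P h))).
  apply (act_id K (cf_fr (proj1 (img_cf H K P h)))).
- destruct o as [h o]. destruct l as [|e' l]; [destruct o|].
  assert (o' := o); destruct o as [h' o].
  assert (d := vdom_id (fo φ Z0)).
  assert (t := tot_dom H o' d); assert (tc := tot_cod H o' d); rewrite vcod_id in tc.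
  assert (f1 := cf_post H h t).
  assert (f2 := cev_fr H o'); assert (b2 := cev_bot H o').
  assert (x1 := fm_fr (ff_map P) f1).
  assert (b1 := cf_post_bot h t); rewrite tc in b1.
  assert (Q := proj1 (img_cf H K P (cev_cf H o'))).
  assert (Q' := fr_img H K P f2 b2).
  assert (E1 := fwd_comp_r H K P f1 f2 b2).
  assert (T := fc_fr H f1 f2); assert (bT := fc_bot H f1 f2).
  rewrite b1, b2, hunitl in bT by gb.
  assert (I := fr_img H K P T bT).
  change (cev (φ := φ) (pcons f (pcons g p)) (e :: e' :: l)) with
    (fc φ f (peval_from p g) (e ÷ hidS (tot (e' :: l) (vid (fo φ Z0)))) (cev (φ := φ) (pcons g p) (e' :: l))).
  cbn [ffold_from peval_from].
  refine (act2c K I (act_post K _ (fm_fr (ff_map P) T) _) _).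
  { rewrite F2u'_top, (fm_bot (ff_map P) T), bT; auto. }
  refine (eq_trans (f_equal (fun z => cs ψ _ ÷ (z ÷ _)) E1) _).
  assert (x2 : img Fh (fo φ Z0) (Fr (peval (pcons g p)) (cev (φ := φ) (pcons g p) (e' :: l)))
     = img Fh (fo φ Z0) (Fr (peval (pcons g p)) (cev (φ := φ) (pcons g p) (e' :: l))) ÷ hidS (vid (Fh (fo φ Z0)))).
  { symmetry; rewrite hidS_id; apply vr. rewrite (cf_bot Q), (fm_o (ff_map P)); auto. }
  assert (x3 : fc ψ (F # f) (F # peval (pcons g p)) (Fr f (e ÷ hidS (tot (e' :: l) (vid (fo φ Z0)))))
      (img Fh (fo φ Z0) (Fr (peval (pcons g p)) (cev (φ := φ) (pcons g p) (e' :: l)))) ÷ F2u' Fh (fo φ Z0)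
    = fc ψ (F # f) (F # peval (pcons g p)) (img Fh (fo φ A0) (Fr f e) ÷ hidS (FV Fh (tot (e' :: l) (vid (fo φ Z0)))))
      (img Fh (fo φ Z0) (Fr (peval (pcons g p)) (cev (φ := φ) (pcons g p) (e' :: l))))).
  { rewrite (img_post P (cf_fr h) (cf_bot h) t), tc.
    rewrite x2 at 2; unfold img at 2.
    rewrite (fc_post K x1 Q'); rewrite ?F2u'_top, ?F2u'_rgt, ?lft_hid; auto.
    - rewrite hr; auto. apply F2u'_rgt.
    - rewrite (fm_bot (ff_map P) f1), b1; auto.
    - rewrite top_hid, vdom_id, (cf_bot Q), (fm_o (ff_map P)); auto. }
  refine (eq_trans (f_equal (fun z => cs ψ _ ÷ z) x3) _).
  assert (y1 := fr_img H K P (cf_fr h) (cf_bot h)).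
  assert (y2 := cf_post K (proj1 (img_cf H K P h)) (a := FV Fh (tot (e' :: l) (vid (fo φ Z0))))).
  specialize (y2 ltac:(rewrite FV_dom, t; symmetry; apply (fm_o (ff_map P)))).
  refine (eq_trans (fc_hc2 K _ _ y2 Q') _).
  rewrite (act_id K y2).
  refine (eq_trans (f_equal (fun z => fc ψ _ _ _ z) (IH _ g e' l o')) _).
  change (imgs (pcons g p) (e' :: l)) with (img Fh (fo φ Y0) (Fr g e') :: imgs p l).
  change (fpath F (pcons g p)) with (pcons (F # g) (fpath F p)).
  rewrite cev_cons.
  rewrite <- (imgs_tot_id o'). auto.
Qed.

Lemma ffold_cev (X Y : B) (p : path X Y) l : okc (φ := φ) p l ->
  cs ψ (ffold F p) ÷ img Fh (fo φ Y) (Fr (peval p) (cev (φ := φ) p l))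
  = cev (φ := ψ) (fpath F p) (imgs p l).
Proof.
destruct p as [X|X Y0 Y f p]; intros o.
- cbn in o; subst l; cbn [ffold].
  assert (d := vdom_id (fo φ X)).
  assert (U := ff_unit P d); rewrite vcod_id in U.
  assert (h := fm_fr (ff_map P) (fu_fr H d)).
  assert (dF := fr_left K h).
  unfold img; refine (eq_trans (act_post K _ h _) _).
  { rewrite F2u'_top, (fm_bot (ff_map P) (fu_fr H d)), (fu_bot H d), vcod_id; auto. }
  refine (eq_trans (f_equal (fun z => z ÷ _) U) _).
  rewrite vA, (F2u_inv (ff_ax P)).
  + unfold cev; cbn. rewrite FV_id, (fm_o (ff_map P)). apply vr.
    rewrite (fu_bot K), vcod_id; auto. rewrite vdom_id, (fm_o (ff_map P)); auto.
  + rewrite (fu_bot K dF), F2u_top, FV_cod, vcod_id; auto.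
  + rewrite F2u_bot, F2u'_top; auto.
- destruct l as [|e l]; [destruct o|]. apply ffold_from_cev; auto.
Qed.

Lemma can_fcell (X Y : B) (p q : path X Y) (c : pcell p q) l l' : okc (φ := φ) p l ->
  can (φ := φ) c l l' -> can (φ := ψ) (fcell F c) (imgs p l) (imgs q l').
Proof.
intros o h _; destruct (h o) as [o' e]; split; [apply imgs_okc; auto|].
assert (Q := cev_cf H o'); assert (R := cev_cf H o).
assert (T := fr_img H K P (cf_fr Q) (cf_bot Q)).
assert (T' := cev_fr K (imgs_okc o')).
assert (W := ffold_cev o'). assert (W' := ffold_cev o).
assert (b := framed_bicat K). assert (i := ffold_inv b (framed_psfun H K P) q).
assert (V : cs ψ (funfold F q) ÷ cev (φ := ψ) (fpath F q) (imgs q l')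
   = img Fh (fo φ Y) (Fr (peval q) (cev (φ := φ) q l'))).
{ eapply (act_inv K); [exact T|apply i|exact W]. }
unfold fcell.
stp K T' V.
rewrite <- W'; unfold img.
refine (act2c K T (act_post K _ (fm_fr (ff_map P) (cf_fr Q)) _) _).
{ rewrite F2u'_top, (fm_bot (ff_map P) (cf_fr Q)), (cf_bot Q); auto. }
f_equal; f_equal. refine (eq_trans (ff_cell P c (cf_fr Q)) _). f_equal; exact e.
Qed.

End CanFun.

Section CanNat.
Context {B C : bicat} {D E : double_category} {φ : framing B D} {ψ : framing C E}.
Context (H : is_framing φ) (K : is_framing ψ).
Context {F0 G0 : B -> C} {F : psfun F0} {G : psfun G0} {Fh Gh : pdfun D E}
    {Fr Gr : forall X Y : B, hom X Y -> dsq D -> dsq E}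
    {s : forall X, hom (F0 X) (G0 X)} {n : psnat F G s}
    {av : dob D -> dv E} {ah : dh D -> dsq E} {e : B -> dsq E}
    (P : ffun φ ψ F Fh Fr) (Q : ffun φ ψ G Gh Gr)
    (N : fnat φ ψ (FV Fh) (FV Gh) (FH Fh) (FH Gh) Fr Gr n av ah e)
    (U : forall A, F2u Fh A ÷ ah (hid A) = hidS (av A) ÷ F2u Gh A).

Lemma nat_unit' A : ah (hid A) ÷ F2u' Gh A = F2u' Fh A ÷ hidS (av A).
Proof.
assert (l : lft (ah (hid A)) = av A) by (rewrite (fn_alft N), hdom_id; auto).
assert (a1 : vdom (av A) = Fh A).
{ rewrite <- l, <- dom_top, (fn_atop N), FH_dom, hdom_id; auto. }
assert (a2 : vcod (av A) = Gh A).
{ rewrite <- l, <- dom_bot, (fn_abot N), FH_dom, hdom_id; auto. }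
assert (t := fn_atop N (hid A)); assert (b := fn_abot N (hid A)).
apply (visoS_injl (visoS_F2u (ff_ax P) A)).
- rewrite top_vcomp, F2u_bot; [auto|]. rewrite b, F2u'_top; auto.
- rewrite top_vcomp, F2u_bot, F2u'_top; auto. rewrite F2u'_bot, top_hid, a1; auto.
- rewrite <- !vA, U, (F2u_inv (ff_ax P)), v1, vA, (F2u_inv (ff_ax Q)), vr;
   rewrite ?top_hid, ?bot_hid, ?F2u_top, ?F2u_bot, ?F2u'_top, ?F2u'_bot, ?t, ?b, ?a1, ?a2; auto.
Qed.

(** The frame of a companion has an identity bottom, where [ah] and the unitors together amount to
    [hidS] of [av] ([nat_unit']). The naturality cell then exchanges two staircases of two steps. *)
Lemma can_nat (X Y : B) (f : hom X Y) ef : cf (φ := φ) f ef ->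
  can (φ := ψ) (fwd (n X Y f)) [img Fh (fo φ Y) (Fr f ef); e Y] [e X; img Gh (fo φ Y) (Gr f ef)].
Proof.
intros h _.
assert (iF := img_cf H K P h); assert (iG := img_cf H K Q h).
destruct iF as [iF lF], iG as [iG lG].
assert (cX := fn_cf N X); assert (cY := fn_cf N Y).
split; [exact (conj cX (conj iG eq_refl))|].
unfold cev; cbn [stair tot ev evf].
assert (gX := fn_gdom H K N (fr_left H (cf_fr h))); assert (gY := fn_gdom H K N (fr_dom (cf_fr h))).
assert (sX := fn_fr2 H K N (fr_left H (cf_fr h))); assert (sY := fn_fr2 H K N (fr_dom (cf_fr h))).
assert (bX := fn_bot2 H K N (fr_left H (cf_fr h))).
assert (gc : vcod (FV Gh (lft ef)) = Gh (fo φ Y)) by (rewrite FV_cod, (cf_cod h); auto).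
destruct (fn_G N (cf_fr h)) as [g bg]; destruct (fn_F N (cf_fr h)) as [x bx].
assert (y := fn_fr1 H K N (cf_fr h)); assert (tg := fn_target H K N (cf_fr h)).
rewrite (cf_bot h) in bx, bg.
assert (oG := fm_o (ff_map Q) Y).
rewrite (cf_post_id iG), (cf_post_id cY), lG, (fn_lft N).
assert (avc : vcod (av (fo φ Y)) = Gh (fo φ Y)).
{ rewrite <- (fn_lft N), (cf_cod cY); auto. }
rewrite !ur by (congruence || (rewrite oG; auto)).
assert (E0 := fn_eq N (cf_fr h)); rewrite (cf_bot h) in E0.
transitivity (cs ψ (fwd (n X Y f)) ÷ (fc ψ (s X) (G # f) (e X ÷ hidS (FV Gh (lft ef))) (Gr f ef) ÷ F2u' Gh (fo φ Y))).
- f_equal.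
  rewrite <- (vr bX) at 1. unfold img.
  refine (eq_trans (fc_post K sX g _ _ _) _); rewrite ?top_vid, ?F2u'_top; auto.
  + rewrite rgt_vid, F2u'_lft, hcod_id, gc; auto.
  + f_equal; rewrite <- hidS_id. apply h1. rewrite F2u'_lft, gc; auto.
- refine (eq_trans (act_post K (f := comp1 (F # f) (s Y)) (fwd (n X Y f)) tg _) _).
  { rewrite F2u'_top, (fc_bot K sX g), bX, bg. symmetry; apply hunitl; rewrite FH_dom, hdom_id, gc; auto. }
  refine (eq_trans (f_equal (fun z => z ÷ _) E0) _).
  assert (i : rgt (F2u' Gh (fo φ Y)) = vid (fo ψ (G0 Y))) by (rewrite F2u'_rgt; congruence).
  assert (z : F2u' Gh (fo φ Y) = F2u' Gh (fo φ Y) ∥ hidS (vid (fo ψ (G0 Y)))) by (symmetry; apply hr, i).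
  rewrite z, FV_id. rewrite !FV_id in sY.
  rewrite <- oG in sY |- *. rewrite (cf_post_id cY) in sY |- *.
  rewrite (cf_bot h) in y.
  assert (ab : bot (ah (hid (fo φ Y))) = FH Gh (hid (fo φ Y))) by apply (fn_abot N).
  assert (atp : top (ah (hid (fo φ Y))) = FH Fh (hid (fo φ Y))) by apply (fn_atop N).
  rewrite FV_id in y.
  rewrite <- (fc_post K y sY).
  + rewrite (cf_post_id cY). f_equal. unfold img.
    rewrite !vA, nat_unit'; auto.
    * rewrite F2u'_top, bx; auto.
    * assert (l : lft (ah (hid (fo φ Y))) = av (fo φ Y)) by (rewrite (fn_alft N), hdom_id; auto).
      rewrite F2u'_bot, top_hid, <- l, <- dom_top, atp, FH_dom, hdom_id; auto.
    * congruence.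
    * rewrite ab, F2u'_top; auto.
  + rewrite F2u'_top, bot_vcomp; congruence.
  + rewrite top_hid, vdom_id, (cf_bot cY); auto.
  + rewrite lft_hid; auto.
Qed.

Lemma can_nat' (X Y : B) (f : hom X Y) ef : cf (φ := φ) f ef ->
  can (φ := ψ) (bwd (n X Y f)) [e X; img Gh (fo φ Y) (Gr f ef)] [img Fh (fo φ Y) (Fr f ef); e Y].
Proof.
intros h; apply (can_inv K (fn_iso N f)).
- exact (conj (proj1 (img_cf H K P h)) (conj (fn_cf N Y) eq_refl)).
- apply can_nat, h.
Qed.
End CanNat.

(** * The monoidal bicategory *)

Lemma horiz_strict (D : double_category) : strict_framing (φ := horizfr D).
Proof. split; auto. Qed.
Lemma prod_strict {B C : bicat} {D E : double_category} {φ : framing B D} {ψ : framing C E} :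
  strict_framing (φ := φ) -> strict_framing (φ := ψ) -> strict_framing (φ := prodfr φ ψ).
Proof.
intros s t; split; intros; apply injective_projections; cbn;
solve [apply (sf_w s)|apply (sf_w t)|apply (sf_c s)|apply (sf_c t)|apply (sf_u s)|apply (sf_u t)].
Qed.
Lemma unit_strict : strict_framing (φ := unitfr).
Proof. split; auto; [intros X Y Z f g [] π'; auto|intros X []; auto]. Qed.

#[global] Strategy 1000 [dprod dfst dsnd dcomp dpair did dunit dconst dbang].
#[global] Strategy expand [dprodD dunitD].

Section HorizM.
Context (D : double_category) (M : monoidal_double D).
Context (la : liftable (dalpha M)) (ll : liftable (dlambda M)) (lr : liftable (drho M)).
Local Notation HD := (Horiz D).
Local Notation φ1 := (horizfr D).
Local Notation φ2 := (prodfr φ1 φ1).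
Local Notation φ3 := (prodfr φ2 φ1).
Local Notation φ4 := (prodfr φ3 φ1).
Local Notation T := (Hten M).

Lemma ax1 : is_framing φ1. Proof. apply horizfr_ax. Qed.
Lemma ax2 : is_framing φ2. Proof. apply prodfr_ax; apply ax1. Qed.
Lemma ax3 : is_framing φ3. Proof. apply (prodfr_ax ax2 ax1). Qed.
Lemma ax4 : is_framing φ4. Proof. apply (prodfr_ax ax3 ax1). Qed.
Lemma st1 : strict_framing (φ := φ1). Proof. apply horiz_strict. Qed.
Lemma st2 : strict_framing (φ := φ2). Proof. apply (prod_strict st1 st1). Qed.
Lemma st3 : strict_framing (φ := φ3). Proof. apply (prod_strict st2 st1). Qed.

Lemma ten_ff : ffun φ2 φ1 T (dt M) (fun _ _ _ π => FS (dt M) π).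
Proof.
apply (strict_ff ax2 st2); try (intros; reflexivity); try (intros; split; reflexivity).
apply dt_ax.
Qed.

Lemma uni_ff : ffun unitfr φ1 (Hfun0 (dI M)) (dI M) (fun _ _ _ π => FS (dI M) π).
Proof.
apply (strict_ff unitfr_ax unit_strict (F := Hfun0 (dI M)) (Fh := dI M)); try (intros; reflexivity); try (intros; split; reflexivity).
apply dI_ax.
Qed.

Lemma tenf_ff {A : bicat} {L : double_category} {χ : framing A L} (G : is_framing χ)
  {F0 G0 : A -> HD} {F : psfun F0} {F' : psfun G0} {Fh Gh : pdfun L D} {Fr Gr}
  (P : ffun χ φ1 F Fh Fr) (Q : ffun χ φ1 F' Gh Gr) :
  ffun χ φ1 (tenf T F F') (dtens (dt M) Fh Gh) (fun X Y f π => FS (dt M) (Fr X Y f π, Gr X Y f π)).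
Proof. exact (compf_ff G ax2 ax1 (pairf_ff (φ := φ1) (ψ := φ1) P Q) ten_ff). Qed.

Lemma p31_ff : ffun φ3 φ1 (pr31 HD) (dp31 D) (fun _ _ _ π => fst (fst π)).
Proof. unfold pr31, dp31; exact (compf_ff ax3 ax2 ax1 (fstf_ff (ψ := φ1) ax2) (fstf_ff (ψ := φ1) ax1)). Qed.
Lemma p32_ff : ffun φ3 φ1 (pr32 HD) (dp32 D) (fun _ _ _ π => snd (fst π)).
Proof. unfold pr32, dp32; exact (compf_ff ax3 ax2 ax1 (fstf_ff (ψ := φ1) ax2) (sndf_ff (φ := φ1) ax1)). Qed.
Lemma p33_ff : ffun φ3 φ1 (pr33 HD) (dp33 D) (fun _ _ _ π => snd π).
Proof. unfold pr33, dp33; exact (sndf_ff (φ := φ2) ax1). Qed.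

Lemma p4 {F0 : prodb (prodb HD HD) HD -> HD} {F : psfun F0} {Fh Fr} (P : ffun φ3 φ1 F Fh Fr) :
  ffun φ4 φ1 (compf (fstf (prodb (prodb HD HD) HD) HD) F)
    (dcomp (dfst (dprod (dprod D D) D) D) Fh) (fun X Y f π => Fr _ _ (fst f) (fst π)).
Proof. exact (compf_ff ax4 ax3 ax1 (fstf_ff (ψ := φ1) ax3) P). Qed.

Lemma as_fn : fnat φ3 φ1 (FV (dtens (dt M) (dtens (dt M) (dp31 D) (dp32 D)) (dp33 D)))
  (FV (dtens (dt M) (dp31 D) (dtens (dt M) (dp32 D) (dp33 D))))
  (FH (dtens (dt M) (dtens (dt M) (dp31 D) (dp32 D)) (dp33 D)))
  (FH (dtens (dt M) (dp31 D) (dtens (dt M) (dp32 D) (dp33 D))))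
  (fun _ _ _ π => FS (dtens (dt M) (dtens (dt M) (dp31 D) (dp32 D)) (dp33 D)) π)
  (fun _ _ _ π => FS (dtens (dt M) (dp31 D) (dtens (dt M) (dp32 D) (dp33 D))) π)
  (Hasn la) (dalpha M) (va_h (dalpha M)) (fun X => eps (la (fst (fst X), snd (fst X), snd X))).
Proof.
assert (P := tenf_ff ax3 (tenf_ff ax3 p31_ff p32_ff) p33_ff).
assert (Q := tenf_ff ax3 p31_ff (tenf_ff ax3 p32_ff p33_ff)).
apply (lift_fn ax3 st3 (n := Hasn la) (i := dalpha_inv M) (l := la) (ff_map P) (ff_map Q) (ff_ax P) (ff_ax Q)).
- intros; reflexivity.
- intros; reflexivity.
- intros; reflexivity.
Qed.

Lemma as_psnat : is_psnat _ _ (Hasn la).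
Proof.
assert (P := tenf_ff ax3 (tenf_ff ax3 p31_ff p32_ff) p33_ff).
assert (Q := tenf_ff ax3 p31_ff (tenf_ff ax3 p32_ff p33_ff)).
apply (framed_psnat ax3 ax1 P Q as_fn).
split; intros; [apply (va_comp (dalpha M))|apply (va_unit (dalpha M))]; auto.
Qed.

Lemma lu_ff : ffun φ1 φ1 (tenf T (compf (bangf HD) (Hfun0 (dI M))) (idf HD))
  (dtens (dt M) (dcomp (dbang D) (dI M)) (did D)) (fun _ _ _ π => FS (dtens (dt M) (dcomp (dbang D) (dI M)) (did D)) π).
Proof. exact (tenf_ff ax1 (compf_ff ax1 unitfr_ax ax1 bangf_ff uni_ff) (idf_ff ax1)). Qed.

Lemma ru_ff : ffun φ1 φ1 (tenf T (idf HD) (compf (bangf HD) (Hfun0 (dI M))))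
  (dtens (dt M) (did D) (dcomp (dbang D) (dI M))) (fun _ _ _ π => FS (dtens (dt M) (did D) (dcomp (dbang D) (dI M))) π).
Proof. exact (tenf_ff ax1 (idf_ff ax1) (compf_ff ax1 unitfr_ax ax1 bangf_ff uni_ff)). Qed.

Lemma id_ff : ffun φ1 φ1 (idf HD) (did D) (fun _ _ _ π => FS (did D) π).
Proof. exact (idf_ff ax1). Qed.

Lemma lu_fn : fnat φ1 φ1 (FV (dtens (dt M) (dcomp (dbang D) (dI M)) (did D))) (FV (did D))
  (FH (dtens (dt M) (dcomp (dbang D) (dI M)) (did D))) (FH (did D))
  (fun _ _ _ π => FS (dtens (dt M) (dcomp (dbang D) (dI M)) (did D)) π) (fun _ _ _ π => FS (did D) π)
  (Hlun1 ll) (dlambda M) (va_h (dlambda M)) (fun X => eps (ll X)).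
Proof.
apply (lift_fn ax1 st1 (n := Hlun1 ll) (i := dlambda_inv M) (l := ll) (ff_map lu_ff) (ff_map id_ff) (ff_ax lu_ff) (ff_ax id_ff));
intros; reflexivity.
Qed.

Lemma ru_fn : fnat φ1 φ1 (FV (dtens (dt M) (did D) (dcomp (dbang D) (dI M)))) (FV (did D))
  (FH (dtens (dt M) (did D) (dcomp (dbang D) (dI M)))) (FH (did D))
  (fun _ _ _ π => FS (dtens (dt M) (did D) (dcomp (dbang D) (dI M))) π) (fun _ _ _ π => FS (did D) π)
  (Hrun1 lr) (drho M) (va_h (drho M)) (fun X => eps (lr X)).
Proof.
apply (lift_fn ax1 st1 (n := Hrun1 lr) (i := drho_inv M) (l := lr) (ff_map ru_ff) (ff_map id_ff) (ff_ax ru_ff) (ff_ax id_ff));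
intros; reflexivity.
Qed.

Lemma lu_psnat : is_psnat _ _ (Hlun1 ll).
Proof.
apply (framed_psnat ax1 ax1 lu_ff id_ff lu_fn).
split; intros; [apply (va_comp (dlambda M))|apply (va_unit (dlambda M))]; auto.
Qed.

Lemma ru_psnat : is_psnat _ _ (Hrun1 lr).
Proof.
apply (framed_psnat ax1 ax1 ru_ff id_ff ru_fn).
split; intros; [apply (va_comp (drho M))|apply (va_unit (drho M))]; auto.
Qed.

Local Notation HM := (Hmonoidal la ll lr).

Section Instances.
Context {A : bicat} {L : double_category} {χ : framing A L} (G : is_framing χ).
Context {F0 G0 K0 : A -> HD} {F1 : psfun F0} {F2 : psfun G0} {F3 : psfun K0} {Fh Gh Kh : pdfun L D}
  {Fr Gr Kr : forall X Y : A, hom X Y -> dsq L -> dsq D}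
  (P : ffun χ φ1 F1 Fh Fr) (Q : ffun χ φ1 F2 Gh Gr) (R : ffun χ φ1 F3 Kh Kr).

Lemma asnat_fn : fnat χ φ1
  (FV (dtens (dt M) (dtens (dt M) Fh Gh) Kh)) (FV (dtens (dt M) Fh (dtens (dt M) Gh Kh)))
  (FH (dtens (dt M) (dtens (dt M) Fh Gh) Kh)) (FH (dtens (dt M) Fh (dtens (dt M) Gh Kh)))
  (fun X Y f π => FS (dt M) (FS (dt M) (Fr f π, Gr f π), Kr f π))
  (fun X Y f π => FS (dt M) (Fr f π, FS (dt M) (Gr f π, Kr f π)))
  (asnat HM F1 F2 F3) (fun X => dalpha M (Fh X, Gh X, Kh X))
  (fun k => va_h (dalpha M) (FH Fh k, FH Gh k, FH Kh k)) (fun X => eps (la (F0 X, G0 X, K0 X))).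
Proof.
assert (W := pairf_ff (φ := φ2) (ψ := φ1) (pairf_ff (φ := φ1) (ψ := φ1) P Q) R).
exact (fn_pre as_fn (ff_map W) G (ff_ax W)).
Qed.

Lemma unif_ff : ffun χ φ1 (unif HM A) (dcomp (dbang L) (dI M)) (fun _ _ _ π => FS (dI M) tt).
Proof. exact (compf_ff G unitfr_ax ax1 bangf_ff uni_ff). Qed.

Lemma lunat_fn : fnat χ φ1
  (FV (dtens (dt M) (dcomp (dbang L) (dI M)) Fh)) (FV Fh)
  (FH (dtens (dt M) (dcomp (dbang L) (dI M)) Fh)) (FH Fh)
  (fun X Y f π => FS (dt M) (FS (dI M) tt, Fr f π)) Fr
  (lunat HM F1) (fun X => dlambda M (Fh X)) (fun k => va_h (dlambda M) (FH Fh k)) (fun X => eps (ll (F0 X))).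
Proof. exact (fn_pre lu_fn (ff_map P) G (ff_ax P)). Qed.

Lemma runat_fn : fnat χ φ1
  (FV (dtens (dt M) Fh (dcomp (dbang L) (dI M)))) (FV Fh)
  (FH (dtens (dt M) Fh (dcomp (dbang L) (dI M)))) (FH Fh)
  (fun X Y f π => FS (dt M) (Fr f π, FS (dI M) tt)) Fr
  (runat HM F1) (fun X => drho M (Fh X)) (fun k => va_h (drho M) (FH Fh k)) (fun X => eps (lr (F0 X))).
Proof. exact (fn_pre ru_fn (ff_map P) G (ff_ax P)). Qed.

Lemma idn1_fn : fnat χ φ1 (FV Fh) (FV Fh) (FH Fh) (FH Fh) Fr Fr (idn F1)
   (fun X => vid (Fh X)) (fun k => vidS (FH Fh k)) (fun X => hidS (vid (F0 X : dob D))).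
Proof. exact (fn_idn ax1 (ff_map P) (ff_ax P)). Qed.
End Instances.

Lemma tenn_fn {A : bicat} {L : double_category} {χ : framing A L} (G : is_framing χ)
  {F0 G0 : A -> HD} {F1 : map1 F0} {G1 : map1 G0} {fv gv : dv L -> dv D} {fk gk : dh L -> dh D}
  {Fr Gr : forall X Y : A, hom X Y -> dsq L -> dsq D}
  {s : forall X, hom (F0 X) (G0 X)} {n : psnat F1 G1 s}
  {av : dob L -> dv D} {ah : dh L -> dsq D} {e : A -> dsq D}
  (N : fnat χ φ1 fv gv fk gk Fr Gr n av ah e)
  {F0' G0' : A -> HD} {F1' : map1 F0'} {G1' : map1 G0'} {fv' gv' : dv L -> dv D} {fk' gk' : dh L -> dh D}
  {Fr' Gr' : forall X Y : A, hom X Y -> dsq L -> dsq D}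
  {s' : forall X, hom (F0' X) (G0' X)} {n' : psnat F1' G1' s'}
  {av' : dob L -> dv D} {ah' : dh L -> dsq D} {e' : A -> dsq D}
  (N' : fnat χ φ1 fv' gv' fk' gk' Fr' Gr' n' av' ah' e') :
  fnat χ φ1 (fun v => FV (dt M) (fv v, fv' v)) (fun v => FV (dt M) (gv v, gv' v))
   (fun v => FH (dt M) (fk v, fk' v)) (fun v => FH (dt M) (gk v, gk' v))
   (fun X Y f π => FS (dt M) (Fr _ _ f π, Fr' _ _ f π)) (fun X Y f π => FS (dt M) (Gr _ _ f π, Gr' _ _ f π))
   (tenn T n n') (fun X => FV (dt M) (av X, av' X)) (fun k => FS (dt M) (ah k, ah' k))
   (fun X => img (D := dprodD D D) (dt M) (G0 X, G0' X) (FS (dt M) (e X, e' X))).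
Proof. exact (fn_post G ax2 ax1 (fn_pair N N') ten_ff). Qed.

End HorizM.

(** * Coherence of premonoidal structures with canonical constraints *)

Lemma can_conv {B : bicat} {D : double_category} {φ : framing B D} (X Y : B) (p q : path X Y)
  (c : pcell p q) l l' m m' : can (φ := φ) c l l' -> l = m -> l' = m' -> can (φ := φ) c m m'.
Proof. intros h <- <-; exact h. Qed.

Lemma can_to {B : bicat} {D : double_category} {φ : framing B D} (X Y : B) (p q : path X Y)
  (c : pcell p q) l l' m' : can (φ := φ) c l l' -> l' = m' -> can (φ := φ) c l m'.
Proof. intros h <-; exact h. Qed.

(** [imgs] refers to the 1-cells of the path; on companion frames its entries depend only on the
    target object and the square, and [i] records this dependence. The lists in coherence proofs
    then compute. *)
Fixpoint imap {B : bicat} {D : double_category} (i : B -> dsq D -> dsq D) {X Y : B} (p : path X Y)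
  (l : list (dsq D)) : list (dsq D) :=
  match p with
  | pnil => []
  | @pcons _ X Y _ f p' => match l with [] => [] | e :: l' => i Y e :: imap i p' l' end
  end.

(** Two hooks, rebound wherever new companions and canonical cells become available: [can_cf] proves
    that squares are companion frames, [can_cell] that a single cell is canonical. [can_chain] runs
    along a pasting and computes the staircase after each step. *)
Ltac can_cf := fail.
Ltac can_cell := fail.
Ltac can_red := lazy beta iota delta [plen firstn skipn imap app fpath].
Ltac can_step H := can_red; lazymatch goal with
  | |- can (@pctx _ _ _ _ _ ?p ?q ?q' ?c ?r) ?L _ =>
    refine (can_to (can_ctx H (p := p) (q := q) (q' := q') (r := r) (c := c) (L := L) _) _);
      [can_red; can_cell|can_red; reflexivity]
  | _ => can_cell end.
Ltac can_chain H := lazymatch goal with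
  | |- can (pcomp _ _) _ _ => eapply (can_pcomp H); [can_chain H|can_step H]
  | _ => can_step H end.
Ltac can_image h := lazymatch goal with
  | |- can (@fcell _ _ _ _ _ _ ?p ?q ?c) _ _ =>
    refine (can_conv (h _ _ _ p q c _ _ _ _) _ _); [|can_cell|reflexivity|reflexivity]; can_cf end.

Section Premonoidal.
Context {B : bicat} {D : double_category} {φ : framing B D} (H : is_framing φ).
Context {bow : B -> B -> B} {I : B} (P : premonoidal_data bow I).
Local Notation "X ⋈ Y" := (bow X Y) (at level 25, left associativity).
Local Notation cf := (cf (φ := φ)).
Local Notation can := (can (φ := φ)).
Local Notation okc := (okc (φ := φ)).

(** What the cocycle and normalization axioms use of a premonoidal structure, over an arbitrary
    framing; the horizontal and the Kleisli bicategory then share the three proofs that follow. *)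
Record canon (eA : B -> B -> B -> dsq D) (eL eR : B -> dsq D) (iL iR : B -> B -> dsq D -> dsq D) : Prop := {
  cp_a : forall X Y Z, cf (pa P X Y Z) (eA X Y Z);
  cp_l : forall X, cf (pl P X) (eL X);
  cp_r : forall X, cf (pr P X) (eR X);
  cp_L : forall X Y Z (f : hom Y Z) e, cf f e -> cf (pL P X # f) (iL X Z e);
  cp_R : forall X Y Z (f : hom Y Z) e, cf f e -> cf (pR P X # f) (iR X Z e);
  cp_fL : forall X Y Z (p q : path Y Z) (c : pcell p q) l l', okc p l -> can c l l' ->
    can (fcell (pL P X) c) (imap (iL X) p l) (imap (iL X) q l');
  cp_fR : forall X Y Z (p q : path Y Z) (c : pcell p q) l l', okc p l -> can c l l' ->
    can (fcell (pR P X) c) (imap (iR X) p l) (imap (iR X) q l');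
  cp_a1 : forall Y Z X X' (f : hom X X') e, cf f e ->
    can (fwd (pa1 P Y Z X X' f)) [iR Z (X' ⋈ Y) (iR Y X' e); eA X' Y Z] [eA X Y Z; iR (Y ⋈ Z) X' e];
  cp_a2 : forall X Z Y Y' (f : hom Y Y') e, cf f e ->
    can (fwd (pa2 P X Z Y Y' f)) [iR Z (X ⋈ Y') (iL X Y' e); eA X Y' Z] [eA X Y Z; iL X (Y' ⋈ Z) (iR Z Y' e)];
  cp_a3 : forall X Y Z Z' (f : hom Z Z') e, cf f e ->
    can (fwd (pa3 P X Y Z Z' f)) [iL (X ⋈ Y) Z' e; eA X Y Z'] [eA X Y Z; iL X (Y ⋈ Z') (iL Y Z' e)];
  cp_a2' : forall X Z Y Y' (f : hom Y Y') e, cf f e ->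
    can (bwd (pa2 P X Z Y Y' f)) [eA X Y Z; iL X (Y' ⋈ Z) (iR Z Y' e)] [iR Z (X ⋈ Y') (iL X Y' e); eA X Y' Z];
  cp_a3' : forall X Y Z Z' (f : hom Z Z') e, cf f e ->
    can (bwd (pa3 P X Y Z Z' f)) [eA X Y Z; iL X (Y ⋈ Z') (iL Y Z' e)] [iL (X ⋈ Y) Z' e; eA X Y Z'];
  cp_p : forall X Y Z W, can (fwd (pp P X Y Z W))
    [iR W (X ⋈ (Y ⋈ Z)) (eA X Y Z); eA X (Y ⋈ Z) W; iL X (Y ⋈ (Z ⋈ W)) (eA Y Z W)]
    [eA (X ⋈ Y) Z W; eA X Y (Z ⋈ W)];
  cp_m : forall X Y, can (fwd (pm P X Y)) [eA X I Y; iL X Y (eL Y)] [iR Y X (eR X)];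
  cp_ll : forall X Y, can (fwd (pll P X Y)) [eA I X Y; eL (X ⋈ Y)] [iR Y X (eL X)];
  cp_rr : forall X Y, can (fwd (prr P X Y)) [eA X Y I; iL X Y (eR Y)] [eR (X ⋈ Y)] }.

Context {eA : B -> B -> B -> dsq D} {eL eR : B -> dsq D} {iL iR : B -> B -> dsq D -> dsq D}
  (C : canon eA eL eR iL iR).

Ltac can_cf ::= lazymatch goal with
  | |- Submission.cf _ _ => first [apply (cp_a C) | apply (cp_l C) | apply (cp_r C) | apply (cp_L C); can_cf | apply (cp_R C); can_cf]
  | |- _ => first [exact eq_refl | split; can_cf] end.
Ltac can_cell ::= first
  [ apply (cp_p C) | apply (cp_m C) | apply (cp_ll C) | apply (cp_rr C)
  | apply (cp_a1 C); can_cf | apply (cp_a2 C); can_cf | apply (cp_a3 C); can_cf | apply (cp_a2' C); can_cf | apply (cp_a3' C); can_cf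
  | can_image (cp_fL C)  | can_image (cp_fR C)  ].


Lemma canon_cocycle : cocycle_axiom P.
Proof.
intros X Y Z W V.
(* Only the source staircase is given. The first pasting computes the target staircase, and the
   second has to arrive at the same list. *)
eapply (can_eq H (l := [iR V _ (iR W _ (eA X Y Z)); iR V _ (eA X (Y ⋈ Z) W); iR V _ (iL X _ (eA Y Z W));
  eA X (Y ⋈ (Z ⋈ W)) V; iL X _ (eA Y (Z ⋈ W) V); iL X _ (iL Y _ (eA Z W V))])); [can_cf|can_chain H|can_chain H].
Qed.

Lemma canon_norm_l : normalization_left P.
Proof.
intros X Y Z.
eapply (can_eq H (l := [iR Z _ (eA X I Y); eA X (I ⋈ Y) Z; iL X _ (eA I Y Z); iL X _ (eL (Y ⋈ Z))]));
  [can_cf|can_chain H|can_chain H].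
Qed.

Lemma canon_norm_r : normalization_right P.
Proof.
intros X Y Z.
eapply (can_eq H (l := [iR Z _ (eA X Y I); eA X (Y ⋈ I) Z; iL X _ (eA Y I Z); iL X _ (iL Y _ (eL Z))]));
  [can_cf|can_chain H|can_chain H].
Qed.
End Premonoidal.

(** * Lifted equalities are canonical *)

Section Lifted.
Context {D : double_category}.
Local Notation HD := (Horiz D).
Local Notation φ1 := (horizfr D).

(** The companion law by which [eps] absorbs the [iota] of a lifted equality ([lift_sq]). It passes
    to composites, pairs and images. *)
Definition vcmp {E : double_category} {u : dv E} (c : companion_data u) : Prop := iot c ÷ eps c = hidS u.

Lemma vcmp_ax {E : double_category} {u : dv E} (c : companion u) : vcmp c.
Proof. apply (companion_ax c). Qed.
Lemma vcmp_id {E : double_category} (A : dob E) : vcmp (cmp_id A).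
Proof. unfold vcmp; cbn. rewrite <- hidS_v, u1; rewrite ?vdom_id, ?vcod_id; auto. Qed.
Lemma vcmp_pair {E E' : double_category} {u : dv E} {v : dv E'} (c : companion_data u) (d : companion_data v) :
  vcmp c -> vcmp d -> vcmp (E := dprodD E E') (u := (u, v)) (cmp_pair c d).
Proof. unfold vcmp; cbn; congruence. Qed.
Lemma vcmp_map {E E' : double_category} {F : pdfun E E'} (Q : is_pdfun F) {u : dv E} (c : companion_data u) :
  vcmp c -> vcmp (cmp_map F c).
Proof.
unfold vcmp; cbn; intros e.
rewrite vA by gb. rewrite <- (vA (s1 := FS F (iot c))) by gb.
rewrite <- (FS_vcomp Q), e by gb. rewrite <- vA by gb.
rewrite <- (F2u_nat Q), vA, (F2u_inv Q), vr; gb.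
Qed.
(** [cmp_comp] arranges the two squares in rows; interchange brings them to the staircase form of
    [cev]. *)
Lemma eps_comp {u v : dv D} (e : vcod u = vdom v) (c : companion_data u) (d : companion_data v) :
  eps (cmp_comp e c d) = (eps c ÷ hidS v) ∥ eps d.
Proof.
cbn; rewrite <- (h1 (s := eps d) (u := v)) at 1 by gb.
rewrite exch by gb. rewrite v1 by gb; auto.
Qed.
Lemma vcmp_comp {u v : dv D} (e : vcod u = vdom v) (c : companion_data u) (d : companion_data v) :
  vcmp c -> vcmp d -> vcmp (cmp_comp e c d).
Proof.
unfold vcmp; rewrite eps_comp; intros x y; cbn.
rewrite vA by gb. rewrite exch by gb. rewrite y.
rewrite v1, hr by gb. rewrite <- vA, x, hidS_v by gb; auto.
Qed.

(** Below [[iota_u | Id^u | eps_v]] the square [eps_u] meets [iota_u] and cancels it, which leaves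
    [eps_v]. *)
Lemma lift_sq {u v : dv D} (c : companion_data u) (d : companion_data v) : u = v -> vcmp c ->
  ((iot c ∥ hidS u) ∥ eps d) ÷ eps c = eps d.
Proof.
intros e h; destruct e.
rewrite (hr (s := iot c)) by gb.
rewrite <- (hr (s := eps c) (u := vid (vcod u))) at 1 by gb.
rewrite exch by gb. rewrite h, hidS_id, vr, h1 by gb; auto.
Qed.

Lemma lift_can {u v : dv D} (c : companion_data u) (d : companion_data v) (e : u = v)
  (X Y : HD) (p q : path X Y) (ep : hval (peval p) = cmp d) (eq : hval (peval q) = cmp c) l l' :
  vcmp c -> vcmp d -> okc (φ := φ1) p l -> okc (φ := φ1) q l' -> cev (φ := φ1) p l = eps d ->
  cev (φ := φ1) q l' = eps c ->
  is_iso2 (lift_eq e ep eq) /\ can (φ := φ1) (fwd (lift_eq e ep eq)) l l'.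
Proof.
intros hc hd o o' E E'.
assert (A := horizfr_ax D).
assert (W : cs φ1 (fwd (lift_eq e ep eq) : cell (peval p) (peval q)) ÷ cev (φ := φ1) q l' = cev (φ := φ1) p l).
{ rewrite E, E'; apply (lift_sq d e hc). }
assert (W' : cs φ1 (bwd (lift_eq e ep eq) : cell (peval q) (peval p)) ÷ cev (φ := φ1) p l = cev (φ := φ1) q l').
{ rewrite E, E'; apply (lift_sq c (eq_sym e) hd). }
assert (f := cev_fr A o); assert (f' := cev_fr A o').
split.
- apply (pid_iso A (cf_fr (cev_cf A o)) (π' := cev (φ := φ1) q l')); auto; try apply (cev_iso A); auto.
  assert (z := cf_fr (cev_cf A o')); rewrite E' in z; rewrite E, E'.
  replace (lft (eps d)) with (lft (eps c)); auto. rewrite !eps_lft; auto.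
- intros _; auto.
Qed.

Lemma cev_cons2 {B : bicat} {φ : framing B D} (H : is_framing φ) (X Y Z W : B) (f : hom X Y) (g : hom Y Z) (p : path Z W) e l E :
  okc (φ := φ) (pcons g p) l -> E = cev (φ := φ) (pcons g p) l ->
  cev (φ := φ) (pcons f (pcons g p)) (e :: l) = fc φ f (peval (pcons g p)) (e ÷ hidS (lft E)) E.
Proof.
intros o ->; rewrite cev_cons, (fr_lft (cev_fr H o)).
destruct l; [destruct o|auto].
Qed.

Lemma cev_cmp (X Y Z W : HD) (f : hom X Y) (g : hom Y Z) (p : path Z W) a l u v (e : vcod u = vdom v)
  (c : companion_data u) (d : companion_data v) :
  okc (φ := φ1) (pcons g p) l -> a = eps c -> cev (φ := φ1) (pcons g p) l = eps d ->
  cev (φ := φ1) (pcons f (pcons g p)) (a :: l) = eps (cmp_comp e c d).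
Proof.
intros o E E'; rewrite (cev_cons2 (horizfr_ax D) f a o eq_refl), E', eps_comp, eps_lft, E; auto.
Qed.
End Lifted.

(** * The tensor product *)

Section Tensor.
Context {D : double_category} (M : monoidal_double D).
Local Notation HD := (Horiz D).

(** The companion frame of [X ⊗ f] obtained from that of [f], written with the unitor of the binary
    tensor; [img_L] identifies it with the image under the one-variable functor. *)
Definition iL (X Z : HD) (e : dsq D) : dsq D := img (D := dprodD D D) (dt M) (X, Z) (FS (dt M) (hidS (vid X), e)).
Definition iR (Y Z : HD) (e : dsq D) : dsq D := img (D := dprodD D D) (dt M) (Z, Y) (FS (dt M) (e, hidS (vid Y))).

Lemma img_did (A : dob D) e : bot e = hid A -> img (did D) A e = e.
Proof. intros h; unfold img; cbn; apply vr, h. Qed.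
(** The unitor of a tensor of functors is that of the tensor product together with the images of
    those of the factors, so companion frames can be mapped in stages. *)
Lemma img_tens {L : double_category} (F G : pdfun L D) (A : dob L) a b : bot a = FH F (hid A) ->
  bot b = FH G (hid A) ->
  img (dtens (dt M) F G) A (FS (dt M) (a, b))
  = img (D := dprodD D D) (dt M) (F A, G A) (FS (dt M) (img F A a, img G A b)).
Proof.
intros e e'; unfold img; cbn.
assert (z := FS_vcomp (dt_ax M) (a := (a, b)) (b := (F2u' F A, F2u' G A))); cbn in z.
rewrite z by (rewrite !F2u'_top, e, e'; auto).
apply eq_sym, vA; rewrite ?FS_bot, ?FS_top, ?F2u'_top; cbn; rewrite ?F2u'_top, ?F2u'_bot, ?e, ?e'; auto.
Qed.
Lemma img_comp {L E : double_category} (F : pdfun L D) (G : pdfun D E) (Q : is_pdfun G) (A : dob L) a : bot a = FH F (hid A) ->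
  img (dcomp F G) A (FS G a) = img G (F A) (FS G (img F A a)).
Proof.
intros e; unfold img; cbn.
rewrite (FS_vcomp Q) by (rewrite F2u'_top; auto).
apply eq_sym, vA; rewrite ?FS_bot, ?FS_top, ?F2u'_top, ?F2u'_bot, ?e; auto.
Qed.
Lemma img_const (X Y : dob D) : img (dconst D X) Y (hidS (vid X)) = hidS (vid X).
Proof. unfold img; cbn; rewrite hidS_id; apply v1; gb. Qed.
End Tensor.

Lemma can_cell1 {B : bicat} {D : double_category} {φ : framing B D} (H : is_framing φ) (X Y : B)
  (f g : hom X Y) (c : cell f g) e e' : cf (φ := φ) g e' -> cs φ c ÷ e' = e ->
  can (φ := φ) (c : pcell ⟪f⟫ ⟪g⟫) [e] [e'].
Proof.
intros h E [h' _]; split; [exact (conj h eq_refl)|].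
rewrite (cev_one h), (cev_one h'); exact E.
Qed.

Section Images.
Context {B C : bicat} {D E : double_category} {φ : framing B D} {ψ : framing C E}.
Context (H : is_framing φ) (K : is_framing ψ).
Context {F0 : B -> C} {F : psfun F0} {Fh : pdfun D E}
  {Fr : forall X Y : B, hom X Y -> dsq D -> dsq E} (P : ffun φ ψ F Fh Fr) (i : B -> dsq D -> dsq E).
Context (J : forall (Y Z : B) (f : hom Y Z) e, cf (φ := φ) f e -> img Fh (fo φ Z) (Fr f e) = i Z e).

Lemma img_cf' (Y Z : B) (f : hom Y Z) e : cf (φ := φ) f e -> cf (φ := ψ) (F # f) (i Z e).
Proof. intros h; rewrite <- (J h); apply (img_cf H K P h). Qed.

Lemma can_f2 (X Y : B) (f g : hom X Y) (c : cell f g) e e' : cf (φ := φ) f e ->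
  can (φ := φ) (c : pcell ⟪f⟫ ⟪g⟫) [e] [e'] ->
  can (φ := ψ) (one (f2 F c) : pcell ⟪F # f⟫ ⟪F # g⟫) [i Y e] [i Y e'].
Proof.
intros h k _; destruct (k (conj h eq_refl)) as [[h' _] E1].
rewrite (cev_one h'), (cev_one h) in E1.
assert (J1 := img_cf' h); assert (J2 := img_cf' h').
split; [exact (conj J2 eq_refl)|].
rewrite (cev_one J1), (cev_one J2), <- (J h), <- (J h').
unfold img. refine (eq_trans (act_post K _ (fm_fr (ff_map P) (cf_fr h')) _) _).
{ rewrite (fm_bot (ff_map P) (cf_fr h')), (cf_bot h'), F2u'_top; auto. }
refine (f_equal (fun z => z ÷ _) (eq_trans (ff_cell P c (cf_fr h')) _)). f_equal. exact E1.
Qed.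

Lemma can_unit (X : B) :
  can (φ := ψ) (bwd (funit F X) : pcell ⟪F # id1 X⟫ ⟪id1 (F0 X)⟫) [i X (fu φ X (vid (fo φ X)))]
    [fu ψ (F0 X) (vid (fo ψ (F0 X)))] /\
  can (φ := ψ) (fwd (funit F X) : pcell ⟪id1 (F0 X)⟫ ⟪F # id1 X⟫) [fu ψ (F0 X) (vid (fo ψ (F0 X)))]
    [i X (fu φ X (vid (fo φ X)))].
Proof.
assert (c1 := cf_id H X); assert (c2 := cf_id K (F0 X)); assert (c3 := img_cf' c1).
assert (W : cs ψ (fwd (funit F X)) ÷ i X (fu φ X (vid (fo φ X))) = fu ψ (F0 X) (vid (fo ψ (F0 X)))).
(* The unitor is the iterated compositor of the empty path. *)
{ rewrite <- (J c1). refine (eq_trans (ffold_cev H K P (p := @pnil _ X) (l := []) eq_refl) eq_refl). }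
split.
- apply (can_cell1 K c2). eapply (act_inv K); [apply (cf_fr c3)|apply (ff_uiso P X)|exact W].
- apply (can_cell1 K c3), W.
Qed.

End Images.

Lemma imgs_imap {B : bicat} {D : double_category} {φ : framing B D}
  {Fh : pdfun D D} {Fr : forall X Y : B, hom X Y -> dsq D -> dsq D} (i : B -> dsq D -> dsq D)
  (J : forall (Y Z : B) (f : hom Y Z) e, cf (φ := φ) f e -> img Fh (fo φ Z) (Fr Y Z f e) = i Z e)
  (Y Z : B) (p : path Y Z) l : okc (φ := φ) p l -> imgs (φ := φ) (Fh := Fh) (Fr := Fr) p l = imap i p l.
Proof.
revert l; induction p as [A|A Y0 Z0 f p IH]; cbn; auto.
intros [|e l]; [intros []|intros [h o]]; rewrite (J _ _ f e h), (IH l o); auto.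
Qed.

Lemma can_fcell' {B : bicat} {D : double_category} {φ : framing B D} (H : is_framing φ) {F0 : B -> B}
  {F : psfun F0} {Fh : pdfun D D} {Fr : forall X Y : B, hom X Y -> dsq D -> dsq D} (P : ffun φ φ F Fh Fr)
  (i : B -> dsq D -> dsq D)
  (J : forall (Y Z : B) (f : hom Y Z) e, cf (φ := φ) f e -> img Fh (fo φ Z) (Fr Y Z f e) = i Z e)
  (Y Z : B) (p q : path Y Z) (c : pcell p q) l l' : okc (φ := φ) p l -> can (φ := φ) c l l' ->
  can (φ := φ) (fcell F c) (imap i p l) (imap i q l').
Proof.
intros o h; rewrite <- (imgs_imap J o), <- (imgs_imap J (proj1 (h o))).
apply (can_fcell H H P o h).
Qed.

(** * Companion frames of tensored 1-cells *)

Section HorizM2.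
Context (D : double_category) (M : monoidal_double D).
Context (la : liftable (dalpha M)) (ll : liftable (dlambda M)) (lr : liftable (drho M)).
Local Notation HD := (Horiz D).
Local Notation φ1 := (horizfr D).
Local Notation φ2 := (prodfr φ1 φ1).
Local Notation φ3 := (prodfr φ2 φ1).
Local Notation HM := (Hmonoidal la ll lr).
Local Notation T := (Hten M).
Local Notation ax1 := (ax1 D).
Local Notation cf := (cf (φ := φ1)).
Local Notation can := (can (φ := φ1)).
Local Notation "X ⊗ Y" := (dt M (X, Y)) (at level 25, left associativity).

Definition eA (X Y Z : HD) : dsq D := eps (la (X, Y, Z)).
Definition eLm (X : HD) : dsq D := eps (ll X).
Definition eRm (X : HD) : dsq D := eps (lr X).

Lemma cf_a X Y Z : cf (Has1 la X Y Z) (eA X Y Z).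
Proof. exact (fn_cf (as_fn la) (X, Y, Z)). Qed.
Lemma cf_l X : cf (Hlu1 ll X) (eLm X).
Proof. exact (fn_cf (lu_fn ll) X). Qed.
Lemma cf_r X : cf (Hru1 lr X) (eRm X).
Proof. exact (fn_cf (ru_fn lr) X). Qed.

Lemma cf_hid (X : HD) : cf (id1 X) (hidS (vid X)).
Proof. apply (cf_id ax1 X). Qed.
Lemma cf_pair (X Y X' Y' : HD) (f : hom X Y) (g : hom X' Y') e e' : cf f e -> cf g e' ->
  Submission.cf (φ := φ2) (X := (X, X')) (Y := (Y, Y')) ⟨f, g⟩ (e, e').
Proof.
intros [] []; split; cbn; [apply fr_both; auto|f_equal; auto|apply visoS_pair; auto].
Qed.
Lemma cf_ten (X Y X' Y' : HD) (f : hom X Y) (g : hom X' Y') e e' : cf f e -> cf g e' ->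
  cf (T # ⟨f, g⟩) (img (D := dprodD D D) (dt M) (Y, Y') (FS (dt M) (e, e'))).
Proof. intros h h'; exact (proj1 (img_cf (ax2 D) ax1 (ten_ff M) (cf_pair h h'))). Qed.

Lemma tenL_ff X : ffun φ1 φ1 (tenL HM X) (dtens (dt M) (dconst D X) (did D)) (fun _ _ _ π => FS (dt M) (hidS (vid X), π)).
Proof. exact (tenf_ff M ax1 (constf_ff ax1 X) (idf_ff ax1)). Qed.
Lemma tenR_ff X : ffun φ1 φ1 (tenR HM X) (dtens (dt M) (did D) (dconst D X)) (fun _ _ _ π => FS (dt M) (π, hidS (vid X))).
Proof. exact (tenf_ff M ax1 (idf_ff ax1) (constf_ff ax1 X)). Qed.

Lemma img_L (X Y Z : HD) (f : hom Y Z) e : cf f e ->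
  img (dtens (dt M) (dconst D X) (did D)) Z (FS (dt M) (hidS (vid X), e)) = iL M X Z e.
Proof.
intros h; rewrite img_tens, img_const, img_did; cbn; rewrite ?bot_hid, ?vcod_id, ?(cf_bot h); auto.
Qed.
Lemma img_R (X Y Z : HD) (f : hom Y Z) e : cf f e ->
  img (dtens (dt M) (did D) (dconst D X)) Z (FS (dt M) (e, hidS (vid X))) = iR M X Z e.
Proof.
intros h; rewrite img_tens, img_const, img_did; cbn; rewrite ?bot_hid, ?vcod_id, ?(cf_bot h); auto.
Qed.

Lemma cf_L (X Y Z : HD) (f : hom Y Z) e : cf f e -> cf (tenL HM X # f) (iL M X Z e).
Proof. apply (img_cf' ax1 ax1 (tenL_ff X) (i := iL M X)); intros; eapply img_L; eauto. Qed.
Lemma cf_R (X Y Z : HD) (f : hom Y Z) e : cf f e -> cf (tenR HM X # f) (iR M X Z e).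
Proof. apply (img_cf' ax1 ax1 (tenR_ff X) (i := iR M X)); intros; eapply img_R; eauto. Qed.

Lemma bot_FS2 (F : pdfun (dprod D D) D) a b A B : bot a = hid A -> bot b = hid B ->
  bot (FS F (a, b)) = FH F (hid A, hid B).
Proof. intros e e'; rewrite FS_bot; cbn; rewrite e, e'; auto. Qed.

Lemma img_as_l (X Y Z : dob D) a b c : bot a = hid X -> bot b = hid Y -> bot c = hid Z ->
  img (D := dprodD (dprodD D D) D) (dtens (dt M) (dtens (dt M) (dp31 D) (dp32 D)) (dp33 D)) (X, Y, Z) (FS (dt M) (FS (dt M) (a, b), c))
  = img (D := dprodD D D) (dt M) (X ⊗ Y, Z) (FS (dt M) (img (D := dprodD D D) (dt M) (X, Y) (FS (dt M) (a, b)), c)).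
Proof.
intros ea eb ec.
rewrite (img_tens M (L := dprodD (dprodD D D) D)); cbn; auto; [|apply bot_FS2; auto].
rewrite (img_tens M (L := dprodD (dprodD D D) D)); cbn; auto.
f_equal; f_equal; unfold img; cbn; rewrite ?v1, ?vr by (rewrite ?v1 by gb; gb); auto.
Qed.
Lemma img_as_r (X Y Z : dob D) a b c : bot a = hid X -> bot b = hid Y -> bot c = hid Z ->
  img (D := dprodD (dprodD D D) D) (dtens (dt M) (dp31 D) (dtens (dt M) (dp32 D) (dp33 D))) (X, Y, Z) (FS (dt M) (a, FS (dt M) (b, c)))
  = img (D := dprodD D D) (dt M) (X, Y ⊗ Z) (FS (dt M) (a, img (D := dprodD D D) (dt M) (Y, Z) (FS (dt M) (b, c)))).
Proof.
intros ea eb ec.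
rewrite (img_tens M (L := dprodD (dprodD D D) D)); cbn; auto; [|apply bot_FS2; auto].
rewrite (img_tens M (L := dprodD (dprodD D D) D) (F := dp32 D)); cbn; auto.
f_equal; f_equal; unfold img; cbn; rewrite ?v1, ?vr by (rewrite ?v1 by gb; gb); auto.
Qed.

Lemma can_as (X Y Z X' Y' Z' : HD) (f : hom X X') (g : hom Y Y') (h : hom Z Z') e e' e'' :
  cf f e -> cf g e' -> cf h e'' ->
  let F := fun A B a b => img (D := dprodD D D) (dt M) (A, B) (FS (dt M) (a, b)) in
  can (fwd (Hasn la (X, Y, Z) (X', Y', Z') ⟨⟨f, g⟩, h⟩))
   [F (X' ⊗ Y') Z' (F X' Y' e e') e''; eA X' Y' Z'] [eA X Y Z; F X' (Y' ⊗ Z') e (F Y' Z' e' e'')] /\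
  can (bwd (Hasn la (X, Y, Z) (X', Y', Z') ⟨⟨f, g⟩, h⟩))
   [eA X Y Z; F X' (Y' ⊗ Z') e (F Y' Z' e' e'')] [F (X' ⊗ Y') Z' (F X' Y' e e') e''; eA X' Y' Z'].
Proof.
intros c c' c'' F.
assert (P := tenf_ff M (ax3 D) (tenf_ff M (ax3 D) (p31_ff D) (p32_ff D)) (p33_ff D)).
assert (Q := tenf_ff M (ax3 D) (p31_ff D) (tenf_ff M (ax3 D) (p32_ff D) (p33_ff D))).
assert (k : Submission.cf (φ := φ3) (X := (X, Y, Z)) (Y := (X', Y', Z')) ⟨⟨f, g⟩, h⟩ (e, e', e'')).
{ destruct (cf_pair c c'), c''; split; cbn; [apply fr_both; auto|f_equal; auto|apply visoS_pair; auto]. }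
assert (E1 := img_as_l (cf_bot c) (cf_bot c') (cf_bot c'')); assert (E2 := img_as_r (cf_bot c) (cf_bot c') (cf_bot c'')).
cbn in E1, E2.
split.
- refine (can_conv (can_nat (ax3 D) ax1 P Q (as_fn la) (va_unit (dalpha M)) k) (f_equal (fun z => [z; _]) E1) (f_equal (fun z => [_; z]) E2)).
- refine (can_conv (can_nat' (ax3 D) ax1 P Q (as_fn la) (va_unit (dalpha M)) k) (f_equal (fun z => [_; z]) E2) (f_equal (fun z => [z; _]) E1)).
Qed.

(** The unit is a pseudofunctor from the point, so [FH (dI M) tt] is only isomorphic to the identity
    of the unit object; this square is its companion frame. *)
Definition eU : dsq D := F2u' (dI M) tt.
Lemma img_unit : img (D := dunitD) (dI M) tt (FS (dI M) tt) = eU.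
Proof.
unfold img, eU. assert (z := FS_vid (dI_ax M) tt); cbn in z; rewrite z. apply v1; apply F2u'_top.
Qed.

Lemma can_lu (X X' : HD) (f : hom X X') e : cf f e ->
  can (fwd (Hlun1 ll X X' f)) [img (D := dprodD D D) (dt M) (dI M tt, X') (FS (dt M) (eU, e)); eLm X'] [eLm X; e] /\
  can (bwd (Hlun1 ll X X' f)) [eLm X; e] [img (D := dprodD D D) (dt M) (dI M tt, X') (FS (dt M) (eU, e)); eLm X'].
Proof.
intros c.
assert (E' : img (did D) X' e = e) by apply (img_did (cf_bot c)).
assert (E : img (dtens (dt M) (dcomp (dbang D) (dI M)) (did D)) X' (FS (dt M) (FS (dI M) tt, e))
  = img (D := dprodD D D) (dt M) (dI M tt, X') (FS (dt M) (eU, e))).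
{ rewrite img_tens, E'; cbn; rewrite ?FS_bot, ?(cf_bot c); auto.
  f_equal; f_equal; f_equal; auto. unfold img, eU; cbn.
  assert (z := FS_vid (dI_ax M) tt); cbn in z; rewrite z.
  assert (y : vidS (FH (dI M) tt) ÷ F2u' (dI M) tt = F2u' (dI M) tt) by exact (v1 (F2u'_top (dI M) tt)).
  rewrite !y; auto. }
split.
- refine (can_conv (can_nat ax1 ax1 (lu_ff M) (id_ff D) (lu_fn ll) (va_unit (dlambda M)) c) (f_equal (fun z => [z; _]) E) (f_equal (fun z => [_; z]) E')).
- refine (can_conv (can_nat' ax1 ax1 (lu_ff M) (id_ff D) (lu_fn ll) (va_unit (dlambda M)) c) (f_equal (fun z => [_; z]) E') (f_equal (fun z => [z; _]) E)).
Qed.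

Lemma can_ru (X X' : HD) (f : hom X X') e : cf f e ->
  can (fwd (Hrun1 lr X X' f)) [img (D := dprodD D D) (dt M) (X', dI M tt) (FS (dt M) (e, eU)); eRm X'] [eRm X; e] /\
  can (bwd (Hrun1 lr X X' f)) [eRm X; e] [img (D := dprodD D D) (dt M) (X', dI M tt) (FS (dt M) (e, eU)); eRm X'].
Proof.
intros c.
assert (E' : img (did D) X' e = e) by apply (img_did (cf_bot c)).
assert (E : img (dtens (dt M) (did D) (dcomp (dbang D) (dI M))) X' (FS (dt M) (e, FS (dI M) tt))
  = img (D := dprodD D D) (dt M) (X', dI M tt) (FS (dt M) (e, eU))).
{ rewrite img_tens, E'; cbn; rewrite ?FS_bot, ?(cf_bot c); auto.
  f_equal; f_equal; f_equal; auto. unfold img, eU; cbn.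
  assert (z := FS_vid (dI_ax M) tt); cbn in z; rewrite z.
  assert (y : vidS (FH (dI M) tt) ÷ F2u' (dI M) tt = F2u' (dI M) tt) by exact (v1 (F2u'_top (dI M) tt)).
  rewrite !y; auto. }
split.
- refine (can_conv (can_nat ax1 ax1 (ru_ff M) (id_ff D) (ru_fn lr) (va_unit (drho M)) c) (f_equal (fun z => [z; _]) E) (f_equal (fun z => [_; z]) E')).
- refine (can_conv (can_nat' ax1 ax1 (ru_ff M) (id_ff D) (ru_fn lr) (va_unit (drho M)) c) (f_equal (fun z => [_; z]) E') (f_equal (fun z => [z; _]) E)).
Qed.

Lemma can_ten2 (X Y X' Y' : HD) (f f' : hom X Y) (g g' : hom X' Y') (c : cell f f') (d : cell g g') e e' u u' :
  cf f e -> cf g u -> can (c : pcell ⟪f⟫ ⟪f'⟫) [e] [e'] -> can (d : pcell ⟪g⟫ ⟪g'⟫) [u] [u'] ->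
  can (one (f2 T (cpair c d)) : pcell ⟪T # ⟨f, g⟩⟫ ⟪T # ⟨f', g'⟩⟫)
    [img (D := dprodD D D) (dt M) (Y, Y') (FS (dt M) (e, u))] [img (D := dprodD D D) (dt M) (Y, Y') (FS (dt M) (e', u'))].
Proof.
intros h k h' k'.
destruct (h' (conj h eq_refl)) as [[h2 _] E1], (k' (conj k eq_refl)) as [[k2 _] E2].
rewrite (cev_one h2), (cev_one h) in E1; rewrite (cev_one k2), (cev_one k) in E2.
refine (can_f2 (ax2 D) ax1 (ten_ff M) (i := fun Z π => img (D := dprodD D D) (dt M) (fst Z, snd Z) (FS (dt M) π)) _ (cf_pair h k) _).
- intros [] []; auto.
- apply (can_cell1 (ax2 D) (cf_pair h2 k2)); cbn; f_equal; auto.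
Qed.

Lemma can_id (X Y : HD) (f : hom X Y) e : cf f e -> can (id2 f : pcell ⟪f⟫ ⟪f⟫) [e] [e].
Proof. intros h; apply (can_cell1 ax1 h), (act_id ax1 (cf_fr h)). Qed.

Lemma can_tenunit (Y Z : HD) :
  can (bwd (funit T (Y, Z)) : pcell ⟪T # ⟨id1 Y, id1 Z⟩⟫ ⟪id1 (Y ⊗ Z : HD)⟫)
    [img (D := dprodD D D) (dt M) (Y, Z) (FS (dt M) (hidS (vid Y), hidS (vid Z)))] [hidS (vid (Y ⊗ Z))] /\
  can (fwd (funit T (Y, Z)) : pcell ⟪id1 (Y ⊗ Z : HD)⟫ ⟪T # ⟨id1 Y, id1 Z⟩⟫) [hidS (vid (Y ⊗ Z))]
    [img (D := dprodD D D) (dt M) (Y, Z) (FS (dt M) (hidS (vid Y), hidS (vid Z)))].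
Proof.
exact (can_unit (ax2 D) ax1 (ten_ff M) (i := fun Z π => img (D := dprodD D D) (dt M) (fst Z, snd Z) (FS (dt M) π))
  ltac:(intros ? [] ? ? ?; reflexivity) (Y, Z)).
Qed.
Lemma can_uniunit :
  can (bwd (funit (Hfun0 (dI M)) tt) : pcell ⟪Hfun0 (dI M) # @id1 unitb tt⟫ ⟪id1 (dI M tt : HD)⟫) [eU] [hidS (vid (dI M tt))] /\
  can (fwd (funit (Hfun0 (dI M)) tt) : pcell ⟪id1 (dI M tt : HD)⟫ ⟪Hfun0 (dI M) # @id1 unitb tt⟫) [hidS (vid (dI M tt))] [eU].
Proof.
exact (can_unit unitfr_ax ax1 (uni_ff M) (i := fun _ _ => eU) ltac:(intros ? [] ? [] ?; exact img_unit) tt).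
Qed.
End HorizM2.

(** * Canonicity of the constraints of the horizontal bicategory *)

Section HorizM3.
Context (D : double_category) (M : monoidal_double D).
Context (la : liftable (dalpha M)) (ll : liftable (dlambda M)) (lr : liftable (drho M)).
Local Notation φ1 := (horizfr D).
Local Notation HM := (Hmonoidal la ll lr).
Local Notation ax1 := (ax1 D).
Local Notation cf := (cf (φ := φ1)).
Local Notation can := (can (φ := φ1)).
Local Notation okc := (okc (φ := φ1)).
Local Notation "X ⊗ Y" := (dt M (X, Y)) (at level 25, left associativity).
Local Notation eA := (eA la).
Local Notation eL := (eLm ll).
Local Notation eR := (eRm lr).
Local Notation iL := (iL M).
Local Notation iR := (iR M).

Lemma eps_tenR (u : dv D) (c : companion_data u) (Y A : dob D) : vcod u = A ->
  eps (cmp_tenR M c Y) = iR Y A (eps c).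
Proof. intros <-; unfold Submission.iR, img; cbn; rewrite vcod_id; auto. Qed.
Lemma eps_tenL (u : dv D) (c : companion_data u) (Y A : dob D) : vcod u = A ->
  eps (cmp_tenL M Y c) = iL Y A (eps c).
Proof. intros <-; unfold Submission.iL, img; cbn; rewrite vcod_id; auto. Qed.
Lemma vcmp_tenR (u : dv D) (c : companion_data u) (Y : dob D) : vcmp c -> vcmp (cmp_tenR M c Y).
Proof. intros h; apply (vcmp_map (E := dprodD D D) (dt_ax M)), vcmp_pair; auto. apply vcmp_id. Qed.
Lemma vcmp_tenL (u : dv D) (c : companion_data u) (Y : dob D) : vcmp c -> vcmp (cmp_tenL M Y c).
Proof. intros h; apply (vcmp_map (E := dprodD D D) (dt_ax M)), vcmp_pair; auto. apply vcmp_id. Qed.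

Ltac can_cf ::= lazymatch goal with
  | |- Submission.cf _ _ => first [apply cf_a | apply cf_l | apply cf_r | apply (cf_L la ll lr); can_cf | apply (cf_R la ll lr); can_cf]
  | |- _ => first [exact eq_refl | split; can_cf] end.

Ltac vc := repeat first [apply vcmp_ax | apply vcmp_comp | apply vcmp_tenR | apply vcmp_tenL | apply vcmp_id].
Ltac ce := first
  [ eapply cev_cmp; [can_cf| |ce]; ce
  | rewrite eps_tenR with (A := vcod _) by reflexivity ].
Lemma can_mp X Y Z W : is_iso2 (Hmp la X Y Z W) /\ can (fwd (Hmp la X Y Z W))
    [iR W (X ⊗ (Y ⊗ Z)) (eA X Y Z); eA X (Y ⊗ Z) W; iL X (Y ⊗ (Z ⊗ W)) (eA Y Z W)]
    [eA (X ⊗ Y) Z W; eA X Y (Z ⊗ W)].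
Proof.
unfold Hmp; apply lift_can; [vc|vc|can_cf|can_cf| |].
- eapply cev_cmp; [can_cf|symmetry; apply eps_tenR; gb|].
  eapply cev_cmp; [can_cf|auto|].
  rewrite cev_one by can_cf. symmetry; apply eps_tenL; gb.
- eapply cev_cmp; [can_cf|auto|]. rewrite cev_one by can_cf. auto.
Qed.

Lemma can_mid X Y : is_iso2 (Hmid la ll lr X Y) /\ can (fwd (Hmid la ll lr X Y))
  [eA X (dI M tt) Y; iL X Y (eL Y)] [iR Y X (eR X)].
Proof.
unfold Hmid; apply lift_can; [vc|vc|can_cf|can_cf| |].
- eapply cev_cmp; [can_cf|auto|]. rewrite cev_one by can_cf. symmetry; apply eps_tenL; gb.
- rewrite cev_one by can_cf. symmetry; apply eps_tenR; gb.
Qed.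

Lemma can_left X Y : is_iso2 (Hleft la ll X Y) /\ can (fwd (Hleft la ll X Y))
  [eA (dI M tt) X Y; eL (X ⊗ Y)] [iR Y X (eL X)].
Proof.
unfold Hleft; apply lift_can; [vc|vc|can_cf|can_cf| |].
- eapply cev_cmp; [can_cf|auto|]. rewrite cev_one by can_cf. auto.
- rewrite cev_one by can_cf. symmetry; apply eps_tenR; gb.
Qed.

Lemma can_right X Y : is_iso2 (Hright la lr X Y) /\ can (fwd (Hright la lr X Y))
  [eA X Y (dI M tt); iL X Y (eR Y)] [eR (X ⊗ Y)].
Proof.
unfold Hright; apply lift_can; [vc|vc|can_cf|can_cf| |].
- eapply cev_cmp; [can_cf|auto|]. rewrite cev_one by can_cf. symmetry; apply eps_tenL; gb.
- rewrite cev_one by can_cf. auto.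
Qed.

(** Naturality in one variable is [Hasn] with identities in the other slots, followed by the
    replacement of a tensor of identities by an identity. Both cells are canonical. *)
Lemma can_a1 Y Z X X' (f : hom X X') e : cf f e ->
  can (fwd (as_1 HM Y Z X X' f)) [iR Z (X' ⊗ Y) (iR Y X' e); eA X' Y Z] [eA X Y Z; iR (Y ⊗ Z) X' e] /\
  can (bwd (as_1 HM Y Z X X' f)) [eA X Y Z; iR (Y ⊗ Z) X' e] [iR Z (X' ⊗ Y) (iR Y X' e); eA X' Y Z].
Proof.
intros h. destruct (can_as la h (cf_hid Y) (cf_hid Z)) as [a1 a2].
destruct (can_tenunit M Y Z) as [u1 u2].
assert (x1 := can_ten2 (M := M) h (cf_ten M (cf_hid Y) (cf_hid Z)) (can_id h) u1).
assert (x2 := can_ten2 (M := M) h (cf_hid (Y ⊗ Z)) (can_id h) u2).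
split; cbn [as_1 nat2 fwd bwd].
- eapply (can_pcomp ax1); [exact a1|].
  refine (can_to (can_ctx ax1 (p := ⟪Has1 la X Y Z⟫) (L := [eA X Y Z; _]) (r := ⟪⟫) x1) eq_refl).
- eapply (can_pcomp ax1); [|exact a2].
  refine (can_to (can_ctx ax1 (p := ⟪Has1 la X Y Z⟫) (L := [eA X Y Z; _]) (r := ⟪⟫) x2) eq_refl).
Qed.

Lemma can_a2 X Z Y Y' (f : hom Y Y') e : cf f e ->
  can (fwd (as_2 HM X Z Y Y' f)) [iR Z (X ⊗ Y') (iL X Y' e); eA X Y' Z] [eA X Y Z; iL X (Y' ⊗ Z) (iR Z Y' e)] /\
  can (bwd (as_2 HM X Z Y Y' f)) [eA X Y Z; iL X (Y' ⊗ Z) (iR Z Y' e)] [iR Z (X ⊗ Y') (iL X Y' e); eA X Y' Z].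
Proof. intros h; exact (can_as la (cf_hid X) h (cf_hid Z)). Qed.

Lemma can_a3 X Y Z Z' (f : hom Z Z') e : cf f e ->
  can (fwd (as_3 HM X Y Z Z' f)) [iL (X ⊗ Y) Z' e; eA X Y Z'] [eA X Y Z; iL X (Y ⊗ Z') (iL Y Z' e)] /\
  can (bwd (as_3 HM X Y Z Z' f)) [eA X Y Z; iL X (Y ⊗ Z') (iL Y Z' e)] [iL (X ⊗ Y) Z' e; eA X Y Z'].
Proof.
intros h. destruct (can_as la (cf_hid X) (cf_hid Y) h) as [a1 a2].
destruct (can_tenunit M X Y) as [u1 u2].
assert (x1 := can_ten2 (M := M) (cf_ten M (cf_hid X) (cf_hid Y)) h u1 (can_id h)).
assert (x2 := can_ten2 (M := M) (cf_hid (X ⊗ Y)) h u2 (can_id h)).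
split; cbn [as_3 nat2 fwd bwd].
- eapply (can_pcomp ax1); [|exact a1].
  refine (can_to (can_ctx ax1 (p := ⟪⟫) (L := [_; eA X Y Z']) (r := ⟪Has1 la X Y Z'⟫) x2) eq_refl).
- eapply (can_pcomp ax1); [exact a2|].
  refine (can_to (can_ctx ax1 (p := ⟪⟫) (L := [_; eA X Y Z']) (r := ⟪Has1 la X Y Z'⟫) x1) eq_refl).
Qed.

Lemma can_lu1 X X' (f : hom X X') e : cf f e ->
  can (fwd (lu_1 HM X X' f)) [iL (dI M tt) X' e; eL X'] [eL X; e] /\
  can (bwd (lu_1 HM X X' f)) [eL X; e] [iL (dI M tt) X' e; eL X'].
Proof.
intros h. destruct (can_lu ll h) as [a1 a2]. destruct (can_uniunit M) as [u1 u2].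
assert (cu : cf (Hfun0 (dI M) # @id1 unitb tt) (eU M)).
{ rewrite <- img_unit. exact (proj1 (img_cf unitfr_ax ax1 (uni_ff M) (X := tt) (Y := tt) (s := tt) (e := tt) (cf_id unitfr_ax tt))). }
assert (x1 := can_ten2 (M := M) cu h u1 (can_id h)).
assert (x2 := can_ten2 (M := M) (cf_hid (dI M tt)) h u2 (can_id h)).
split; cbn [lu_1 nat2 fwd bwd].
- eapply (can_pcomp ax1); [|exact a1].
  refine (can_to (can_ctx ax1 (p := ⟪⟫) (L := [_; eL X']) (r := ⟪Hlu1 ll X'⟫) x2) eq_refl).
- eapply (can_pcomp ax1); [exact a2|].
  refine (can_to (can_ctx ax1 (p := ⟪⟫) (L := [_; eL X']) (r := ⟪Hlu1 ll X'⟫) x1) eq_refl).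
Qed.

Lemma can_ru1 X X' (f : hom X X') e : cf f e ->
  can (fwd (ru_1 HM X X' f)) [iR (dI M tt) X' e; eR X'] [eR X; e] /\
  can (bwd (ru_1 HM X X' f)) [eR X; e] [iR (dI M tt) X' e; eR X'].
Proof.
intros h. destruct (can_ru lr h) as [a1 a2]. destruct (can_uniunit M) as [u1 u2].
assert (cu : cf (Hfun0 (dI M) # @id1 unitb tt) (eU M)).
{ rewrite <- img_unit. exact (proj1 (img_cf unitfr_ax ax1 (uni_ff M) (X := tt) (Y := tt) (s := tt) (e := tt) (cf_id unitfr_ax tt))). }
assert (x1 := can_ten2 (M := M) h cu (can_id h) u1).
assert (x2 := can_ten2 (M := M) h (cf_hid (dI M tt)) (can_id h) u2).
split; cbn [ru_1 nat2 fwd bwd].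
- eapply (can_pcomp ax1); [|exact a1].
  refine (can_to (can_ctx ax1 (p := ⟪⟫) (L := [_; eR X']) (r := ⟪Hru1 lr X'⟫) x2) eq_refl).
- eapply (can_pcomp ax1); [exact a2|].
  refine (can_to (can_ctx ax1 (p := ⟪⟫) (L := [_; eR X']) (r := ⟪Hru1 lr X'⟫) x1) eq_refl).
Qed.

Lemma can_fL X Y Z (p q : path Y Z) (c : pcell p q) l l' : okc p l -> can c l l' ->
  can (fcell (tenL HM X) c) (imap (iL X) p l) (imap (iL X) q l').
Proof. apply (can_fcell' ax1 (tenL_ff la ll lr X)); intros; eapply img_L; eauto. Qed.
Lemma can_fR X Y Z (p q : path Y Z) (c : pcell p q) l l' : okc p l -> can c l l' ->
  can (fcell (tenR HM X) c) (imap (iR X) p l) (imap (iR X) q l').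
Proof. apply (can_fcell' ax1 (tenR_ff la ll lr X)); intros; eapply img_R; eauto. Qed.

Lemma canon_HM : canon (φ := φ1) (premonoidal_of HM) eA eL eR iL iR.
Proof.
split; intros.
- apply cf_a.
- apply cf_l.
- apply cf_r.
- apply cf_L; auto.
- apply cf_R; auto.
- apply can_fL; auto.
- apply can_fR; auto.
- apply can_a1; auto.
- apply can_a2; auto.
- apply can_a3; auto.
- apply can_a2; auto.
- apply can_a3; auto.
- apply can_mp.
- apply can_mid.
- apply can_left.
- apply can_right.
Qed.
End HorizM3.

Section ModifCan.
Context {B C : bicat} {D E : double_category} {φ : framing B D} {ψ : framing C E}.
Context (H : is_framing φ) (K : is_framing ψ).
Context {F0 G0 : B -> C} {F : map1 F0} {G : map1 G0} {fv gv : dv D -> dv E} {fk gk : dh D -> dh E}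
    {Fr Gr : forall X Y : B, hom X Y -> dsq D -> dsq E}.

(** [framed_modif] with the action of the components supplied by canonicity. Each application ends
    with an equation between strict squares, which is an axiom on 1h-cells of the double-categorical
    structure or a consequence of such axioms. *)
Lemma modif_can {p q : forall X, path (F0 X) (G0 X)}
  {n : psnat F G (fun X => peval (p X))} {n' : psnat F G (fun X => peval (q X))}
  {av av' : dob D -> dv E} {ah ah' : dh D -> dsq E} {e e' : B -> dsq E}
  (N : fnat φ ψ fv gv fk gk Fr Gr n av ah e) (N' : fnat φ ψ fv gv fk gk Fr Gr n' av' ah' e')
  (l l' : forall X : B, list (dsq E)) (m : forall X, iso2 (p X) (q X)) :
  (forall X, is_iso2 (m X) /\ can (φ := ψ) (fwd (m X)) (l X) (l' X)) ->
  (forall X, okc (φ := ψ) (p X) (l X)) ->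
  (forall X, e X = cev (φ := ψ) (p X) (l X)) -> (forall X, e' X = cev (φ := ψ) (q X) (l' X)) ->
  (forall k, ah k = ah' k) -> is_inv_modif m n n'.
Proof.
intros h o E1 E2 E3; apply (framed_modif H K N N'); auto.
- intros X; apply h.
- intros X; rewrite E1, E2; apply (h X), o.
Qed.

Lemma cev_two (X Y Z : C) (f : hom X Y) (g : hom Y Z) e1 e2 : okc (φ := ψ) ⟪f; g⟫ [e1; e2] ->
  fc ψ f g (e1 ÷ hidS (lft e2)) e2 = cev (φ := ψ) ⟪f; g⟫ [e1; e2].
Proof.
intros (_ & o & _). symmetry; apply (cev_cons2 K _ _ (p := ⟪⟫)).
- split; [exact o|reflexivity].
- rewrite cev_one; auto.
Qed.

Lemma cev_three (X Y Z W : C) (f : hom X Y) (g : hom Y Z) (h : hom Z W) e1 e2 e3 : okc (φ := ψ) ⟪f; g; h⟫ [e1; e2; e3] ->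
  fc ψ f (comp1 g h) (e1 ÷ hidS (lft (fc ψ g h (e2 ÷ hidS (lft e3)) e3))) (fc ψ g h (e2 ÷ hidS (lft e3)) e3)
  = cev (φ := ψ) ⟪f; g; h⟫ [e1; e2; e3].
Proof.
intros (_ & o). rewrite (cev_two o). symmetry; apply (cev_cons2 K _ _ (p := ⟪h⟫)); auto.
Qed.
End ModifCan.

Section HorizM4.
Context (D : double_category) (M : monoidal_double D).
Context (la : liftable (dalpha M)) (ll : liftable (dlambda M)) (lr : liftable (drho M)).
Local Notation HD := (Horiz D).
Local Notation φ1 := (horizfr D).
Local Notation φ2 := (prodfr φ1 φ1).
Local Notation φ3 := (prodfr φ2 φ1).
Local Notation φ4 := (prodfr φ3 φ1).
Local Notation HM := (Hmonoidal la ll lr).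
Local Notation ax1 := (ax1 D).
Local Notation ax2 := (ax2 D).
Local Notation ax4 := (ax4 D).
Local Notation eA := (eA la).
Local Notation eL := (eLm ll).
Local Notation eR := (eRm lr).
Local Notation iL := (iL M).
Local Notation iR := (iR M).

Ltac can_cf ::= lazymatch goal with
  | |- Submission.cf _ _ => first [apply cf_a | apply cf_l | apply cf_r | apply (cf_L la ll lr); can_cf | apply (cf_R la ll lr); can_cf]
  | |- _ => first [exact eq_refl | split; can_cf] end.

Definition pr41_ff := p4 (p31_ff D). Definition pr42_ff := p4 (p32_ff D). Definition pr43_ff := p4 (p33_ff D).
Definition pr44_ff : ffun φ4 φ1 (pr44 HD) (dsnd (dprod (dprod D D) D) D) (fun _ _ _ π => snd π) := sndf_ff (φ := φ3) ax1.
Definition pr21_ff : ffun φ2 φ1 (pr21 HD) (dp21 D) (fun _ _ _ π => fst π) := fstf_ff (ψ := φ1) ax1.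
Definition pr22_ff : ffun φ2 φ1 (pr22 HD) (dp22 D) (fun _ _ _ π => snd π) := sndf_ff (φ := φ1) ax1.

Lemma mon_p_H : let a := pr41 HD in let b := pr42 HD in let c := pr43 HD in let d := pr44 HD in
    is_inv_modif (fun x : prodb (prodb (prodb HD HD) HD) HD =>
      mp HM (fst (fst (fst x))) (snd (fst (fst x))) (snd (fst x)) (snd x))
    (compn (tenn (ten HM) (asnat HM a b c) (idn d))
         (compn (asnat HM a (tenf (ten HM) b c) d) (tenn (ten HM) (idn a) (asnat HM b c d))))
      (compn (asnat HM (tenf (ten HM) a b) c d) (asnat HM a b (tenf (ten HM) c d))).
Proof.
intros a b c d.
eapply (modif_can ax4 ax1) with
  (l := fun x => let X := fst (fst (fst x)) in let Y := snd (fst (fst x)) in let Z := snd (fst x) in let W := snd x in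
    [iR W (Hten0 M X (Hten0 M Y Z)) (eA X Y Z); eA X (Hten0 M Y Z) W; iL X (Hten0 M Y (Hten0 M Z W)) (eA Y Z W)])
  (l' := fun x => let X := fst (fst (fst x)) in let Y := snd (fst (fst x)) in let Z := snd (fst x) in let W := snd x in
    [eA (Hten0 M X Y) Z W; eA X Y (Hten0 M Z W)]).
- eapply (fn_comp ax4 ax1).
  + exact (tenn_fn M ax4 (asnat_fn la ll lr ax4 pr41_ff pr42_ff pr43_ff) (idn1_fn pr44_ff)).
  + eapply (fn_comp ax4 ax1).
    * exact (asnat_fn la ll lr ax4 pr41_ff (tenf_ff M ax4 pr42_ff pr43_ff) pr44_ff).
    * exact (tenn_fn M ax4 (idn1_fn pr41_ff) (asnat_fn la ll lr ax4 pr42_ff pr43_ff pr44_ff)).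
- eapply (fn_comp ax4 ax1).
  + exact (asnat_fn la ll lr ax4 (tenf_ff M ax4 pr41_ff pr42_ff) pr43_ff pr44_ff).
  + exact (asnat_fn la ll lr ax4 pr41_ff pr42_ff (tenf_ff M ax4 pr43_ff pr44_ff)).
- intros; exact (can_mp la ll lr _ _ _ _).
- intros; can_cf.
- intros; apply (cev_three ax1). can_cf.
- intros; apply (cev_two ax1). can_cf.
- intros k; apply dpentagon_h.
Qed.

Lemma mon_mid_H : let a := pr21 HD in let b := pr22 HD in
    is_inv_modif (fun x : prodb HD HD => mmid HM (fst x) (snd x))
    (compn (asnat HM a (unif HM _) b) (tenn (ten HM) (idn a) (lunat HM b)))
      (tenn (ten HM) (runat HM a) (idn b)).
Proof.
intros a b.
eapply (modif_can ax2 ax1 (p := fun x => ⟪as1 HM (fst x) (uni0 HM) (snd x); ten HM # ⟨id1 (fst x), lu1 HM (snd x)⟩⟫)) with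
  (l := fun x => [eA (fst x) (dI M tt) (snd x); iL (fst x) (snd x) (eL (snd x))])
  (l' := fun x => [iR (snd x) (fst x) (eR (fst x))]).
- eapply (fn_comp ax2 ax1).
  + exact (asnat_fn la ll lr ax2 pr21_ff (unif_ff la ll lr ax2) pr22_ff).
  + exact (tenn_fn M ax2 (idn1_fn pr21_ff) (lunat_fn la ll lr ax2 pr22_ff)).
- exact (tenn_fn M ax2 (runat_fn la ll lr ax2 pr21_ff) (idn1_fn pr22_ff)).
- intros; exact (can_mid la ll lr _ _).
- intros; can_cf.
- intros; apply (cev_two ax1). can_cf.
- intros; symmetry; apply (cev_one (φ := φ1)); can_cf.
- intros k; apply dmiddle_h.
Qed.

Lemma mon_left_H : let a := pr21 HD in let b := pr22 HD in
    is_inv_modif (fun x : prodb HD HD => mleft HM (fst x) (snd x))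
    (compn (asnat HM (unif HM _) a b) (lunat HM (tenf (ten HM) a b)))
      (tenn (ten HM) (lunat HM a) (idn b)).
Proof.
intros a b.
eapply (modif_can ax2 ax1 (p := fun x => ⟪as1 HM (uni0 HM) (fst x) (snd x); lu1 HM (Hten0 M (fst x) (snd x))⟫)) with
  (l := fun x => [eA (dI M tt) (fst x) (snd x); eL (Hten0 M (fst x) (snd x))])
  (l' := fun x => [iR (snd x) (fst x) (eL (fst x))]).
- eapply (fn_comp ax2 ax1).
  + exact (asnat_fn la ll lr ax2 (unif_ff la ll lr ax2) pr21_ff pr22_ff).
  + exact (lunat_fn la ll lr ax2 (tenf_ff M ax2 pr21_ff pr22_ff)).
- exact (tenn_fn M ax2 (lunat_fn la ll lr ax2 pr21_ff) (idn1_fn pr22_ff)).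
- intros; exact (can_left la ll lr _ _).
- intros; can_cf.
- intros; apply (cev_two ax1). can_cf.
- intros; symmetry; apply (cev_one (φ := φ1)); can_cf.
- intros k; apply dleft_h.
Qed.

Lemma mon_right_H : let a := pr21 HD in let b := pr22 HD in
    is_inv_modif (fun x : prodb HD HD => mright HM (fst x) (snd x))
    (compn (asnat HM a b (unif HM _)) (tenn (ten HM) (idn a) (runat HM b)))
      (runat HM (tenf (ten HM) a b)).
Proof.
intros a b.
eapply (modif_can ax2 ax1 (p := fun x => ⟪as1 HM (fst x) (snd x) (uni0 HM); ten HM # ⟨id1 (fst x), ru1 HM (snd x)⟩⟫)) with
  (l := fun x => [eA (fst x) (snd x) (dI M tt); iL (fst x) (snd x) (eR (snd x))])
  (l' := fun x => [eR (Hten0 M (fst x) (snd x))]).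
- eapply (fn_comp ax2 ax1).
  + exact (asnat_fn la ll lr ax2 pr21_ff pr22_ff (unif_ff la ll lr ax2)).
  + exact (tenn_fn M ax2 (idn1_fn pr21_ff) (runat_fn la ll lr ax2 pr22_ff)).
- exact (runat_fn la ll lr ax2 (tenf_ff M ax2 pr21_ff pr22_ff)).
- intros; exact (can_right la ll lr _ _).
- intros; can_cf.
- intros; apply (cev_two ax1). can_cf.
- intros; symmetry; apply (cev_one (φ := φ1)); can_cf.
- intros k; apply dright_h.
Qed.

Context (la' : inverse_liftable (dalpha M)) (ll' : inverse_liftable (dlambda M)) (lr' : inverse_liftable (drho M)).

(** The weak inverse is a companion of the vertical inverse, which [inverse_liftable] provides. The
    two totals are identities, so the composites are canonically isomorphic to identity 1-cells. *)
Lemma hat_equiv {C : double_category} {F G : pdfun C D} (a : vtrans F G) (i : invertible a) (l : liftable a)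
  (j : inverse_liftable a) (A : dob C) (s : @hom HD (F A) (G A)) : Submission.cf (φ := φ1) s (eps (l A)) -> is_equivalence s.
Proof.
intros h. destruct (va_iso i A) as (v & v1 & v2 & v3 & v4).
rewrite va_cod in v1, v4; rewrite va_dom in v2, v3.
destruct (j A v v1 v2 v3 v4) as [c].
assert (k1 : hdom (cmp c) = G A) by (rewrite cmp_dom; auto).
assert (k2 : hcod (cmp c) = F A) by (rewrite cmp_cod; auto).
assert (V : viso v) by (exists (a A); rewrite va_dom, va_cod, v1, v2; auto).
apply (can_equiv ax1 (g := ({| hval := cmp c; hval_dom := k1; hval_cod := k2 |} : @hom HD (G A) (F A))) (e := eps (l A)) (e' := eps c) h).
- split.
  + apply frH; auto; [apply eps_top|]. rewrite eps_rgt, v2; auto.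
  + rewrite eps_bot, v2; auto.
  + apply visoS_eps, V.
- rewrite !eps_lft; auto.
- rewrite !eps_lft; auto.
Qed.

Lemma Hmonoidal_ax : is_monoidal HM.
Proof.
split.
- apply (framed_bicat ax1).
- apply (framed_psfun ax2 ax1 (ten_ff M)).
- apply (framed_psfun unitfr_ax ax1 (uni_ff M)).
- apply as_psnat.
- apply lu_psnat.
- apply ru_psnat.
- intros; apply (hat_equiv (C := dprodD (dprodD D D) D) (dalpha_inv M) (l := la) la' (A := (X, Y, Z))); apply cf_a.
- intros; apply (hat_equiv (dlambda_inv M) (l := ll) ll' (A := X)); apply cf_l.
- intros; apply (hat_equiv (drho_inv M) (l := lr) lr' (A := X)); apply cf_r.
- exact mon_p_H.
- exact mon_mid_H.
- exact mon_left_H.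
- exact mon_right_H.
- apply (canon_cocycle ax1 (canon_HM la ll lr)).
- apply (canon_norm_l ax1 (canon_HM la ll lr)).
- apply (canon_norm_r ax1 (canon_HM la ll lr)).
Qed.
End HorizM4.

(** * The pseudomonad *)

Section Monad.
Context (D : double_category) (V : vertical_monad D).
Context (imu : invertible (dmu V)) (ieta : invertible (deta V)).
Context (lmu : liftable (dmu V)) (leta : liftable (deta V)).
Local Notation HD := (Horiz D).
Local Notation φ1 := (horizfr D).
Local Notation ax1 := (ax1 D).
Local Notation st1 := (st1 D).
Local Notation HT := (Hmonad imu ieta lmu leta).
Local Notation cf := (cf (φ := φ1)).
Local Notation can := (can (φ := φ1)).
Local Notation okc := (okc (φ := φ1)).

Definition iT (Z : HD) (e : dsq D) : dsq D := img V Z (FS V e).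
Definition eM (X : HD) : dsq D := eps (lmu X).
Definition eE (X : HD) : dsq D := eps (leta X).

Lemma hfun_ff (F : pdfun D D) : is_pdfun F -> ffun φ1 φ1 (Hfun F) F (fun _ _ _ π => FS F π).
Proof.
intros P; apply (strict_ff ax1 st1 P); try (intros; reflexivity); intros; split; reflexivity.
Qed.

Lemma V_ff : ffun φ1 φ1 (Hfun V) V (fun _ _ _ π => FS V π).
Proof. apply hfun_ff, dT_ax. Qed.

Lemma VV_ff : ffun φ1 φ1 (compf (Hfun V) (Hfun V)) (dcomp V V) (fun _ _ _ π => FS V (FS V π)).
Proof. exact (compf_ff ax1 ax1 ax1 V_ff V_ff). Qed.

Lemma mu_fn : fnat φ1 φ1 (FV (dcomp V V)) (FV V) (FH (dcomp V V)) (FH V)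
  (fun _ _ _ π => FS (dcomp V V) π) (fun _ _ _ π => FS V π)
  (Hmu imu lmu) (dmu V) (va_h (dmu V)) eM.
Proof.
apply (lift_fn ax1 st1 (n := Hmu imu lmu) (i := imu) (l := lmu) (ff_map VV_ff) (ff_map V_ff) (ff_ax VV_ff) (ff_ax V_ff));
intros; reflexivity.
Qed.

Lemma eta_fn : fnat φ1 φ1 (FV (did D)) (FV V) (FH (did D)) (FH V)
  (fun _ _ _ π => FS (did D) π) (fun _ _ _ π => FS V π)
  (Heta ieta leta) (deta V) (va_h (deta V)) eE.
Proof.
apply (lift_fn ax1 st1 (n := Heta ieta leta) (i := ieta) (l := leta) (ff_map (id_ff D)) (ff_map V_ff) (ff_ax (id_ff D)) (ff_ax V_ff));
intros; reflexivity.
Qed.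

Lemma cf_M X : cf (Hmu1 lmu X) (eM X).
Proof. exact (fn_cf mu_fn X). Qed.
Lemma cf_E X : cf (Heta1 leta X) (eE X).
Proof. exact (fn_cf eta_fn X). Qed.
Lemma cf_T (X Y : HD) (f : hom X Y) e : cf f e -> cf (Hfun V # f) (iT Y e).
Proof. apply (img_cf' ax1 ax1 V_ff (i := iT)); reflexivity. Qed.
Lemma can_fT Y Z (p q : path Y Z) (c : pcell p q) l l' : okc p l -> can c l l' ->
  can (fcell (Hfun V) c) (imap iT p l) (imap iT q l').
Proof. apply (can_fcell' ax1 V_ff); reflexivity. Qed.

Lemma eps_map (u : dv D) (c : companion_data u) (A : dob D) : vcod u = A ->
  eps (cmp_map V c) = iT A (eps c).
Proof. intros <-; reflexivity. Qed.

Lemma can_mu (X Y : HD) (f : hom X Y) e : cf f e ->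
  can (fwd (Hmu imu lmu X Y f)) [iT (V Y) (iT Y e); eM Y] [eM X; iT Y e] /\
  can (bwd (Hmu imu lmu X Y f)) [eM X; iT Y e] [iT (V Y) (iT Y e); eM Y].
Proof.
intros c.
assert (E : img (dcomp V V) Y (FS V (FS V e)) = iT (V Y) (iT Y e)).
{ apply (img_comp (dT_ax V)). rewrite FS_bot, (cf_bot c); auto. }
split.
- refine (can_conv (can_nat ax1 ax1 VV_ff V_ff mu_fn (va_unit (dmu V)) c) (f_equal (fun z => [z; _]) E) eq_refl).
- refine (can_conv (can_nat' ax1 ax1 VV_ff V_ff mu_fn (va_unit (dmu V)) c) eq_refl (f_equal (fun z => [z; _]) E)).
Qed.

Lemma can_eta (X Y : HD) (f : hom X Y) e : cf f e ->
  can (fwd (Heta ieta leta X Y f)) [e; eE Y] [eE X; iT Y e] /\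
  can (bwd (Heta ieta leta X Y f)) [eE X; iT Y e] [e; eE Y].
Proof.
intros c.
assert (E : img (did D) Y e = e) by apply (img_did (cf_bot c)).
split.
- refine (can_conv (can_nat ax1 ax1 (id_ff D) V_ff eta_fn (va_unit (deta V)) c) (f_equal (fun z => [z; _]) E) eq_refl).
- refine (can_conv (can_nat' ax1 ax1 (id_ff D) V_ff eta_fn (va_unit (deta V)) c) eq_refl (f_equal (fun z => [z; _]) E)).
Qed.

Ltac can_cf ::= lazymatch goal with
  | |- Submission.cf _ _ => first [apply cf_M | apply cf_E | apply cf_T; can_cf]
  | |- _ => first [exact eq_refl | split; can_cf] end.

Ltac vc := repeat first [apply vcmp_ax | apply vcmp_comp | apply (vcmp_map (dT_ax V)) | apply vcmp_id].

Lemma can_mm X : is_iso2 (Hmm lmu X) /\ can (fwd (Hmm lmu X)) [iT (V X) (eM X); eM X] [eM (V X); eM X].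
Proof.
unfold Hmm; apply lift_can; [vc|vc|can_cf|can_cf| |].
- eapply cev_cmp; [can_cf|symmetry; apply eps_map; gb|]. rewrite cev_one by can_cf. auto.
- eapply cev_cmp; [can_cf|auto|]. rewrite cev_one by can_cf. auto.
Qed.
Lemma can_ml X : is_iso2 (Hml lmu leta X) /\ can (fwd (Hml lmu leta X)) [eE (V X); eM X] [].
Proof.
unfold Hml; apply lift_can; [vc|vc|can_cf|can_cf| |].
- eapply cev_cmp; [can_cf|auto|]. rewrite cev_one by can_cf. auto.
- auto.
Qed.
Lemma can_mr X : is_iso2 (Hmr lmu leta X) /\ can (fwd (Hmr lmu leta X)) [iT (V X) (eE X); eM X] [].
Proof.
unfold Hmr; apply lift_can; [vc|vc|can_cf|can_cf| |].
- eapply cev_cmp; [can_cf|symmetry; apply eps_map; gb|]. rewrite cev_one by can_cf. auto.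
- auto.
Qed.

Ltac can_cell ::= first
  [ apply can_mm | apply can_ml | apply can_mr
  | apply can_mu; can_cf | apply can_eta; can_cf
  | lazymatch goal with |- Submission.can (@fcell _ _ _ _ _ _ ?p ?q ?c) _ _ =>
    refine (can_conv (can_fT (p := p) (q := q) (c := c) _ _) _ _); [|can_cell|reflexivity|reflexivity]; can_cf end ].

Lemma Hmonad_ax : is_pseudomonad HT.
Proof.
split.
- apply (framed_psfun ax1 ax1 V_ff).
- apply (framed_psnat ax1 ax1 VV_ff V_ff mu_fn).
  split; intros; [apply (va_comp (dmu V))|apply (va_unit (dmu V))]; auto.
- apply (framed_psnat ax1 ax1 (id_ff D) V_ff eta_fn).
  split; intros; [apply (va_comp (deta V))|apply (va_unit (deta V))]; auto.
- eapply (modif_can ax1 ax1) with (l := fun X => [iT (V X) (eM X); eM X]) (l' := fun X => [eM (V X); eM X]).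
  + exact (fn_comp ax1 ax1 (fn_post ax1 ax1 ax1 mu_fn V_ff) mu_fn).
  + exact (fn_comp ax1 ax1 (fn_pre mu_fn (ff_map V_ff) ax1 (ff_ax V_ff)) mu_fn).
  + exact can_mm.
  + intros; can_cf.
  + intros; apply (cev_two ax1); can_cf.
  + intros; apply (cev_two ax1); can_cf.
  + apply dmu_assoc_h.
- eapply (modif_can ax1 ax1 (q := fun X => @pnil HD (V X))) with (l := fun X => [eE (V X); eM X]) (l' := fun X => []).
  + exact (fn_comp ax1 ax1 (fn_pre eta_fn (ff_map V_ff) ax1 (ff_ax V_ff)) mu_fn).
  + exact (fn_idn ax1 (ff_map V_ff) (ff_ax V_ff)).
  + exact can_ml.
  + intros; can_cf.
  + intros; apply (cev_two ax1); can_cf.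
  + intros; reflexivity.
  + apply dmu_l_h.
- eapply (modif_can ax1 ax1 (q := fun X => @pnil HD (V X))) with (l := fun X => [iT (V X) (eE X); eM X]) (l' := fun X => []).
  + exact (fn_comp ax1 ax1 (fn_post ax1 ax1 ax1 eta_fn V_ff) mu_fn).
  + exact (fn_idn ax1 (ff_map V_ff) (ff_ax V_ff)).
  + exact can_mr.
  + intros; can_cf.
  + intros; apply (cev_two ax1); can_cf.
  + intros; reflexivity.
  + apply dmu_r_h.
- intros X; eapply (can_eq ax1 (l := [iT _ (iT _ (eM X)); iT _ (eM X); eM X])); [can_cf|can_chain constr:(ax1)|can_chain constr:(ax1)].
- intros X; eapply (can_eq ax1 (l := [iT _ (eE (V X)); iT _ (eM X); eM X])); [can_cf|can_chain constr:(ax1)|can_chain constr:(ax1)].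
Qed.
End Monad.

(** * Strengths *)

(** Strengths and premonoidal structures are data, whereas [ex_can] asserts existence. The chosen
    cell is handled through its canonicity, which determines it. *)
Definition pick_can {B : bicat} {D : double_category} {φ : framing B D} (H : is_framing φ) (X Y : B)
  (p q : path X Y) l l' (o : okc (φ := φ) p l) (o' : okc (φ := φ) q l')
  (e : tot l (vid (fo φ Y)) = tot l' (vid (fo φ Y))) :
  {i : iso2 p q | is_iso2 i /\ can (φ := φ) (fwd i) l l'} :=
  constructive_indefinite_description _ (ex_can H o o' e).

Section Strength.
Context (D : double_category) (M : monoidal_double D) (V : vertical_monad D).
Context (la : liftable (dalpha M)) (ll : liftable (dlambda M)) (lr : liftable (drho M)).
Context (imu : invertible (dmu V)) (ieta : invertible (deta V)).
Context (lmu : liftable (dmu V)) (leta : liftable (deta V)).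
Local Notation HD := (Horiz D).
Local Notation φ1 := (horizfr D).
Local Notation φ2 := (prodfr φ1 φ1).
Local Notation φ3 := (prodfr φ2 φ1).
Local Notation ax1 := (ax1 D).
Local Notation ax2 := (ax2 D).
Local Notation ax3 := (ax3 D).
Local Notation HM := (Hmonoidal la ll lr).
Local Notation HT := (Hmonad imu ieta lmu leta).
Local Notation cf := (cf (φ := φ1)).
Local Notation can := (can (φ := φ1)).
Local Notation okc := (okc (φ := φ1)).
Local Notation "X ⊗ Y" := (dt M (X, Y)) (at level 25, left associativity).
Local Notation I := (dI M tt).
Local Notation eA := (eA la).
Local Notation eL := (eLm ll).
Local Notation eR := (eRm lr).
Local Notation eM := (eM lmu).
Local Notation eE := (eE leta).
Local Notation iL := (iL M).
Local Notation iR := (iR M).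
Local Notation iT := (iT V).
Local Notation iten X Y a b := (img (D := dprodD D D) (dt M) (X, Y) (FS (dt M) (a, b))).

Lemma lft_iten (X Y X' Y' : HD) (f : hom X Y) (g : hom X' Y') e e' : cf f e -> cf g e' ->
  lft (iten Y Y' e e') = FV (dt M) (lft e, lft e').
Proof. intros h h'; exact (proj2 (img_cf ax2 ax1 (ten_ff M) (cf_pair h h'))). Qed.
Lemma lft_iL (X Y Z : HD) (f : hom Y Z) e : cf f e -> lft (iL X Z e) = FV (dt M) (vid X, lft e).
Proof. intros h; refine (eq_trans (lft_iten (cf_hid X) h) _); rewrite lft_hid; auto. Qed.
Lemma lft_iR (X Y Z : HD) (f : hom Y Z) e : cf f e -> lft (iR X Z e) = FV (dt M) (lft e, vid X).
Proof. intros h; refine (eq_trans (lft_iten h (cf_hid X)) _); rewrite lft_hid; auto. Qed.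
Lemma lft_iT (Y Z : HD) (f : hom Y Z) e : cf f e -> lft (iT Z e) = FV V (lft e).
Proof. intros h; exact (proj2 (img_cf ax1 ax1 (V_ff V) h)). Qed.

Lemma can_vunit (Y : HD) :
  can (bwd (funit (Hfun V) Y) : pcell ⟪Hfun V # id1 Y⟫ ⟪id1 (V Y : HD)⟫) [iT Y (hidS (vid Y))] [hidS (vid (V Y))] /\
  can (fwd (funit (Hfun V) Y) : pcell ⟪id1 (V Y : HD)⟫ ⟪Hfun V # id1 Y⟫) [hidS (vid (V Y))] [iT Y (hidS (vid Y))].
Proof.
exact (can_unit ax1 ax1 (V_ff V) (i := iT) ltac:(reflexivity) Y).
Qed.

Section Left.
Context (t : left_vstrength M V) (it : invertible t) (lt : liftable t).
Local Notation t' := (Hlstr la ll lr imu ieta lmu leta it lt).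

Definition eT (X Y : HD) : dsq D := eps (lt (X, Y)).

Lemma tF_ff : ffun φ2 φ1 (tenf (Hten M) (pr21 HD) (compf (pr22 HD) (Hfun V))) (dtens (dt M) (dp21 D) (dcomp (dp22 D) V))
  (fun _ _ _ π => FS (dt M) (fst π, FS V (snd π))).
Proof. exact (tenf_ff M ax2 (pr21_ff D) (compf_ff ax2 ax1 ax1 (pr22_ff D) (V_ff V))). Qed.
Lemma tG_ff : ffun φ2 φ1 (compf (tenf (Hten M) (pr21 HD) (pr22 HD)) (Hfun V)) (dcomp (dtens (dt M) (dp21 D) (dp22 D)) V)
  (fun _ _ _ π => FS V (FS (dt M) (fst π, snd π))).
Proof. exact (compf_ff ax2 ax1 ax1 (tenf_ff M ax2 (pr21_ff D) (pr22_ff D)) (V_ff V)). Qed.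

Lemma st2' : strict_framing (φ := φ2). Proof. apply (prod_strict (horiz_strict D) (horiz_strict D)). Qed.

Lemma t_fn : fnat φ2 φ1 (FV (dtens (dt M) (dp21 D) (dcomp (dp22 D) V))) (FV (dcomp (dtens (dt M) (dp21 D) (dp22 D)) V))
  (FH (dtens (dt M) (dp21 D) (dcomp (dp22 D) V))) (FH (dcomp (dtens (dt M) (dp21 D) (dp22 D)) V))
  (fun _ _ _ π => FS (dt M) (fst π, FS V (snd π))) (fun _ _ _ π => FS V (FS (dt M) (fst π, snd π)))
  t' t (va_h t) (fun X => eT (fst X) (snd X)).
Proof.
apply (lift_fn ax2 st2' (n := t') (i := it) (l := lt) (ff_map tF_ff) (ff_map tG_ff) (ff_ax tF_ff) (ff_ax tG_ff));
intros; reflexivity.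
Qed.

Lemma t_psnat : is_psnat _ _ t'.
Proof.
apply (framed_psnat ax2 ax1 tF_ff tG_ff t_fn).
split; intros; [apply (va_comp t)|apply (va_unit t)]; auto.
Qed.

Lemma cf_t X Y : cf (Hlstr1 lt X Y) (eT X Y).
Proof. exact (fn_cf t_fn (X, Y)). Qed.

Lemma can_t (X Y X' Y' : HD) (f : hom X X') (g : hom Y Y') e e' : cf f e -> cf g e' ->
  can (fwd (t' (X, Y) (X', Y') ⟨f, g⟩)) [iten X' (V Y') e (iT Y' e'); eT X' Y'] [eT X Y; iT (X' ⊗ Y') (iten X' Y' e e')] /\
  can (bwd (t' (X, Y) (X', Y') ⟨f, g⟩)) [eT X Y; iT (X' ⊗ Y') (iten X' Y' e e')] [iten X' (V Y') e (iT Y' e'); eT X' Y'].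
Proof.
intros c c'.
assert (k : Submission.cf (φ := φ2) (X := (X, Y)) (Y := (X', Y')) ⟨f, g⟩ (e, e')) by apply (cf_pair c c').
assert (E1 : img (D := dprodD D D) (dtens (dt M) (dp21 D) (dcomp (dp22 D) V)) (X', Y') (FS (dt M) (e, FS V e'))
  = iten X' (V Y') e (iT Y' e')).
{ rewrite (img_tens M (L := dprodD D D)); cbn; auto; [|apply (cf_bot c)|rewrite FS_bot, (cf_bot c'); auto].
  f_equal; f_equal; f_equal.
  - unfold img; cbn; apply vr, (cf_bot c).
  - unfold Submission.iT, img; cbn. rewrite (FS_vid (dT_ax V)), v1; auto. apply F2u'_top. }
assert (E2 : img (D := dprodD D D) (dcomp (dtens (dt M) (dp21 D) (dp22 D)) V) (X', Y') (FS V (FS (dt M) (e, e')))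
  = iT (X' ⊗ Y') (iten X' Y' e e')).
{ rewrite (img_comp (L := dprodD D D) (dT_ax V)); cbn; [|apply bot_FS2; [apply (cf_bot c)|apply (cf_bot c')]].
  unfold Submission.iT; f_equal; f_equal.
  rewrite (img_tens M (L := dprodD D D)); cbn; auto; [|apply (cf_bot c)|apply (cf_bot c')].
  f_equal; f_equal; f_equal; unfold img; cbn; apply vr; [apply (cf_bot c)|apply (cf_bot c')]. }
split.
- refine (can_conv (can_nat ax2 ax1 tF_ff tG_ff t_fn (va_unit t) k) (f_equal (fun z => [z; _]) E1) (f_equal (fun z => [_; z]) E2)).
- refine (can_conv (can_nat' ax2 ax1 tF_ff tG_ff t_fn (va_unit t) k) (f_equal (fun z => [_; z]) E2) (f_equal (fun z => [z; _]) E1)).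
Qed.

Lemma can_tsnd (X Y Y' : HD) (f : hom Y Y') e : cf f e ->
  can (fwd (t_snd t' X f)) [iL X (V Y') (iT Y' e); eT X Y'] [eT X Y; iT (X ⊗ Y') (iL X Y' e)] /\
  can (bwd (t_snd t' X f)) [eT X Y; iT (X ⊗ Y') (iL X Y' e)] [iL X (V Y') (iT Y' e); eT X Y'].
Proof. intros h; exact (can_t (cf_hid X) h). Qed.

(** Naturality in the first variable leaves [T] of an identity in the second slot; the unitor of [T]
    replaces it, and this correction is canonical too. *)
Lemma can_tfst (X X' Y : HD) (f : hom X X') e : cf f e ->
  can (fwd (t_fst t' f Y)) [iR (V Y) X' e; eT X' Y] [eT X Y; iT (X' ⊗ Y) (iR Y X' e)] /\
  can (bwd (t_fst t' f Y)) [eT X Y; iT (X' ⊗ Y) (iR Y X' e)] [iR (V Y) X' e; eT X' Y].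
Proof.
intros h. destruct (can_t h (cf_hid Y)) as [a1 a2]. destruct (can_vunit Y) as [u1 u2].
assert (x1 := can_ten2 (M := M) h (cf_T V (cf_hid Y)) (can_id h) u1).
assert (x2 := can_ten2 (M := M) h (cf_hid (V Y)) (can_id h) u2).
split; cbn [t_fst fwd bwd].
- eapply (can_pcomp ax1); [|exact a1].
  refine (can_to (can_ctx ax1 (p := ⟪⟫) (L := [_; eT X' Y]) (r := ⟪Hlstr1 lt X' Y⟫) x2) eq_refl).
- eapply (can_pcomp ax1); [exact a2|].
  refine (can_to (can_ctx ax1 (p := ⟪⟫) (L := [_; eT X' Y]) (r := ⟪Hlstr1 lt X' Y⟫) x1) eq_refl).
Qed.

Lemma tnat_fn {A : bicat} {L : double_category} {χ : framing A L} (G : is_framing χ)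
  {F0 G0 : A -> HD} {F1 : psfun F0} {F2 : psfun G0} {Fh Gh : pdfun L D}
  {Fr Gr : forall X Y : A, hom X Y -> dsq L -> dsq D}
  (P : ffun χ φ1 F1 Fh Fr) (Q : ffun χ φ1 F2 Gh Gr) :
  fnat χ φ1 (FV (dtens (dt M) Fh (dcomp Gh V))) (FV (dcomp (dtens (dt M) Fh Gh) V))
    (FH (dtens (dt M) Fh (dcomp Gh V))) (FH (dcomp (dtens (dt M) Fh Gh) V))
    (fun X Y f π => FS (dt M) (Fr X Y f π, FS V (Gr X Y f π))) (fun X Y f π => FS V (FS (dt M) (Fr X Y f π, Gr X Y f π)))
    (tnat (M := HM) (T := HT) t' F1 F2) (fun X => t (Fh X, Gh X)) (fun k => va_h t (FH Fh k, FH Gh k)) (fun X => eT (F0 X) (G0 X)).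
Proof.
assert (W := pairf_ff (φ := φ1) (ψ := φ1) P Q).
exact (fn_pre t_fn (ff_map W) G (ff_ax W)).
Qed.
End Left.
End Strength.

#[global] Strategy 1000 [Hfun Hfun2 Hten Hfun0 Hmu Heta Hasn Hlun1 Hrun1 Hlstr Hrstr].
#[global] Strategy expand [compf tenf pairf pr21 pr22 pr31 pr32 pr33 fstf sndf constf idf bangf].

(** * The left strength *)

Section Strength2.
Context (D : double_category) (M : monoidal_double D) (V : vertical_monad D).
Context (la : liftable (dalpha M)) (ll : liftable (dlambda M)) (lr : liftable (drho M)).
Context (imu : invertible (dmu V)) (ieta : invertible (deta V)).
Context (lmu : liftable (dmu V)) (leta : liftable (deta V)).
Local Notation HD := (Horiz D).
Local Notation φ1 := (horizfr D).
Local Notation ax1 := (ax1 D).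
Local Notation ax2 := (ax2 D).
Local Notation ax3 := (ax3 D).
Local Notation HM := (Hmonoidal la ll lr).
Local Notation HT := (Hmonad imu ieta lmu leta).
Local Notation can := (can (φ := φ1)).
Local Notation "X ⊗ Y" := (dt M (X, Y)) (at level 25, left associativity).
Local Notation I := (dI M tt).
Local Notation eA := (eA la).
Local Notation eL := (eLm ll).
Local Notation eM := (eM lmu).
Local Notation eE := (eE leta).
Local Notation iL := (iL M).
Local Notation iR := (iR M).
Local Notation iT := (iT V).
Context (t : left_vstrength M V) (it : invertible t) (lt : liftable t).
Local Notation t' := (Hlstr la ll lr imu ieta lmu leta it lt).
Local Notation eT := (eT lt).

Ltac can_cf ::= lazymatch goal with
  | |- Submission.cf _ _ => first [ apply (cf_t la ll lr imu ieta lmu leta it) | apply (cf_a la) | apply (cf_l ll) | apply (cf_r lr)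
      | apply (cf_M imu) | apply (cf_E ieta)
      | apply (cf_L la ll lr); can_cf | apply (cf_R la ll lr); can_cf | apply cf_T; can_cf ]
  | |- _ => first [exact eq_refl | split; can_cf] end.

Ltac lfts := repeat first [erewrite lft_iL by can_cf | erewrite lft_iR by can_cf | erewrite lft_iT by can_cf].
Ltac tots := cbn [tot]; lfts; unfold Submission.eT, Submission.eA, Submission.eLm, Submission.eRm, Submission.eM, Submission.eE; rewrite !eps_lft;
  repeat rewrite (ur (D := D)) by gb.

Ltac can_cell ::= lazymatch goal with
  | |- Submission.can (@fcell _ _ _ (tenL _ _) _ _ ?p ?q ?c) _ _ =>
    refine (can_conv (can_fL (p := p) (q := q) (c := c) _ _) _ _); [|can_cell|reflexivity|reflexivity]; can_cf
  | |- Submission.can (@fcell _ _ _ (pL _ _) _ _ ?p ?q ?c) _ _ =>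
    refine (can_conv (can_fL (p := p) (q := q) (c := c) _ _) _ _); [|can_cell|reflexivity|reflexivity]; can_cf
  | |- Submission.can (@fcell _ _ _ (pR _ _) _ _ ?p ?q ?c) _ _ =>
    refine (can_conv (can_fR (p := p) (q := q) (c := c) _ _) _ _); [|can_cell|reflexivity|reflexivity]; can_cf
  | |- Submission.can (@fcell _ _ _ _ _ _ ?p ?q ?c) _ _ =>
    refine (can_conv (can_fT (p := p) (q := q) (c := c) _ _) _ _); [|can_cell|reflexivity|reflexivity]; can_cf
  | |- Submission.can (fwd (mp _ _ _ _ _)) _ _ => apply (can_mp la ll lr)
  | |- Submission.can (fwd (mmid _ _ _)) _ _ => apply (can_mid la ll lr)
  | |- Submission.can (fwd (mleft _ _ _)) _ _ => apply (can_left la ll lr)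
  | |- Submission.can (fwd (mright _ _ _)) _ _ => apply (can_right la ll lr)
  | |- Submission.can (fwd (mm _ _)) _ _ => apply (can_mm imu)
  | |- Submission.can (fwd (ml _ _)) _ _ => apply (can_ml imu ieta)
  | |- Submission.can (fwd (mr _ _)) _ _ => apply (can_mr imu ieta)
  | |- Submission.can (_ (t_fst _ _ _)) _ _ => apply can_tfst; can_cf
  | |- Submission.can (_ (t_snd _ _ _)) _ _ => apply can_tsnd; can_cf
  | |- Submission.can (_ (nat2 (mu _) _)) _ _ => apply can_mu; can_cf
  | |- Submission.can (_ (nat2 (eta _) _)) _ _ => apply can_eta; can_cf
  | |- Submission.can (_ (nat2 (pa1 _ _ _) _)) _ _ => apply can_a1; can_cf
  | |- Submission.can (_ (nat2 (pa2 _ _ _) _)) _ _ => apply can_a2; can_cf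
  | |- Submission.can (_ (nat2 (pa3 _ _ _) _)) _ _ => apply can_a3; can_cf
  | |- Submission.can (_ (nat2 (pln _) _)) _ _ => apply can_lu1; can_cf
  | |- Submission.can (_ (nat2 (prn _) _)) _ _ => apply can_ru1; can_cf
  | |- Submission.can (fwd (proj1_sig ?u)) _ _ => exact (proj2 (proj2_sig u))
  | |- Submission.can (bwd (proj1_sig ?u)) _ _ => apply (can_inv ax1 (proj1 (proj2_sig u))); [|exact (proj2 (proj2_sig u))]; can_cf
  end.


Lemma ls_w_H (w : forall X Y, iso2 ⟪Hlstr1 lt X (V Y); Hfun V # Hlstr1 lt X Y; Hmu1 lmu (X ⊗ Y)⟫
    ⟪tenL HM X # Hmu1 lmu Y; Hlstr1 lt X Y⟫) :
  (forall X Y, is_iso2 (w X Y) /\ can (fwd (w X Y)) [eT X (V Y); iT (V (X ⊗ Y)) (eT X Y); eM (X ⊗ Y)] [iL X (V Y) (eM Y); eT X Y]) ->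
  let p := pr21 HD in let q := pr22 HD in
    is_inv_modif (fun x : prodb HD HD => w (fst x) (snd x))
      (compn (tnat (M := HM) (T := HT) t' p (compf q HT)) (compn (postn t' HT) (pren (tenf (ten HM) p q) (mu HT))))
      (compn (tenn (ten HM) (idn p) (pren q (mu HT))) t').
Proof.
intros hw p q.
eapply (modif_can ax2 ax1) with
      (l := fun x => let X := fst x in let Y := snd x in [eT X (V Y); iT (V (Hten0 M X Y)) (eT X Y); eM (Hten0 M X Y)])
      (l' := fun x => let X := fst x in let Y := snd x in [iL X (V Y) (eM Y); eT X Y]).
- eapply (fn_comp ax2 ax1).
  + exact (tnat_fn la ll lr imu ieta lmu leta it lt ax2 (pr21_ff D) (compf_ff ax2 ax1 ax1 (pr22_ff D) (V_ff V))).
  + eapply (fn_comp ax2 ax1).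
    * exact (fn_post ax2 ax1 ax1 (t_fn la ll lr imu ieta lmu leta it lt) (V_ff V)).
    * exact (fn_pre (mu_fn imu lmu) (ff_map (tenf_ff M ax2 (pr21_ff D) (pr22_ff D))) ax2 (ff_ax (tenf_ff M ax2 (pr21_ff D) (pr22_ff D)))).
- eapply (fn_comp ax2 ax1).
  + exact (tenn_fn M ax2 (idn1_fn (pr21_ff D)) (fn_pre (mu_fn imu lmu) (ff_map (pr22_ff D)) ax2 (ff_ax (pr22_ff D)))).
  + exact (t_fn la ll lr imu ieta lmu leta it lt).
- intros; exact (hw _ _).
- intros; can_cf.
- intros; apply (cev_three ax1); can_cf.
- intros; apply (cev_two ax1); can_cf.
- intros [f g]; exact (eq_sym (lt_mu_h t f g)).
Qed.
(** The canonicity of [w] and [z] is exported because the axioms relating the two strengths of a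
    bistrong pseudomonad contain these cells. *)
Lemma left_strength_ex : exists S : left_strength t',
  (forall X Y, is_iso2 (ls_w S X Y) /\ can (fwd (ls_w S X Y)) [eT X (V Y); iT (V (X ⊗ Y)) (eT X Y); eM (X ⊗ Y)] [iL X (V Y) (eM Y); eT X Y]) /\
  (forall X Y, is_iso2 (ls_z S X Y) /\ can (fwd (ls_z S X Y)) [iL X (V Y) (eE Y); eT X Y] [eE (X ⊗ Y)]).
Proof.
(* The four cells exist because the axioms of a vertical strength on objects are the required
   equalities of totals. The axioms on 1h-cells return below as the modification conditions. *)
assert (px : forall X, {i : iso2 ⟪Hlstr1 lt I X; Hfun V # Hlu1 ll X⟫ ⟪Hlu1 ll (V X)⟫ |
  is_iso2 i /\ can (fwd i) [eT I X; iT X (eL X)] [eL (V X)]}).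
{ intros X; apply (pick_can ax1); [can_cf|can_cf|].
  tots. symmetry; apply (lt_lambda t). }
assert (py : forall X Y Z, {i : iso2 ⟪Hlstr1 lt (X ⊗ Y) Z; Hfun V # Has1 la X Y Z⟫
    ⟪Has1 la X Y (V Z); tenL HM X # Hlstr1 lt Y Z; Hlstr1 lt X (Y ⊗ Z)⟫ |
  is_iso2 i /\ can (fwd i) [eT (X ⊗ Y) Z; iT (X ⊗ (Y ⊗ Z)) (eA X Y Z)] [eA X Y (V Z); iL X (V (Y ⊗ Z)) (eT Y Z); eT X (Y ⊗ Z)]}).
{ intros X Y Z; apply (pick_can ax1); [can_cf|can_cf|].
  tots. symmetry; apply (lt_alpha t). }
assert (pw : forall X Y, {i : iso2 ⟪Hlstr1 lt X (V Y); Hfun V # Hlstr1 lt X Y; Hmu1 lmu (X ⊗ Y)⟫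
    ⟪tenL HM X # Hmu1 lmu Y; Hlstr1 lt X Y⟫ |
  is_iso2 i /\ can (fwd i) [eT X (V Y); iT (V (X ⊗ Y)) (eT X Y); eM (X ⊗ Y)] [iL X (V Y) (eM Y); eT X Y]}).
{ intros X Y; apply (pick_can ax1); [can_cf|can_cf|].
  tots. symmetry; apply (lt_mu t). }
assert (pz : forall X Y, {i : iso2 ⟪tenL HM X # Heta1 leta Y; Hlstr1 lt X Y⟫ ⟪Heta1 leta (X ⊗ Y)⟫ |
  is_iso2 i /\ can (fwd i) [iL X (V Y) (eE Y); eT X Y] [eE (X ⊗ Y)]}).
{ intros X Y; apply (pick_can ax1); [can_cf|can_cf|].
  tots. symmetry; apply (lt_eta t). }
unshelve eexists.
{ refine (@Build_left_strength HD HM HT _ t' (t_psnat la ll lr imu ieta lmu leta it lt) (fun X => proj1_sig (px X)) (fun X Y Z => proj1_sig (py X Y Z))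
    (fun X Y => proj1_sig (pw X Y)) (fun X Y => proj1_sig (pz X Y)) _ _ _ _ _ _ _ _ _ _ _ _ _ _); cbv zeta.
  - eapply (modif_can ax1 ax1 (p := fun X => ⟪Hlstr1 lt I X; Hfun V # Hlu1 ll X⟫) (q := fun X => ⟪Hlu1 ll (V X)⟫)) with
      (l := fun X => [eT I X; iT X (eL X)]) (l' := fun X => [eL (V X)]).
    + exact (fn_comp ax1 ax1 (tnat_fn la ll lr imu ieta lmu leta it lt ax1 (unif_ff la ll lr ax1) (id_ff D)) (fn_post ax1 ax1 ax1 (lu_fn ll) (V_ff V))).
    + exact (fn_pre (lu_fn ll) (ff_map (V_ff V)) ax1 (ff_ax (V_ff V))).
    + exact (fun X => proj2_sig (px X)).
    + intros; can_cf.
    + intros; apply (cev_two ax1); can_cf.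
    + intros; symmetry; apply (cev_one (φ := φ1)); can_cf.
    + intros; symmetry; apply (lt_lambda_h t).
  - eapply (modif_can ax3 ax1) with
      (l := fun x => let X := fst (fst x) in let Y := snd (fst x) in let Z := snd x in [eT (Hten0 M X Y) Z; iT (Hten0 M X (Hten0 M Y Z)) (eA X Y Z)])
      (l' := fun x => let X := fst (fst x) in let Y := snd (fst x) in let Z := snd x in
         [eA X Y (V Z); iL X (V (Hten0 M Y Z)) (eT Y Z); eT X (Hten0 M Y Z)]).
    + exact (fn_comp ax3 ax1 (tnat_fn la ll lr imu ieta lmu leta it lt ax3 (tenf_ff M ax3 (p31_ff D) (p32_ff D)) (p33_ff D)) (fn_post ax3 ax1 ax1 (as_fn la) (V_ff V))).
    + exact (fn_comp ax3 ax1 (asnat_fn la ll lr ax3 (p31_ff D) (p32_ff D) (compf_ff ax3 ax1 ax1 (p33_ff D) (V_ff V)))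
        (fn_comp ax3 ax1 (tenn_fn M ax3 (idn1_fn (p31_ff D)) (tnat_fn la ll lr imu ieta lmu leta it lt ax3 (p32_ff D) (p33_ff D)))
          (tnat_fn la ll lr imu ieta lmu leta it lt ax3 (p31_ff D) (tenf_ff M ax3 (p32_ff D) (p33_ff D))))).
    + intros; exact (proj2_sig (py _ _ _)).
    + intros; can_cf.
    + intros; apply (cev_two ax1); can_cf.
    + intros; apply (cev_three ax1); can_cf.
    + intros [[f g] h]; exact (eq_sym (lt_alpha_h t f g h)).
  - exact (ls_w_H (fun X Y => proj2_sig (pw X Y))).
  - eapply (modif_can ax2 ax1 (q := fun x => ⟪Heta1 leta (Hten0 M (fst x) (snd x))⟫)) with
      (l := fun x => let X := fst x in let Y := snd x in [iL X (V Y) (eE Y); eT X Y])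
      (l' := fun x => let X := fst x in let Y := snd x in [eE (Hten0 M X Y)]).
    + exact (fn_comp ax2 ax1 (tenn_fn M ax2 (idn1_fn (pr21_ff D)) (fn_pre (eta_fn ieta leta) (ff_map (pr22_ff D)) ax2 (ff_ax (pr22_ff D))))
        (t_fn la ll lr imu ieta lmu leta it lt)).
    + exact (fn_pre (eta_fn ieta leta) (ff_map (tenf_ff M ax2 (pr21_ff D) (pr22_ff D))) ax2 (ff_ax (tenf_ff M ax2 (pr21_ff D) (pr22_ff D)))).
    + intros; exact (proj2_sig (pz _ _)).
    + intros; can_cf.
    + intros; apply (cev_two ax1); can_cf.
    + intros; symmetry; apply (cev_one (φ := φ1)); can_cf.
    + intros [f g]; exact (eq_sym (lt_eta_h t f g)).
  (* From here on, each coherence axiom compares two canonical cells with a common source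
     staircase. *)
  - intros X Y Z W; eapply (can_eq ax1 (l := [eT (X ⊗ Y ⊗ Z) W; iT _ (iR W _ (eA X Y Z)); iT _ (eA X (Y ⊗ Z) W); iT _ (iL X _ (eA Y Z W))]));
     [can_cf|can_chain constr:(ax1)|can_chain constr:(ax1)].
  - intros X Y; eapply (can_eq ax1 (l := [eT (I ⊗ X) Y; iT _ (eA I X Y); iT _ (eL (X ⊗ Y))]));
     [can_cf|can_chain constr:(ax1)|can_chain constr:(ax1)].
  - intros X Y; eapply (can_eq ax1 (l := [eT (X ⊗ I) Y; iT _ (eA X I Y); iT _ (iL X _ (eL Y))]));
     [can_cf|can_chain constr:(ax1)|can_chain constr:(ax1)].
  - intros X Y; eapply (can_eq ax1 (l := [eT X (V (V Y)); iT _ (eT X (V Y)); iT _ (iT _ (eT X Y)); iT _ (eM (X ⊗ Y)); eM (X ⊗ Y)]));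
     [can_cf|can_chain constr:(ax1)|can_chain constr:(ax1)].
  - intros X Y; eapply (can_eq ax1 (l := [iL X _ (eE (V Y)); eT X (V Y); iT _ (eT X Y); eM (X ⊗ Y)]));
     [can_cf|can_chain constr:(ax1)|can_chain constr:(ax1)].
  - intros X Y; eapply (can_eq ax1 (l := [iL X _ (iT _ (eE Y)); eT X (V Y); iT _ (eT X Y); eM (X ⊗ Y)]));
     [can_cf|can_chain constr:(ax1)|can_chain constr:(ax1)].
  - intros X; eapply (can_eq ax1 (l := [iL I _ (eE X); eT I X; iT _ (eL X)]));
     [can_cf|can_chain constr:(ax1)|can_chain constr:(ax1)].
  - intros X; eapply (can_eq ax1 (l := [eT I (V X); iT _ (eT I X); eM (I ⊗ X); iT _ (eL X)]));
     [can_cf|can_chain constr:(ax1)|can_chain constr:(ax1)].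
  - intros X Y Z; eapply (can_eq ax1 (l := [iL (X ⊗ Y) _ (eE Z); eT (X ⊗ Y) Z; iT _ (eA X Y Z)]));
     [can_cf|can_chain constr:(ax1)|can_chain constr:(ax1)].
  - intros X Y Z; eapply (can_eq ax1 (l := [eT (X ⊗ Y) (V Z); iT _ (eT (X ⊗ Y) Z); eM (X ⊗ Y ⊗ Z); iT _ (eA X Y Z)]));
     [can_cf|can_chain constr:(ax1)|can_chain constr:(ax1)]. }
exact (conj (fun X Y => proj2_sig (pw X Y)) (fun X Y => proj2_sig (pz X Y))).
Qed.
End Strength2.

(** * The right strength *)

Section RightStrength.
Context (D : double_category) (M : monoidal_double D) (V : vertical_monad D).
Context (la : liftable (dalpha M)) (ll : liftable (dlambda M)) (lr : liftable (drho M)).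
Context (imu : invertible (dmu V)) (ieta : invertible (deta V)).
Context (lmu : liftable (dmu V)) (leta : liftable (deta V)).
Local Notation HD := (Horiz D).
Local Notation φ1 := (horizfr D).
Local Notation φ2 := (prodfr φ1 φ1).
Local Notation ax1 := (ax1 D).
Local Notation ax2 := (ax2 D).
Local Notation ax3 := (ax3 D).
Local Notation HM := (Hmonoidal la ll lr).
Local Notation HT := (Hmonad imu ieta lmu leta).
Local Notation cf := (cf (φ := φ1)).
Local Notation can := (can (φ := φ1)).
Local Notation "X ⊗ Y" := (dt M (X, Y)) (at level 25, left associativity).
Local Notation I := (dI M tt).
Local Notation eA := (eA la).
Local Notation eL := (eLm ll).
Local Notation eR := (eRm lr).
Local Notation eM := (eM lmu).
Local Notation eE := (eE leta).
Local Notation iL := (iL M).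
Local Notation iR := (iR M).
Local Notation iT := (iT V).
Local Notation iten X Y a b := (img (D := dprodD D D) (dt M) (X, Y) (FS (dt M) (a, b))).

Context (s : right_vstrength M V) (is : invertible s) (ls : liftable s).
Local Notation s' := (Hrstr la ll lr imu ieta lmu leta is ls).

Definition eS (X Y : HD) : dsq D := eps (ls (X, Y)).

Lemma sF_ff : ffun φ2 φ1 (tenf (Hten M) (compf (pr21 HD) (Hfun V)) (pr22 HD)) (dtens (dt M) (dcomp (dp21 D) V) (dp22 D))
  (fun _ _ _ π => FS (dt M) (FS V (fst π), snd π)).
Proof. exact (tenf_ff M ax2 (compf_ff ax2 ax1 ax1 (pr21_ff D) (V_ff V)) (pr22_ff D)). Qed.
Lemma sG_ff : ffun φ2 φ1 (compf (tenf (Hten M) (pr21 HD) (pr22 HD)) (Hfun V)) (dcomp (dtens (dt M) (dp21 D) (dp22 D)) V)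
  (fun _ _ _ π => FS V (FS (dt M) (fst π, snd π))).
Proof. exact (compf_ff ax2 ax1 ax1 (tenf_ff M ax2 (pr21_ff D) (pr22_ff D)) (V_ff V)). Qed.

Lemma st2s : strict_framing (φ := φ2). Proof. apply (prod_strict (horiz_strict D) (horiz_strict D)). Qed.

Lemma s_fn : fnat φ2 φ1 (FV (dtens (dt M) (dcomp (dp21 D) V) (dp22 D))) (FV (dcomp (dtens (dt M) (dp21 D) (dp22 D)) V))
  (FH (dtens (dt M) (dcomp (dp21 D) V) (dp22 D))) (FH (dcomp (dtens (dt M) (dp21 D) (dp22 D)) V))
  (fun _ _ _ π => FS (dt M) (FS V (fst π), snd π)) (fun _ _ _ π => FS V (FS (dt M) (fst π, snd π)))
  s' s (va_h s) (fun X => eS (fst X) (snd X)).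
Proof.
apply (lift_fn ax2 st2s (n := s') (i := is) (l := ls) (ff_map sF_ff) (ff_map sG_ff) (ff_ax sF_ff) (ff_ax sG_ff));
intros; reflexivity.
Qed.

Lemma s_psnat : is_psnat _ _ s'.
Proof.
apply (framed_psnat ax2 ax1 sF_ff sG_ff s_fn).
split; intros; [apply (va_comp s)|apply (va_unit s)]; auto.
Qed.

Lemma cf_s X Y : cf (Hrstr1 ls X Y) (eS X Y).
Proof. exact (fn_cf s_fn (X, Y)). Qed.

Lemma can_s (X Y X' Y' : HD) (f : hom X X') (g : hom Y Y') e e' : cf f e -> cf g e' ->
  can (fwd (s' (X, Y) (X', Y') ⟨f, g⟩)) [iten (V X') Y' (iT X' e) e'; eS X' Y'] [eS X Y; iT (X' ⊗ Y') (iten X' Y' e e')] /\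
  can (bwd (s' (X, Y) (X', Y') ⟨f, g⟩)) [eS X Y; iT (X' ⊗ Y') (iten X' Y' e e')] [iten (V X') Y' (iT X' e) e'; eS X' Y'].
Proof.
intros c c'.
assert (k : Submission.cf (φ := φ2) (X := (X, Y)) (Y := (X', Y')) ⟨f, g⟩ (e, e')) by apply (cf_pair c c').
assert (E1 : img (D := dprodD D D) (dtens (dt M) (dcomp (dp21 D) V) (dp22 D)) (X', Y') (FS (dt M) (FS V e, e'))
  = iten (V X') Y' (iT X' e) e').
{ rewrite (img_tens M (L := dprodD D D)); cbn; auto; [|rewrite FS_bot, (cf_bot c); auto|apply (cf_bot c')].
  f_equal; f_equal; f_equal.
  - unfold Submission.iT, img; cbn. rewrite (FS_vid (dT_ax V)), v1; auto. apply F2u'_top.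
  - unfold img; cbn; apply vr, (cf_bot c'). }
assert (E2 : img (D := dprodD D D) (dcomp (dtens (dt M) (dp21 D) (dp22 D)) V) (X', Y') (FS V (FS (dt M) (e, e')))
  = iT (X' ⊗ Y') (iten X' Y' e e')).
{ rewrite (img_comp (L := dprodD D D) (dT_ax V)); cbn; [|apply bot_FS2; [apply (cf_bot c)|apply (cf_bot c')]].
  unfold Submission.iT; f_equal; f_equal.
  rewrite (img_tens M (L := dprodD D D)); cbn; auto; [|apply (cf_bot c)|apply (cf_bot c')].
  f_equal; f_equal; f_equal; unfold img; cbn; apply vr; [apply (cf_bot c)|apply (cf_bot c')]. }
split.
- refine (can_conv (can_nat ax2 ax1 sF_ff sG_ff s_fn (va_unit s) k) (f_equal (fun z => [z; _]) E1) (f_equal (fun z => [_; z]) E2)).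
- refine (can_conv (can_nat' ax2 ax1 sF_ff sG_ff s_fn (va_unit s) k) (f_equal (fun z => [_; z]) E2) (f_equal (fun z => [z; _]) E1)).
Qed.

Lemma can_sfst (X X' Y : HD) (f : hom X X') e : cf f e ->
  can (fwd (s_fst s' f Y)) [iR Y (V X') (iT X' e); eS X' Y] [eS X Y; iT (X' ⊗ Y) (iR Y X' e)] /\
  can (bwd (s_fst s' f Y)) [eS X Y; iT (X' ⊗ Y) (iR Y X' e)] [iR Y (V X') (iT X' e); eS X' Y].
Proof. intros h; exact (can_s h (cf_hid Y)). Qed.

Lemma can_ssnd (X Y Y' : HD) (f : hom Y Y') e : cf f e ->
  can (fwd (s_snd s' X f)) [iL (V X) Y' e; eS X Y'] [eS X Y; iT (X ⊗ Y') (iL X Y' e)] /\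
  can (bwd (s_snd s' X f)) [eS X Y; iT (X ⊗ Y') (iL X Y' e)] [iL (V X) Y' e; eS X Y'].
Proof.
intros h. destruct (can_s (cf_hid X) h) as [a1 a2]. destruct (can_vunit V X) as [u1 u2].
assert (x1 := can_ten2 (M := M) (cf_T V (cf_hid X)) h u1 (can_id h)).
assert (x2 := can_ten2 (M := M) (cf_hid (V X)) h u2 (can_id h)).
split; cbn [s_snd fwd bwd].
- eapply (can_pcomp ax1); [|exact a1].
  refine (can_to (can_ctx ax1 (p := ⟪⟫) (L := [_; eS X Y']) (r := ⟪Hrstr1 ls X Y'⟫) x2) eq_refl).
- eapply (can_pcomp ax1); [exact a2|].
  refine (can_to (can_ctx ax1 (p := ⟪⟫) (L := [_; eS X Y']) (r := ⟪Hrstr1 ls X Y'⟫) x1) eq_refl).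
Qed.

Lemma snat_fn {A : bicat} {L : double_category} {χ : framing A L} (G : is_framing χ)
  {F0 G0 : A -> HD} {F1 : psfun F0} {F2 : psfun G0} {Fh Gh : pdfun L D}
  {Fr Gr : forall X Y : A, hom X Y -> dsq L -> dsq D}
  (P : ffun χ φ1 F1 Fh Fr) (Q : ffun χ φ1 F2 Gh Gr) :
  fnat χ φ1 (FV (dtens (dt M) (dcomp Fh V) Gh)) (FV (dcomp (dtens (dt M) Fh Gh) V))
    (FH (dtens (dt M) (dcomp Fh V) Gh)) (FH (dcomp (dtens (dt M) Fh Gh) V))
    (fun X Y f π => FS (dt M) (FS V (Fr X Y f π), Gr X Y f π)) (fun X Y f π => FS V (FS (dt M) (Fr X Y f π, Gr X Y f π)))
    (snat (M := HM) (T := HT) s' F1 F2) (fun X => s (Fh X, Gh X)) (fun k => va_h s (FH Fh k, FH Gh k)) (fun X => eS (F0 X) (G0 X)).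
Proof.
assert (W := pairf_ff (φ := φ1) (ψ := φ1) P Q).
exact (fn_pre s_fn (ff_map W) G (ff_ax W)).
Qed.

Ltac can_cf ::= lazymatch goal with
  | |- Submission.cf _ _ => first [ apply cf_s | apply (cf_a la) | apply (cf_l ll) | apply (cf_r lr)
      | apply (cf_M imu) | apply (cf_E ieta)
      | apply (cf_L la ll lr); can_cf | apply (cf_R la ll lr); can_cf | apply cf_T; can_cf ]
  | |- _ => first [exact eq_refl | split; can_cf] end.

Ltac lfts := repeat first [erewrite lft_iL by can_cf | erewrite lft_iR by can_cf | erewrite lft_iT by can_cf].
Ltac tots := cbn [tot]; lfts; unfold eS, Submission.eA, Submission.eLm, Submission.eRm, Submission.eM, Submission.eE; rewrite !eps_lft;
  repeat rewrite (ur (D := D)) by gb.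

Ltac can_cell ::= lazymatch goal with
  | |- Submission.can (@fcell _ _ _ (tenL _ _) _ _ ?p ?q ?c) _ _ =>
    refine (can_conv (can_fL (p := p) (q := q) (c := c) _ _) _ _); [|can_cell|reflexivity|reflexivity]; can_cf
  | |- Submission.can (@fcell _ _ _ (pL _ _) _ _ ?p ?q ?c) _ _ =>
    refine (can_conv (can_fL (p := p) (q := q) (c := c) _ _) _ _); [|can_cell|reflexivity|reflexivity]; can_cf
  | |- Submission.can (@fcell _ _ _ (pR _ _) _ _ ?p ?q ?c) _ _ =>
    refine (can_conv (can_fR (p := p) (q := q) (c := c) _ _) _ _); [|can_cell|reflexivity|reflexivity]; can_cf
  | |- Submission.can (@fcell _ _ _ _ _ _ ?p ?q ?c) _ _ =>
    refine (can_conv (can_fT (p := p) (q := q) (c := c) _ _) _ _); [|can_cell|reflexivity|reflexivity]; can_cf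
  | |- Submission.can (fwd (mp _ _ _ _ _)) _ _ => apply (can_mp la ll lr)
  | |- Submission.can (fwd (mmid _ _ _)) _ _ => apply (can_mid la ll lr)
  | |- Submission.can (fwd (mleft _ _ _)) _ _ => apply (can_left la ll lr)
  | |- Submission.can (fwd (mright _ _ _)) _ _ => apply (can_right la ll lr)
  | |- Submission.can (fwd (mm _ _)) _ _ => apply (can_mm imu)
  | |- Submission.can (fwd (ml _ _)) _ _ => apply (can_ml imu ieta)
  | |- Submission.can (fwd (mr _ _)) _ _ => apply (can_mr imu ieta)
  | |- Submission.can (_ (s_fst _ _ _)) _ _ => apply can_sfst; can_cf
  | |- Submission.can (_ (s_snd _ _ _)) _ _ => apply can_ssnd; can_cf
  | |- Submission.can (_ (nat2 (mu _) _)) _ _ => apply can_mu; can_cf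
  | |- Submission.can (_ (nat2 (eta _) _)) _ _ => apply can_eta; can_cf
  | |- Submission.can (_ (nat2 (pa1 _ _ _) _)) _ _ => apply can_a1; can_cf
  | |- Submission.can (_ (nat2 (pa2 _ _ _) _)) _ _ => apply can_a2; can_cf
  | |- Submission.can (_ (nat2 (pa3 _ _ _) _)) _ _ => apply can_a3; can_cf
  | |- Submission.can (_ (nat2 (pln _) _)) _ _ => apply can_lu1; can_cf
  | |- Submission.can (_ (nat2 (prn _) _)) _ _ => apply can_ru1; can_cf
  | |- Submission.can (fwd (proj1_sig ?u)) _ _ => exact (proj2 (proj2_sig u))
  | |- Submission.can (bwd (proj1_sig ?u)) _ _ => apply (can_inv ax1 (proj1 (proj2_sig u))); [|exact (proj2 (proj2_sig u))]; can_cf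
  end.



Lemma rs_w_H (w : forall X Y, iso2 ⟪Hrstr1 ls (V X) Y; Hfun V # Hrstr1 ls X Y; Hmu1 lmu (X ⊗ Y)⟫
    ⟪tenR HM Y # Hmu1 lmu X; Hrstr1 ls X Y⟫) :
  (forall X Y, is_iso2 (w X Y) /\ can (fwd (w X Y)) [eS (V X) Y; iT (V (X ⊗ Y)) (eS X Y); eM (X ⊗ Y)] [iR Y (V X) (eM X); eS X Y]) ->
  let p := pr21 HD in let q := pr22 HD in
    is_inv_modif (fun x : prodb HD HD => w (fst x) (snd x))
      (compn (snat (M := HM) (T := HT) s' (compf p HT) q) (compn (postn s' HT) (pren (tenf (ten HM) p q) (mu HT))))
      (compn (tenn (ten HM) (pren p (mu HT)) (idn q)) s').
Proof.
intros hw p q.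
eapply (modif_can ax2 ax1) with
      (l := fun x => let X := fst x in let Y := snd x in [eS (V X) Y; iT (V (Hten0 M X Y)) (eS X Y); eM (Hten0 M X Y)])
      (l' := fun x => let X := fst x in let Y := snd x in [iR Y (V X) (eM X); eS X Y]).
- eapply (fn_comp ax2 ax1).
  + exact (snat_fn ax2 (compf_ff ax2 ax1 ax1 (pr21_ff D) (V_ff V)) (pr22_ff D)).
  + eapply (fn_comp ax2 ax1).
    * exact (fn_post ax2 ax1 ax1 s_fn (V_ff V)).
    * exact (fn_pre (mu_fn imu lmu) (ff_map (tenf_ff M ax2 (pr21_ff D) (pr22_ff D))) ax2 (ff_ax (tenf_ff M ax2 (pr21_ff D) (pr22_ff D)))).
- eapply (fn_comp ax2 ax1).
  + exact (tenn_fn M ax2 (fn_pre (mu_fn imu lmu) (ff_map (pr21_ff D)) ax2 (ff_ax (pr21_ff D))) (idn1_fn (pr22_ff D))).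
  + exact s_fn.
- intros; exact (hw _ _).
- intros; can_cf.
- intros; apply (cev_three ax1); can_cf.
- intros; apply (cev_two ax1); can_cf.
- intros [f g]; exact (eq_sym (rt_mu_h s f g)).
Qed.

Lemma right_strength_ex : exists S : right_strength s',
  (forall X Y, is_iso2 (rs_w S X Y) /\ can (fwd (rs_w S X Y)) [eS (V X) Y; iT (V (X ⊗ Y)) (eS X Y); eM (X ⊗ Y)] [iR Y (V X) (eM X); eS X Y]) /\
  (forall X Y, is_iso2 (rs_z S X Y) /\ can (fwd (rs_z S X Y)) [iR Y (V X) (eE X); eS X Y] [eE (X ⊗ Y)]).
Proof.
assert (px : forall X, {i : iso2 ⟪Hrstr1 ls X I; Hfun V # Hru1 lr X⟫ ⟪Hru1 lr (V X)⟫ |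
  is_iso2 i /\ can (fwd i) [eS X I; iT X (eR X)] [eR (V X)]}).
{ intros X; apply (pick_can ax1); [can_cf|can_cf|].
  tots. symmetry; apply (rt_rho s). }
assert (py : forall X Y Z, {i : iso2 ⟪Has1 la (V X) Y Z; Hrstr1 ls X (Y ⊗ Z)⟫
    ⟪tenR HM Z # Hrstr1 ls X Y; Hrstr1 ls (X ⊗ Y) Z; Hfun V # Has1 la X Y Z⟫ |
  is_iso2 i /\ can (fwd i) [eA (V X) Y Z; eS X (Y ⊗ Z)] [iR Z (V (X ⊗ Y)) (eS X Y); eS (X ⊗ Y) Z; iT (X ⊗ (Y ⊗ Z)) (eA X Y Z)]}).
{ intros X Y Z; apply (pick_can ax1); [can_cf|can_cf|].
  tots. apply (rt_alpha s). }
assert (pw : forall X Y, {i : iso2 ⟪Hrstr1 ls (V X) Y; Hfun V # Hrstr1 ls X Y; Hmu1 lmu (X ⊗ Y)⟫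
    ⟪tenR HM Y # Hmu1 lmu X; Hrstr1 ls X Y⟫ |
  is_iso2 i /\ can (fwd i) [eS (V X) Y; iT (V (X ⊗ Y)) (eS X Y); eM (X ⊗ Y)] [iR Y (V X) (eM X); eS X Y]}).
{ intros X Y; apply (pick_can ax1); [can_cf|can_cf|].
  tots. symmetry; apply (rt_mu s). }
assert (pz : forall X Y, {i : iso2 ⟪tenR HM Y # Heta1 leta X; Hrstr1 ls X Y⟫ ⟪Heta1 leta (X ⊗ Y)⟫ |
  is_iso2 i /\ can (fwd i) [iR Y (V X) (eE X); eS X Y] [eE (X ⊗ Y)]}).
{ intros X Y; apply (pick_can ax1); [can_cf|can_cf|].
  tots. symmetry; apply (rt_eta s). }
unshelve eexists.
{ refine (@Build_right_strength HD HM HT _ s' s_psnat (fun X => proj1_sig (px X)) (fun X Y Z => proj1_sig (py X Y Z))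
    (fun X Y => proj1_sig (pw X Y)) (fun X Y => proj1_sig (pz X Y)) _ _ _ _ _ _ _ _ _ _ _ _ _ _); cbv zeta.
  - eapply (modif_can ax1 ax1 (p := fun X => ⟪Hrstr1 ls X I; Hfun V # Hru1 lr X⟫) (q := fun X => ⟪Hru1 lr (V X)⟫)) with
      (l := fun X => [eS X I; iT X (eR X)]) (l' := fun X => [eR (V X)]).
    + exact (fn_comp ax1 ax1 (snat_fn ax1 (id_ff D) (unif_ff la ll lr ax1)) (fn_post ax1 ax1 ax1 (ru_fn lr) (V_ff V))).
    + exact (fn_pre (ru_fn lr) (ff_map (V_ff V)) ax1 (ff_ax (V_ff V))).
    + exact (fun X => proj2_sig (px X)).
    + intros; can_cf.
    + intros; apply (cev_two ax1); can_cf.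
    + intros; symmetry; apply (cev_one (φ := φ1)); can_cf.
    + intros; symmetry; apply (rt_rho_h s).
  - eapply (modif_can ax3 ax1) with
      (l := fun x => let X := fst (fst x) in let Y := snd (fst x) in let Z := snd x in [eA (V X) Y Z; eS X (Hten0 M Y Z)])
      (l' := fun x => let X := fst (fst x) in let Y := snd (fst x) in let Z := snd x in
         [iR Z (V (Hten0 M X Y)) (eS X Y); eS (Hten0 M X Y) Z; iT (Hten0 M X (Hten0 M Y Z)) (eA X Y Z)]).
    + exact (fn_comp ax3 ax1 (asnat_fn la ll lr ax3 (compf_ff ax3 ax1 ax1 (p31_ff D) (V_ff V)) (p32_ff D) (p33_ff D))
        (snat_fn ax3 (p31_ff D) (tenf_ff M ax3 (p32_ff D) (p33_ff D)))).
    + exact (fn_comp ax3 ax1 (tenn_fn M ax3 (snat_fn ax3 (p31_ff D) (p32_ff D)) (idn1_fn (p33_ff D)))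
        (fn_comp ax3 ax1 (snat_fn ax3 (tenf_ff M ax3 (p31_ff D) (p32_ff D)) (p33_ff D)) (fn_post ax3 ax1 ax1 (as_fn la) (V_ff V)))).
    + intros; exact (proj2_sig (py _ _ _)).
    + intros; can_cf.
    + intros; apply (cev_two ax1); can_cf.
    + intros; apply (cev_three ax1); can_cf.
    + intros [[f g] h]; exact (rt_alpha_h s f g h).
  - exact (rs_w_H (fun X Y => proj2_sig (pw X Y))).
  - eapply (modif_can ax2 ax1 (q := fun x => ⟪Heta1 leta (Hten0 M (fst x) (snd x))⟫)) with
      (l := fun x => let X := fst x in let Y := snd x in [iR Y (V X) (eE X); eS X Y])
      (l' := fun x => let X := fst x in let Y := snd x in [eE (Hten0 M X Y)]).
    + exact (fn_comp ax2 ax1 (tenn_fn M ax2 (fn_pre (eta_fn ieta leta) (ff_map (pr21_ff D)) ax2 (ff_ax (pr21_ff D))) (idn1_fn (pr22_ff D))) s_fn).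
    + exact (fn_pre (eta_fn ieta leta) (ff_map (tenf_ff M ax2 (pr21_ff D) (pr22_ff D))) ax2 (ff_ax (tenf_ff M ax2 (pr21_ff D) (pr22_ff D)))).
    + intros; exact (proj2_sig (pz _ _)).
    + intros; can_cf.
    + intros; apply (cev_two ax1); can_cf.
    + intros; symmetry; apply (cev_one (φ := φ1)); can_cf.
    + intros [f g]; exact (eq_sym (rt_eta_h s f g)).
  - intros X Y Z W; eapply (can_eq ax1 (l := [iR W _ (eA (V X) Y Z); eA (V X) (Y ⊗ Z) W; iL (V X) _ (eA Y Z W); eS X (Y ⊗ (Z ⊗ W))]));
     [can_cf|can_chain constr:(ax1)|can_chain constr:(ax1)].
  - intros X Y; eapply (can_eq ax1 (l := [eA (V X) Y I; iL (V X) _ (eR Y); eS X Y]));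
     [can_cf|can_chain constr:(ax1)|can_chain constr:(ax1)].
  - intros X Y; eapply (can_eq ax1 (l := [eA (V X) I Y; iL (V X) _ (eL Y); eS X Y]));
     [can_cf|can_chain constr:(ax1)|can_chain constr:(ax1)].
  - intros X Y; eapply (can_eq ax1 (l := [eS (V (V X)) Y; iT _ (eS (V X) Y); iT _ (iT _ (eS X Y)); iT _ (eM (X ⊗ Y)); eM (X ⊗ Y)]));
     [can_cf|can_chain constr:(ax1)|can_chain constr:(ax1)].
  - intros X Y; eapply (can_eq ax1 (l := [iR Y _ (eE (V X)); eS (V X) Y; iT _ (eS X Y); eM (X ⊗ Y)]));
     [can_cf|can_chain constr:(ax1)|can_chain constr:(ax1)].
  - intros X Y; eapply (can_eq ax1 (l := [iR Y _ (iT _ (eE X)); eS (V X) Y; iT _ (eS X Y); eM (X ⊗ Y)]));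
     [can_cf|can_chain constr:(ax1)|can_chain constr:(ax1)].
  - intros X; eapply (can_eq ax1 (l := [iR I _ (eE X); eS X I; iT _ (eR X)]));
     [can_cf|can_chain constr:(ax1)|can_chain constr:(ax1)].
  - intros X; eapply (can_eq ax1 (l := [eS (V X) I; iT _ (eS X I); eM (X ⊗ I); iT _ (eR X)]));
     [can_cf|can_chain constr:(ax1)|can_chain constr:(ax1)].
  - intros X Y Z; eapply (can_eq ax1 (l := [iR Z _ (iR Y _ (eE X)); eA (V X) Y Z; eS X (Y ⊗ Z)]));
     [can_cf|can_chain constr:(ax1)|can_chain constr:(ax1)].
  - intros X Y Z; eapply (can_eq ax1 (l := [eA (V (V X)) Y Z; eS (V X) (Y ⊗ Z); iT _ (eS X (Y ⊗ Z)); eM (X ⊗ (Y ⊗ Z))]));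
     [can_cf|can_chain constr:(ax1)|can_chain constr:(ax1)]. }
exact (conj (fun X Y => proj2_sig (pw X Y)) (fun X Y => proj2_sig (pz X Y))).
Qed.
End RightStrength.

(** * Compatibility of the two strengths *)

Section Bistrong.
Context (D : double_category) (M : monoidal_double D) (V : vertical_monad D).
Context (la : liftable (dalpha M)) (ll : liftable (dlambda M)) (lr : liftable (drho M)).
Context (imu : invertible (dmu V)) (ieta : invertible (deta V)).
Context (lmu : liftable (dmu V)) (leta : liftable (deta V)).
Local Notation HD := (Horiz D).
Local Notation φ1 := (horizfr D).
Local Notation ax1 := (ax1 D).
Local Notation ax3 := (ax3 D).
Local Notation HM := (Hmonoidal la ll lr).
Local Notation HT := (Hmonad imu ieta lmu leta).
Local Notation can := (can (φ := φ1)).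
Local Notation "X ⊗ Y" := (dt M (X, Y)) (at level 25, left associativity).
Local Notation eA := (eA la).
Local Notation eM := (eM lmu).
Local Notation eE := (eE leta).
Local Notation iL := (iL M).
Local Notation iR := (iR M).
Local Notation iT := (iT V).
Context (t : left_vstrength M V) (it : invertible t) (lt : liftable t).
Context (s : right_vstrength M V) (is : invertible s) (ls : liftable s).
Context (ts : vertically_bistrong t s).
Local Notation t' := (Hlstr la ll lr imu ieta lmu leta it lt).
Local Notation s' := (Hrstr la ll lr imu ieta lmu leta is ls).
Local Notation eT := (eT lt).
Local Notation eS := (eS ls).

Ltac can_cf ::= lazymatch goal with
  | |- Submission.cf _ _ => first [ apply (cf_s la ll lr imu ieta lmu leta is) | apply (cf_t la ll lr imu ieta lmu leta it) | apply (cf_a la) | apply (cf_l ll) | apply (cf_r lr)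
      | apply (cf_M imu) | apply (cf_E ieta)
      | apply (cf_L la ll lr); can_cf | apply (cf_R la ll lr); can_cf | apply cf_T; can_cf ]
  | |- _ => first [exact eq_refl | split; can_cf] end.

Ltac lfts := repeat first [erewrite lft_iL by can_cf | erewrite lft_iR by can_cf | erewrite lft_iT by can_cf].
Ltac tots := cbn [tot]; lfts; unfold Submission.eT, Submission.eS, Submission.eA, Submission.eLm, Submission.eRm, Submission.eM, Submission.eE; rewrite !eps_lft;
  repeat rewrite (ur (D := D)) by gb.

Ltac can_cell ::= lazymatch goal with
  | |- Submission.can (@fcell _ _ _ (tenL _ _) _ _ ?p ?q ?c) _ _ =>
    refine (can_conv (can_fL (p := p) (q := q) (c := c) _ _) _ _); [|can_cell|reflexivity|reflexivity]; can_cf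
  | |- Submission.can (@fcell _ _ _ (pL _ _) _ _ ?p ?q ?c) _ _ =>
    refine (can_conv (can_fL (p := p) (q := q) (c := c) _ _) _ _); [|can_cell|reflexivity|reflexivity]; can_cf
  | |- Submission.can (@fcell _ _ _ (pR _ _) _ _ ?p ?q ?c) _ _ =>
    refine (can_conv (can_fR (p := p) (q := q) (c := c) _ _) _ _); [|can_cell|reflexivity|reflexivity]; can_cf
  | |- Submission.can (@fcell _ _ _ _ _ _ ?p ?q ?c) _ _ =>
    refine (can_conv (can_fT (p := p) (q := q) (c := c) _ _) _ _); [|can_cell|reflexivity|reflexivity]; can_cf
  | |- Submission.can (fwd (mp _ _ _ _ _)) _ _ => apply (can_mp la ll lr)
  | |- Submission.can (fwd (mmid _ _ _)) _ _ => apply (can_mid la ll lr)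
  | |- Submission.can (fwd (mleft _ _ _)) _ _ => apply (can_left la ll lr)
  | |- Submission.can (fwd (mright _ _ _)) _ _ => apply (can_right la ll lr)
  | |- Submission.can (fwd (mm _ _)) _ _ => apply (can_mm imu)
  | |- Submission.can (fwd (ml _ _)) _ _ => apply (can_ml imu ieta)
  | |- Submission.can (fwd (mr _ _)) _ _ => apply (can_mr imu ieta)
  | |- Submission.can (_ (t_fst _ _ _)) _ _ => apply can_tfst; can_cf
  | |- Submission.can (_ (s_fst _ _ _)) _ _ => apply can_sfst; can_cf
  | |- Submission.can (_ (s_snd _ _ _)) _ _ => apply can_ssnd; can_cf
  | |- Submission.can (_ (t_snd _ _ _)) _ _ => apply can_tsnd; can_cf
  | |- Submission.can (_ (nat2 (mu _) _)) _ _ => apply can_mu; can_cf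
  | |- Submission.can (_ (nat2 (eta _) _)) _ _ => apply can_eta; can_cf
  | |- Submission.can (_ (nat2 (pa1 _ _ _) _)) _ _ => apply can_a1; can_cf
  | |- Submission.can (_ (nat2 (pa2 _ _ _) _)) _ _ => apply can_a2; can_cf
  | |- Submission.can (_ (nat2 (pa3 _ _ _) _)) _ _ => apply can_a3; can_cf
  | |- Submission.can (_ (nat2 (pln _) _)) _ _ => apply can_lu1; can_cf
  | |- Submission.can (_ (nat2 (prn _) _)) _ _ => apply can_ru1; can_cf
  | h : forall X Y, _ /\ Submission.can (fwd (ls_w ?S X Y)) _ _ |- Submission.can (fwd (ls_w ?S _ _)) _ _ => apply h
  | h : forall X Y, _ /\ Submission.can (fwd (ls_z ?S X Y)) _ _ |- Submission.can (fwd (ls_z ?S _ _)) _ _ => apply h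
  | h : forall X Y, _ /\ Submission.can (fwd (rs_w ?S X Y)) _ _ |- Submission.can (fwd (rs_w ?S _ _)) _ _ => apply h
  | h : forall X Y, _ /\ Submission.can (fwd (rs_z ?S X Y)) _ _ |- Submission.can (fwd (rs_z ?S _ _)) _ _ => apply h
  | h : forall X Y, _ /\ Submission.can (fwd (rs_w ?S X Y)) _ _ |- Submission.can (bwd (rs_w ?S ?X ?Y)) _ _ =>
      apply (can_inv ax1 (proj1 (h X Y))); [|apply h]; can_cf
  | |- Submission.can (fwd (proj1_sig ?u)) _ _ => exact (proj2 (proj2_sig u))
  | |- Submission.can (bwd (proj1_sig ?u)) _ _ => apply (can_inv ax1 (proj1 (proj2_sig u))); [|exact (proj2 (proj2_sig u))]; can_cf
  end.



Lemma bistrong_ex : inhabited (bistrong t' s').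
Proof.
destruct (left_strength_ex la ll lr imu ieta lmu leta it lt) as (L & hlw & hlz).
destruct (right_strength_ex la ll lr imu ieta lmu leta is ls) as (R & hrw & hrz).
(* The totals agree by vertical bistrength on objects; its version on 1h-cells makes the chosen
   cells a modification. *)
assert (pq : forall X Y Z, {i : iso2 ⟪tenR HM Z # Hlstr1 lt X Y; Hrstr1 ls (X ⊗ Y) Z; Hfun V # Has1 la X Y Z⟫
    ⟪Has1 la X (V Y) Z; tenL HM X # Hrstr1 ls Y Z; Hlstr1 lt X (Y ⊗ Z)⟫ |
  is_iso2 i /\ can (fwd i) [iR Z (V (X ⊗ Y)) (eT X Y); eS (X ⊗ Y) Z; iT (X ⊗ (Y ⊗ Z)) (eA X Y Z)]
    [eA X (V Y) Z; iL X (V (Y ⊗ Z)) (eS Y Z); eT X (Y ⊗ Z)]}).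
{ intros X Y Z; apply (pick_can ax1); [can_cf|can_cf|].
  tots. apply (vbs ts). }
constructor.
refine (@Build_bistrong HD HM HT _ t' _ s' L R (fun X Y Z => proj1_sig (pq X Y Z)) _ _ _); cbv zeta.
- eapply (modif_can ax3 ax1) with
      (l := fun x => let X := fst (fst x) in let Y := snd (fst x) in let Z := snd x in
         [iR Z (V (Hten0 M X Y)) (eT X Y); eS (Hten0 M X Y) Z; iT (Hten0 M X (Hten0 M Y Z)) (eA X Y Z)])
      (l' := fun x => let X := fst (fst x) in let Y := snd (fst x) in let Z := snd x in
         [eA X (V Y) Z; iL X (V (Hten0 M Y Z)) (eS Y Z); eT X (Hten0 M Y Z)]).
  + exact (fn_comp ax3 ax1 (tenn_fn M ax3 (tnat_fn la ll lr imu ieta lmu leta it lt ax3 (p31_ff D) (p32_ff D)) (idn1_fn (p33_ff D)))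
      (fn_comp ax3 ax1 (snat_fn la ll lr imu ieta lmu leta is ls ax3 (tenf_ff M ax3 (p31_ff D) (p32_ff D)) (p33_ff D)) (fn_post ax3 ax1 ax1 (as_fn la) (V_ff V)))).
  + exact (fn_comp ax3 ax1 (asnat_fn la ll lr ax3 (p31_ff D) (compf_ff ax3 ax1 ax1 (p32_ff D) (V_ff V)) (p33_ff D))
      (fn_comp ax3 ax1 (tenn_fn M ax3 (idn1_fn (p31_ff D)) (snat_fn la ll lr imu ieta lmu leta is ls ax3 (p32_ff D) (p33_ff D)))
        (tnat_fn la ll lr imu ieta lmu leta it lt ax3 (p31_ff D) (tenf_ff M ax3 (p32_ff D) (p33_ff D))))).
  + intros; exact (proj2_sig (pq _ _ _)).
  + intros; can_cf.
  + intros; apply (cev_three ax1); can_cf.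
  + intros; apply (cev_three ax1); can_cf.
  + intros [[f g] h]; exact (vbs_h ts f g h).
- intros X Y Z; eapply (can_eq ax1 (l := [iR Z _ (iL X _ (eE Y)); iR Z _ (eT X Y); eS (X ⊗ Y) Z; iT _ (eA X Y Z)]));
   [can_cf|can_chain constr:(ax1)|can_chain constr:(ax1)].
- intros X Y Z; eapply (can_eq ax1 (l := [iR Z _ (eT X (V Y)); iR Z _ (iT _ (eT X Y)); iR Z _ (eM (X ⊗ Y)); eS (X ⊗ Y) Z; iT _ (eA X Y Z)]));
   [can_cf|can_chain constr:(ax1)|can_chain constr:(ax1)].
Qed.
End Bistrong.

(** * The two descriptions of the Kleisli bicategory *)

Section Agree.
Context (D : double_category) (V : vertical_monad D).
Context (imu : invertible (dmu V)) (ieta : invertible (deta V)).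
Context (lmu : liftable (dmu V)) (leta : liftable (deta V)).
Local Notation HT := (Hmonad imu ieta lmu leta).
Local Notation K := (kleisli HT).

(** Over an identity the square of a companion-lift is [[iota | eps]]. Hence the square of [μ] that
    pads a Kleisli composite of globular cells is a vertical identity, as in the bicategory. *)
Lemma hat_sq_id {F G : pdfun D D} (a : vtrans F G) (l : liftable a) A : hat_sq l A A (vid A) = vidS (cmp (l A)).
Proof.
unfold hat_sq; rewrite !FV_id, !hidS_id, v1, vr by gb.
apply (companion_ax (l A)).
Qed.

Definition ksq_cell (A B : dob D) (f g : @hom K A B) (c : ksq f g (kvid A) (kvid B)) : @cell K A B f g.
Proof.
refine ({| sval := kval c |} : gcell (f : hcell _ _) (g : hcell _ _)).
- apply k_top.
- apply k_bot.
- rewrite k_lft; auto.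
- rewrite k_rgt; cbn; apply FV_id.
Defined.

Lemma ksq_eq (A B C E : dob D) (f : @hom K A B) (g : @hom K C E) u v (c d : ksq f g u v) : kval c = kval d -> c = d.
Proof. destruct c, d; cbn; intros <-; f_equal; apply proof_irrelevance. Qed.

Lemma kval_rect_l (A B C E : dob D) (f : @hom K A B) (g : @hom K C E) u u' v (e : u = u') (c : ksq f g u v) :
  kval (eq_rect u (fun w => ksq f g w v) c u' e) = kval c.
Proof. destruct e; auto. Qed.
Lemma kval_rect_r (A B C E : dob D) (f : @hom K A B) (g : @hom K C E) u v v' (e : v = v') (c : ksq f g u v) :
  kval (eq_rect v (fun w => ksq f g u w) c v' e) = kval c.
Proof. destruct e; auto. Qed.

Lemma kleisli_agree_holds : kleisli_agree imu ieta lmu leta.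
Proof.
exists ksq_cell.
repeat apply conj; try (intros; apply gcell_eq; reflexivity).
- intros A B f g; exists (fun c => ksq_of c); split; intros; [apply ksq_eq|apply gcell_eq]; reflexivity.
(* The transports along the unit laws in [ps_horiz] do not change the underlying square. *)
- intros A B f g h c d; apply gcell_eq; cbn.
  exact (eq_trans (kval_rect_r (f := f) (g := h) _ _) (kval_rect_l (f := f) (g := h) _ _)).
- intros A B C f f' g g' c d; apply gcell_eq; cbn.
  rewrite hat_sq_id; auto.
Qed.
End Agree.

(** * The framing of the Kleisli bicategory *)

Section KleisliFraming.
Context (D : double_category) (V : vertical_monad D).
Context (imu : invertible (dmu V)) (ieta : invertible (deta V)).
Context (lmu : liftable (dmu V)) (leta : liftable (deta V)).
Local Notation HD := (Horiz D).
Local Notation φ1 := (horizfr D).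
Local Notation HT := (Hmonad imu ieta lmu leta).
Local Notation K := (kleisli HT).
Local Notation η := (deta V).
Local Notation μ := (dmu V).
Local Notation eM := (eM lmu).
Local Notation eE := (eE leta).
Local Notation iT := (iT V).
Local Notation ev := (ev (φ := φ1)).
Local Notation cf := (cf (φ := φ1)).

(** [invertible] supplies inverses of squares; the inverse of the vertical cell [η X] is read off as
    a side of the inverse square at an identity. *)
Definition ei (X : dob D) : dv D := lft (ieta (hid X)).
Definition th (f : dh D) : dsq D := ieta f.

Lemma th_top f : top (th f) = FH V f. Proof. unfold th; rewrite vi_top; apply va_bot. Qed.
Lemma th_bot f : bot (th f) = f. Proof. unfold th; rewrite vi_bot; apply va_top. Qed.
Lemma th_l f : va_h η f ÷ th f = vidS f. Proof. unfold th; rewrite vi_l; f_equal; apply va_top. Qed.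
Lemma th_r f : th f ÷ va_h η f = vidS (FH V f). Proof. unfold th; rewrite vi_r; f_equal; apply va_bot. Qed.
Lemma th_iso f : visoS (th f).
Proof.
exists (va_h η f); rewrite th_top, th_bot, va_top, va_bot, th_r, th_l; auto.
Qed.

Lemma ei_dom X : vdom (ei X) = V X.
Proof. unfold ei; rewrite <- dom_top; fold (th (hid X)); rewrite th_top; gb. Qed.
Lemma ei_cod X : vcod (ei X) = X.
Proof. unfold ei; rewrite <- dom_bot; fold (th (hid X)); rewrite th_bot; gb. Qed.
Lemma ei_l X : η X ∙ ei X = vid X.
Proof.
assert (e := f_equal (@lft D) (th_l (hid X))).
rewrite lft_vcomp, va_lft, lft_vid, hdom_id in e; auto. rewrite va_bot, th_top; auto.
Qed.
Lemma inv_sides f : (lft (th f) ∙ η (hdom f) = vid (V (hdom f)) /\ rgt (th f) ∙ η (hcod f) = vid (V (hcod f))) /\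
  vdom (lft (th f)) = V (hdom f) /\ vcod (lft (th f)) = hdom f /\ vdom (rgt (th f)) = V (hcod f) /\ vcod (rgt (th f)) = hcod f.
Proof.
assert (t := th_top f); assert (b := th_bot f); assert (e := th_r f).
assert (e1 := f_equal (@lft D) e); assert (e2 := f_equal (@rgt D) e).
rewrite lft_vcomp, va_lft, lft_vid, FH_dom in e1 by (rewrite va_top; auto).
rewrite rgt_vcomp, va_rgt, rgt_vid, FH_cod in e2 by (rewrite va_top; auto).
rewrite <- !dom_top, <- !dom_bot, <- !cod_top, <- !cod_bot, t, b, FH_dom, FH_cod; auto.
Qed.
Lemma ei_r X : ei X ∙ η X = vid (V X).
Proof. destruct (inv_sides (hid X)) as [[h _] _]; rewrite hdom_id in h; exact h. Qed.
Lemma ei_iso X : viso (ei X).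
Proof. exists (η X); rewrite ei_dom, ei_cod, ei_l, ei_r, va_dom, va_cod; auto. Qed.
Lemma eta_iso X : viso (η X).
Proof. exists (ei X); rewrite ei_dom, ei_cod, ei_l, ei_r, va_dom, va_cod; auto. Qed.
Lemma ei_unique X v : vdom v = V X -> η X ∙ v = vid X -> v = ei X.
Proof.
intros d e; apply (viso_inj (eta_iso X)); [rewrite d, va_cod; auto|rewrite ei_dom, va_cod; auto|].
rewrite e, ei_l; auto.
Qed.
Lemma th_lft f : lft (th f) = ei (hdom f).
Proof.
destruct (inv_sides f) as [_ (d1 & d2 & d3 & d4)].
apply ei_unique; auto.
assert (e1 := f_equal (@lft D) (th_l f)).
rewrite lft_vcomp, va_lft, lft_vid in e1; auto. rewrite va_bot, th_top; auto.
Qed.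
Lemma th_rgt f : rgt (th f) = ei (hcod f).
Proof.
destruct (inv_sides f) as [_ (d1 & d2 & d3 & d4)].
apply ei_unique; auto.
assert (e1 := f_equal (@rgt D) (th_l f)).
rewrite rgt_vcomp, va_rgt, rgt_vid in e1; auto. rewrite va_bot, th_top; auto.
Qed.
(** The unit law says that [μ] retracts [η], so an invertible [η] forces [μ] to be its inverse: the
    monad is idempotent. The same argument applies to squares ([th_mu]). *)
Lemma ei_mu Z : ei (V Z) = μ Z.
Proof. symmetry; apply ei_unique; [exact (va_dom μ Z)|apply dmu_l]. Qed.

Lemma th_unique f s : top s = FH V f -> va_h η f ÷ s = vidS f -> s = th f.
Proof.
intros t e. assert (I := th_iso f). destruct I as (u & u1 & u2 & u3 & u4).
assert (J : visoS (va_h η f)) by apply (visoS_vi (ieta f)).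
apply (visoS_injl J); rewrite ?t, ?th_top, ?va_bot; auto. rewrite e, th_l; auto.
Qed.
Lemma th_mu h : va_h μ h = th (FH V h).
Proof. apply th_unique; [exact (va_top μ h)|apply dmu_l_h]. Qed.
Lemma th_nat s : FS V s ÷ th (bot s) = th (top s) ÷ s.
Proof.
assert (J : visoS (va_h η (top s))) by apply (visoS_vi (ieta (top s))).
assert (t := th_top); assert (b := th_bot).
apply (visoS_injl J); rewrite ?top_vcomp, ?va_bot, ?FS_top, ?t; auto; rewrite ?FS_bot, ?b; auto.
rewrite <- (vA (s2 := FS V s)), <- (va_natS η s), vA, th_l, <- vA, th_l, v1, vr; cbn;
rewrite ?va_bot, ?va_top, ?FS_top, ?FS_bot, ?t, ?b; auto.
Qed.
Lemma th_comp f g : hcod f = hdom g -> F2c V f g ÷ th (hcomp f g) = th f ∥ th g.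
Proof.
intros h; assert (t := th_top); assert (b := th_bot).
assert (e := va_comp η h).
assert (lr : rgt (va_h η f) = lft (va_h η g)) by (rewrite va_rgt, va_lft, h; auto).
assert (lr' : rgt (th f) = lft (th g)) by (rewrite th_rgt, th_lft, h; auto).
assert (J : visoS (va_h η f ∥ va_h η g)) by (apply visoS_hcomp; auto; apply (visoS_vi (ieta _))).
assert (c : hcod (FH V f) = hdom (FH V g)) by (rewrite FH_dom, FH_cod, h; auto).
apply (visoS_injl J).
- rewrite top_vcomp, F2c_top, bot_hcomp, !va_bot; auto. rewrite F2c_bot, t; auto.
- rewrite top_hcomp, bot_hcomp, !va_bot, !t; auto.
- rewrite <- vA, <- e, exch, !th_l, <- vidS_h; auto.
  + cbn; rewrite v1; [apply th_l|]. apply va_top.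
  + rewrite va_bot; auto.
  + rewrite va_bot; auto.
  + rewrite bot_hcomp, !va_bot, F2c_top; auto.
  + rewrite F2c_bot, t; auto.
Qed.
Lemma th_unit A : th (hid A) = F2u' V A ÷ hidS (ei A).
Proof.
symmetry; apply th_unique.
- rewrite top_vcomp, F2u'_top; auto. rewrite F2u'_bot, top_hid, ei_dom; auto.
- assert (e := va_unit η A); cbn in e. rewrite v1 in e by apply va_top.
  rewrite e, vA, <- (vA (s1 := F2u V A)), (F2u_inv (dT_ax V)), v1, <- hidS_v, ei_l, hidS_id;
  rewrite ?top_hid, ?bot_hid, ?ei_dom, ?va_cod, ?F2u_bot, ?F2u_top, ?F2u'_top, ?F2u'_bot; auto.
  rewrite top_vcomp, F2u'_top; auto. rewrite F2u'_bot, top_hid, ei_dom; auto.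
Qed.

(** In the notation of the double category, [[θ_g | ε_μ]]. *)
Definition kap (Z : dob D) (g : dh D) : dsq D := th g ∥ eM Z.

(** The frame [fu] of a Kleisli identity is the companion square of [η] continued by [ei X ∙ a]; its
    left side is [a] because [η X ∙ ei X] is an identity. The predicate [good] spells out the
    iterates of [η], later named [eta_chain]. *)
Definition kleislifr : framing K D :=
  @Build_framing K D (fun X => X) (fun X Y (f : @hom K X Y) => hval (f : hcell X (V Y)))
    (fun X Y f g c => sval (c : gcell (f : hcell X (V Y)) g))
    (fun Y b => ei Y ∙ b)
    (fun X Y Z f g π π' => π ∥ (kap Z (hval (g : hcell Y (V Z))) ÷ π'))
    (fun X a => eE X ÷ hidS (ei X ∙ a))
    (fun X a => exists n, a = nat_rect (fun _ => dob D -> dv D) (fun X => vid X) (fun _ e X => η X ∙ e (V X)) n X).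
Local Notation ψ := kleislifr.

Lemma fr_HD {X Y : K} {f : @hom K X Y} {a b π} : fr ψ f a b π ->
  fr φ1 (f : @hom HD X (V Y)) a (ei Y ∙ b) π.
Proof. intros h; apply frH; apply h. Qed.

Lemma rgt_dom {X Y : K} {f : @hom K X Y} {a b π} : fr ψ f a b π ->
  vdom (ei Y ∙ b) = V Y /\ vcod (ei Y ∙ b) = vcod b.
Proof. intros [_ _ _ h]; cbn in h; rewrite vdom_comp, vcod_comp, ei_dom by (rewrite ei_cod; auto); auto. Qed.

(** Separates the second factor of a Kleisli composite into a frame of [T g] and one of the
    companion of [μ]; interchange applies because the frame below can be extended by a horizontal
    identity. *)
Lemma kap_act Z g π : top π = g -> hcod g = V Z -> vdom (rgt π) = V Z -> 
  kap Z g ÷ π = (th g ÷ π) ∥ (eM Z ÷ hidS (rgt π)).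
Proof.
intros <- e d.
rewrite <- (hr (s := π) (u := rgt π)) at 2 by auto.
unfold kap; apply exch; rewrite ?lft_hid; auto.
- rewrite th_rgt, e, ei_mu; symmetry; apply eps_lft.
- apply th_bot.
- unfold Submission.eM; rewrite eps_bot, top_hid, d, va_cod; auto.
Qed.

Lemma kap_bdry Z (g : dh D) : hcod g = V Z -> 
  (top (kap Z g) = hcomp (FH V g) (cmp (lmu Z)) /\ bot (kap Z g) = g) /\
  (lft (kap Z g) = ei (hdom g) /\ rgt (kap Z g) = vid (V Z)).
Proof.
intros e; assert (r : rgt (th g) = lft (eM Z)) by (rewrite th_rgt, e, ei_mu; symmetry; apply eps_lft).
unfold kap; rewrite top_hcomp, bot_hcomp, lft_hcomp, rgt_hcomp, th_top, th_bot, th_lft; auto.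
unfold Submission.eM; rewrite eps_top, eps_bot, eps_rgt, va_cod; repeat split; auto.
apply hunitr; auto.
Qed.

Lemma kap_iso Z (g : dh D) : hcod g = V Z -> visoS (kap Z g).
Proof.
intros e; unfold kap; apply visoS_hcomp.
- rewrite th_rgt, e, ei_mu; symmetry; apply eps_lft.
- apply th_iso.
- apply (cf_iso (cf_M imu lmu Z)).
Qed.

Lemma fr_right {Y Z : K} (g : @hom K Y Z) b c π : fr ψ g b c π ->
  (top (kap Z (hval (g : hcell Y (V Z))) ÷ π) = hcomp (FH V (hval (g : hcell Y (V Z)))) (cmp (lmu Z)) /\
   bot (kap Z (hval (g : hcell Y (V Z))) ÷ π) = bot π) /\
  (lft (kap Z (hval (g : hcell Y (V Z))) ÷ π) = ei Y ∙ b /\ rgt (kap Z (hval (g : hcell Y (V Z))) ÷ π) = ei Z ∙ c).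
Proof.
intros h. destruct (kap_bdry (Z := Z) (hval_cod (g : hcell Y (V Z)))) as [[h1 h2] [h3 h4]].
assert (e : bot (kap Z (hval (g : hcell Y (V Z)))) = top π) by (rewrite h2; symmetry; apply h).
rewrite top_vcomp, bot_vcomp, lft_vcomp, rgt_vcomp, h1, h3, h4, (fr_lft h), (fr_rgt h), hval_dom; auto.
cbn; rewrite u1 by apply (rgt_dom h); auto.
Qed.

(** There are two ways to frame [T f] from [e]: by [th] above it or by its image [iT]. Naturality of
    [th] shows that they agree once the image is continued by [ei Y]. *)
Lemma th_cf (X Y : HD) (f : hom X Y) e : cf f e -> th (hval f) ÷ e = iT Y e ÷ hidS (ei Y).
Proof.
intros h; rewrite <- (fr_top (cf_fr h) : top e = hval f), <- th_nat, (cf_bot h), th_unit.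
unfold Submission.iT, img; rewrite vA; auto.
- rewrite FS_bot, (cf_bot h), F2u'_top; auto.
- rewrite F2u'_bot, top_hid, ei_dom; auto.
Qed.
End KleisliFraming.

Lemma can_stair {B : bicat} {D : double_category} {φ : framing B D} (H : is_framing φ) (X Y : B)
  (p q : path X Y) (c : pcell p q) l l' a : can (φ := φ) c l l' -> okc (φ := φ) p l -> vdom a = fo φ Y ->
  cs φ c ÷ ev (φ := φ) q (stair l' a) a = ev (φ := φ) p (stair l a) a.
Proof.
intros h o d; destruct (h o) as [o' e].
rewrite <- (stair_post H o d), <- (stair_post H o' d), <- e.
apply (act_post H c (cev_fr H o')). rewrite top_hid, (cev_bot H o'), d; auto.
Qed.

(** * Associativity in the Kleisli bicategory *)

Section KleisliAssoc.
Context (D : double_category) (V : vertical_monad D).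
Context (imu : invertible (dmu V)) (ieta : invertible (deta V)).
Context (lmu : liftable (dmu V)) (leta : liftable (deta V)).
Local Notation HD := (Horiz D).
Local Notation φ1 := (horizfr D).
Local Notation ax1 := (ax1 D).
Local Notation HT := (Hmonad imu ieta lmu leta).
Local Notation K := (kleisli HT).
Local Notation μ := (dmu V).
Local Notation eM := (eM lmu).
Local Notation iT := (iT V).
Local Notation ei := (ei ieta).
Local Notation th := (th ieta).
Local Notation kap := (kap ieta lmu).
Local Notation ψ := (kleislifr imu ieta lmu leta).
Context (X Y Z W : dob D) (f : hcell X (V Y)) (g : hcell Y (V Z)) (h : hcell Z (V W)).
Context (a b c d : dv D) (π1 π2 π3 : dsq D).
Context (h1 : fr ψ (X := X) (Y := Y) f a b π1) (h2 : fr ψ (X := Y) (Y := Z) g b c π2) (h3 : fr ψ (X := Z) (Y := W) h c d π3).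
Local Notation T := (Hfun V).
Local Notation r := (ei W ∙ d).
Local Notation ρ := (π2 ∥ (kap W (hval h) ÷ π3)).
Local Notation gh := (comp1 (g : @hom HD Y (V Z)) (comp1 (T # (h : @hom HD Z (V W))) (Hmu1 lmu W))).
Local Notation fg := (comp1 (f : @hom HD X (V Y)) (comp1 (T # (g : @hom HD Y (V Z))) (Hmu1 lmu Z))).
Local Notation frH1 := (fr φ1).

(** [th] leads from [T k] to [k], so placing it above a frame of [k] gives a frame of [T k] with the
    same bottom. On the right it contributes [ei (V B)], which is [μ B]. *)
Lemma frame_T (A B : HD) (k : @hom HD A (V B)) x y s : frH1 k x y s ->
  frH1 (T # k) (ei A ∙ x) (μ B ∙ y) (th (hval k) ÷ s).
Proof.
intros q. assert (e : bot (th (hval k)) = top s) by (rewrite th_bot; symmetry; apply (fr_top q)).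
apply frH.
- rewrite top_vcomp, th_top; auto.
- rewrite lft_vcomp, th_lft, hval_dom, (fr_lft q); auto.
- rewrite rgt_vcomp, th_rgt, hval_cod, (fr_rgt q), ei_mu; auto.
Qed.

Lemma frame_f : frH1 (f : @hom HD X (V Y)) a (ei Y ∙ b) π1. Proof. exact (fr_HD h1). Qed.
Lemma frame_g : frH1 (g : @hom HD Y (V Z)) b (ei Z ∙ c) π2. Proof. exact (fr_HD h2). Qed.
Lemma frame_h : frH1 (h : @hom HD Z (V W)) c r π3. Proof. exact (fr_HD h3). Qed.
Lemma frame_Tg : frH1 (T # (g : @hom HD Y (V Z))) (ei Y ∙ b) (μ Z ∙ (ei Z ∙ c)) (th (hval g) ÷ π2).
Proof. apply (frame_T frame_g). Qed.
Lemma frame_Th : frH1 (T # (h : @hom HD Z (V W))) (ei Z ∙ c) (μ W ∙ r) (th (hval h) ÷ π3).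
Proof. apply (frame_T frame_h). Qed.
Lemma frame_mu_Z : frH1 (Hmu1 lmu Z) (μ Z ∙ (ei Z ∙ c)) (ei Z ∙ c) (eM Z ÷ hidS (ei Z ∙ c)).
Proof.
assert (q := cf_post ax1 (cf_M imu lmu Z) (a := ei Z ∙ c) (proj1 (rgt_dom h2))).
rewrite (eps_lft (lmu Z) : lft (eM Z) = μ Z) in q; exact q.
Qed.
Lemma frame_mu_W : frH1 (Hmu1 lmu W) (μ W ∙ r) r (eM W ÷ hidS r).
Proof.
assert (q := cf_post ax1 (cf_M imu lmu W) (a := r) (proj1 (rgt_dom h3))).
rewrite (eps_lft (lmu W) : lft (eM W) = μ W) in q; exact q.
Qed.
Lemma mu_r_bdry : vdom (μ W ∙ r) = V (V W) /\ vcod (μ W ∙ r) = vcod r.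
Proof.
assert (q := proj1 (rgt_dom h3)); assert (q' := va_dom μ W); assert (q'' := va_cod μ W); cbn in q', q''.
rewrite vdom_comp, vcod_comp; auto; rewrite q'', q; auto.
Qed.
Lemma frame_TTh : frH1 (T # T # (h : @hom HD Z (V W))) (μ Z ∙ (ei Z ∙ c)) (μ (V W) ∙ (μ W ∙ r)) (th (FH V (hval h)) ÷ (th (hval h) ÷ π3)).
Proof. assert (q := frame_T frame_Th); rewrite ei_mu in q; exact q. Qed.
Lemma frame_mu_TW : frH1 (Hmu1 lmu (V W)) (μ (V W) ∙ (μ W ∙ r)) (μ W ∙ r) (eM (V W) ÷ hidS (μ W ∙ r)).
Proof.
assert (q := cf_post ax1 (cf_M imu lmu (V W)) (a := μ W ∙ r) (proj1 mu_r_bdry)).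
rewrite (eps_lft (lmu (V W)) : lft (eM (V W)) = μ (V W)) in q; exact q.
Qed.
Lemma frame_Tmu : frH1 (T # Hmu1 lmu W) (μ (V W) ∙ (μ W ∙ r)) (μ W ∙ r) (iT (V W) (eM W) ÷ hidS (μ W ∙ r)).
Proof.
assert (q := cf_post ax1 (cf_T V (cf_M imu lmu W)) (a := μ W ∙ r) (proj1 mu_r_bdry)).
assert (l : lft (iT (V W) (eM W)) = FV V (μ W)).
{ refine (eq_trans (proj2 (img_cf ax1 ax1 (V_ff V) (cf_M imu lmu W))) _). f_equal; apply (eps_lft (lmu W)). }
(* Associativity of the vertical monad gives this left side the form in which the frame of [T T h]
   ends. *)
assert (e : FV V (μ W) ∙ (μ W ∙ r) = μ (V W) ∙ (μ W ∙ r)).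
{ assert (q' := va_dom μ W); assert (q'' := va_cod μ W); assert (q3 := va_cod μ (V W)); cbn in q', q'', q3.
  assert (q4 := proj1 (rgt_dom h3)); clear q; set (r0 := r) in *; clearbody r0.
  rewrite <- !uA, dmu_assoc; auto; rewrite ?FV_cod, ?q', ?q'', ?q3, ?q4; auto. }
rewrite l, e in q; exact q.
Qed.

Lemma rho_eq : ρ = π2 ∥ ((th (hval h) ÷ π3) ∥ (eM W ÷ hidS r)).
Proof.
rewrite (kap_act ieta lmu (fr_top h3)), (fr_rgt h3); auto; [apply hval_cod|].
rewrite (fr_rgt h3); apply (rgt_dom h3).
Qed.
Lemma rho_fr : fr ψ (X := Y) (Y := W) gh b d ρ.
Proof.
destruct (fr_right h3) as [[k1 k2] [k3 k4]].
assert (e : rgt π2 = lft (kap W (hval h) ÷ π3)) by (rewrite k3; apply (fr_rgt h2)).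
split; [rewrite top_hcomp, k1, (fr_top h2)|rewrite lft_hcomp; [apply h2|]|rewrite rgt_hcomp, k4|apply h3]; auto.
Qed.

(** By [th_comp], the compositors in [ffold] distribute [th] over a composite. So the frame of [T]
    applied to a Kleisli composite opens up into consecutive frames of the images of its three
    factors. *)
Lemma ffold_th :
  cs φ1 (ffold T ⟪g : @hom HD Y (V Z); T # (h : @hom HD Z (V W)); Hmu1 lmu W⟫) ÷ (th (hval gh) ÷ ρ)
  = ev (φ := φ1) ⟪T # (g : @hom HD Y (V Z)); T # T # (h : @hom HD Z (V W)); T # Hmu1 lmu W⟫
     [th (hval g) ÷ π2; th (FH V (hval h)) ÷ (th (hval h) ÷ π3); iT (V W) (eM W) ÷ hidS (μ W ∙ r)] (μ W ∙ r).
Proof.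
rewrite rho_eq.
assert (tg : top π2 = hval g) by apply (fr_top frame_g); assert (tH : top π3 = hval h) by apply (fr_top frame_h).
assert (lg := fr_rgt frame_g); assert (lh := fr_lft frame_h); assert (lh' := fr_rgt frame_h); cbn in lg, lh, lh'.
assert (dg := hval_dom g); assert (cg := hval_cod g); assert (dh := hval_dom h); assert (ch := hval_cod h).
assert (dm := cmp_dom (lmu W)); assert (cm := cmp_cod (lmu W)).
assert (vd := va_dom μ W); assert (vc := va_cod μ W); cbn in vd, vc; rewrite vd in dm; rewrite vc in cm.
(* The third square is wanted as an image frame, the form on which [can_mm] acts; [th_cf] provides
   the conversion. *)
assert (K3 : th (cmp (lmu W)) ÷ (eM W ÷ hidS r) = iT (V W) (eM W) ÷ hidS (μ W ∙ r)).
{ assert (q := th_cf ieta (cf_M imu lmu W)); cbn in q.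
  assert (dr1 := proj1 (rgt_dom h3)); cbn in dr1.
  rewrite <- (cf_post2 (cf_T V (cf_M imu lmu W)) (a := μ W) (b := r)) by (cbn; congruence).
  replace (hidS (μ W)) with (hidS (ei (V W))) by (rewrite (ei_mu ieta W); auto).
  rewrite <- q, vA; [reflexivity| |].
  - rewrite th_bot; symmetry; apply eps_top.
  - rewrite (cf_bot (cf_M imu lmu W)), top_hid; cbn; f_equal; auto. }
assert (tb := @th_bot); assert (tt := @th_top).
assert (TH : hcod (FH V (hval h)) = hdom (cmp (lmu W))) by (rewrite FH_cod, ch, dm; auto).
change (((vidS (FH V (hval g)) ∥ ((vidS (FH V (FH V (hval h))) ∥ vidS (FH V (cmp (lmu W)))) ÷ F2c V (FH V (hval h)) (cmp (lmu W))))
   ÷ F2c V (hval g) (hcomp (FH V (hval h)) (cmp (lmu W))))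
   ÷ (th (hcomp (hval g) (hcomp (FH V (hval h)) (cmp (lmu W)))) ÷ (π2 ∥ ((th (hval h) ÷ π3) ∥ (eM W ÷ hidS r))))
  = (th (hval g) ÷ π2) ∥ ((th (FH V (hval h)) ÷ (th (hval h) ÷ π3)) ∥ (iT (V W) (eM W) ÷ hidS (μ W ∙ r)))).
rewrite <- K3.
rewrite <- (vidS_h (f := FH V (FH V (hval h)))), v1 by (rewrite ?F2c_top, ?FH_dom, ?FH_cod; congruence).
assert (c1 : hcod (hval g) = hdom (hcomp (FH V (hval h)) (cmp (lmu W)))) by (rewrite hdom_comp, FH_dom; congruence).
assert (TG : hcod (FH V (hval g)) = hdom (hcomp (FH V (FH V (hval h))) (FH V (cmp (lmu W)))))
  by (rewrite hdom_comp by (rewrite FH_dom, FH_cod; congruence); rewrite !FH_dom, FH_cod; congruence).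
assert (l1 : rgt (th (FH V (hval h))) = lft (th (cmp (lmu W)))) by (rewrite th_rgt, th_lft; congruence).
assert (l2 : rgt (th (hval g)) = lft (th (FH V (hval h)) ∥ th (cmp (lmu W))))
  by (rewrite lft_hcomp, th_rgt, th_lft, FH_dom; congruence).
set (R := π2 ∥ _).
assert (y : top (eM W ÷ hidS r) = cmp (lmu W)) by apply (fr_top frame_mu_W).
assert (k1 : rgt (th (hval h) ÷ π3) = lft (eM W ÷ hidS r)) by (rewrite (fr_rgt frame_Th), (fr_lft frame_mu_W); auto).
assert (k2 : rgt π2 = lft ((th (hval h) ÷ π3) ∥ (eM W ÷ hidS r))) by (rewrite lft_hcomp, (fr_lft frame_Th), lg; auto).
assert (Rt : top R = hcomp (hval g) (hcomp (FH V (hval h)) (cmp (lmu W)))).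
{ unfold R; rewrite !top_hcomp, y, top_vcomp, th_top; auto; [congruence|rewrite th_bot; auto]. }
assert (o1 : bot (th (hval h)) = top π3) by (rewrite th_bot; auto).
assert (o2 : top (th (hval h) ÷ π3) = FH V (hval h)) by (rewrite top_vcomp, th_top; auto).
rewrite <- (exch (s1 := th (FH V (hval h)))); rewrite ?th_bot; auto.
rewrite <- (exch (s1 := th (hval g))); rewrite ?bot_hcomp, ?top_hcomp, ?th_bot, ?o2, ?y; auto.
fold R.
rewrite <- (th_comp ieta TH), <- (v1 (s := th (hval g)) (th_top ieta (hval g))).
assert (l3 : rgt (vidS (FH V (hval g))) = lft (F2c V (FH V (hval h)) (cmp (lmu W))))
  by (rewrite F2c_lft, rgt_vid, FH_cod, FH_dom; congruence).
rewrite <- exch; auto.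
- rewrite <- (th_comp ieta c1).
  assert (B : bot (vidS (FH V (hval g)) ∥ F2c V (FH V (hval h)) (cmp (lmu W))) =
     top (F2c V (hval g) (hcomp (FH V (hval h)) (cmp (lmu W)))))
    by (rewrite bot_hcomp, bot_vid, F2c_bot, F2c_top; auto).
  rewrite <- !vA; auto; rewrite ?top_hcomp, ?bot_hcomp, ?top_vcomp, ?bot_vcomp, ?F2c_top, ?F2c_bot, ?tt, ?tb, ?bot_vid, ?Rt; auto.
- rewrite th_rgt, th_lft; congruence.
- rewrite bot_vid, tt; auto.
- rewrite F2c_bot, tt; auto.
Qed.

Local Notation π4 := (th (hval gh) ÷ ρ).
Local Notation m1 := (@Hmu1 D V lmu).
Lemma frame_Tgh : frH1 (T # gh) (ei Y ∙ b) (μ W ∙ r) (th (hval gh) ÷ ρ).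
Proof. exact (frame_T (fr_HD rho_fr)). Qed.

(** The structural cells of the Kleisli bicategory are pastings in [Horiz D]. Reading a Kleisli
    composite frame along the three-step path there lets these pastings be evaluated with the
    framing of [Horiz D]. *)
Lemma kleisli_comp (A B C : dob D) (k : hcell A (V B)) (k' : hcell B (V C)) x y z σ σ' :
  fr ψ (X := A) (Y := B) k x y σ -> fr ψ (X := B) (Y := C) k' y z σ' ->
  fc ψ (X := A) (Y := B) (Z := C) k k' σ σ' = ev (φ := φ1) ⟪k : @hom HD A (V B); T # (k' : @hom HD B (V C)); m1 C⟫ [σ; th (hval k') ÷ σ'; eM C ÷ hidS (ei C ∙ z)] (ei C ∙ z).
Proof.
intros q q'; cbn; f_equal.
rewrite (kap_act ieta lmu (fr_top q')), (fr_rgt q'); auto; [apply hval_cod|].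
rewrite (fr_rgt q'); apply (rgt_dom q').
Qed.

Lemma assoc_mu_nat :
  cs φ1 (bwd (Hmu imu lmu _ _ h)) ÷ ev (φ := φ1) ⟪T # T # (h : @hom HD Z (V W)); m1 (V W)⟫
     [th (FH V (hval h)) ÷ (th (hval h) ÷ π3); eM (V W) ÷ hidS (μ W ∙ r)] (μ W ∙ r)
  = ev (φ := φ1) ⟪m1 Z; T # (h : @hom HD Z (V W))⟫ [eM Z ÷ hidS (ei Z ∙ c); th (hval h) ÷ π3] (μ W ∙ r).
Proof.
assert (fv : frH1 (h : @hom HD Z (V W)) (vid Z) (vid (V W)) (vidS (hval h))).
{ apply frH; rewrite ?lft_vid, ?rgt_vid, ?hval_dom, ?hval_cod, ?top_vid; auto. }
assert (o : bot (th (hval h)) = top π3) by (rewrite th_bot; symmetry; apply (fr_top frame_h)).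
assert (tt : top (th (hval h) ÷ π3) = FH V (bot (vidS (hval h)))) by (rewrite top_vcomp, th_top, bot_vid; auto).
(* Naturality of the lifted [μ] at the identity frame of [h], continued by [th] above [π3]. By
   [th_mu] the square of [μ] at [h] is [th] at [T h], so the frame of [T T h] appears. *)
assert (e := fn_eq_post' ax1 ax1 (mu_fn imu lmu) fv tt).
rewrite bot_vid in e, tt.
assert (k1 : FV V (vid (V W)) ∙ rgt (th (hval h) ÷ π3) = μ W ∙ r).
{ rewrite (fr_rgt frame_Th). rewrite FV_id. cbn; apply u1, mu_r_bdry. }
assert (k2 : FV V (vid Z) ∙ lft (th (hval h) ÷ π3) = ei Z ∙ c).
{ rewrite (fr_lft frame_Th), FV_id; apply u1, (fr_left ax1 frame_Th). }
assert (k3 : FS V (vidS (hval h)) ÷ (th (hval h) ÷ π3) = th (hval h) ÷ π3).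
{ rewrite (FS_vid (dT_ax V)); apply v1, tt. }
assert (k4 : FS V (FS V (vidS (hval h))) ÷ va_h μ (hval h) ÷ (th (hval h) ÷ π3) = th (FH V (hval h)) ÷ (th (hval h) ÷ π3)).
{ rewrite !(FS_vid (dT_ax V)), v1 by apply (va_top μ). rewrite (th_mu ieta (hval h)); auto. }
refine (eq_trans (f_equal (fun z => _ ÷ z) (f_equal2 (@hcompS D) (eq_sym k4) (f_equal (fun z => _ ÷ hidS z) (eq_sym k1)))) (eq_trans e (f_equal2 (@hcompS D) (f_equal (fun z => _ ÷ hidS z) k2) k3))).
Qed.

Lemma assoc_mm :
  cs φ1 (bwd (Hmm lmu W)) ÷ ev (φ := φ1) ⟪T # m1 W; m1 W⟫ [iT (V W) (eM W) ÷ hidS (μ W ∙ r); eM W ÷ hidS r] r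
  = ev (φ := φ1) ⟪m1 (V W); m1 W⟫ [eM (V W) ÷ hidS (μ W ∙ r); eM W ÷ hidS r] r.
Proof.
destruct (can_mm imu lmu W) as [i k].
assert (o : okc (φ := φ1) ⟪T # m1 W; m1 W⟫ [iT (V W) (eM W); eM W]).
{ split; [apply (cf_T V (cf_M imu lmu W))|split; [apply (cf_M imu lmu W)|reflexivity]]. }
assert (o' : okc (φ := φ1) ⟪m1 (V W); m1 W⟫ [eM (V W); eM W]).
{ split; [apply (cf_M imu lmu)|split; [apply (cf_M imu lmu W)|reflexivity]]. }
assert (e := can_stair ax1 (can_inv ax1 i o k) o' (proj1 (rgt_dom h3))).
cbn [stair tot] in e. rewrite (eps_lft (lmu W) : lft (eM W) = μ W) in e; exact e.
Qed.

Lemma assoc_unfold :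
  cs φ1 (unfold ⟪f : @hom HD X (V Y); T # (g : @hom HD Y (V Z)); m1 Z⟫)
    ÷ ev (φ := φ1) ⟪f : @hom HD X (V Y); T # (g : @hom HD Y (V Z)); m1 Z⟫ [π1; th (hval g) ÷ π2; eM Z ÷ hidS (ei Z ∙ c)] (ei Z ∙ c)
  = ev (φ := φ1) ⟪fg⟫ [fc ψ (X := X) (Y := Y) (Z := Z) f g π1 π2] (ei Z ∙ c).
Proof.
rewrite (kleisli_comp h1 h2). apply (act_id ax1 (ev_fr ax1 (okf3 frame_f frame_Tg frame_mu_Z))).
Qed.

Lemma frame_fg : frH1 fg a (ei Z ∙ c) (fc ψ (X := X) (Y := Y) (Z := Z) f g π1 π2).
Proof. rewrite (kleisli_comp h1 h2). exact (ev_fr ax1 (okf3 frame_f frame_Tg frame_mu_Z)). Qed.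
Lemma fg_fr : fr ψ (X := X) (Y := Z) fg a c (fc ψ (X := X) (Y := Y) (Z := Z) f g π1 π2).
Proof. destruct frame_fg; split; auto; apply h2. Qed.

(** The four cells of the Kleisli associator in the order in which they act on the target frame;
    each changes only its own segment of the path. *)
Lemma assoc_steps :
  (cs φ1 (⟪f : @hom HD X (V Y)⟫ ◁ ffold T ⟪g : @hom HD Y (V Z); T # (h : @hom HD Z (V W)); m1 W⟫ ▷ ⟪m1 W⟫)
    ÷ ev (φ := φ1) ⟪f : @hom HD X (V Y); T # gh; m1 W⟫ [π1; π4; eM W ÷ hidS r] r
  = ev (φ := φ1) ⟪f : @hom HD X (V Y); T # (g : @hom HD Y (V Z)); T # T # (h : @hom HD Z (V W)); T # m1 W; m1 W⟫
      [π1; th (hval g) ÷ π2; th (FH V (hval h)) ÷ (th (hval h) ÷ π3); iT (V W) (eM W) ÷ hidS (μ W ∙ r); eM W ÷ hidS r] r /\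
  cs φ1 (⟪f : @hom HD X (V Y); T # (g : @hom HD Y (V Z)); T # T # (h : @hom HD Z (V W))⟫ ◁ bwd (Hmm lmu W) ▷ ⟪⟫)
    ÷ ev (φ := φ1) ⟪f : @hom HD X (V Y); T # (g : @hom HD Y (V Z)); T # T # (h : @hom HD Z (V W)); T # m1 W; m1 W⟫
      [π1; th (hval g) ÷ π2; th (FH V (hval h)) ÷ (th (hval h) ÷ π3); iT (V W) (eM W) ÷ hidS (μ W ∙ r); eM W ÷ hidS r] r
  = ev (φ := φ1) ⟪f : @hom HD X (V Y); T # (g : @hom HD Y (V Z)); T # T # (h : @hom HD Z (V W)); m1 (V W); m1 W⟫
      [π1; th (hval g) ÷ π2; th (FH V (hval h)) ÷ (th (hval h) ÷ π3); eM (V W) ÷ hidS (μ W ∙ r); eM W ÷ hidS r] r) /\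
  (cs φ1 (⟪f : @hom HD X (V Y); T # (g : @hom HD Y (V Z))⟫ ◁ bwd (Hmu imu lmu _ _ h) ▷ ⟪m1 W⟫)
    ÷ ev (φ := φ1) ⟪f : @hom HD X (V Y); T # (g : @hom HD Y (V Z)); T # T # (h : @hom HD Z (V W)); m1 (V W); m1 W⟫
      [π1; th (hval g) ÷ π2; th (FH V (hval h)) ÷ (th (hval h) ÷ π3); eM (V W) ÷ hidS (μ W ∙ r); eM W ÷ hidS r] r
  = ev (φ := φ1) ⟪f : @hom HD X (V Y); T # (g : @hom HD Y (V Z)); m1 Z; T # (h : @hom HD Z (V W)); m1 W⟫
      [π1; th (hval g) ÷ π2; eM Z ÷ hidS (ei Z ∙ c); th (hval h) ÷ π3; eM W ÷ hidS r] r /\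
  cs φ1 (⟪⟫ ◁ unfold ⟪f : @hom HD X (V Y); T # (g : @hom HD Y (V Z)); m1 Z⟫ ▷ ⟪T # (h : @hom HD Z (V W)); m1 W⟫)
    ÷ ev (φ := φ1) ⟪f : @hom HD X (V Y); T # (g : @hom HD Y (V Z)); m1 Z; T # (h : @hom HD Z (V W)); m1 W⟫
      [π1; th (hval g) ÷ π2; eM Z ÷ hidS (ei Z ∙ c); th (hval h) ÷ π3; eM W ÷ hidS r] r
  = ev (φ := φ1) ⟪fg; T # (h : @hom HD Z (V W)); m1 W⟫ [fc ψ (X := X) (Y := Y) (Z := Z) f g π1 π2; th (hval h) ÷ π3; eM W ÷ hidS r] r).
Proof.
repeat split.
- exact (act_ctx ax1 (p := ⟪f : @hom HD X (V Y)⟫) (l := [_]) (k := [_; _; _]) (k' := [_]) (t := [_])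
  (okf1 frame_f) (okf3 frame_Tg frame_TTh frame_Tmu) (okf1 frame_Tgh) (okf1 frame_mu_W) ffold_th).
- exact (actr ax1 (p := ⟪f : @hom HD X (V Y); T # (g : @hom HD Y (V Z)); T # T # (h : @hom HD Z (V W))⟫) (l := [_; _; _]) (k := [_; _]) (k' := [_; _])
  (okf3 frame_f frame_Tg frame_TTh) (okf2 frame_mu_TW frame_mu_W) (okf2 frame_Tmu frame_mu_W) assoc_mm).
- exact (act_ctx ax1 (p := ⟪f : @hom HD X (V Y); T # (g : @hom HD Y (V Z))⟫) (l := [_; _]) (k := [_; _]) (k' := [_; _]) (t := [_])
  (okf2 frame_f frame_Tg) (okf2 frame_mu_Z frame_Th) (okf2 frame_TTh frame_mu_TW) (okf1 frame_mu_W) assoc_mu_nat).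
- exact (actl ax1 (r := ⟪T # (h : @hom HD Z (V W)); m1 W⟫) (k := [_]) (k' := [_; _; _]) (t := [_; _])
  (okf1 frame_fg) (okf3 frame_f frame_Tg frame_mu_Z) (okf2 frame_Th frame_mu_W) assoc_unfold).
Qed.

Lemma kleisli_assoc :
  cs ψ (@assoc K X Y Z W f g h) ÷ fc ψ (X := X) (Y := Y) (Z := W) f gh π1 (fc ψ (X := Y) (Y := Z) (Z := W) g h π2 π3)
  = fc ψ (X := X) (Y := Z) (Z := W) fg h (fc ψ (X := X) (Y := Y) (Z := Z) f g π1 π2) π3.
Proof.
change (fc ψ (X := Y) (Y := Z) (Z := W) g h π2 π3) with ρ.
rewrite (kleisli_comp h1 rho_fr), (kleisli_comp (k := fg) fg_fr h3).
destruct assoc_steps as [[s1 s2] [s3 s4]].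
refine (act2c ax1 (ev_fr ax1 (okf3 frame_f frame_Tgh frame_mu_W)) s1 _).
refine (act2c ax1 (ev_fr ax1 (okf_cons frame_f (okf_cons frame_Tg (okf3 frame_TTh frame_Tmu frame_mu_W)))) s2 _).
exact (act2c ax1 (ev_fr ax1 (okf_cons frame_f (okf_cons frame_Tg (okf3 frame_TTh frame_mu_TW frame_mu_W)))) s3 s4).
Qed.

(** The inverse associator is the reversed pasting of inverse cells, so [act_inv] turns the local
    actions of the associator into those needed here. *)
Lemma kleisli_assoc' :
  cs ψ (@assoc' K X Y Z W f g h) ÷ fc ψ (X := X) (Y := Z) (Z := W) fg h (fc ψ (X := X) (Y := Y) (Z := Z) f g π1 π2) π3
  = fc ψ (X := X) (Y := Y) (Z := W) f gh π1 (fc ψ (X := Y) (Y := Z) (Z := W) g h π2 π3).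
Proof.
change (fc ψ (X := Y) (Y := Z) (Z := W) g h π2 π3) with ρ.
rewrite (kleisli_comp h1 rho_fr), (kleisli_comp (k := fg) fg_fr h3).
assert (s1 := act_inv ax1 frame_Tgh (proj2 (ffold_inv (framed_bicat ax1) (framed_psfun ax1 ax1 (V_ff V)) ⟪g : @hom HD Y (V Z); T # (h : @hom HD Z (V W)); m1 W⟫)) ffold_th).
assert (s2 := act_inv ax1 (ev_fr ax1 (okf2 frame_Tmu frame_mu_W)) (proj1 (proj1 (can_mm imu lmu W))) assoc_mm).
assert (s3 := act_inv ax1 (ev_fr ax1 (okf2 frame_TTh frame_mu_TW)) (proj1 (fn_iso (mu_fn imu lmu) (X := Z) (Y := V W) h)) assoc_mu_nat).
assert (s4 := act_inv ax1 (d := fold ⟪f : @hom HD X (V Y); T # (g : @hom HD Y (V Z)); m1 Z⟫) (ev_fr ax1 (okf3 frame_f frame_Tg frame_mu_Z)) (bi_lid (framed_bicat ax1) (id2 _)) assoc_unfold).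
refine (act2c ax1 (ev_fr ax1 (okf3 frame_fg frame_Th frame_mu_W)) (actl ax1 (r := ⟪T # (h : @hom HD Z (V W)); m1 W⟫) (k' := [_]) (k := [_; _; _]) (t := [_; _])
  (okf3 frame_f frame_Tg frame_mu_Z) (okf1 frame_fg) (okf2 frame_Th frame_mu_W) s4) _).
refine (act2c ax1 (ev_fr ax1 (okf_cons frame_f (okf_cons frame_Tg (okf3 frame_mu_Z frame_Th frame_mu_W)))) (act_ctx ax1 (p := ⟪f : @hom HD X (V Y); T # (g : @hom HD Y (V Z))⟫) (l := [_; _]) (k := [_; _]) (k' := [_; _]) (t := [_])
  (okf2 frame_f frame_Tg) (okf2 frame_TTh frame_mu_TW) (okf2 frame_mu_Z frame_Th) (okf1 frame_mu_W) s3) _).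
refine (act2c ax1 (ev_fr ax1 (okf_cons frame_f (okf_cons frame_Tg (okf3 frame_TTh frame_mu_TW frame_mu_W)))) (actr ax1 (p := ⟪f : @hom HD X (V Y); T # (g : @hom HD Y (V Z)); T # T # (h : @hom HD Z (V W))⟫) (l := [_; _; _]) (k := [_; _]) (k' := [_; _])
  (okf3 frame_f frame_Tg frame_TTh) (okf2 frame_Tmu frame_mu_W) (okf2 frame_mu_TW frame_mu_W) s2) _).
exact (act_ctx ax1 (p := ⟪f : @hom HD X (V Y)⟫) (l := [_]) (k' := [_; _; _]) (k := [_]) (t := [_])
  (okf1 frame_f) (okf1 frame_Tgh) (okf3 frame_Tg frame_TTh frame_Tmu) (okf1 frame_mu_W) s1).
Qed.
End KleisliAssoc.

(** * Unit laws in the Kleisli bicategory *)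

Section KleisliUnit.
Context (D : double_category) (V : vertical_monad D).
Context (imu : invertible (dmu V)) (ieta : invertible (deta V)).
Context (lmu : liftable (dmu V)) (leta : liftable (deta V)).
Local Notation HD := (Horiz D).
Local Notation φ1 := (horizfr D).
Local Notation ax1 := (ax1 D).
Local Notation HT := (Hmonad imu ieta lmu leta).
Local Notation K := (kleisli HT).
Local Notation η := (deta V).
Local Notation μ := (dmu V).
Local Notation eM := (eM lmu).
Local Notation eE := (eE leta).
Local Notation iT := (iT V).
Local Notation ei := (ei ieta).
Local Notation th := (th ieta).
Local Notation ψ := (kleislifr imu ieta lmu leta).
Local Notation T := (Hfun V).
Local Notation m1 := (@Hmu1 D V lmu).
Local Notation n1 := (@Heta1 D V leta).
Local Notation frH1 := (fr φ1).

Lemma cfE_fr (Z : HD) a : vdom a = V Z -> frH1 (n1 Z) (η Z ∙ a) a (eE Z ÷ hidS a).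
Proof.
intros d; assert (q := cf_post ax1 (cf_E ieta leta Z) (a := a) d).
rewrite (eps_lft (leta Z) : lft (eE Z) = η Z) in q; exact q.
Qed.
Lemma cfM_fr (Z : HD) a : vdom a = V Z -> frH1 (m1 Z) (μ Z ∙ a) a (eM Z ÷ hidS a).
Proof.
intros d; assert (q := cf_post ax1 (cf_M imu lmu Z) (a := a) d).
rewrite (eps_lft (lmu Z) : lft (eM Z) = μ Z) in q; exact q.
Qed.

Lemma fu_K (X : K) a : vdom a = fo ψ X -> fr ψ (id1 X) a a (fu ψ X a).
Proof.
intros d; cbn in d.
assert (e : vdom (ei X ∙ a) = V X) by (rewrite vdom_comp, ei_dom; auto; rewrite ei_cod; auto).
destruct (cfE_fr e) as [k1 k2 k3 k4]; split; auto.
refine (eq_trans k2 _); rewrite <- uA, ei_l by (rewrite ?va_cod, ?ei_dom, ?ei_cod; auto).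
apply u1; auto.
Qed.

Context (X Y : dob D) (f : hcell X (V Y)) (a b : dv D) (π : dsq D).
Context (h : fr ψ (X := X) (Y := Y) f a b π).
Local Notation r := (ei Y ∙ b).

Lemma lun_eta :
  cs φ1 (bwd (Heta ieta leta _ _ f)) ÷ ev (φ := φ1) ⟪f : @hom HD X (V Y); n1 (V Y)⟫ [π; eE (V Y) ÷ hidS (μ Y ∙ r)] (μ Y ∙ r)
  = ev (φ := φ1) ⟪n1 X; T # (f : @hom HD X (V Y))⟫ [eE X ÷ hidS (ei X ∙ a); th (hval f) ÷ π] (μ Y ∙ r).
Proof.
assert (x := fr_HD h). assert (w := frame_T ieta x).
assert (fv : frH1 (f : @hom HD X (V Y)) (vid X) (vid (V Y)) (vidS (hval f))).
{ apply frH; rewrite ?lft_vid, ?rgt_vid, ?hval_dom, ?hval_cod, ?top_vid; auto. }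
assert (tt : top (th (hval f) ÷ π) = FH V (bot (vidS (hval f)))) by (rewrite bot_vid; apply (fr_top w)).
assert (e := fn_eq_post' ax1 ax1 (eta_fn ieta leta) fv tt).
rewrite bot_vid in e, tt.
assert (k1 : FV V (vid (V Y)) ∙ rgt (th (hval f) ÷ π) = μ Y ∙ r).
{ rewrite (fr_rgt w). rewrite FV_id. cbn; apply u1. apply (fr_dom w). }
assert (k2 : FV V (vid X) ∙ lft (th (hval f) ÷ π) = ei X ∙ a).
{ rewrite (fr_lft w), FV_id; apply u1, (fr_left ax1 w). }
assert (k3 : FS V (vidS (hval f)) ÷ (th (hval f) ÷ π) = th (hval f) ÷ π).
{ rewrite (FS_vid (dT_ax V)); apply v1, tt. }
(* Here [η_f] followed by its inverse [th] cancels, and the frame of [f] itself is left. *)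
assert (k4 : vidS (hval f) ÷ va_h η (hval f) ÷ (th (hval f) ÷ π) = π).
{ rewrite v1 by apply (va_top η). rewrite <- vA, th_l, v1; auto.
  - apply x.
  - rewrite th_top; apply (va_bot η).
  - rewrite th_bot; symmetry; apply x. }
refine (eq_trans (f_equal (fun z => _ ÷ z) (f_equal2 (@hcompS D) (eq_sym k4) (f_equal (fun z => _ ÷ hidS z) (eq_sym k1)))) (eq_trans e (f_equal2 (@hcompS D) (f_equal (fun z => _ ÷ hidS z) k2) k3))).
Qed.

Lemma lun_ml : cs φ1 (fwd (Hml lmu leta Y)) ÷ ev (φ := φ1) (@pnil HD (V Y)) [] r
  = ev (φ := φ1) ⟪n1 (V Y); m1 Y⟫ [eE (V Y) ÷ hidS (μ Y ∙ r); eM Y ÷ hidS r] r.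
Proof.
destruct (can_ml imu ieta lmu leta Y) as [i k].
assert (o : okc (φ := φ1) ⟪n1 (V Y); m1 Y⟫ [eE (V Y); eM Y]).
{ split; [apply (cf_E ieta leta)|split; [apply (cf_M imu lmu Y)|reflexivity]]. }
assert (e := can_stair ax1 k o (proj1 (rgt_dom h))).
cbn [stair tot] in e. rewrite (eps_lft (lmu Y) : lft (eM Y) = μ Y) in e; exact e.
Qed.

Lemma run_mr : cs φ1 (fwd (Hmr lmu leta Y)) ÷ ev (φ := φ1) (@pnil HD (V Y)) [] r
  = ev (φ := φ1) ⟪T # n1 Y; m1 Y⟫ [th (cmp (leta Y)) ÷ (eE Y ÷ hidS r); eM Y ÷ hidS r] r.
Proof.
destruct (can_mr imu ieta lmu leta Y) as [i k].
assert (o : okc (φ := φ1) ⟪T # n1 Y; m1 Y⟫ [iT (V Y) (eE Y); eM Y]).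
{ split; [apply (cf_T V (cf_E ieta leta Y))|split; [apply (cf_M imu lmu Y)|reflexivity]]. }
assert (e := can_stair ax1 k o (proj1 (rgt_dom h))).
cbn [stair tot] in e. rewrite (eps_lft (lmu Y) : lft (eM Y) = μ Y) in e.
(* The image frame produced by [can_mr] is exchanged for [th] above the companion square of [η], the
   frame that occurs in the Kleisli composite. *)
rewrite <- (cf_post2 (cf_T V (cf_E ieta leta Y)) (a := μ Y) (b := r)) in e.
2:{ apply (va_dom μ). } 2:{ rewrite (va_cod μ); symmetry; apply (rgt_dom h). }
replace (hidS (μ Y)) with (hidS (ei (V Y))) in e by (rewrite (ei_mu ieta Y); auto).
rewrite <- (th_cf ieta (cf_E ieta leta Y)), vA in e; [exact e| |].
- rewrite th_bot; symmetry; apply eps_top.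
- rewrite (cf_bot (cf_E ieta leta Y)), top_hid; cbn; f_equal; symmetry; apply (rgt_dom h).
Qed.

Lemma frame_eta_T : frH1 (n1 (V Y)) r (μ Y ∙ r) (eE (V Y) ÷ hidS (μ Y ∙ r)).
Proof.
assert (w := frame_T ieta (fr_HD h)). assert (q := cfE_fr (fr_dom w)).
destruct q as [k1 k2 k3 k4]; split; auto; rewrite k2.
assert (d := va_dom μ Y); assert (d' := va_cod μ Y); assert (d2 := va_cod η (V Y)); cbn in d, d', d2.
assert (dr := proj1 (rgt_dom h)). set (r0 := r) in *; clearbody r0.
rewrite <- uA by congruence. refine (eq_trans (f_equal (fun z => z ∙ r0) (dmu_l V Y)) _). apply u1; auto.
Qed.
Lemma frame_T_eta : frH1 (T # n1 Y) r (μ Y ∙ r) (th (cmp (leta Y)) ÷ (eE Y ÷ hidS r)).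
Proof.
assert (q := frame_T ieta (fr_HD (fu_K (X := Y) (a := b) (fr_dom h)))). cbn in q.
exact q.
Qed.
Lemma frame_mu : frH1 (m1 Y) (μ Y ∙ r) r (eM Y ÷ hidS r).
Proof. apply cfM_fr, (rgt_dom h). Qed.

Lemma frame_eta : frH1 (n1 X) a (ei X ∙ a) (eE X ÷ hidS (ei X ∙ a)).
Proof. exact (fr_HD (fu_K (fr_left ax1 (fr_HD h)))). Qed.

Lemma kleisli_lun : cs ψ (@lun K X Y f) ÷ π = fc ψ (X := X) (Y := X) (Z := Y) (@id1 K X) f (fu ψ X a) π.
Proof.
assert (x := fr_HD h).
refine (eq_trans _ (eq_sym (kleisli_comp (fu_K (X := X) (fr_left ax1 x)) h))).
refine (act2c ax1 (ev_fr ax1 (okf1 x)) (actr ax1 (p := ⟪f : @hom HD X (V Y)⟫) (l := [_]) (k := [_; _]) (k' := [])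
  (okf1 x) (okf2 frame_eta_T frame_mu) _ lun_ml) _).
- repeat split; apply (rgt_dom h).
- exact (actl ax1 (r := ⟪m1 Y⟫) (k := [_; _]) (k' := [_; _]) (t := [_])
  (okf2 frame_eta (frame_T ieta x)) (okf2 x frame_eta_T) (okf1 frame_mu) lun_eta).
Qed.

Lemma kleisli_lun' : cs ψ (@lun' K X Y f) ÷ fc ψ (X := X) (Y := X) (Z := Y) (@id1 K X) f (fu ψ X a) π = π.
Proof.
assert (x := fr_HD h).
assert (s1 := act_inv ax1 (ev_fr ax1 (okf2 x frame_eta_T)) (proj1 (fn_iso (eta_fn ieta leta) (X := X) (Y := V Y) f)) lun_eta).
assert (o : okf (φ := φ1) (@pnil HD (V Y)) [] r r) by (repeat split; apply (rgt_dom h)).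
assert (s2 := act_inv ax1 (ev_fr ax1 o) (proj2 (proj1 (can_ml imu ieta lmu leta Y))) lun_ml).
refine (eq_trans (f_equal (fun z => _ ÷ z) (kleisli_comp (fu_K (X := X) (fr_left ax1 x)) h)) _).
refine (act2c ax1 (ev_fr ax1 (okf3 frame_eta (frame_T ieta x) frame_mu)) (actl ax1 (r := ⟪m1 Y⟫) (k := [_; _]) (k' := [_; _]) (t := [_])
  (okf2 x frame_eta_T) (okf2 frame_eta (frame_T ieta x)) (okf1 frame_mu) s1) _).
exact (actr ax1 (p := ⟪f : @hom HD X (V Y)⟫) (l := [_]) (k' := [_; _]) (k := []) (okf1 x) o (okf2 frame_eta_T frame_mu) s2).
Qed.

Lemma kleisli_run : cs ψ (@run K X Y f) ÷ π = fc ψ (X := X) (Y := Y) (Z := Y) f (@id1 K Y) π (fu ψ Y b).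
Proof.
assert (x := fr_HD h).
refine (eq_trans _ (eq_sym (kleisli_comp h (fu_K (X := Y) (fr_dom h))))).
refine (actr ax1 (p := ⟪f : @hom HD X (V Y)⟫) (l := [_]) (k := [_; _]) (k' := [])
  (okf1 x) (okf2 frame_T_eta frame_mu) _ run_mr).
repeat split; apply (rgt_dom h).
Qed.

Lemma kleisli_run' : cs ψ (@run' K X Y f) ÷ fc ψ (X := X) (Y := Y) (Z := Y) f (@id1 K Y) π (fu ψ Y b) = π.
Proof.
assert (x := fr_HD h).
assert (o : okf (φ := φ1) (@pnil HD (V Y)) [] r r) by (repeat split; apply (rgt_dom h)).
assert (s2 := act_inv ax1 (ev_fr ax1 o) (proj2 (proj1 (can_mr imu ieta lmu leta Y))) run_mr).
refine (eq_trans (f_equal (fun z => _ ÷ z) (kleisli_comp h (fu_K (X := Y) (fr_dom h)))) _).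
exact (actr ax1 (p := ⟪f : @hom HD X (V Y)⟫) (l := [_]) (k' := [_; _]) (k := []) (okf1 x) o (okf2 frame_T_eta frame_mu) s2).
Qed.
End KleisliUnit.

(** * The Kleisli bicategory as a framed bicategory *)

Section KleisliFramed.
Context (D : double_category) (V : vertical_monad D).
Context (imu : invertible (dmu V)) (ieta : invertible (deta V)).
Context (lmu : liftable (dmu V)) (leta : liftable (deta V)).
Local Notation ax1 := (ax1 D).
Local Notation η := (deta V).
Local Notation μ := (dmu V).
Local Notation ei := (ei ieta).
Local Notation ψ := (kleislifr imu ieta lmu leta).
Local Notation kap := (kap ieta lmu).
Local Notation eM := (eM lmu).

(** Naturality of [th] turns [T y] above into [y] below, and the identity right side of [y] leaves
    the companion of [μ] untouched. This makes frames compatible with horizontal composition of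
    2-cells. *)
Lemma kap_nat (Z : dob D) (y : dsq D) : rgt y = vid (V Z) ->
  (FS V y ∥ vidS (cmp (lmu Z))) ÷ kap Z (bot y) = kap Z (top y) ÷ y.
Proof.
intros e.
assert (c : hcod (bot y) = V Z) by (rewrite cod_bot, e, vcod_id; auto).
assert (c' : hcod (top y) = V Z) by (rewrite cod_top, e, vdom_id; auto).
assert (l : rgt (Submission.th ieta (bot y)) = lft (eM Z)) by (rewrite th_rgt, c, ei_mu; symmetry; apply eps_lft).
rewrite (kap_act ieta lmu (g := top y)); auto; [|rewrite e, vdom_id; auto].
unfold Submission.kap. rewrite exch, th_nat; auto.
- f_equal. rewrite v1 by apply eps_top. rewrite e; symmetry; apply (cf_post_id (cf_M imu lmu Z)).
- rewrite FS_rgt, e, FV_id, lft_vid; f_equal. rewrite cmp_dom; symmetry; apply (va_dom μ).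
- rewrite FS_bot, th_top; auto.
- rewrite bot_vid; symmetry; apply eps_top.
Qed.

(** A frame in the Kleisli bicategory turns the left side [η^n] into the right
    side [e / η^(n+1)], so the good vertical cells are the iterates of [η]. *)
Fixpoint eta_chain n (X : dob D) : dv D :=
  match n with 0 => vid X | Datatypes.S n' => η X ∙ eta_chain n' (V X) end.
Fixpoint eta_chain_sq n (f : dh D) : dsq D :=
  match n with 0 => vidS f | Datatypes.S n' => va_h η f ÷ eta_chain_sq n' (FH V f) end.

Lemma eta_chain_ax n : forall X, vdom (eta_chain n X) = X /\ viso (eta_chain n X).
Proof.
induction n as [|n IH]; intros X; cbn.
- split; [apply vdom_id|apply viso_id].
- destruct (IH (V X)) as [h1 h2]. assert (e : vcod (η X) = vdom (eta_chain n (V X))) by (rewrite h1; apply va_cod).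
  rewrite vdom_comp; auto. split; [apply va_dom|apply viso_comp; auto; apply (eta_iso ieta)].
Qed.
Lemma eta_chain_sq_ax n : forall f, top (eta_chain_sq n f) = f /\ lft (eta_chain_sq n f) = eta_chain n (hdom f) /\
  rgt (eta_chain_sq n f) = eta_chain n (hcod f) /\ visoS (eta_chain_sq n f).
Proof.
induction n as [|n IH]; intros f; cbn.
- rewrite top_vid, lft_vid, rgt_vid; repeat split; apply visoS_id.
- destruct (IH (FH V f)) as (h1 & h2 & h3 & h4). assert (e : bot (va_h η f) = top (eta_chain_sq n (FH V f))) by (rewrite h1; apply va_bot).
  rewrite top_vcomp, lft_vcomp, rgt_vcomp, h2, h3, va_lft, va_rgt, FH_dom, FH_cod; auto.
  repeat split; [apply va_top|]. apply visoS_comp; auto. apply (visoS_vi (ieta f)).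
Qed.
Lemma good_eq X a : good ψ X a <-> exists n, a = eta_chain n X.
Proof.
assert (E : forall n X, eta_chain n X = nat_rect (fun _ => dob D -> dv D) (fun X => vid X) (fun _ e X => η X ∙ e (V X)) n X).
{ induction n as [|n IH]; intros Z; cbn; auto. rewrite IH; auto. }
split; intros [n ->]; exists n; rewrite E; auto.
Qed.

Lemma kleisli_framing : is_framing ψ.
Proof.
split.
- intros X Y f; apply hval_dom.
- intros X Y f b e; cbn in *. rewrite hval_cod, vdom_comp, ei_dom; auto. rewrite ei_cod; auto.
- intros Y b e; cbn in *. apply vcod_comp; rewrite ei_cod; auto.
- intros Y b v e e'; cbn in *. apply uA; rewrite ?ei_cod; auto.
- intros Y b e i; cbn in *. apply viso_comp; auto; [rewrite ei_cod; auto|apply ei_iso].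
- intros X Y f g c; apply s_top.
- intros X Y f g c; apply s_bot.
- intros X Y f g c; exact (cs_lft ax1 (X := X) (Y := V Y) (f := f) (g := g) c).
- intros X Y f g c; exact (cs_rgt ax1 (X := X) (Y := V Y) (f := f) (g := g) c).
- intros X Y f g h c d; reflexivity.
- intros X Y f; reflexivity.
- intros X Y f g c d; exact (@cs_inj _ _ _ ax1 X (V Y) f g c d).
- intros X Y f g s; exact (@cs_full _ _ _ ax1 X (V Y) f g s).
- intros X Y Z f g a b c π π' h h'.
  destruct (fr_right h') as [[k1 k2] [k3 k4]].
  assert (e : rgt π = lft (kap Z (hval (g : hcell Y (V Z))) ÷ π')) by (rewrite k3; apply h).
  split; cbn -[top lft rgt]; [rewrite top_hcomp, k1, (fr_top h)|rewrite lft_hcomp; [apply h|]|rewrite rgt_hcomp, k4|apply h']; auto.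
- intros X Y Z f g a b c π π' h h'.
  destruct (fr_right h') as [[k1 k2] [k3 k4]].
  assert (e : rgt π = lft (kap Z (hval (g : hcell Y (V Z))) ÷ π')) by (rewrite k3; apply h).
  cbn; rewrite bot_hcomp, k2; auto.
- intros X Y Z f g a b c π π' s s' h h' e1 e2 e3.
  destruct (fr_right h') as [[k1 k2] [k3 k4]].
  assert (e : rgt π = lft (kap Z (hval (g : hcell Y (V Z))) ÷ π')) by (rewrite k3; apply h).
  destruct (kap_bdry ieta lmu (Z := Z) (hval_cod (g : hcell Y (V Z)))) as [[_ o] _].
  cbn; rewrite <- vA, exch; auto; [congruence|rewrite o; symmetry; apply h'].
- intros X Y Z f g a b c π π' h h' i i'.
  destruct (fr_right h') as [[k1 k2] [k3 k4]].
  assert (e : rgt π = lft (kap Z (hval (g : hcell Y (V Z))) ÷ π')) by (rewrite k3; apply h).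
  destruct (kap_bdry ieta lmu (Z := Z) (hval_cod (g : hcell Y (V Z)))) as [[_ o] _].
  apply visoS_hcomp; auto. apply visoS_comp; auto; [rewrite o; symmetry; apply h'|].
  apply (kap_iso imu), hval_cod.
- intros X Y Z f f' g g' x y a b c π π' h h'.
  destruct (fr_right h') as [[k1 k2] [k3 k4]].
  assert (e : rgt π = lft (kap Z (hval (g' : hcell Y (V Z))) ÷ π')) by (rewrite k3; apply h).
  set (sx := sval (x : @gcell D X (V Y) f f')). set (sy := sval (y : @gcell D Y (V Z) g g')).
  change ((sx ∥ (FS V sy ∥ vidS (cmp (lmu Z)))) ÷ (π ∥ (kap Z (hval (g' : hcell Y (V Z))) ÷ π'))
    = (sx ÷ π) ∥ (kap Z (hval (g : hcell Y (V Z))) ÷ (sy ÷ π'))).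
  destruct (kap_bdry ieta lmu (Z := Z) (hval_cod (g' : hcell Y (V Z)))) as [[o1 o2] _].
  destruct (kap_bdry ieta lmu (Z := Z) (hval_cod (g : hcell Y (V Z)))) as [[o3 o4] _].
  assert (t1 : top sy = hval (g : hcell Y (V Z))) by apply s_top.
  assert (t2 : bot sy = hval (g' : hcell Y (V Z))) by apply s_bot.
  assert (t3 : rgt sy = vid (V Z)) by (apply s_rgt).
  assert (t4 : lft sy = vid Y) by (apply s_lft).
  assert (t5 : rgt sx = vid (V Y)) by (apply s_rgt).
  assert (t6 : bot sx = top π) by (refine (eq_trans (s_bot _) _); symmetry; apply h).
  assert (t7 : rgt (FS V sy) = lft (vidS (cmp (lmu Z)))).
  { rewrite FS_rgt, t3, FV_id, lft_vid, cmp_dom; f_equal; symmetry; apply (va_dom μ). }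
  assert (t8 : top π' = hval (g' : hcell Y (V Z))) by apply h'.
  rewrite exch; auto.
  + f_equal. rewrite <- t1, <- t2 in *. rewrite <- !vA, (kap_nat t3); auto.
    * rewrite bot_hcomp, FS_bot, bot_vid; congruence.
    * congruence.
  + rewrite lft_hcomp, t5, FS_lft, t4, FV_id; auto.
  + rewrite k1, bot_hcomp, FS_bot, bot_vid, t2; auto.
- intros X a d; apply fu_K, d.
- intros X a d; cbn in d. change (bot (Submission.eE leta X ÷ hidS (ei X ∙ a)) = hid (vcod a)). rewrite bot_vcomp, bot_hid, vcod_comp; auto.
  + rewrite ei_cod; auto.
  + rewrite top_hid, vdom_comp, ei_dom by (rewrite ei_cod; auto). apply (cf_bot (cf_E ieta leta X)).
- intros X a v d e; cbn in d. change (Submission.eE leta X ÷ hidS (ei X ∙ a) ÷ hidS v = Submission.eE leta X ÷ hidS (ei X ∙ (a ∙ v))). rewrite (cf_post2 (cf_E ieta leta X)); auto.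
  + rewrite uA; auto; rewrite ei_cod; auto.
  + rewrite vdom_comp, ei_dom; auto; rewrite ei_cod; auto.
  + rewrite vcod_comp; auto; rewrite ei_cod; auto.
- intros X a d i; cbn in d. refine (cf_post_iso (cf_E ieta leta X) (a := ei X ∙ a) _ _).
  + rewrite vdom_comp, ei_dom; auto; rewrite ei_cod; auto.
  + apply viso_comp; auto; [rewrite ei_cod; auto|apply ei_iso].
- intros X Y Z W f g h a b c d π1 π2 π3 h1 h2 h3; exact (kleisli_assoc h1 h2 h3).
- intros X Y Z W f g h a b c d π1 π2 π3 h1 h2 h3; exact (kleisli_assoc' h1 h2 h3).
- intros X Y f a b π h; exact (kleisli_lun h).
- intros X Y f a b π h; exact (kleisli_lun' h).
- intros X Y f a b π h; exact (kleisli_run h).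
- intros X Y f a b π h; exact (kleisli_run' h).
- intros X; exists 0; reflexivity.
- intros X a g; apply good_eq in g; destruct g as [n ->]; apply eta_chain_ax.
- intros X Y f a g; apply good_eq in g; destruct g as [n ->].
  destruct (eta_chain_sq_ax n (hval (f : hcell X (V Y)))) as (h1 & h2 & h3 & h4).
  exists (eta_chain (Datatypes.S n) Y), (eta_chain_sq n (hval (f : hcell X (V Y)))).
  destruct (eta_chain_ax n (V Y)) as [d _]. destruct (eta_chain_ax (Datatypes.S n) Y) as [d' _].
  repeat split; auto.
  + apply good_eq; eauto.
  + rewrite h2; f_equal; apply hval_dom.
  (* The right side is the chain at [V Y]; inserting the identity [ei Y ∙ η Y] in front of it gives
     the next chain at [Y]. *)
  + rewrite h3, hval_cod; cbn. rewrite <- uA, ei_r, u1; auto; rewrite ?ei_cod, ?va_dom, ?va_cod; auto.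
Qed.
End KleisliFramed.

Lemma fr_post0 {B : bicat} {D : double_category} {φ : framing B D} (H : is_framing φ) (X Y : B) (f : hom X Y) a b π s :
  fr φ f a b π -> top s = bot π -> lft s = vid (vcod a) -> rgt s = vid (vcod b) -> fr φ f a b (π ÷ s).
Proof.
intros h e l r; assert (q := fr_post H h e). rewrite l, r, !ur in q; auto.
Qed.

(** * Pseudofunctors and transformations with a prescribed action on frames *)

Section LiftPsfun.
Context {B C : bicat} {D E : double_category} {φ : framing B D} {ψ : framing C E}.
Context (H : is_framing φ) (K : is_framing ψ).
Context {F0 : B -> C} {F : map1 F0} {Fh : pdfun D E} {Fr : forall X Y : B, hom X Y -> dsq D -> dsq E}.
Context (P : fmap φ ψ F Fh Fr) (Q : is_pdfun Fh).

(** One good frame defines the 2-cell by [ex_cell]. Factoring an arbitrary frame through it and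
    moving the remainder out with [fm_post] extends the equation to all frames. *)
Lemma ex_f2 (X Y : B) (f g : hom X Y) (c : cell f g) : exists d : cell (F f) (F g),
  forall a b π, fr φ g a b π -> cs ψ d ÷ Fr g π = Fr f (cs φ c ÷ π).
Proof.
destruct (good_fr H g (good_id H X)) as (b0 & π0 & G0 & x0 & I0).
destruct (ex_cell K (fm_fr P (fr_act H c x0)) (fm_fr P x0)) as [d e].
- rewrite (fm_bot P x0), (fm_bot P (fr_act H c x0)), (act_bot H c x0); auto.
- apply (fm_iso P x0 I0).
- exists d; intros a b π x.
  destruct (fr_factor H x x0 I0 (proj2 (good_dom H G0))) as (s & v & w & -> & e1 & _).
  assert (e2 : top (FS Fh s) = bot (Fr g π0)) by (rewrite FS_top, e1, (fm_bot P x0); auto).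
  rewrite (fm_post P x0 e1), (act_post K d (fm_fr P x0) e2), e, (act_post H c x0 e1).
  symmetry; apply (fm_post P (fr_act H c x0)). rewrite (act_bot H c x0); auto.
Qed.

Lemma ex_fcomp (X Y Z : B) (f : hom X Y) (g : hom Y Z) : exists i : iso2 ⟪F f; F g⟫ ⟪F (comp1 f g)⟫,
  is_iso2 i /\ forall a b c π π', fr φ f a b π -> fr φ g b c π' ->
    cs ψ (fwd i) ÷ Fr (comp1 f g) (fc φ f g π π')
    = fc ψ (F f) (F g) (Fr f π) (Fr g π') ÷ F2c Fh (bot π) (bot π').
Proof.
destruct (good_fr H f (good_id H X)) as (a1 & π1 & G1 & x1 & I1).
destruct (good_fr H g G1) as (a2 & π2 & G2 & x2 & I2).
assert (x := fc_fr H x1 x2); assert (y := fc_fr K (fm_fr P x1) (fm_fr P x2)).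
destruct (fr_hbot H x1) as [d1 c1], (fr_hbot H x2) as [d2 c2].
assert (h : hcod (bot π1) = hdom (bot π2)) by congruence.
assert (t : top (F2c Fh (bot π1) (bot π2)) = bot (fc ψ (F f) (F g) (Fr f π1) (Fr g π2))).
{ rewrite (fc_bot K (fm_fr P x1) (fm_fr P x2)), (fm_bot P x1), (fm_bot P x2), F2c_top; auto. }
assert (z : fr ψ (comp1 (F f) (F g)) (FV Fh (vid (fo φ X))) (FV Fh a2)
  (fc ψ (F f) (F g) (Fr f π1) (Fr g π2) ÷ F2c Fh (bot π1) (bot π2))).
{ apply (fr_post0 K y t).
  - rewrite F2c_lft, FV_cod, d1; auto.
  - rewrite F2c_rgt, FV_cod, c2; auto. }
destruct (ex_iso K (p := ⟪F f; F g⟫) (q := ⟪F (comp1 f g)⟫) z (fm_fr P x)) as (i & i1 & i2).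
- rewrite bot_vcomp, F2c_bot, (fm_bot P x), (fc_bot H x1 x2); auto.
- apply visoS_comp; auto.
  + apply (fc_iso K (fm_fr P x1) (fm_fr P x2) (fm_iso P x1 I1) (fm_iso P x2 I2)).
  + exists (F2c' Fh (bot π1) (bot π2)). rewrite F2c'_top, F2c'_bot, F2c_bot, F2c_top, (F2c_inv Q), (F2c'_inv Q); auto.
- apply (fm_iso P x), (fc_iso H x1 x2 I1 I2).
- exists i; split; auto; intros a b c π π' u u'.
  destruct (fr_factor H u x1 I1 (proj2 (good_dom H G1))) as (s & v & w & -> & e1 & e2 & e3 & e4 & e5).
  destruct (fr_factor H u' x2 I2 (proj2 (good_dom H G2))) as (s' & v' & w' & -> & e1' & e2' & e3' & e4' & e5').
  (* The two quotient squares are composable: their adjacent sides have the same composite [b] after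
     the invertible cell [a1]. *)
  assert (W : rgt s = lft s').
  { rewrite e3, e2'. apply (viso_inj (proj2 (good_dom H G1))); [| |congruence].
    - rewrite <- e3, <- cod_top, e1; auto.
    - rewrite <- e2', <- dom_top, e1'; auto. }
  rewrite (fc_post H x1 x2 e1 e1' W), (fm_post P x), (fm_post P x1 e1), (fm_post P x2 e1').
  2:{ rewrite top_hcomp, (fc_bot H x1 x2); congruence. }
  rewrite (act_post K _ (fm_fr P x)).
  2:{ rewrite FS_top, top_hcomp, (fm_bot P x), (fc_bot H x1 x2); congruence. }
  refine (eq_trans (f_equal (fun z => z ÷ _) i2) _).
  rewrite (fc_post K (fm_fr P x1) (fm_fr P x2)), !bot_vcomp; auto.
  + assert (h' : hcod (bot s) = hdom (bot s')) by (rewrite cod_bot, dom_bot; congruence).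
    assert (W' : rgt (FS Fh s) = lft (FS Fh s')) by (rewrite FS_lft, FS_rgt; congruence).
    assert (k0 : bot (fc ψ (F f) (F g) (Fr f π1) (Fr g π2)) = hcomp (FH Fh (bot π1)) (FH Fh (bot π2)))
      by (rewrite (fc_bot K (fm_fr P x1) (fm_fr P x2)), (fm_bot P x1), (fm_bot P x2); auto).
    assert (k1 : top (FS Fh s ∥ FS Fh s') = hcomp (FH Fh (bot π1)) (FH Fh (bot π2)))
      by (rewrite top_hcomp, !FS_top; congruence).
    assert (k2 : bot (FS Fh s ∥ FS Fh s') = top (F2c Fh (bot s) (bot s')))
      by (rewrite bot_hcomp, !FS_bot, F2c_top; congruence).
    assert (k3 : top (FS Fh (s ∥ s')) = bot (F2c Fh (bot π1) (bot π2)))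
      by (rewrite FS_top, top_hcomp, F2c_bot; congruence).
    rewrite !vA; try congruence.
    f_equal. rewrite <- e1, <- e1', <- (F2c_nat Q); auto.
  + rewrite FS_top, (fm_bot P x1); congruence.
  + rewrite FS_top, (fm_bot P x2); congruence.
  + rewrite FS_lft, FS_rgt; congruence.
Qed.

Lemma ex_funit (X : B) : exists i : iso2 ⟪⟫ ⟪F (id1 X)⟫,
  is_iso2 i /\ forall a, vdom a = fo φ X ->
    cs ψ (fwd i) ÷ Fr (id1 X) (fu φ X a) = fu ψ (F0 X) (FV Fh a) ÷ F2u Fh (vcod a).
Proof.
assert (d := vdom_id (fo φ X)). assert (x := fu_fr H d).
assert (d' : vdom (FV Fh (vid (fo φ X))) = fo ψ (F0 X)) by (rewrite FV_dom, d, (fm_o P); auto).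
assert (y := fu_fr K d').
assert (t : top (F2u Fh (fo φ X)) = bot (fu ψ (F0 X) (FV Fh (vid (fo φ X))))).
{ rewrite (fu_bot K d'), F2u_top, FV_cod, vcod_id; auto. }
assert (z : fr ψ (id1 (F0 X)) (FV Fh (vid (fo φ X))) (FV Fh (vid (fo φ X)))
  (fu ψ (F0 X) (FV Fh (vid (fo φ X))) ÷ F2u Fh (fo φ X))).
{ apply (fr_post0 K y t); rewrite ?F2u_lft, ?F2u_rgt, FV_cod, vcod_id; auto. }
assert (bb : bot (Fr (id1 X) (fu φ X (vid (fo φ X)))) = FH Fh (hid (fo φ X))) by (rewrite (fm_bot P x), (fu_bot H d), vcod_id; auto).
destruct (ex_iso K (p := ⟪⟫) (q := ⟪F (id1 X)⟫) z (fm_fr P x)) as (i & i1 & i2).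
- rewrite bb, bot_vcomp, F2u_bot; auto.
- apply visoS_comp; auto.
  + apply (fu_iso K d'). rewrite FV_id; apply viso_id.
  + exists (F2u' Fh (fo φ X)). rewrite F2u'_top, F2u'_bot, F2u_bot, F2u_top, (F2u_inv Q), (F2u'_inv Q); auto.
- apply (fm_iso P x), (fu_iso H d), viso_id.
- exists i; split; auto; intros a da.
  assert (e : fu φ X a = fu φ X (vid (fo φ X)) ÷ hidS a).
  { rewrite (fu_post H d), u1; auto. rewrite vcod_id; auto. }
  rewrite e, (fm_post P x) by (rewrite top_hid, (fu_bot H d), vcod_id; congruence).
  rewrite (act_post K _ (fm_fr P x)) by (rewrite FS_top, top_hid, bb; congruence).
  refine (eq_trans (f_equal (fun z => z ÷ _) i2) _).
  assert (q : fu ψ (F0 X) (FV Fh a) = fu ψ (F0 X) (FV Fh (vid (fo φ X))) ÷ hidS (FV Fh a)).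
  { rewrite (fu_post K d'), FV_id, u1; rewrite ?FV_dom, ?FV_cod, ?vcod_id; congruence. }
  rewrite q, !vA; rewrite ?top_hid, ?bot_hid, ?FV_dom, ?FV_cod, ?FS_top, ?top_hid, ?F2u_top, ?F2u_bot; try congruence.
  + rewrite <- da, <- (F2u_nat Q); auto.
  + rewrite (fu_bot K d'), FV_cod, vcod_id; congruence.
  + rewrite (fu_bot K d'), FV_cod, vcod_id; congruence.
Qed.

Definition lift_psfun : psfun F0 :=
  {| f1 := F;
     f2 := fun X Y f g c => proj1_sig (constructive_indefinite_description _ (ex_f2 c));
     fcomp := fun X Y Z f g => proj1_sig (constructive_indefinite_description _ (ex_fcomp f g));
     funit := fun X => proj1_sig (constructive_indefinite_description _ (ex_funit X)) |}.

Lemma lift_ff : ffun φ ψ lift_psfun Fh Fr.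
Proof.
split; auto; intros; cbn.
- destruct constructive_indefinite_description as [d h]; cbn; eauto.
- destruct constructive_indefinite_description as [d [h h']]; cbn; eauto.
- destruct constructive_indefinite_description as [d [h h']]; cbn; eauto.
- destruct constructive_indefinite_description as [d [h h']]; exact h.
- destruct constructive_indefinite_description as [d [h h']]; exact h.
Qed.
End LiftPsfun.

(** The content of an invertible [vtrans] with its components as parameters. The constraints are
    needed one variable at a time and with unitors inserted, and their components are best given by
    explicit formulas. *)
Record vstrict {D E : double_category} (Fh Gh : pdfun D E) (av : dob D -> dv E) (ah : dh D -> dsq E) : Prop := {
  vt_dom : forall A, vdom (av A) = Fh A;
  vt_cod : forall A, vcod (av A) = Gh A;
  vt_top : forall k, top (ah k) = FH Fh k;
  vt_bot : forall k, bot (ah k) = FH Gh k;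
  vt_lft : forall k, lft (ah k) = av (hdom k);
  vt_rgt : forall k, rgt (ah k) = av (hcod k);
  vt_iso : forall k, visoS (ah k);
  vt_nat : forall v, FV Fh v ∙ av (vcod v) = av (vdom v) ∙ FV Gh v;
  vt_natS : forall s, FS Fh s ÷ ah (bot s) = ah (top s) ÷ FS Gh s;
  vt_vnat : vnat Fh Gh av ah }.

Section LiftPsnat.
Context {B C : bicat} {D E : double_category} {φ : framing B D} {ψ : framing C E}.
Context (H : is_framing φ) (K : is_framing ψ).
Context {F0 G0 : B -> C} {F : map1 F0} {G : map1 G0} {Fh Gh : pdfun D E} {Fr Gr : forall X Y : B, hom X Y -> dsq D -> dsq E}.
Context (P : fmap φ ψ F Fh Fr) (P' : fmap φ ψ G Gh Gr) (Q : is_pdfun Fh) (Q' : is_pdfun Gh).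
Context {av : dob D -> dv E} {ah : dh D -> dsq E} (A : vstrict Fh Gh av ah).
Context {s : forall X, hom (F0 X) (G0 X)} {e : B -> dsq E}.
Context (c : forall X, cf (φ := ψ) (s X) (e X)) (l : forall X, lft (e X) = av (fo φ X)).

Lemma ln_left (X Y : B) (f : hom X Y) a b π : fr φ f a b π ->
  fr ψ (s X) (av (fo φ X) ∙ FV Gh a) (FV Gh a) (e X ÷ hidS (FV Gh a)) /\ bot (e X ÷ hidS (FV Gh a)) = hid (Gh (vcod a)).
Proof.
intros h; assert (d : vdom (FV Gh a) = fo ψ (G0 X)) by (rewrite FV_dom, (fr_left H h), (fm_o P'); auto).
split; [rewrite <- l; apply (cf_post K (c X) d)|].
rewrite (cf_post_bot (c X) d), FV_cod; auto.
Qed.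
Lemma ln_mid (X Y : B) (f : hom X Y) a b π : fr φ f a b π ->
  fr ψ (F f) (av (fo φ X) ∙ FV Gh a) (av (fo φ Y) ∙ FV Gh b) (Fr f π ÷ ah (bot π)).
Proof.
intros h; destruct (fr_hbot H h) as [d1 d2].
assert (t : top (ah (bot π)) = bot (Fr f π)) by (rewrite (vt_top A), (fm_bot P h); auto).
assert (q := fr_post K (fm_fr P h) t).
rewrite (vt_lft A), (vt_rgt A), d1, d2, !(vt_nat A), (fr_left H h), (fr_dom h) in q; exact q.
Qed.
Lemma ln_right (X Y : B) (f : hom X Y) a b π : fr φ f a b π ->
  fr ψ (s Y) (av (fo φ Y) ∙ FV Gh b) (FV Gh b) (e Y ÷ hidS (FV Gh b)) /\ bot (e Y ÷ hidS (FV Gh b)) = hid (Gh (vcod b)).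
Proof.
intros h; assert (d : vdom (FV Gh b) = fo ψ (G0 Y)) by (rewrite FV_dom, (fr_dom h), (fm_o P'); auto).
split; [rewrite <- l; apply (cf_post K (c Y) d)|].
rewrite (cf_post_bot (c Y) d), FV_cod; auto.
Qed.

(** Source and target frames have the same bottom because the companions contribute identities. A
    good frame determines the cell, and naturality of [ah] carries the equation to every frame that
    factors through it. *)
Lemma ex_nat (X Y : B) (f : hom X Y) : exists i : iso2 ⟪F f; s Y⟫ ⟪s X; G f⟫,
  is_iso2 i /\ forall a b π, fr φ f a b π ->
    cs ψ (fwd i) ÷ fc ψ (s X) (G f) (e X ÷ hidS (FV Gh a)) (Gr f π)
    = fc ψ (F f) (s Y) (Fr f π ÷ ah (bot π)) (e Y ÷ hidS (FV Gh b)).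
Proof.
destruct (good_fr H f (good_id H X)) as (b0 & π0 & G1 & x & I).
set (a0 := vid (fo φ X)) in x.
destruct (ln_left x) as [x1 y1], (ln_right x) as [x3 y3]; assert (x2 := ln_mid x); assert (x4 := fm_fr P' x).
destruct (fr_hbot H x) as [d1 d2].
assert (V : viso b0) by apply (good_dom H G1).
assert (t : top (ah (bot π0)) = bot (Fr f π0)) by (rewrite (vt_top A), (fm_bot P x); auto).
assert (y2 : bot (Fr f π0 ÷ ah (bot π0)) = FH Gh (bot π0)) by (rewrite bot_vcomp, (vt_bot A); auto).
assert (FG : forall v, viso v -> viso (FV Gh v)).
{ intros v (w & w1 & w2 & w3 & w4); exists (FV Gh w).
  rewrite <- !(FV_comp Q'), w3, w4, !FV_id, !FV_dom, !FV_cod; auto; repeat split; congruence. }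
destruct (ex_iso K (p := ⟪F f; s Y⟫) (q := ⟪s X; G f⟫) (fc_fr K x2 x3) (fc_fr K x1 x4)) as (i & i1 & i2).
- rewrite (fc_bot K x2 x3), (fc_bot K x1 x4), y1, y2, y3, (fm_bot P' x), hunitl, hunitr; auto.
  + rewrite FH_cod, d2; auto.
  + rewrite FH_dom, d1; auto.
- apply (fc_iso K x2 x3).
  + apply visoS_comp; auto; [apply (fm_iso P x I)|apply (vt_iso A)].
  + apply (cf_post_iso (c Y)); auto. rewrite FV_dom, (fr_dom x), (fm_o P'); auto.
- apply (fc_iso K x1 x4); [|apply (fm_iso P' x I)].
  apply (cf_post_iso (c X)); [rewrite FV_dom, (fr_left H x), (fm_o P'); auto|apply FG, viso_id].
- exists i; split; auto; intros a b π u.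
  destruct (fr_factor H u x I V) as (r & v & w & -> & e1 & e2 & e3 & e4 & e5).
  assert (E1 : vcod a0 = vdom v) by (rewrite <- e2, <- dom_top, e1; auto).
  assert (E2 : vcod b0 = vdom w) by (rewrite <- e3, <- cod_top, e1; auto).
  assert (L : e X ÷ hidS (FV Gh a) = (e X ÷ hidS (FV Gh a0)) ÷ hidS (FV Gh v)).
  { rewrite (cf_post2 (c X)); rewrite ?FV_dom, ?FV_cod, ?E1, ?(fr_left H x), ?(fm_o P'); auto.
    rewrite <- e4, (FV_comp Q'); auto. }
  assert (R : e Y ÷ hidS (FV Gh b) = (e Y ÷ hidS (FV Gh b0)) ÷ hidS (FV Gh w)).
  { rewrite (cf_post2 (c Y)); rewrite ?FV_dom, ?FV_cod, ?E2, ?(fr_dom x), ?(fm_o P'); auto.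
    rewrite <- e5, (FV_comp Q'); auto. }
  assert (tr : top (FS Gh r) = FH Gh (bot π0)) by (rewrite FS_top, e1; auto).
  assert (N : Fr f (π0 ÷ r) ÷ ah (bot (π0 ÷ r)) = (Fr f π0 ÷ ah (bot π0)) ÷ FS Gh r).
  { rewrite (fm_post P x e1), bot_vcomp by auto.
    assert (tF : top (FS Fh r) = bot (Fr f π0)) by (rewrite FS_top, e1, (fm_bot P x); auto).
    rewrite !vA, (vt_natS A), e1; auto.
    - rewrite (vt_bot A); auto.
    - rewrite FS_bot, (vt_top A); auto. }
  rewrite L, R, N, (fm_post P' x e1).
  rewrite (fc_post K x1 x4), (fc_post K x2 x3).
  + rewrite h1 by (rewrite FS_lft; congruence). rewrite hr by (rewrite FS_rgt; congruence).
    rewrite (act_post K _ (fc_fr K x1 x4)).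
    * f_equal; exact i2.
    * rewrite (fc_bot K x1 x4), y1, (fm_bot P' x), tr, hunitl; auto. rewrite FH_dom, d1; auto.
  + rewrite y2; auto.
  + rewrite top_hid, y3, FV_dom; congruence.
  + rewrite FS_rgt, lft_hid; congruence.
  + rewrite top_hid, y1, FV_dom; congruence.
  + rewrite (fm_bot P' x); auto.
  + rewrite FS_lft, rgt_hid; congruence.
Qed.

Definition lift_psnat : psnat F G s :=
  {| nat2 := fun X Y f => proj1_sig (constructive_indefinite_description _ (ex_nat f)) |}.

Lemma lift_nat_fn : fnat φ ψ (FV Fh) (FV Gh) (FH Fh) (FH Gh) Fr Gr lift_psnat av ah e.
Proof.
split; intros; try solve [apply A | apply c | apply l].
- split; [apply (fm_fr P H0)|apply (fm_bot P H0)].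
- split; [apply (fm_fr P' H0)|apply (fm_bot P' H0)].
- apply (fm_iso P' H0 H1).
- apply (fm_iso P H0 H1).
- destruct H0 as (w & w1 & w2 & w3 & w4); exists (FV Gh w).
  rewrite <- !(FV_comp Q'), w3, w4, !FV_id, !FV_dom, !FV_cod; auto; repeat split; congruence.
- rewrite FV_cod, (vt_dom A); auto.
- rewrite FV_dom, (vt_cod A); auto.
- cbn; destruct constructive_indefinite_description as [d [h h']]; exact h.
- cbn; destruct constructive_indefinite_description as [d [h h']]; cbn; eauto.
Qed.
End LiftPsnat.

(** * Squares as the arrows of a monoidal category *)

Section Typed.
Context (D : double_category) (M : monoidal_double D).
Local Notation I := (dI M tt).
Local Notation "X ⊗ Y" := (dt M (X, Y)) (at level 25, left associativity).
Local Notation "f ⊠ g" := (FH (dt M) (f, g)) (at level 25, left associativity).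

(** Only top and bottom are indices; the sides of a vertical composite take care of themselves.
    Squares thus form a category with a tensor product in which the strict pentagon and triangles
    hold, and constraints can be moved by rewriting. *)
Record tsq (f g : dh D) := { tv :> dsq D; tv_top : top tv = f; tv_bot : bot tv = g }.

Lemma teq f g (s t : tsq f g) : tv s = tv t -> s = t.
Proof. destruct s, t; cbn; intros <-; f_equal; apply proof_irrelevance. Qed.

Definition tid f : tsq f f.
Proof. refine {| tv := vidS f |}; abstract gb. Defined.
Definition tcomp f g h (s : tsq f g) (t : tsq g h) : tsq f h.
Proof.
refine {| tv := s ÷ t |};
abstract (rewrite ?top_vcomp, ?bot_vcomp by (rewrite tv_bot, tv_top; reflexivity); rewrite ?tv_top, ?tv_bot; reflexivity).
Defined.
Local Notation "s ⋆ t" := (tcomp s t) (at level 42, right associativity).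
Definition tten f f' g g' (s : tsq f f') (t : tsq g g') : tsq (f ⊠ g) (f' ⊠ g').
Proof.
refine {| tv := FS (dt M) (tv s, tv t) |}; abstract (rewrite ?FS_top, ?FS_bot; cbn; rewrite ?tv_top, ?tv_bot; reflexivity).
Defined.
Local Notation "s ⊛ t" := (tten s t) (at level 36, left associativity).
Local Notation "1" := (tid _).

Lemma tA f g h k (s : tsq f g) (t : tsq g h) (r : tsq h k) : (s ⋆ t) ⋆ r = s ⋆ t ⋆ r.
Proof. apply teq, vA; rewrite tv_top, tv_bot; auto. Qed.
Lemma t1 f g (s : tsq f g) : 1 ⋆ s = s.
Proof. apply teq, v1, tv_top. Qed.
Lemma tr f g (s : tsq f g) : s ⋆ 1 = s.
Proof. apply teq, vr, tv_bot. Qed.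
Lemma tten_comp f g h f' g' h' (s : tsq f g) (t : tsq g h) (s' : tsq f' g') (t' : tsq g' h') :
  (s ⋆ t) ⊛ (s' ⋆ t') = s ⊛ s' ⋆ t ⊛ t'.
Proof.
apply teq; cbn. refine (FS_vcomp (dt_ax M) (a := (tv s, tv s')) (b := (tv t, tv t')) _). cbn; rewrite !tv_top, !tv_bot; auto.
Qed.
Lemma tten_l f g h k (s : tsq f g) (t : tsq g h) : (s ⋆ t) ⊛ tid k = s ⊛ 1 ⋆ t ⊛ 1.
Proof. rewrite <- tten_comp, t1; auto. Qed.
Lemma tten_r f g h k (s : tsq f g) (t : tsq g h) : tid k ⊛ (s ⋆ t) = 1 ⊛ s ⋆ 1 ⊛ t.
Proof. rewrite <- tten_comp, t1; auto. Qed.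
Lemma tten_id f g : tid f ⊛ tid g = 1.
Proof. apply teq; apply (FS_vid (dt_ax M) (f, g)). Qed.
Lemma tten_swap f g f' g' (s : tsq f g) (s' : tsq f' g') : s ⊛ 1 ⋆ 1 ⊛ s' = 1 ⊛ s' ⋆ s ⊛ 1.
Proof. rewrite <- !tten_comp, !t1, !tr; auto. Qed.

Definition tα f g h : tsq (f ⊠ g ⊠ h) (f ⊠ (g ⊠ h)).
Proof. refine {| tv := va_h (dalpha M) (f, g, h) |}; [apply (va_top (dalpha M))|apply (va_bot (dalpha M))]. Defined.
Definition tλ f : tsq (FH (dI M) tt ⊠ f) f.
Proof. refine {| tv := va_h (dlambda M) f |}; [apply (va_top (dlambda M))|apply (va_bot (dlambda M))]. Defined.
Definition tρ f : tsq (f ⊠ FH (dI M) tt) f.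
Proof. refine {| tv := va_h (drho M) f |}; [apply (va_top (drho M))|apply (va_bot (drho M))]. Defined.
(** The comparison of a tensor of identities with the identity of the tensor product; [κi] is its
    inverse, and [u0] is the analogous comparison for the unit object. *)
Definition κ X Y : tsq (hid X ⊠ hid Y) (hid (X ⊗ Y)).
Proof. refine {| tv := F2u' (dt M) (X, Y) |}; [apply (F2u'_top (dt M))|apply (F2u'_bot (dt M))]. Defined.
Definition κi X Y : tsq (hid (X ⊗ Y)) (hid X ⊠ hid Y).
Proof. refine {| tv := F2u (dt M) (X, Y) |}; [apply (F2u_top (dt M))|apply (F2u_bot (dt M))]. Defined.
Definition u0 : tsq (hid I) (FH (dI M) tt).
Proof. refine {| tv := F2u (dI M) tt |}; [apply (F2u_top (dI M))|apply (F2u_bot (dI M))]. Defined.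
Definition thid (u : dv D) X Y (e : vdom u = X) (e' : vcod u = Y) : tsq (hid X) (hid Y).
Proof. refine {| tv := hidS u |}; abstract gb. Defined.
Definition hα X Y Z := thid (va_dom (dalpha M) (X, Y, Z)) (va_cod (dalpha M) (X, Y, Z)).
Definition hλ X := thid (va_dom (dlambda M) X) (va_cod (dlambda M) X).
Definition hρ X := thid (va_dom (drho M) X) (va_cod (drho M) X).

Lemma κK X Y : κ X Y ⋆ κi X Y = 1.
Proof. apply teq; apply (F2u'_inv (dt_ax M)). Qed.
Lemma κiK X Y : κi X Y ⋆ κ X Y = 1.
Proof. apply teq; apply (F2u_inv (dt_ax M)). Qed.

Lemma tα_nat f f' g g' h h' (a : tsq f f') (b : tsq g g') (c : tsq h h') :
  (a ⊛ b) ⊛ c ⋆ tα f' g' h' = tα f g h ⋆ a ⊛ (b ⊛ c).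
Proof.
apply teq. assert (q := va_natS (dalpha M) (tv a, tv b, tv c)). cbn in q. rewrite !tv_top, !tv_bot in q. exact q.
Qed.
Lemma tλ_nat f f' (a : tsq f f') : 1 ⊛ a ⋆ tλ f' = tλ f ⋆ a.
Proof.
apply teq. assert (q := va_natS (dlambda M) (tv a)). cbn in q. rewrite !tv_top, !tv_bot in q.
rewrite (FS_vid (dI_ax M) tt : FS (dI M) tt = _) in q. exact q.
Qed.
Lemma tρ_nat f f' (a : tsq f f') : a ⊛ 1 ⋆ tρ f' = tρ f ⋆ a.
Proof.
apply teq. assert (q := va_natS (drho M) (tv a)). cbn in q. rewrite !tv_top, !tv_bot in q.
rewrite (FS_vid (dI_ax M) tt : FS (dI M) tt = _) in q. exact q.
Qed.
Lemma tpent f g h k : tα f g h ⊛ tid k ⋆ tα f (g ⊠ h) k ⋆ tid f ⊛ tα g h k = tα (f ⊠ g) h k ⋆ tα f g (h ⊠ k).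
Proof. apply teq; apply dpentagon_h. Qed.
Lemma tmid f g : tα f (FH (dI M) tt) g ⋆ 1 ⊛ tλ g = tρ f ⊛ 1.
Proof. apply teq; apply dmiddle_h. Qed.
Lemma tleft f g : tα (FH (dI M) tt) f g ⋆ tλ (f ⊠ g) = tλ f ⊛ 1.
Proof. apply teq; apply dleft_h. Qed.
Lemma tright f g : tα f g (FH (dI M) tt) ⋆ 1 ⊛ tρ g = tρ (f ⊠ g).
Proof. apply teq; apply dright_h. Qed.

(** The unitor axiom of [α], read as a formula for [α] at identity 1h-cells: conjugated by the
    comparisons, it is the horizontal identity square of a vertical cell. *)
Lemma hα_eq X Y Z : κi (X ⊗ Y) Z ⋆ κi X Y ⊛ 1 ⋆ tα _ _ _ = hα X Y Z ⋆ κi X (Y ⊗ Z) ⋆ 1 ⊛ κi Y Z.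
Proof.
apply teq. assert (q := va_unit (dalpha M) (X, Y, Z)). cbn in q |- *.
rewrite ?v1 in q by gb.
rewrite (FS_vid (dt_ax M) (hid X, hid Y) : FS (dt M) (vidS (hid X), vidS (hid Y)) = _),
  (FS_vid (dt_ax M) (hid Y, hid Z) : FS (dt M) (vidS (hid Y), vidS (hid Z)) = _), !vr in q by apply F2u_bot.
rewrite !vA in q by gb; exact q.
Qed.
Lemma hλ_eq X : κi I X ⋆ u0 ⊛ 1 ⋆ tλ _ = hλ X.
Proof.
apply teq. assert (q := va_unit (dlambda M) X). cbn in q |- *.
rewrite (FS_vid (dI_ax M) tt : FS (dI M) tt = _), (vr (s := hidS _)), (vr (s := F2u (dI M) tt)), vA in q by (first [apply F2u_bot|gb]).
exact q.
Qed.
Lemma hρ_eq X : κi X I ⋆ 1 ⊛ u0 ⋆ tρ _ = hρ X.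
Proof.
apply teq. assert (q := va_unit (drho M) X). cbn in q |- *.
rewrite (FS_vid (dI_ax M) tt : FS (dI M) tt = _), (vr (s := hidS _)), (vr (s := F2u (dI M) tt)), vA in q by (first [apply F2u_bot|gb]).
exact q.
Qed.
Lemma hα_eq' X Y Z : κ X Y ⊛ 1 ⋆ κ (X ⊗ Y) Z ⋆ hα X Y Z = tα _ _ _ ⋆ 1 ⊛ κ Y Z ⋆ κ X (Y ⊗ Z).
Proof.
assert (q := f_equal (fun z => κ X Y ⊛ tid (hid Z) ⋆ κ (X ⊗ Y) Z ⋆ z ⋆ 1 ⊛ κ Y Z ⋆ κ X (Y ⊗ Z)) (hα_eq X Y Z)).
cbn beta in q; rewrite !tA in q.
rewrite <- (tA (tid _ ⊛ κi Y Z)), <- tten_r, κiK, tten_id, t1, κiK, tr in q.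
rewrite <- (tA (κ (X ⊗ Y) Z) (κi _ _)), κK, t1, <- (tA (κ X Y ⊛ _)), <- tten_l, κK, tten_id, t1 in q.
auto.
Qed.
Lemma hλ_eq' X : κ I X ⋆ hλ X = u0 ⊛ 1 ⋆ tλ _.
Proof. rewrite <- hλ_eq, <- tA, κK, t1; auto. Qed.
Lemma hρ_eq' X : κ X I ⋆ hρ X = 1 ⊛ u0 ⋆ tρ _.
Proof. rewrite <- hρ_eq, <- tA, κK, t1; auto. Qed.

(** The associator with identities in two slots. Where a functor such as [RH (Y ⊗ Z)] involves the
    identity of a tensor product instead of a tensor of identities, [κ] or [κi] is inserted; [luk]
    and [ruk] treat the unit object in the same way. *)
Definition a1t Y Z k : tsq (k ⊠ hid Y ⊠ hid Z) (k ⊠ hid (Y ⊗ Z)) := tα k (hid Y) (hid Z) ⋆ 1 ⊛ κ Y Z.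
Definition a2t X Z k : tsq (hid X ⊠ k ⊠ hid Z) (hid X ⊠ (k ⊠ hid Z)) := tα (hid X) k (hid Z).
Definition a3t X Y k : tsq (hid (X ⊗ Y) ⊠ k) (hid X ⊠ (hid Y ⊠ k)) := κi X Y ⊛ 1 ⋆ tα (hid X) (hid Y) k.
Definition luk k : tsq (hid I ⊠ k) k := u0 ⊛ 1 ⋆ tλ k.
Definition ruk k : tsq (k ⊠ hid I) k := 1 ⊛ u0 ⋆ tρ k.

Lemma tpent' f g h k z (r : tsq _ z) :
  tα f g h ⊛ tid k ⋆ tα f (g ⊠ h) k ⋆ tid f ⊛ tα g h k ⋆ r = tα (f ⊠ g) h k ⋆ tα f g (h ⊠ k) ⋆ r.
Proof. rewrite <- (tA (tα (f ⊠ g) h k)), <- tpent, !tA; auto. Qed.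
Lemma tα_nat' f f' g g' h h' (a : tsq f f') (b : tsq g g') (c : tsq h h') z (r : tsq _ z) :
  (a ⊛ b) ⊛ c ⋆ tα f' g' h' ⋆ r = tα f g h ⋆ a ⊛ (b ⊛ c) ⋆ r.
Proof. rewrite <- !tA, tα_nat; auto. Qed.

(** This and the next nine equations are the conditions that [framed_modif] leaves for [pp], [pm],
    [pll] and [prr] in each variable. The comparison cells move aside by naturality, and the strict
    pentagon or a strict triangle remains. *)
Lemma ah_p1 Y Z W k : a1t Y Z k ⊛ 1 ⋆ a1t (Y ⊗ Z) W k ⋆ 1 ⊛ hα Y Z W = a1t Z W (k ⊠ hid Y) ⋆ a1t Y (Z ⊗ W) k.
Proof.
unfold a1t. rewrite tten_l, !tA, tα_nat', <- !tten_r, hα_eq', !tten_r, tpent'.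
rewrite <- (tten_id k (hid Y)), tα_nat'; auto.
Qed.
Lemma ah_p2 X Z W k : a2t X Z k ⊛ 1 ⋆ a2t X W (k ⊠ hid Z) ⋆ 1 ⊛ a1t Z W k = a1t Z W (hid X ⊠ k) ⋆ a2t X (Z ⊗ W) k.
Proof.
unfold a1t, a2t. rewrite tten_r, tpent', !tA, <- (tten_id (hid X) k), tα_nat; auto.
Qed.
Lemma ah_p3 X Y W k : a3t X Y k ⊛ 1 ⋆ a2t X W (hid Y ⊠ k) ⋆ 1 ⊛ a2t Y W k = a2t (X ⊗ Y) W k ⋆ a3t X Y (k ⊠ hid W).
Proof.
unfold a3t, a2t. rewrite tten_l, !tA, tpent, tα_nat', tten_id; auto.
Qed.
Lemma ah_p4 X Y Z k : hα X Y Z ⊛ tid k ⋆ a3t X (Y ⊗ Z) k ⋆ 1 ⊛ a3t Y Z k = a3t (X ⊗ Y) Z k ⋆ a3t X Y (hid Z ⊠ k).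
Proof.
unfold a3t. rewrite tten_r, !tA, <- tα_nat'.
rewrite <- (tA (κi X (Y ⊗ Z) ⊛ 1)), <- tten_l, <- (tA (hα X Y Z ⊛ 1)), <- tten_l, <- hα_eq.
rewrite !tten_l, !tA, tpent, <- (tten_id (hid Z) k), tα_nat'; auto.
Qed.
Lemma ah_m1 Y k : a1t I Y k ⋆ 1 ⊛ hλ Y = ruk k ⊛ 1.
Proof.
unfold a1t, ruk. rewrite tA, <- tten_r, hλ_eq', tten_r, <- tα_nat', tmid, tten_l; auto.
Qed.
Lemma ah_m2 X k : a3t X I k ⋆ 1 ⊛ luk k = hρ X ⊛ 1.
Proof.
unfold a3t, luk. rewrite tA, tten_r, <- tα_nat', tmid, <- !tten_l, hρ_eq; auto.
Qed.
Lemma ah_l1 Y k : a2t I Y k ⋆ luk (k ⊠ hid Y) = luk k ⊛ 1.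
Proof.
unfold a2t, luk. rewrite <- (tten_id k (hid Y)), <- tα_nat', tleft, tten_l; auto.
Qed.
Lemma ah_l2 X k : a3t I X k ⋆ luk (hid X ⊠ k) = hλ X ⊛ 1.
Proof.
unfold a3t, luk. rewrite tA, <- (tten_id (hid X) k) at 1. rewrite <- tα_nat', tleft, <- !tten_l, hλ_eq; auto.
Qed.
Lemma ah_r1 Y k : a1t Y I k ⋆ 1 ⊛ hρ Y = ruk (k ⊠ hid Y).
Proof.
unfold a1t, ruk. rewrite tA, <- tten_r, hρ_eq', tten_r, <- tα_nat', tright, tten_id; auto.
Qed.
Lemma ah_r2 X k : a2t X I k ⋆ 1 ⊛ ruk k = ruk (hid X ⊠ k).
Proof.
unfold a2t, ruk. rewrite tten_r, <- tα_nat', tright, tten_id; auto.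
Qed.
End Typed.

(** * Unitors and the compositor at identities *)

Section UnitSquares.
Context {C : dcat} {D : double_category} {F : pdfun C D} (P : is_pdfun F).
Context (hun : forall A : dob C, hcomp (hid A) (hid A) = hid A) (hd : forall A : dob C, hdom (hid A) = A) (hc : forall A : dob C, hcod (hid A) = A).

Lemma F2c_hid A : F2c F (hid A) (hid A) = F2u' F A ∥ vidS (FH F (hid A)).
Proof.
assert (q := F2c_unitl P (hid A)). rewrite hd in q.
assert (k : hcod (hid A) = hdom (hid A)) by (rewrite hd, hc; auto).
assert (r1 : rgt (F2u F A) = lft (vidS (FH F (hid A)))) by (rewrite F2u_rgt, lft_vid, FH_dom, hd; auto).
assert (r2 : rgt (F2u' F A) = lft (vidS (FH F (hid A)))) by (rewrite F2u'_rgt, lft_vid, FH_dom, hd; auto).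
assert (z := f_equal (fun z => (F2u' F A ∥ vidS (FH F (hid A))) ÷ z) q). cbn beta in z.
rewrite <- vA, exch, (F2u'_inv P), v1 in z; try (rewrite ?top_vid, ?bot_vid, ?F2u'_bot, ?F2u_top; auto; fail).
- rewrite <- vidS_h, v1 in z by (rewrite ?FH_dom, ?FH_cod, ?hd, ?hc; try rewrite F2c_top; auto).
  rewrite vr in z; auto. rewrite bot_hcomp, bot_vid, F2u'_bot; auto. rewrite hunitl; auto. rewrite FH_dom, hd; auto.
- rewrite bot_hcomp, top_hcomp, F2u'_bot, F2u_top, bot_vid, top_vid; auto.
- rewrite bot_hcomp, F2u_bot, bot_vid, F2c_top; auto.
Qed.
Lemma F2u'_comp A : F2c F (hid A) (hid A) ÷ F2u' F A = F2u' F A ∥ F2u' F A.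
Proof.
assert (r2 : rgt (F2u' F A) = lft (vidS (FH F (hid A)))) by (rewrite F2u'_rgt, lft_vid, FH_dom, hd; auto).
rewrite F2c_hid.
transitivity ((F2u' F A ∥ vidS (FH F (hid A))) ÷ (hidS (vid (F A)) ∥ F2u' F A)).
- f_equal; symmetry; apply h1, F2u'_lft.
- rewrite exch; rewrite ?rgt_hid, ?F2u'_lft, ?F2u'_bot, ?bot_vid, ?F2u'_top, ?top_hid, ?vdom_id; auto.
  f_equal; [rewrite hidS_id; apply vr, F2u'_bot|apply v1, F2u'_top].
Qed.
(** Checked after composing with the inverse unitor, where [F2u'_comp] merges two adjacent
    copies. *)
Lemma F2u_comp A : (F2u F A ∥ F2u F A) ÷ F2c F (hid A) (hid A) = F2u F A.
Proof.
assert (k : hcod (hid A) = hdom (hid A)) by (rewrite hd, hc; auto).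
assert (r1 : rgt (F2u F A) = lft (F2u F A)) by (rewrite F2u_rgt, F2u_lft; auto).
assert (r2 : rgt (F2u' F A) = lft (F2u' F A)) by (rewrite F2u'_rgt, F2u'_lft; auto).
assert (J : visoS (F2u' F A)).
{ exists (F2u F A). rewrite F2u_top, F2u_bot, F2u'_top, F2u'_bot, (F2u_inv P), (F2u'_inv P); auto. }
assert (b : bot (F2u F A ∥ F2u F A) = top (F2c F (hid A) (hid A))) by (rewrite bot_hcomp, F2u_bot, F2c_top; auto).
assert (b' : bot (F2c F (hid A) (hid A)) = top (F2u' F A)) by (rewrite F2c_bot, hun, F2u'_top; auto).
apply (visoS_inj J).
- rewrite bot_vcomp, b', F2u'_top; auto.
- rewrite F2u_bot, F2u'_top; auto.
- rewrite vA, F2u'_comp, exch, (F2u_inv P); auto; rewrite ?F2u_bot, ?F2u'_top; auto.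
  rewrite <- vidS_h, hunitl; auto; rewrite ?hdom_id, ?hcod_id; auto.
Qed.
End UnitSquares.

Section PairUnits.
Context (D : double_category).
Lemma pair_hh (A : dob (dprod D D)) : hcomp (hid A) (hid A) = hid A.
Proof. destruct A; cbn; f_equal; apply hunitl; gb. Qed.
Lemma pair_hd (A : dob (dprod D D)) : hdom (hid A) = A.
Proof. destruct A; cbn; f_equal; gb. Qed.
Lemma pair_hc (A : dob (dprod D D)) : hcod (hid A) = A.
Proof. destruct A; cbn; f_equal; gb. Qed.
End PairUnits.

(** * One-variable constraints as strict vertical transformations *)

Section Constraints.
Context (D : double_category) (M : monoidal_double D).
Local Notation I := (dI M tt).
Local Notation "X ⊗ Y" := (dt M (X, Y)) (at level 25, left associativity).
Local Notation "f ⊠ g" := (FH (dt M) (f, g)) (at level 25, left associativity).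

Definition RH (Y : dob D) : pdfun D D := dtens (dt M) (did D) (dconst D Y).
Definition LH (X : dob D) : pdfun D D := dtens (dt M) (dconst D X) (did D).

Lemma RH_ax Y : is_pdfun (RH Y).
Proof. exact (dcomp_ax (D := dprodD D D) (dpair_ax (did_ax D) (dconst_ax D Y)) (dt_ax M)). Qed.
Lemma LH_ax X : is_pdfun (LH X).
Proof. exact (dcomp_ax (D := dprodD D D) (dpair_ax (dconst_ax D X) (did_ax D)) (dt_ax M)). Qed.

Lemma hh A : hcomp (hid A) (hid A) = hid (d := D) A.
Proof. apply hunitl; gb. Qed.
Lemma dt_vid f g : FS (dt M) (vidS f, vidS g) = vidS (f ⊠ g).
Proof. apply (FS_vid (dt_ax M) (f, g)). Qed.
(** The constant factor contributes only identity squares, so the compositor of [RH Y] is that of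
    the tensor product at identities in the second slot. *)
Lemma F2cR Y f g : hcod f = hdom g -> F2c (RH Y) f g = F2c (dt M) (f, hid Y) (g, hid Y).
Proof.
intros h; cbn. rewrite hidS_id, dt_vid; apply vr.
refine (eq_trans (F2c_bot (dt M) (f := (f, hid Y)) (g := (g, hid Y)) _) _); cbn; [f_equal; auto; gb|].
rewrite hh; auto.
Qed.
Lemma F2cL X f g : hcod f = hdom g -> F2c (LH X) f g = F2c (dt M) (hid X, f) (hid X, g).
Proof.
intros h; cbn. rewrite hidS_id, dt_vid; apply vr.
refine (eq_trans (F2c_bot (dt M) (f := (hid X, f)) (g := (hid X, g)) _) _); cbn; [f_equal; auto; gb|].
rewrite hh; auto.
Qed.
Lemma F2uR Y A : F2u (RH Y) A = F2u (dt M) (A, Y).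
Proof. cbn. rewrite hidS_id, dt_vid; apply vr, (F2u_bot (dt M)). Qed.
Lemma F2uL X A : F2u (LH X) A = F2u (dt M) (X, A).
Proof. cbn. rewrite hidS_id, dt_vid; apply vr, (F2u_bot (dt M)). Qed.
Lemma FSR Y s : FS (RH Y) s = FS (dt M) (s, vidS (hid Y)).
Proof. cbn. rewrite hidS_id; auto. Qed.
Lemma FSL X s : FS (LH X) s = FS (dt M) (vidS (hid X), s).
Proof. cbn. rewrite hidS_id; auto. Qed.

Lemma dt_nat a b a' b' : rgt a = lft b -> rgt a' = lft b' ->
  (FS (dt M) (a, a') ∥ FS (dt M) (b, b')) ÷ F2c (dt M) (bot a, bot a') (bot b, bot b')
  = F2c (dt M) (top a, top a') (top b, top b') ÷ FS (dt M) (a ∥ b, a' ∥ b').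
Proof. intros e e'. apply (F2c_nat (dt_ax M) (a := (a, a')) (b := (b, b'))). cbn; congruence. Qed.

(** The compositor axiom of [α], freed of the identity squares contributed by the projections. *)
Lemma alpha_comp f g f' g' f'' g'' : hcod f = hdom g -> hcod f' = hdom g' -> hcod f'' = hdom g'' ->
  F2c (dt M) (f ⊠ f', f'') (g ⊠ g', g'') ÷ FS (dt M) (F2c (dt M) (f, f') (g, g'), vidS (hcomp f'' g''))
    ÷ va_h (dalpha M) (hcomp f g, hcomp f' g', hcomp f'' g'')
  = (va_h (dalpha M) (f, f', f'') ∥ va_h (dalpha M) (g, g', g''))
    ÷ (F2c (dt M) (f, f' ⊠ f'') (g, g' ⊠ g'') ÷ FS (dt M) (vidS (hcomp f g), F2c (dt M) (f', f'') (g', g''))).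
Proof.
intros e e' e''.
assert (q := va_comp (dalpha M) (f := (f, f', f'')) (g := (g, g', g''))). cbn in q.
assert (vv : forall k, vidS k ÷ vidS k = vidS (d := D) k) by (intros k; apply v1, top_vid).
rewrite !vv, !dt_vid in q.
assert (d : forall a b a' b', hcod a = hdom b -> hcod a' = hdom b' -> F2c (dt M) (a, a') (b, b') ÷ vidS (hcomp a b ⊠ hcomp a' b') = F2c (dt M) (a, a') (b, b')).
{ intros a b a' b' h h'; apply vr, (F2c_bot (dt M) (f := (a, a')) (g := (b, b'))); cbn; congruence. }
rewrite !d in q by auto.
apply q; congruence.
Qed.

Lemma visoS_tsq (f g : dh D) (s : tsq f g) (t : tsq g f) : tcomp s t = tid f -> tcomp t s = tid g -> visoS s.
Proof.
intros e e'; exists t; rewrite !tv_top, !tv_bot.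
split; [|split; [|split]]; auto; [exact (f_equal (@tv _ _ _) e)|exact (f_equal (@tv _ _ _) e')].
Qed.
Lemma visoS_dt a b : visoS a -> visoS b -> visoS (FS (dt M) (a, b)).
Proof.
intros (a' & a1 & a2 & a3 & a4) (b' & b1 & b2 & b3 & b4); exists (FS (dt M) (a', b')).
assert (q := FS_vcomp (dt_ax M) (a := (a, b)) (b := (a', b'))).
assert (q' := FS_vcomp (dt_ax M) (a := (a', b')) (b := (a, b))).
cbn in q, q'. rewrite !FS_top, !FS_bot, <- q, <- q' by congruence; cbn.
rewrite a3, a4, b3, b4, !dt_vid; split; [|split; [|split]]; auto; f_equal; congruence.
Qed.
Lemma visoS_κ X Y : visoS (κ M X Y).
Proof. apply (visoS_tsq (κK M X Y) (κiK M X Y)). Qed.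
Lemma visoS_κi X Y : visoS (κi M X Y).
Proof. apply (visoS_tsq (κiK M X Y) (κK M X Y)). Qed.
Lemma visoS_u0 : visoS (F2u (dI M) tt).
Proof.
exists (F2u' (dI M) tt). rewrite F2u_top, F2u_bot, F2u'_top, F2u'_bot.
split; [|split; [|split]]; auto; [exact (F2u_inv (dI_ax M) tt)|exact (F2u'_inv (dI_ax M) tt)].
Qed.

Lemma dt_idv A B : FV (dt M) (vid A, vid B) = vid (A ⊗ B).
Proof. apply (FV_id (dt M) (A, B)). Qed.

Local Notation "s ⋆ t" := (tcomp s t) (at level 42, right associativity).
Local Notation "s ⊛ t" := (tten M s t) (at level 36, left associativity).

Definition tsq_of (s : dsq D) : tsq (top s) (bot s) := {| tv := s; tv_top := eq_refl; tv_bot := eq_refl |}.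

Lemma dt_merge a b a' b' : bot a = top b -> bot a' = top b' ->
  FS (dt M) (a ÷ b, a' ÷ b') = FS (dt M) (a, a') ÷ FS (dt M) (b, b').
Proof. intros e e'; apply (FS_vcomp (dt_ax M) (a := (a, a')) (b := (b, b'))); cbn; congruence. Qed.
(** Vertical pasting of two equations that share the squares [Q] and [R]; it joins the compositor
    axiom of [α] to that of [κ]. *)
Lemma chain (P A S L Q R T U : dsq D) : P ÷ A = L ÷ (Q ÷ R) -> T ÷ U = Q ÷ (R ÷ S) ->
  bot P = top A -> bot A = top S -> bot L = top Q -> bot Q = top R -> bot R = top S -> bot L = top T -> bot T = top U ->
  P ÷ (A ÷ S) = L ÷ T ÷ U.
Proof.
intros e e' b1 b2 b3 b4 b5 b6 b7.
rewrite <- vA, e, !vA, e'; auto; rewrite ?top_vcomp, ?bot_vcomp; auto.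
Qed.
Ltac bx := first [solve [gb] | solve [gb; rewrite ?hh; gb] | idtac].

Lemma κ_comp X Y : F2c (dt M) (hid X, hid Y) (hid X, hid Y) ÷ F2u' (dt M) (X, Y) = F2u' (dt M) (X, Y) ∥ F2u' (dt M) (X, Y).
Proof. exact (F2u'_comp (dt_ax M) (@pair_hd D) (@pair_hc D) (X, Y)). Qed.
Lemma κi_comp X Y : (F2u (dt M) (X, Y) ∥ F2u (dt M) (X, Y)) ÷ F2c (dt M) (hid X, hid Y) (hid X, hid Y) = F2u (dt M) (X, Y).
Proof. exact (F2u_comp (dt_ax M) (@pair_hh D) (@pair_hd D) (@pair_hc D) (X, Y)). Qed.

(** Compatibility with compositors combines that of [α] with the merging of adjacent [κ] through the
    compositor ([κ_comp]). Compatibility with unitors is [hα_eq], one comparison moved across. *)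
Lemma A1_strict Y Z : vstrict (dcomp (RH Y) (RH Z)) (RH (Y ⊗ Z)) (fun X => dalpha M (X, Y, Z)) (fun k => a1t M Y Z k).
Proof.
assert (n : forall k, bot (va_h (dalpha M) (k, hid Y, hid Z)) = top (FS (dt M) (vidS k, tv (κ M Y Z)))).
{ intros k; rewrite FS_top; refine (eq_trans (va_bot (dalpha M) _) _); cbn; rewrite top_vid, F2u'_top; auto. }
split.
- intros A; apply (va_dom (dalpha M)).
- intros A; apply (va_cod (dalpha M)).
- intros k; apply tv_top.
- intros k; apply tv_bot.
- intros k; cbn; rewrite lft_vcomp, FS_lft, va_lft by apply n; cbn. rewrite lft_vid, F2u'_lft, !hdom_id; cbn.
  rewrite dt_idv; apply ur, (va_cod (dalpha M)).
- intros k; cbn; rewrite rgt_vcomp, FS_rgt, va_rgt by apply n; cbn. rewrite rgt_vid, F2u'_rgt, !hcod_id; cbn.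
  rewrite dt_idv; apply ur, (va_cod (dalpha M)).
- intros k; apply visoS_comp; [apply n| |].
  + apply (visoS_vi (dalpha_inv M _)).
  + apply visoS_dt; [apply visoS_id|apply visoS_κ].
- intros v. assert (q := va_nat (dalpha M) (v, vid Y, vid Z)); cbn in q |- *. rewrite !vcod_id, !vdom_id, dt_idv in q; exact q.
- intros s. rewrite FSR. change (FS (dcomp (RH Y) (RH Z)) s) with (FS (RH Z) (FS (RH Y) s)). rewrite !FSR.
  refine (f_equal (@tv _ _ _) (_ : (tsq_of s ⊛ tid _) ⊛ tid _ ⋆ a1t M Y Z (bot s) = a1t M Y Z (top s) ⋆ tsq_of s ⊛ tid _)).
  unfold a1t. rewrite tα_nat', tten_id, tA, tten_swap; auto.
- split.
  + intros f g h.
    change (F2c (dcomp (RH Y) (RH Z)) f g) with (F2c (RH Z) (FH (RH Y) f) (FH (RH Y) g) ÷ FS (RH Z) (F2c (RH Y) f g)).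
    rewrite FSR, !F2cR; auto; [|rewrite FH_cod, FH_dom; congruence].
    assert (q := alpha_comp (f' := hid Y) (g' := hid Y) (f'' := hid Z) (g'' := hid Z) h ltac:(gb) ltac:(gb)).
    rewrite !hh in q.
    assert (e1 : rgt (va_h (dalpha M) (f, hid Y, hid Z)) = lft (va_h (dalpha M) (g, hid Y, hid Z))).
    { rewrite va_rgt, va_lft; cbn. rewrite h, !hdom_id, !hcod_id; auto. }
    assert (e2 : rgt (tv (κ M Y Z)) = lft (tv (κ M Y Z))) by (cbn; rewrite F2u'_rgt, F2u'_lft; auto).
    assert (e3 : rgt (vidS f) = lft (vidS g)) by (rewrite rgt_vid, lft_vid, h; auto).
    assert (N := dt_nat e3 e2); cbn in N. rewrite !bot_vid, !top_vid, !F2u'_top, !F2u'_bot in N; cbn in N.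
    rewrite <- vidS_h, <- κ_comp in N by auto.
    rewrite <- (v1 (s := vidS (hcomp f g)) (top_vid _)) in N.
    rewrite dt_merge in N by bx.
    cbn [a1t tcomp tten tα tid tv κ]. rewrite <- exch by bx.
    apply (chain q N); bx.
  + intros A.
    change (F2u (dcomp (RH Y) (RH Z)) A) with (F2u (RH Z) (RH Y A) ÷ FS (RH Z) (F2u (RH Y) A)).
    rewrite FSR, !F2uR.
    refine (f_equal (@tv _ _ _) (_ : (κi M (A ⊗ Y) Z ⋆ κi M A Y ⊛ tid _) ⋆ a1t M Y Z (hid A) = hα M A Y Z ⋆ κi M A (Y ⊗ Z))).
    assert (q := f_equal (fun z => z ⋆ tid _ ⊛ κ M Y Z) (hα_eq M A Y Z)); cbn beta in q.
    rewrite !tA, <- tten_r, κiK, tten_id, tr in q. unfold a1t; rewrite !tA; exact q.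
Qed.

Lemma A2_strict X Z : vstrict (dcomp (LH X) (RH Z)) (dcomp (RH Z) (LH X)) (fun Y => dalpha M (X, Y, Z)) (fun k => a2t M X Z k).
Proof.
split.
- intros A; apply (va_dom (dalpha M)).
- intros A; apply (va_cod (dalpha M)).
- intros k; apply tv_top.
- intros k; apply tv_bot.
- intros k; refine (eq_trans (va_lft (dalpha M) _) _); cbn; rewrite !hdom_id; auto.
- intros k; refine (eq_trans (va_rgt (dalpha M) _) _); cbn; rewrite !hcod_id; auto.
- intros k; apply (visoS_vi (dalpha_inv M _)).
- intros v. assert (q := va_nat (dalpha M) (vid X, v, vid Z)); cbn in q |- *. rewrite !vcod_id, !vdom_id in q; exact q.
- intros s. change (FS (RH Z) (FS (LH X) s) ÷ a2t M X Z (bot s) = a2t M X Z (top s) ÷ FS (LH X) (FS (RH Z) s)). rewrite !FSR, !FSL.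
  exact (f_equal (@tv _ _ _) (tα_nat M (tid _) (tsq_of s) (tid _))).
- split.
  + intros f g h.
    change (F2c (RH Z) (FH (LH X) f) (FH (LH X) g) ÷ FS (RH Z) (F2c (LH X) f g) ÷ va_h (dalpha M) (hid X, hcomp f g, hid Z)
      = (va_h (dalpha M) (hid X, f, hid Z) ∥ va_h (dalpha M) (hid X, g, hid Z)) ÷ (F2c (LH X) (FH (RH Z) f) (FH (RH Z) g) ÷ FS (LH X) (F2c (RH Z) f g))).
    rewrite FSR, FSL, !F2cR, !F2cL by (rewrite ?FH_cod, ?FH_dom; congruence).
    assert (q := alpha_comp (f := hid X) (g := hid X) (f'' := hid Z) (g'' := hid Z) ltac:(gb) h ltac:(gb)).
    rewrite !hh in q; exact q.
  + intros A.
    change (F2u (RH Z) (LH X A) ÷ FS (RH Z) (F2u (LH X) A) ÷ a2t M X Z (hid A)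
      = hidS (dalpha M (X, A, Z)) ÷ (F2u (LH X) (RH Z A) ÷ FS (LH X) (F2u (RH Z) A))).
    rewrite FSR, FSL, !F2uR, !F2uL.
    refine (f_equal (@tv _ _ _) (_ : (κi M (X ⊗ A) Z ⋆ κi M X A ⊛ tid _) ⋆ a2t M X Z (hid A) = hα M X A Z ⋆ κi M X (A ⊗ Z) ⋆ tid _ ⊛ κi M A Z)).
    rewrite tA; apply hα_eq.
Qed.

Lemma A3_strict X Y : vstrict (LH (X ⊗ Y)) (dcomp (LH Y) (LH X)) (fun Z => dalpha M (X, Y, Z)) (fun k => a3t M X Y k).
Proof.
assert (n : forall k, bot (FS (dt M) (tv (κi M X Y), vidS k)) = top (va_h (dalpha M) (hid X, hid Y, k))).
{ intros k; rewrite FS_bot; refine (eq_trans _ (eq_sym (va_top (dalpha M) _))); cbn; rewrite bot_vid, F2u_bot; auto. }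
split.
- intros A; apply (va_dom (dalpha M)).
- intros A; apply (va_cod (dalpha M)).
- intros k; apply tv_top.
- intros k; apply tv_bot.
- intros k; cbn; rewrite lft_vcomp, FS_lft, va_lft by apply n; cbn. rewrite lft_vid, F2u_lft, !hdom_id; cbn.
  rewrite dt_idv; apply u1, (va_dom (dalpha M)).
- intros k; cbn; rewrite rgt_vcomp, FS_rgt, va_rgt by apply n; cbn. rewrite rgt_vid, F2u_rgt, !hcod_id; cbn.
  rewrite dt_idv; apply u1, (va_dom (dalpha M)).
- intros k; apply visoS_comp; [apply n| |].
  + apply visoS_dt; [apply visoS_κi|apply visoS_id].
  + apply (visoS_vi (dalpha_inv M _)).
- intros v. assert (q := va_nat (dalpha M) (vid X, vid Y, v)); cbn in q |- *. rewrite !vcod_id, !vdom_id, dt_idv in q; exact q.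
- intros s. change (FS (LH (X ⊗ Y)) s ÷ a3t M X Y (bot s) = a3t M X Y (top s) ÷ FS (LH X) (FS (LH Y) s)). rewrite !FSL.
  refine (f_equal (@tv _ _ _) (_ : tid _ ⊛ tsq_of s ⋆ a3t M X Y (bot s) = a3t M X Y (top s) ⋆ tid _ ⊛ (tid _ ⊛ tsq_of s))).
  unfold a3t. rewrite tA, <- tα_nat, tten_id, <- !tA, tten_swap; auto.
- split.
  + intros f g h.
    change (F2c (LH (X ⊗ Y)) f g ÷ a3t M X Y (hcomp f g)
      = (a3t M X Y f ∥ a3t M X Y g) ÷ (F2c (LH X) (FH (LH Y) f) (FH (LH Y) g) ÷ FS (LH X) (F2c (LH Y) f g))).
    rewrite FSL, !F2cL by (rewrite ?FH_cod, ?FH_dom; congruence).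
    assert (q := alpha_comp (f := hid X) (g := hid X) (f' := hid Y) (g' := hid Y) ltac:(gb) ltac:(gb) h).
    rewrite !hh in q.
    assert (e1 : rgt (va_h (dalpha M) (hid X, hid Y, f)) = lft (va_h (dalpha M) (hid X, hid Y, g))).
    { rewrite va_rgt, va_lft; cbn. rewrite h, !hdom_id, !hcod_id; auto. }
    assert (e2 : rgt (tv (κi M X Y)) = lft (tv (κi M X Y))) by (cbn; rewrite F2u_rgt, F2u_lft; auto).
    assert (e3 : rgt (vidS f) = lft (vidS g)) by (rewrite rgt_vid, lft_vid, h; auto).
    assert (N := dt_nat e2 e3); cbn in N. rewrite !bot_vid, !top_vid, !F2u_top, !F2u_bot in N; cbn in N.
    rewrite <- vidS_h in N by auto.
    assert (N2 : F2c (dt M) (hid (X ⊗ Y), f) (hid (X ⊗ Y), g) ÷ FS (dt M) (F2u (dt M) (X, Y), vidS (hcomp f g))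
      = (FS (dt M) (F2u (dt M) (X, Y), vidS f) ∥ FS (dt M) (F2u (dt M) (X, Y), vidS g)) ÷ (F2c (dt M) (hid X ⊠ hid Y, f) (hid X ⊠ hid Y, g)
        ÷ FS (dt M) (F2c (dt M) (hid X, hid Y) (hid X, hid Y), vidS (hcomp f g)))).
    { rewrite <- vA, N, vA, <- dt_merge, κi_comp, v1 by bx; auto. }
    cbn [a3t tcomp tten tα tid tv κi]. rewrite <- exch by bx.
    rewrite <- vA, N2, !vA by bx. rewrite <- (vA (s1 := F2c _ _ _)), q by bx. reflexivity.
  + intros A.
    change (F2u (LH (X ⊗ Y)) A ÷ a3t M X Y (hid A)
      = hidS (dalpha M (X, Y, A)) ÷ (F2u (LH X) (LH Y A) ÷ FS (LH X) (F2u (LH Y) A))).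
    rewrite FSL, !F2uL.
    refine (f_equal (@tv _ _ _) (_ : κi M (X ⊗ Y) A ⋆ a3t M X Y (hid A) = hα M X Y A ⋆ κi M X (Y ⊗ A) ⋆ tid _ ⊛ κi M Y A)).
    apply hα_eq.
Qed.

Lemma u0_comp : (F2u (dI M) tt ∥ F2u (dI M) tt) ÷ F2c (dI M) tt tt = F2u (dI M) tt.
Proof.
apply (F2u_comp (C := dunit) (dI_ax M)); intros []; reflexivity.
Qed.

(** As for the associator, with [u0_comp] merging two adjacent unitors of the unit object. *)
Lemma L_strict : vstrict (LH I) (did D) (fun X => dlambda M X) (fun k => luk M k).
Proof.
assert (n : forall k, bot (FS (dt M) (F2u (dI M) tt, vidS k)) = top (va_h (dlambda M) k)).
{ intros k; rewrite FS_bot; refine (eq_trans _ (eq_sym (va_top (dlambda M) _))); cbn; rewrite bot_vid, F2u_bot; auto. }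
split.
- intros A; apply (va_dom (dlambda M)).
- intros A; apply (va_cod (dlambda M)).
- intros k; apply tv_top.
- intros k; apply tv_bot.
- intros k; cbn; rewrite lft_vcomp, FS_lft, va_lft by apply n; cbn. rewrite lft_vid, F2u_lft; cbn.
  rewrite dt_idv; apply u1, (va_dom (dlambda M)).
- intros k; cbn; rewrite rgt_vcomp, FS_rgt, va_rgt by apply n; cbn. rewrite rgt_vid, F2u_rgt; cbn.
  rewrite dt_idv; apply u1, (va_dom (dlambda M)).
- intros k; apply visoS_comp; [apply n| |].
  + apply visoS_dt; [apply visoS_u0|apply visoS_id].
  + apply (visoS_vi (dlambda_inv M _)).
- intros v. assert (q := va_nat (dlambda M) v); cbn in q |- *.
  rewrite (FV_id (dI M) tt : FV (dI M) tt = _) in q; exact q.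
- intros s. rewrite FSL.
  refine (f_equal (@tv _ _ _) (_ : tid _ ⊛ tsq_of s ⋆ luk M (bot s) = luk M (top s) ⋆ tsq_of s)).
  unfold luk. rewrite tA, <- tλ_nat, <- !tA, tten_swap; auto.
- split.
  + intros f g h. change (F2c (LH I) f g ÷ luk M (hcomp f g) = (luk M f ∥ luk M g) ÷ vidS (hcomp f g)).
    rewrite F2cL by auto.
    assert (q := va_comp (dlambda M) h); cbn in q.
    rewrite (FS_vid (dI_ax M) tt : FS (dI M) tt = _), (vr (s := F2c (dI M) tt tt)) in q by (apply (F2c_bot (dI M) (f := tt) (g := tt)); auto).
    assert (e1 : rgt (va_h (dlambda M) f) = lft (va_h (dlambda M) g)) by (rewrite va_rgt, va_lft, h; auto).
    assert (e2 : rgt (F2u (dI M) tt) = lft (F2u (dI M) tt)) by (rewrite F2u_rgt, F2u_lft; auto).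
    assert (e3 : rgt (vidS f) = lft (vidS g)) by (rewrite rgt_vid, lft_vid, h; auto).
    assert (N := dt_nat e2 e3); cbn in N. rewrite !bot_vid, !top_vid, !F2u_top, !F2u_bot in N; cbn in N.
    rewrite <- vidS_h in N by auto.
    assert (c0 : hcod (FH (dI M) tt) = hdom (FH (dI M) tt)) by (rewrite FH_cod, FH_dom; auto).
    assert (t0 := F2c_top (dI M) (f := tt) (g := tt) eq_refl). assert (b0 := F2c_bot (dI M) (f := tt) (g := tt) eq_refl). cbn in t0, b0.
    assert (N2 : F2c (dt M) (hid I, f) (hid I, g) ÷ FS (dt M) (F2u (dI M) tt, vidS (hcomp f g))
      = (FS (dt M) (F2u (dI M) tt, vidS f) ∥ FS (dt M) (F2u (dI M) tt, vidS g)) ÷ (F2c (dt M) (FH (dI M) tt, f) (FH (dI M) tt, g)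
        ÷ FS (dt M) (F2c (dI M) tt tt, vidS (hcomp f g)))).
    { rewrite <- vA, N, vA, <- dt_merge, u0_comp, v1 by bx; auto. all: rewrite ?t0; bx. }
    cbn [luk tcomp tten tλ tid tv u0]. rewrite <- exch by bx.
    rewrite <- vA, N2, !vA by (rewrite ?t0, ?b0; bx).
    rewrite <- (vA (s1 := F2c _ _ _)), q by bx. reflexivity.
  + intros A. rewrite F2uL. change (κi M I A ⋆ luk M (hid A) = hidS (dlambda M A) ÷ vidS (hid A) :> dsq D).
    rewrite vr by gb. exact (f_equal (@tv _ _ _) (hλ_eq M A)).
Qed.

(** Tensoring with a vertical isomorphism is strictly natural in the remaining variable. Applied to
    the vertical cell of a companion frame, this yields the central structures. *)
Lemma CL_strict A A' u : vdom u = A -> vcod u = A' -> viso u ->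
  vstrict (LH A) (LH A') (fun Y => FV (dt M) (u, vid Y)) (fun k => FS (dt M) (hidS u, vidS k)).
Proof.
intros d c i; split.
- intros Y; rewrite FV_dom; cbn; rewrite d, vdom_id; auto.
- intros Y; rewrite FV_cod; cbn; rewrite c, vcod_id; auto.
- intros k; rewrite FS_top; cbn; rewrite top_hid, top_vid, d; auto.
- intros k; rewrite FS_bot; cbn; rewrite bot_hid, bot_vid, c; auto.
- intros k; rewrite FS_lft; cbn; rewrite lft_hid, lft_vid; auto.
- intros k; rewrite FS_rgt; cbn; rewrite rgt_hid, rgt_vid; auto.
- intros k; apply visoS_dt; [apply visoS_hid, i|apply visoS_id].
- intros v; cbn. rewrite <- (FV_comp (dt_ax M) (u := (vid A, v)) (v := (u, vid (vcod v)))), <- (FV_comp (dt_ax M) (u := (u, vid (vdom v))) (v := (vid A', v))); cbn.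
  + rewrite !u1, !ur; auto.
  + rewrite vcod_id, vdom_id, c; auto.
  + rewrite vcod_id, vdom_id, d; auto.
- intros s. rewrite !FSL, <- !dt_merge; cbn; rewrite ?top_hid, ?bot_hid, ?top_vid, ?bot_vid, ?d, ?c; auto.
  rewrite (v1 (s := hidS u)), (vr (s := hidS u)), v1, vr; rewrite ?top_hid, ?bot_hid, ?d, ?c; auto.
- split.
  + intros f g h. rewrite !F2cL by auto.
    assert (e2 : rgt (hidS u) = lft (hidS u)) by (rewrite rgt_hid, lft_hid; auto).
    assert (e3 : rgt (vidS f) = lft (vidS g)) by (rewrite rgt_vid, lft_vid, h; auto).
    assert (N := dt_nat e2 e3). rewrite !top_hid, !bot_hid, !top_vid, !bot_vid, h1, <- vidS_h, d, c in N by (rewrite ?lft_hid; auto).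
    symmetry; exact N.
  + intros Y. rewrite !F2uL. assert (q := F2u_nat (dt_ax M) (u, vid Y)); cbn in q.
    rewrite d, c, vdom_id, vcod_id, hidS_id in q. symmetry; exact q.
Qed.
Lemma R_strict : vstrict (RH I) (did D) (fun X => drho M X) (fun k => ruk M k).
Proof.
assert (n : forall k, bot (FS (dt M) (vidS k, F2u (dI M) tt)) = top (va_h (drho M) k)).
{ intros k; rewrite FS_bot; refine (eq_trans _ (eq_sym (va_top (drho M) _))); cbn; rewrite bot_vid, F2u_bot; auto. }
split.
- intros A; apply (va_dom (drho M)).
- intros A; apply (va_cod (drho M)).
- intros k; apply tv_top.
- intros k; apply tv_bot.
- intros k; cbn; rewrite lft_vcomp, FS_lft, va_lft by apply n; cbn. rewrite lft_vid, F2u_lft; cbn.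
  rewrite dt_idv; apply u1, (va_dom (drho M)).
- intros k; cbn; rewrite rgt_vcomp, FS_rgt, va_rgt by apply n; cbn. rewrite rgt_vid, F2u_rgt; cbn.
  rewrite dt_idv; apply u1, (va_dom (drho M)).
- intros k; apply visoS_comp; [apply n| |].
  + apply visoS_dt; [apply visoS_id|apply visoS_u0].
  + apply (visoS_vi (drho_inv M _)).
- intros v. assert (q := va_nat (drho M) v); cbn in q |- *.
  rewrite (FV_id (dI M) tt : FV (dI M) tt = _) in q; exact q.
- intros s. rewrite FSR.
  refine (f_equal (@tv _ _ _) (_ : tsq_of s ⊛ tid _ ⋆ ruk M (bot s) = ruk M (top s) ⋆ tsq_of s)).
  unfold ruk. rewrite tA, <- tρ_nat, <- !tA, <- tten_swap; auto.
- split.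
  + intros f g h. change (F2c (RH I) f g ÷ ruk M (hcomp f g) = (ruk M f ∥ ruk M g) ÷ vidS (hcomp f g)).
    rewrite F2cR by auto.
    assert (q := va_comp (drho M) h); cbn in q.
    rewrite (FS_vid (dI_ax M) tt : FS (dI M) tt = _), (vr (s := F2c (dI M) tt tt)) in q by (apply (F2c_bot (dI M) (f := tt) (g := tt)); auto).
    assert (e1 : rgt (va_h (drho M) f) = lft (va_h (drho M) g)) by (rewrite va_rgt, va_lft, h; auto).
    assert (e2 : rgt (F2u (dI M) tt) = lft (F2u (dI M) tt)) by (rewrite F2u_rgt, F2u_lft; auto).
    assert (e3 : rgt (vidS f) = lft (vidS g)) by (rewrite rgt_vid, lft_vid, h; auto).
    assert (N := dt_nat e3 e2); cbn in N. rewrite !bot_vid, !top_vid, !F2u_top, !F2u_bot in N; cbn in N.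
    rewrite <- vidS_h in N by auto.
    assert (c0 : hcod (FH (dI M) tt) = hdom (FH (dI M) tt)) by (rewrite FH_cod, FH_dom; auto).
    assert (t0 := F2c_top (dI M) (f := tt) (g := tt) eq_refl). assert (b0 := F2c_bot (dI M) (f := tt) (g := tt) eq_refl). cbn in t0, b0.
    assert (N2 : F2c (dt M) (f, hid I) (g, hid I) ÷ FS (dt M) (vidS (hcomp f g), F2u (dI M) tt)
      = (FS (dt M) (vidS f, F2u (dI M) tt) ∥ FS (dt M) (vidS g, F2u (dI M) tt)) ÷ (F2c (dt M) (f, FH (dI M) tt) (g, FH (dI M) tt)
        ÷ FS (dt M) (vidS (hcomp f g), F2c (dI M) tt tt))).
    { rewrite <- vA, N, vA, <- dt_merge, u0_comp, v1 by bx; auto. all: rewrite ?t0; bx. }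
    cbn [ruk tcomp tten tρ tid tv u0]. rewrite <- exch by bx.
    rewrite <- vA, N2, !vA by (rewrite ?t0, ?b0; bx).
    rewrite <- (vA (s1 := F2c _ _ _)), q by bx. reflexivity.
  + intros A. rewrite F2uR. change (κi M A I ⋆ ruk M (hid A) = hidS (drho M A) ÷ vidS (hid A) :> dsq D).
    rewrite vr by gb. exact (f_equal (@tv _ _ _) (hρ_eq M A)).
Qed.


Lemma CR_strict A A' u : vdom u = A -> vcod u = A' -> viso u ->
  vstrict (RH A) (RH A') (fun Y => FV (dt M) (vid Y, u)) (fun k => FS (dt M) (vidS k, hidS u)).
Proof.
intros d c i; split.
- intros Y; rewrite FV_dom; cbn; rewrite d, vdom_id; auto.
- intros Y; rewrite FV_cod; cbn; rewrite c, vcod_id; auto.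
- intros k; rewrite FS_top; cbn; rewrite top_hid, top_vid, d; auto.
- intros k; rewrite FS_bot; cbn; rewrite bot_hid, bot_vid, c; auto.
- intros k; rewrite FS_lft; cbn; rewrite lft_hid, lft_vid; auto.
- intros k; rewrite FS_rgt; cbn; rewrite rgt_hid, rgt_vid; auto.
- intros k; apply visoS_dt; [apply visoS_id|apply visoS_hid, i].
- intros v; cbn. rewrite <- (FV_comp (dt_ax M) (u := (v, vid A)) (v := (vid (vcod v), u))), <- (FV_comp (dt_ax M) (u := (vid (vdom v), u)) (v := (v, vid A'))); cbn.
  + rewrite !u1, !ur; auto.
  + rewrite vcod_id, vdom_id, c; auto.
  + rewrite vcod_id, vdom_id, d; auto.
- intros s. rewrite !FSR, <- !dt_merge; cbn; rewrite ?top_hid, ?bot_hid, ?top_vid, ?bot_vid, ?d, ?c; auto.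
  rewrite (v1 (s := hidS u)), (vr (s := hidS u)), v1, vr; rewrite ?top_hid, ?bot_hid, ?d, ?c; auto.
- split.
  + intros f g h. rewrite !F2cR by auto.
    assert (e2 : rgt (hidS u) = lft (hidS u)) by (rewrite rgt_hid, lft_hid; auto).
    assert (e3 : rgt (vidS f) = lft (vidS g)) by (rewrite rgt_vid, lft_vid, h; auto).
    assert (N := dt_nat e3 e2). rewrite !top_hid, !bot_hid, !top_vid, !bot_vid, h1, <- vidS_h, d, c in N by (rewrite ?lft_hid; auto).
    symmetry; exact N.
  + intros Y. rewrite !F2uR. assert (q := F2u_nat (dt_ax M) (vid Y, u)); cbn in q.
    rewrite d, c, vdom_id, vcod_id, hidS_id in q. symmetry; exact q.
Qed.
End Constraints.

(** * Extending functors to the Kleisli bicategory *)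

Section KleisliExtension.
Context (D : double_category) (V : vertical_monad D).
Context (imu : invertible (dmu V)) (ieta : invertible (deta V)).
Context (lmu : liftable (dmu V)) (leta : liftable (deta V)).
Local Notation HD := (Horiz D).
Local Notation φ1 := (horizfr D).
Local Notation ax1 := (ax1 D).
Local Notation HT := (Hmonad imu ieta lmu leta).
Local Notation K := (kleisli HT).
Local Notation η := (deta V).
Local Notation ei := (ei ieta).
Local Notation ψ := (kleislifr imu ieta lmu leta).
Local Notation n1 := (@Heta1 D V leta).
Local Notation eE := (eE leta).

(** The companion frame of [[f | η]] in the Kleisli bicategory, for [f] with
    companion frame [e] in the horizontal bicategory. *)
Definition jE (Y : dob D) (e : dsq D) : dsq D := (e ÷ hidS (η Y)) ∥ eE Y ÷ hidS (ei Y).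

Lemma cf_J (X Y : HD) (f : hom X Y) e : cf (φ := φ1) f e ->
  cf (φ := ψ) (X := X) (Y := Y) (comp1 f (n1 Y)) (jE Y e) /\ lft (jE Y e) = lft e.
Proof.
intros h.
assert (c := fc_cf ax1 h (cf_E ieta leta Y)).
assert (l : lft (eE Y) = η Y) by apply (eps_lft (leta Y)). rewrite l in c.
change (cf (φ := φ1) (comp1 f (n1 Y)) ((e ÷ hidS (η Y)) ∥ eE Y)) in c.
assert (q := cf_post ax1 c (a := ei Y) (ei_dom ieta Y)).
assert (e1 : lft ((e ÷ hidS (η Y)) ∥ eE Y) = lft e ∙ η Y).
{ rewrite lft_hcomp; [apply (fr_lft (cf_post ax1 h (a := η Y) (va_dom η Y)))|].
  rewrite l. refine (fr_rgt (cf_post ax1 h (a := η Y) (va_dom η Y))). }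
assert (e2 : lft e ∙ η Y ∙ ei Y = lft e).
{ rewrite uA, ei_l, ur; auto; rewrite ?(cf_cod h), ?va_dom, ?va_cod, ?ei_dom; auto. }
rewrite e1, e2 in q.
assert (e3 : lft (jE Y e) = lft e) by apply (fr_lft q).
split; auto; split.
- split; [apply (fr_top q)|reflexivity| |apply vdom_id].
  refine (eq_trans (fr_rgt q) _); cbn; symmetry; apply ur, ei_cod.
- refine (eq_trans (cf_post_bot c (a := ei Y) (ei_dom ieta Y)) _); rewrite ei_cod; auto.
- apply (cf_post_iso c (ei_dom ieta Y)), ei_iso.
Qed.

Local Notation axK := (kleisli_framing imu ieta lmu leta).

Section Extension.
Context (G : pdfun D D) (Q : is_pdfun G).
Context (G1 : forall X Y : HD, hom X Y -> @hom HD (G X) (G Y)).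
Context (g1 : forall X Y (f : @hom HD X Y), hval (G1 f) = FH G (hval f)).
Context (t1 : forall Z : dob D, @hom HD (G (V Z)) (V (G Z))) (eS : dob D -> dsq D).
Context (c : forall Z, cf (φ := φ1) (t1 Z) (eS Z)) (l : forall Z, FV G (η Z) ∙ lft (eS Z) = η (G Z)).

(** One construction serves both strengths: [G] is [LH A] with the left strength as [t1], or [RH A]
    with the right one. *)
Definition kext (X Y : K) (f : @hom K X Y) : @hom K (G X) (G Y) :=
  peval ⟪G1 (f : @hom HD X (V Y)); t1 Y⟫.
(** [rgt π] is [e_Y / b], so [η Y ∙ rgt π] recovers [b]. *)
Definition kfr (X Y : K) (f : @hom K X Y) (π : dsq D) : dsq D :=
  FS G π ∥ (eS Y ÷ hidS (ei (G Y) ∙ FV G (η Y ∙ rgt π))).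

Lemma viso_FV v : viso v -> viso (FV G v).
Proof.
intros (w & w1 & w2 & w3 & w4); exists (FV G w).
rewrite <- !(FV_comp Q), w3, w4, !FV_id, !FV_dom, !FV_cod; auto; repeat split; congruence.
Qed.
(** The unit law [l] with [η] inverted on both sides. It brings the vertical cell between the two
    factors of an extended frame to the image under [G] of the right side [ei Y ∙ b] of the given
    frame. *)
Lemma tau_ei Z : lft (eS Z) ∙ ei (G Z) = FV G (ei Z).
Proof.
assert (d := cf_dom ax1 (c Z)); assert (d' := cf_cod (c Z)); cbn in d, d'.
apply (viso_inj (u := FV G (η Z))).
- apply viso_FV, (eta_iso ieta).
- rewrite vdom_comp, d, FV_cod, va_cod; auto. rewrite d', ei_dom; auto.
- rewrite FV_dom, FV_cod, va_cod, ei_dom; auto.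
- rewrite <- (FV_comp Q), ei_l, FV_id, <- uA, l, ei_l; auto; rewrite ?FV_cod, ?va_cod, ?d, ?d', ?ei_dom; auto.
Qed.

Lemma kfr_frames (X Y : K) (f : @hom K X Y) a b π : fr ψ f a b π ->
  kfr f π = FS G π ∥ (eS Y ÷ hidS (ei (G Y) ∙ FV G b)) /\
  fr φ1 (G1 (f : @hom HD X (V Y))) (FV G a) (FV G (ei Y ∙ b)) (FS G π) /\
  fr φ1 (t1 Y) (FV G (ei Y ∙ b)) (ei (G Y) ∙ FV G b) (eS Y ÷ hidS (ei (G Y) ∙ FV G b)) /\
  vdom (ei (G Y) ∙ FV G b) = V (G Y).
Proof.
intros h. assert (d := fr_dom h); cbn in d.
assert (e : η Y ∙ rgt π = b).
{ rewrite (fr_rgt h); cbn. rewrite <- uA, ei_l, u1; auto; rewrite ?va_cod, ?ei_dom, ?ei_cod; auto. }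
assert (dd : vdom (ei (G Y) ∙ FV G b) = V (G Y)).
{ rewrite vdom_comp; rewrite ?ei_dom, ?ei_cod, ?FV_dom, ?d; auto. }
split; [unfold kfr; rewrite e; auto|]. split; [|split; auto].
- apply frH.
  + rewrite FS_top, g1, (fr_top h); auto.
  + rewrite FS_lft, (fr_lft h); auto.
  + rewrite FS_rgt, (fr_rgt h); auto.
- assert (q := cf_post ax1 (c Y) (a := ei (G Y) ∙ FV G b) dd).
  rewrite <- uA, tau_ei, <- (FV_comp Q) in q; auto; rewrite ?ei_cod, ?ei_dom, ?FV_dom, ?d; auto.
  rewrite (cf_cod (c Y)); auto.
Qed.

Lemma kext_fmap : fmap ψ ψ kext G kfr.
Proof.
split.
- intros X; reflexivity.
- intros X Y f a b π h; destruct (kfr_frames h) as (-> & z1 & z2 & z3).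
  assert (q := fc_fr ax1 z1 z2); split; [apply q|apply q|apply q|]. rewrite FV_dom, (fr_dom h); auto.
- intros X Y f a b π h; destruct (kfr_frames h) as (-> & z1 & z2 & z3).
  refine (eq_trans (fc_bot ax1 z1 z2) _). rewrite FS_bot, (cf_post_bot (c Y) z3).
  apply hunitr. destruct (fr_hbot axK h) as [_ e].
  rewrite FH_cod, e, vcod_comp, FV_cod; auto. rewrite ei_cod, FV_dom, (fr_dom h); auto.
- intros X Y f a b π s h e; destruct (kfr_frames h) as (-> & z1 & z2 & z3).
  assert (h' := fr_post axK h e). destruct (kfr_frames h') as (-> & _).
  destruct (fr_hbot axK h) as [_ e'].
  assert (E : vcod b = vdom (rgt s)) by (rewrite <- cod_top, e; auto).
  rewrite (FS_vcomp Q), (FV_comp Q), <- uA, <- (cf_post2 (c Y)); auto.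
  + rewrite <- exch; [| | |rewrite FS_bot, FS_top; congruence|].
    * f_equal; apply hr, FS_rgt.
    * rewrite (fr_rgt z1), (fr_lft z2); auto.
    * rewrite FS_rgt, lft_hid; auto.
    * rewrite (cf_post_bot (c Y) z3), top_hid, vcod_comp, FV_cod, FV_dom, E; auto. rewrite ei_cod, FV_dom, (fr_dom h); auto.
  + rewrite vcod_comp, FV_cod, FV_dom, E; auto. rewrite ei_cod, FV_dom, (fr_dom h); auto.
  + rewrite ei_cod, FV_dom, (fr_dom h); auto.
  + rewrite FV_cod, FV_dom, E; auto.
- intros X Y f a b π h i; destruct (kfr_frames h) as (-> & z1 & z2 & z3).
  assert (vb : viso b).
  { assert (e : η Y ∙ rgt π = b).
    { rewrite (fr_rgt h); cbn. rewrite <- uA, ei_l, u1; auto; rewrite ?va_cod, ?ei_dom, ?ei_cod; try apply (fr_dom h); auto. symmetry; apply (fr_dom h). }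
    rewrite <- e; apply viso_comp; [|apply (eta_iso ieta)|apply visoS_rgt, i].
    rewrite (fr_rgt h); cbn. rewrite vdom_comp, ei_dom, va_cod; auto. rewrite ei_cod; symmetry; apply (fr_dom h). }
  apply visoS_hcomp.
  + rewrite (fr_rgt z1), (fr_lft z2); auto.
  + destruct i as (w & w1 & w2 & w3 & w4); exists (FS G w).
    rewrite <- !(FS_vcomp Q), w3, w4, !(FS_vid Q), !FS_top, !FS_bot; auto; repeat split; congruence.
  + apply (cf_post_iso (c Y) z3), viso_comp; [|apply ei_iso|apply viso_FV, vb].
    rewrite ei_cod, FV_dom, (fr_dom h); auto.
Qed.

Definition Kext := lift_psfun axK axK kext_fmap Q.
Lemma Kext_ff : ffun ψ ψ Kext G kfr.
Proof. apply lift_ff. Qed.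
End Extension.
End KleisliExtension.

(** * The premonoidal structure of the Kleisli bicategory *)

Section KleisliPremonoidal.
Context (D : double_category) (M : monoidal_double D) (V : vertical_monad D).
Context (la : liftable (dalpha M)) (ll : liftable (dlambda M)) (lr : liftable (drho M)).
Context (imu : invertible (dmu V)) (ieta : invertible (deta V)).
Context (lmu : liftable (dmu V)) (leta : liftable (deta V)).
Context (t : left_vstrength M V) (it : invertible t) (lt : liftable t).
Context (s : right_vstrength M V) (is : invertible s) (ls : liftable s).
Local Notation HD := (Horiz D).
Local Notation φ1 := (horizfr D).
Local Notation HM := (Hmonoidal la ll lr).
Local Notation HT := (Hmonad imu ieta lmu leta).
Local Notation K := (kleisli HT).
Local Notation η := (deta V).
Local Notation ei := (ei ieta).
Local Notation ψ := (kleislifr imu ieta lmu leta).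
Local Notation axK := (kleisli_framing imu ieta lmu leta).
Local Notation n1 := (@Heta1 D V leta).
Local Notation jE := (jE ieta leta).
Local Notation "X ⊗ Y" := (ten0 HM X Y) (at level 25, left associativity).
Local Notation I := (uni0 HM).
Local Notation LH := (LH M).
Local Notation RH := (RH M).
Local Notation eT := (eT lt).
Local Notation eS := (eS ls).
Local Notation cf := (cf (φ := ψ)).
Local Notation okc := (okc (φ := ψ)).

Lemma unit_t A Z : FV (LH A) (η Z) ∙ lft (eT A Z) = η (LH A Z).
Proof. unfold Submission.eT; rewrite eps_lft; symmetry; apply (lt_eta t). Qed.
Lemma unit_s A Z : FV (RH A) (η Z) ∙ lft (eS Z A) = η (RH A Z).
Proof. unfold Submission.eS; rewrite eps_lft; symmetry; apply (rt_eta s). Qed.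

Definition KL (A : K) : psfun (B := K) (C := K) (fun Y => A ⊗ Y) :=
  Kext imu ieta lmu leta (LH_ax M A) (G1 := fun X Y f => Hten M # ⟨id1 (A : HD), f⟩) (fun _ _ _ => eq_refl)
    (cf_t la ll lr imu ieta lmu leta it lt A) (unit_t A).
Definition KR (A : K) : psfun (B := K) (C := K) (fun Y => Y ⊗ A) :=
  Kext imu ieta lmu leta (RH_ax M A) (G1 := fun X Y f => Hten M # ⟨f, id1 (A : HD)⟩) (fun _ _ _ => eq_refl)
    (fun Z => cf_s la ll lr imu ieta lmu leta is ls Z A) (unit_s A).

Definition kfL (A X Y : K) (f : @hom K X Y) (π : dsq D) := kfr (LH A) (eT A) f π.
Definition kfR (A X Y : K) (f : @hom K X Y) (π : dsq D) := kfr (RH A) (fun Z => eS Z A) f π.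
Lemma KL_ff A : ffun ψ ψ (KL A) (LH A) (@kfL A).
Proof.
exact (Kext_ff imu ieta lmu leta (LH_ax M A) (G1 := fun X Y f => Hten M # ⟨id1 (A : HD), f⟩) (fun _ _ _ => eq_refl)
    (cf_t la ll lr imu ieta lmu leta it lt A) (unit_t A)).
Qed.
Lemma KR_ff A : ffun ψ ψ (KR A) (RH A) (@kfR A).
Proof.
exact (Kext_ff imu ieta lmu leta (RH_ax M A) (G1 := fun X Y f => Hten M # ⟨f, id1 (A : HD)⟩) (fun _ _ _ => eq_refl)
    (fun Z => cf_s la ll lr imu ieta lmu leta is ls Z A) (unit_s A)).
Qed.

Definition kA (X Y Z : K) := jE (X ⊗ (Y ⊗ Z)) (eA la X Y Z).
Definition kl (X : K) := jE X (eLm ll X).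
Definition kr (X : K) := jE X (eRm lr X).
Definition ka1 (X Y Z : K) : @hom K (X ⊗ Y ⊗ Z) (X ⊗ (Y ⊗ Z)) := comp1 (Has1 la X Y Z) (n1 (X ⊗ (Y ⊗ Z))).
Definition kl1 (X : K) : @hom K (I ⊗ X) X := comp1 (Hlu1 ll X) (n1 X).
Definition kr1 (X : K) : @hom K (X ⊗ I) X := comp1 (Hru1 lr X) (n1 X).

Lemma cf_ka X Y Z : cf (ka1 X Y Z) (kA X Y Z). Proof. apply (cf_J imu ieta lmu leta (cf_a la X Y Z)). Qed.
Lemma cf_kl X : cf (kl1 X) (kl X). Proof. apply (cf_J imu ieta lmu leta (cf_l ll X)). Qed.
Lemma cf_kr X : cf (kr1 X) (kr X). Proof. apply (cf_J imu ieta lmu leta (cf_r lr X)). Qed.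
Lemma lft_kA X Y Z : lft (kA X Y Z) = dalpha M (X, Y, Z).
Proof. refine (eq_trans (proj2 (cf_J imu ieta lmu leta (cf_a la X Y Z))) _); apply eps_lft. Qed.
Lemma lft_kl X : lft (kl X) = dlambda M X.
Proof. refine (eq_trans (proj2 (cf_J imu ieta lmu leta (cf_l ll X))) _); apply eps_lft. Qed.
Lemma lft_kr X : lft (kr X) = drho M X.
Proof. refine (eq_trans (proj2 (cf_J imu ieta lmu leta (cf_r lr X))) _); apply eps_lft. Qed.

(** Images of companion frames under [KL], spelled out to show that they depend only on the target
    object and the square, as [imap] requires; [kiR] does the same for [KR]. *)
Definition kiL (X Z : K) (e : dsq D) : dsq D :=
  img (LH X) Z (FS (LH X) e ∥ (eT X Z ÷ hidS (ei (X ⊗ Z) ∙ FV (LH X) (η Z ∙ rgt e)))).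
Definition kiR (X Z : K) (e : dsq D) : dsq D :=
  img (RH X) Z (FS (RH X) e ∥ (eS Z X ÷ hidS (ei (Z ⊗ X) ∙ FV (RH X) (η Z ∙ rgt e)))).

Lemma cf_KL X Y Z (f : @hom K Y Z) e : cf f e -> cf (KL X # f) (kiL X Z e) /\ lft (kiL X Z e) = FV (LH X) (lft e).
Proof. apply (img_cf axK axK (KL_ff X)). Qed.
Lemma cf_KR X Y Z (f : @hom K Y Z) e : cf f e -> cf (KR X # f) (kiR X Z e) /\ lft (kiR X Z e) = FV (RH X) (lft e).
Proof. apply (img_cf axK axK (KR_ff X)). Qed.

Definition KRR Y Z := compf_ff axK axK axK (KR_ff Y) (KR_ff Z).
Definition KLR X Z := compf_ff axK axK axK (KL_ff X) (KR_ff Z).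
Definition KRL X Z := compf_ff axK axK axK (KR_ff Z) (KL_ff X).
Definition KLL X Y := compf_ff axK axK axK (KL_ff Y) (KL_ff X).

Definition kn1 (Y Z : K) : psnat (compf (KR Y) (KR Z)) (KR (Y ⊗ Z)) (fun X => ka1 X Y Z) :=
  lift_psnat axK axK (ff_map (KRR Y Z)) (ff_map (KR_ff (Y ⊗ Z))) (RH_ax M (Y ⊗ Z)) (A1_strict M Y Z)
    (fun X => cf_ka X Y Z) (fun X => lft_kA X Y Z).
Definition kn2 (X Z : K) : psnat (compf (KL X) (KR Z)) (compf (KR Z) (KL X)) (fun Y => ka1 X Y Z) :=
  lift_psnat axK axK (ff_map (KLR X Z)) (ff_map (KRL X Z)) (ff_ax (KRL X Z)) (A2_strict M X Z)
    (fun Y => cf_ka X Y Z) (fun Y => lft_kA X Y Z).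
Definition kn3 (X Y : K) : psnat (KL (X ⊗ Y)) (compf (KL Y) (KL X)) (fun Z => ka1 X Y Z) :=
  lift_psnat axK axK (ff_map (KL_ff (X ⊗ Y))) (ff_map (KLL X Y)) (ff_ax (KLL X Y)) (A3_strict M X Y)
    (fun Z => cf_ka X Y Z) (fun Z => lft_kA X Y Z).
Definition knl : psnat (KL I) (idf K) kl1 :=
  lift_psnat axK axK (ff_map (KL_ff I)) (ff_map (idf_ff axK)) (did_ax D) (L_strict M) cf_kl lft_kl.
Definition knr : psnat (KR I) (idf K) kr1 :=
  lift_psnat axK axK (ff_map (KR_ff I)) (ff_map (idf_ff axK)) (did_ax D) (R_strict M) cf_kr lft_kr.

Lemma ok_p X Y Z W : okc ⟪KR W # ka1 X Y Z; ka1 X (Y ⊗ Z) W; KL X # ka1 Y Z W⟫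
  [kiR W (X ⊗ (Y ⊗ Z)) (kA X Y Z); kA X (Y ⊗ Z) W; kiL X (Y ⊗ (Z ⊗ W)) (kA Y Z W)].
Proof. split; [apply cf_KR, cf_ka|split; [apply cf_ka|split; [apply cf_KL, cf_ka|reflexivity]]]. Qed.
Lemma ok_p' X Y Z W : okc ⟪ka1 (X ⊗ Y) Z W; ka1 X Y (Z ⊗ W)⟫ [kA (X ⊗ Y) Z W; kA X Y (Z ⊗ W)].
Proof. split; [apply cf_ka|split; [apply cf_ka|reflexivity]]. Qed.
Lemma ok_m X Y : okc ⟪ka1 X I Y; KL X # kl1 Y⟫ [kA X I Y; kiL X Y (kl Y)].
Proof. split; [apply cf_ka|split; [apply cf_KL, cf_kl|reflexivity]]. Qed.
Lemma ok_m' X Y : okc ⟪KR Y # kr1 X⟫ [kiR Y X (kr X)].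
Proof. split; [apply cf_KR, cf_kr|reflexivity]. Qed.
Lemma ok_l X Y : okc ⟪ka1 I X Y; kl1 (X ⊗ Y)⟫ [kA I X Y; kl (X ⊗ Y)].
Proof. split; [apply cf_ka|split; [apply cf_kl|reflexivity]]. Qed.
Lemma ok_l' X Y : okc ⟪KR Y # kl1 X⟫ [kiR Y X (kl X)].
Proof. split; [apply cf_KR, cf_kl|reflexivity]. Qed.
Lemma ok_r X Y : okc ⟪ka1 X Y I; KL X # kr1 Y⟫ [kA X Y I; kiL X Y (kr Y)].
Proof. split; [apply cf_ka|split; [apply cf_KL, cf_kr|reflexivity]]. Qed.
Lemma ok_r' X Y : okc ⟪kr1 (X ⊗ Y)⟫ [kr (X ⊗ Y)].
Proof. split; [apply cf_kr|reflexivity]. Qed.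

Lemma lft_KA X Y Z W : lft (kiR W (X ⊗ (Y ⊗ Z)) (kA X Y Z)) = FV (dt M) (dalpha M (X, Y, Z), vid W).
Proof. rewrite (proj2 (cf_KR W (cf_ka X Y Z))), lft_kA; auto. Qed.
Lemma lft_AK X Y Z W : lft (kiL W (X ⊗ (Y ⊗ Z)) (kA X Y Z)) = FV (dt M) (vid W, dalpha M (X, Y, Z)).
Proof. rewrite (proj2 (cf_KL W (cf_ka X Y Z))), lft_kA; auto. Qed.

Lemma tot_p X Y Z W :
  tot [kiR W (X ⊗ (Y ⊗ Z)) (kA X Y Z); kA X (Y ⊗ Z) W; kiL X (Y ⊗ (Z ⊗ W)) (kA Y Z W)] (vid (X ⊗ (Y ⊗ (Z ⊗ W))))
  = tot [kA (X ⊗ Y) Z W; kA X Y (Z ⊗ W)] (vid (X ⊗ (Y ⊗ (Z ⊗ W)))).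
Proof.
cbn [tot]. rewrite lft_KA, lft_AK, !lft_kA, !ur.
- apply dpentagon.
- apply (va_cod (dalpha M)).
- rewrite FV_cod; cbn; rewrite ?vcod_id, (va_cod (dalpha M)); reflexivity.
Qed.
Lemma tot_m X Y : tot [kA X I Y; kiL X Y (kl Y)] (vid (X ⊗ Y)) = tot [kiR Y X (kr X)] (vid (X ⊗ Y)).
Proof.
cbn [tot]. rewrite (proj2 (cf_KL X (cf_kl Y))), (proj2 (cf_KR Y (cf_kr X))), lft_kA, lft_kl, lft_kr, !ur.
- refine (eq_trans _ (dmiddle M X Y)); reflexivity.
- rewrite FV_cod; cbn; rewrite (va_cod (drho M)), ?vcod_id; reflexivity.
- rewrite FV_cod; cbn; rewrite (va_cod (dlambda M)), ?vcod_id; reflexivity.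
Qed.
Lemma tot_l X Y : tot [kA I X Y; kl (X ⊗ Y)] (vid (X ⊗ Y)) = tot [kiR Y X (kl X)] (vid (X ⊗ Y)).
Proof.
cbn [tot]. rewrite (proj2 (cf_KR Y (cf_kl X))), lft_kA, !lft_kl, !ur.
- apply dleft.
- rewrite FV_cod; cbn; rewrite (va_cod (dlambda M)), ?vcod_id; reflexivity.
- apply (va_cod (dlambda M)).
Qed.
Lemma tot_r X Y : tot [kA X Y I; kiL X Y (kr Y)] (vid (X ⊗ Y)) = tot [kr (X ⊗ Y)] (vid (X ⊗ Y)).
Proof.
cbn [tot]. rewrite (proj2 (cf_KL X (cf_kr Y))), lft_kA, !lft_kr, !ur.
- apply dright.
- apply (va_cod (drho M)).
- rewrite FV_cod; cbn; rewrite (va_cod (drho M)), ?vcod_id; reflexivity.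
Qed.

(** The required equality of totals is the pentagon on objects here, and a unit triangle on objects
    for [km], [kll] and [krr]. *)
Definition kp X Y Z W := pick_can axK (ok_p X Y Z W) (ok_p' X Y Z W) (tot_p X Y Z W).
Definition km X Y := pick_can axK (ok_m X Y) (ok_m' X Y) (tot_m X Y).
Definition kll X Y := pick_can axK (ok_l X Y) (ok_l' X Y) (tot_l X Y).
Definition krr X Y := pick_can axK (ok_r X Y) (ok_r' X Y) (tot_r X Y).

Definition KP : premonoidal_data (B := K) (ten0 HM) (uni0 HM) :=
  {| pL := KL; pR := KR; pa := ka1; pl := kl1; pr := kr1;
     pa1 := kn1; pa2 := kn2; pa3 := kn3; pln := knl; prn := knr;
     pp := fun X Y Z W => proj1_sig (kp X Y Z W); pm := fun X Y => proj1_sig (km X Y);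
     pll := fun X Y => proj1_sig (kll X Y); prr := fun X Y => proj1_sig (krr X Y) |}.

Definition kn1_fn Y Z := lift_nat_fn axK axK (ff_map (KRR Y Z)) (ff_map (KR_ff (Y ⊗ Z))) (RH_ax M (Y ⊗ Z)) (A1_strict M Y Z)
    (fun X => cf_ka X Y Z) (fun X => lft_kA X Y Z).
Definition kn2_fn X Z := lift_nat_fn axK axK (ff_map (KLR X Z)) (ff_map (KRL X Z)) (ff_ax (KRL X Z)) (A2_strict M X Z)
    (fun Y => cf_ka X Y Z) (fun Y => lft_kA X Y Z).
Definition kn3_fn X Y := lift_nat_fn axK axK (ff_map (KL_ff (X ⊗ Y))) (ff_map (KLL X Y)) (ff_ax (KLL X Y)) (A3_strict M X Y)
    (fun Z => cf_ka X Y Z) (fun Z => lft_kA X Y Z).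
Definition knl_fn := lift_nat_fn axK axK (ff_map (KL_ff I)) (ff_map (idf_ff axK)) (did_ax D) (L_strict M) cf_kl lft_kl.
Definition knr_fn := lift_nat_fn axK axK (ff_map (KR_ff I)) (ff_map (idf_ff axK)) (did_ax D) (R_strict M) cf_kr lft_kr.

(** The inverse unitor of a composite factors through those of its parts, so the image of a
    companion frame can be taken in stages. *)
Lemma img_then {F0 G0 : K -> K} {F : psfun F0} {G : psfun G0} {Fh Gh : pdfun D D} {Fr Gr : forall X Y : K, hom X Y -> dsq D -> dsq D}
  (P : ffun ψ ψ F Fh Fr) (Q : ffun ψ ψ G Gh Gr) (X Y : K) (f : hom X Y) e : cf f e ->
  img (dcomp Fh Gh) Y (Gr _ _ (F # f) (Fr _ _ f e)) = img Gh (Fh Y) (Gr _ _ (F # f) (img Fh Y (Fr _ _ f e))).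
Proof.
intros h. assert (b := fm_bot (ff_map P) (cf_fr h)). rewrite (cf_bot h) in b.
assert (z := fm_fr (ff_map P) (cf_fr h)).
unfold img. rewrite (fm_post (ff_map Q) z) by (rewrite b; apply F2u'_top).
rewrite vA; auto.
- rewrite (fm_bot (ff_map Q) z), b, FS_top, F2u'_top; auto.
- rewrite FS_bot, F2u'_bot, F2u'_top; auto.
Qed.

Lemma canon_KP : canon (φ := ψ) KP kA kl kr kiL kiR.
Proof.
split.
- apply cf_ka.
- apply cf_kl.
- apply cf_kr.
- intros; apply cf_KL; auto.
- intros; apply cf_KR; auto.
- intros X Y Z p q c l l'; apply (can_fcell' axK (KL_ff X)); reflexivity.
- intros X Y Z p q c l l'; apply (can_fcell' axK (KR_ff X)); reflexivity.
- intros Y Z X X' f e h.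
  exact (can_conv (can_nat axK axK (KRR Y Z) (KR_ff (Y ⊗ Z)) (kn1_fn Y Z) (vn_unit (vt_vnat (A1_strict M Y Z))) h)
    (f_equal (fun z => [z; _]) (img_then (KR_ff Y) (KR_ff Z) h)) eq_refl).
- intros X Z Y Y' f e h.
  exact (can_conv (can_nat axK axK (KLR X Z) (KRL X Z) (kn2_fn X Z) (vn_unit (vt_vnat (A2_strict M X Z))) h)
    (f_equal (fun z => [z; _]) (img_then (KL_ff X) (KR_ff Z) h)) (f_equal (fun z => [_; z]) (img_then (KR_ff Z) (KL_ff X) h))).
- intros X Y Z Z' f e h.
  exact (can_conv (can_nat axK axK (KL_ff (X ⊗ Y)) (KLL X Y) (kn3_fn X Y) (vn_unit (vt_vnat (A3_strict M X Y))) h)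
    eq_refl (f_equal (fun z => [_; z]) (img_then (KL_ff Y) (KL_ff X) h))).
- intros X Z Y Y' f e h.
  exact (can_conv (can_nat' axK axK (KLR X Z) (KRL X Z) (kn2_fn X Z) (vn_unit (vt_vnat (A2_strict M X Z))) h)
    (f_equal (fun z => [_; z]) (img_then (KR_ff Z) (KL_ff X) h)) (f_equal (fun z => [z; _]) (img_then (KL_ff X) (KR_ff Z) h))).
- intros X Y Z Z' f e h.
  exact (can_conv (can_nat' axK axK (KL_ff (X ⊗ Y)) (KLL X Y) (kn3_fn X Y) (vn_unit (vt_vnat (A3_strict M X Y))) h)
    (f_equal (fun z => [_; z]) (img_then (KL_ff Y) (KL_ff X) h)) eq_refl).
- intros X Y Z W; apply (proj2 (proj2_sig (kp X Y Z W))).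
- intros X Y; apply (proj2 (proj2_sig (km X Y))).
- intros X Y; apply (proj2 (proj2_sig (kll X Y))).
- intros X Y; apply (proj2 (proj2_sig (krr X Y))).
Qed.

(** Every 1-cell with a companion frame is central: its vertical cell acts strictly on the other
    variable, and [lift_psnat] lifts this action with the images of [f] as components. *)
Definition kcl {X X' : K} (f : hom X X') e (h : cf f e) : psnat (KL X) (KL X') (fun Y => KR Y # f) :=
  lift_psnat axK axK (ff_map (KL_ff X)) (ff_map (KL_ff X')) (LH_ax M X')
    (CL_strict M (cf_dom axK h) (cf_cod h) (visoS_lft (cf_iso h)))
    (fun Y => proj1 (cf_KR Y h)) (fun Y => proj2 (cf_KR Y h)).
Definition kcr {X X' : K} (f : hom X X') e (h : cf f e) : psnat (KR X) (KR X') (fun Y => KL Y # f) :=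
  lift_psnat axK axK (ff_map (KR_ff X)) (ff_map (KR_ff X')) (RH_ax M X')
    (CR_strict M (cf_dom axK h) (cf_cod h) (visoS_lft (cf_iso h)))
    (fun Y => proj1 (cf_KL Y h)) (fun Y => proj2 (cf_KL Y h)).
Definition kcl_fn {X X' : K} (f : hom X X') e (h : cf f e) :=
  lift_nat_fn axK axK (ff_map (KL_ff X)) (ff_map (KL_ff X')) (LH_ax M X')
    (CL_strict M (cf_dom axK h) (cf_cod h) (visoS_lft (cf_iso h)))
    (fun Y => proj1 (cf_KR Y h)) (fun Y => proj2 (cf_KR Y h)).
Definition kcr_fn {X X' : K} (f : hom X X') e (h : cf f e) :=
  lift_nat_fn axK axK (ff_map (KR_ff X)) (ff_map (KR_ff X')) (RH_ax M X')
    (CR_strict M (cf_dom axK h) (cf_cod h) (visoS_lft (cf_iso h)))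
    (fun Y => proj1 (cf_KL Y h)) (fun Y => proj2 (cf_KL Y h)).

Definition kcentral {X X' : K} (f : hom X X') e (h : cf f e) : central KP f :=
  {| cen_l := (kcl h : psnat (pL KP X) (pL KP X') (fun Y => pR KP Y # f));
     cen_r := (kcr h : psnat (pR KP X) (pR KP X') (fun Y => pL KP Y # f));
     cen_l_psnat := framed_psnat axK axK (KL_ff X) (KL_ff X') (kcl_fn h)
       (vt_vnat (CL_strict M (cf_dom axK h) (cf_cod h) (visoS_lft (cf_iso h))));
     cen_r_psnat := framed_psnat axK axK (KR_ff X) (KR_ff X') (kcr_fn h)
       (vt_vnat (CR_strict M (cf_dom axK h) (cf_cod h) (visoS_lft (cf_iso h)))) |}.

Lemma kp1 Y Z W : is_inv_modif (fun X => pp KP X Y Z W)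
    (compn (postn (kn1 Y Z) (KR W)) (compn (kn1 (Y ⊗ Z) W) (kcr (cf_ka Y Z W))))
    (compn (pren (KR Y) (kn1 Z W)) (kn1 Y (Z ⊗ W))).
Proof.
eapply (modif_can axK axK) with
  (l := fun X => [kiR W (X ⊗ (Y ⊗ Z)) (kA X Y Z); kA X (Y ⊗ Z) W; kiL X (Y ⊗ (Z ⊗ W)) (kA Y Z W)])
  (l' := fun X => [kA (X ⊗ Y) Z W; kA X Y (Z ⊗ W)]).
- exact (fn_comp axK axK (fn_post axK axK axK (kn1_fn Y Z) (KR_ff W)) (fn_comp axK axK (kn1_fn (Y ⊗ Z) W) (kcr_fn (cf_ka Y Z W)))).
- exact (fn_comp axK axK (fn_pre (kn1_fn Z W) (ff_map (KR_ff Y)) axK (RH_ax M Y)) (kn1_fn Y (Z ⊗ W))).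
- intros X; exact (proj2_sig (kp X Y Z W)).
- intros X; apply ok_p.
- intros X; apply (cev_three axK (ok_p X Y Z W)).
- intros X; apply (cev_two axK (ok_p' X Y Z W)).
(* In the variable [X] the central structure of [ka1 Y Z W] contributes a tensor with the identity
   square of a vertical cell; what remains is the pentagon with comparison cells inserted. *)
- intros k; cbn beta. rewrite FSR, lft_kA. exact (f_equal (@tv _ _ _) (ah_p1 M Y Z W k)).
Qed.
Lemma kp2 X Z W : is_inv_modif (fun Y => pp KP X Y Z W)
    (compn (postn (kn2 X Z) (KR W)) (compn (pren (KR Z) (kn2 X W)) (postn (kn1 Z W) (KL X))))
    (compn (pren (KL X) (kn1 Z W)) (kn2 X (Z ⊗ W))).
Proof.
eapply (modif_can axK axK) with (l := fun Y => [kiR W (X ⊗ (Y ⊗ Z)) (kA X Y Z); kA X (Y ⊗ Z) W; kiL X (Y ⊗ (Z ⊗ W)) (kA Y Z W)]) (l' := fun Y => [kA (X ⊗ Y) Z W; kA X Y (Z ⊗ W)]).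
- exact (fn_comp axK axK (fn_post axK axK axK (kn2_fn X Z) (KR_ff W)) (fn_comp axK axK (fn_pre (kn2_fn X W) (ff_map (KR_ff Z)) axK (RH_ax M Z)) (fn_post axK axK axK (kn1_fn Z W) (KL_ff X)))).
- exact (fn_comp axK axK (fn_pre (kn1_fn Z W) (ff_map (KL_ff X)) axK (LH_ax M X)) (kn2_fn X (Z ⊗ W))).
- intros Y; exact (proj2_sig (kp X Y Z W)).
- intros Y; apply (ok_p X Y Z W).
- intros Y; apply (cev_three axK (ok_p X Y Z W)).
- intros Y; apply (cev_two axK (ok_p' X Y Z W)).
- intros k; cbn beta. rewrite FSR, FSL. exact (f_equal (@tv _ _ _) (ah_p2 M X Z W k)).
Qed.

Lemma kp3 X Y W : is_inv_modif (fun Z => pp KP X Y Z W)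
    (compn (postn (kn3 X Y) (KR W)) (compn (pren (KL Y) (kn2 X W)) (postn (kn2 Y W) (KL X))))
    (compn (kn2 (X ⊗ Y) W) (pren (KR W) (kn3 X Y))).
Proof.
eapply (modif_can axK axK) with (l := fun Z => [kiR W (X ⊗ (Y ⊗ Z)) (kA X Y Z); kA X (Y ⊗ Z) W; kiL X (Y ⊗ (Z ⊗ W)) (kA Y Z W)]) (l' := fun Z => [kA (X ⊗ Y) Z W; kA X Y (Z ⊗ W)]).
- exact (fn_comp axK axK (fn_post axK axK axK (kn3_fn X Y) (KR_ff W)) (fn_comp axK axK (fn_pre (kn2_fn X W) (ff_map (KL_ff Y)) axK (LH_ax M Y)) (fn_post axK axK axK (kn2_fn Y W) (KL_ff X)))).
- exact (fn_comp axK axK (kn2_fn (X ⊗ Y) W) (fn_pre (kn3_fn X Y) (ff_map (KR_ff W)) axK (RH_ax M W))).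
- intros Z; exact (proj2_sig (kp X Y Z W)).
- intros Z; apply (ok_p X Y Z W).
- intros Z; apply (cev_three axK (ok_p X Y Z W)).
- intros Z; apply (cev_two axK (ok_p' X Y Z W)).
- intros k; cbn beta. rewrite FSR, FSL. exact (f_equal (@tv _ _ _) (ah_p3 M X Y W k)).
Qed.

Lemma kp4 X Y Z : is_inv_modif (fun W => pp KP X Y Z W)
    (compn (kcl (cf_ka X Y Z)) (compn (kn3 X (Y ⊗ Z)) (postn (kn3 Y Z) (KL X))))
    (compn (kn3 (X ⊗ Y) Z) (pren (KL Z) (kn3 X Y))).
Proof.
eapply (modif_can axK axK) with (l := fun W => [kiR W (X ⊗ (Y ⊗ Z)) (kA X Y Z); kA X (Y ⊗ Z) W; kiL X (Y ⊗ (Z ⊗ W)) (kA Y Z W)]) (l' := fun W => [kA (X ⊗ Y) Z W; kA X Y (Z ⊗ W)]).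
- exact (fn_comp axK axK (kcl_fn (cf_ka X Y Z)) (fn_comp axK axK (kn3_fn X (Y ⊗ Z)) (fn_post axK axK axK (kn3_fn Y Z) (KL_ff X)))).
- exact (fn_comp axK axK (kn3_fn (X ⊗ Y) Z) (fn_pre (kn3_fn X Y) (ff_map (KL_ff Z)) axK (LH_ax M Z))).
- intros W; exact (proj2_sig (kp X Y Z W)).
- intros W; apply (ok_p X Y Z W).
- intros W; apply (cev_three axK (ok_p X Y Z W)).
- intros W; apply (cev_two axK (ok_p' X Y Z W)).
- intros k; cbn beta. rewrite FSL, lft_kA. exact (f_equal (@tv _ _ _) (ah_p4 M X Y Z k)).
Qed.

Lemma km1 Y : is_inv_modif (fun X => pm KP X Y)
    (compn (kn1 I Y) (kcr (cf_kl Y)))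
    (postn knr (KR Y)).
Proof.
eapply (modif_can axK axK) with (l := fun X => [kA X I Y; kiL X Y (kl Y)]) (l' := fun X => [kiR Y X (kr X)]).
- exact (fn_comp axK axK (kn1_fn I Y) (kcr_fn (cf_kl Y))).
- exact (fn_post axK axK axK knr_fn (KR_ff Y)).
- intros X; exact (proj2_sig (km X Y)).
- intros X; apply (ok_m X Y).
- intros X; apply (cev_two axK (ok_m X Y)).
- intros X; symmetry; apply (cev_one (φ := ψ)); apply (ok_m' X Y).
- intros k; cbn beta. rewrite FSR, lft_kl. exact (f_equal (@tv _ _ _) (ah_m1 M Y k)).
Qed.

Lemma km2 X : is_inv_modif (fun Y => pm KP X Y)
    (compn (kn3 X I) (postn knl (KL X)))
    (kcl (cf_kr X)).
Proof.
eapply (modif_can axK axK) with (l := fun Y => [kA X I Y; kiL X Y (kl Y)]) (l' := fun Y => [kiR Y X (kr X)]).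
- exact (fn_comp axK axK (kn3_fn X I) (fn_post axK axK axK knl_fn (KL_ff X))).
- exact (kcl_fn (cf_kr X)).
- intros Y; exact (proj2_sig (km X Y)).
- intros Y; apply (ok_m X Y).
- intros Y; apply (cev_two axK (ok_m X Y)).
- intros Y; symmetry; apply (cev_one (φ := ψ)); apply (ok_m' X Y).
- intros k; cbn beta. rewrite FSL, lft_kr. exact (f_equal (@tv _ _ _) (ah_m2 M X k)).
Qed.

Lemma kll_1 Y : is_inv_modif (fun X => pll KP X Y)
    (compn (kn2 I Y) (pren (KR Y) knl))
    (postn knl (KR Y)).
Proof.
eapply (modif_can axK axK) with (l := fun X => [kA I X Y; kl (X ⊗ Y)]) (l' := fun X => [kiR Y X (kl X)]).
- exact (fn_comp axK axK (kn2_fn I Y) (fn_pre knl_fn (ff_map (KR_ff Y)) axK (RH_ax M Y))).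
- exact (fn_post axK axK axK knl_fn (KR_ff Y)).
- intros X; exact (proj2_sig (kll X Y)).
- intros X; apply (ok_l X Y).
- intros X; apply (cev_two axK (ok_l X Y)).
- intros X; symmetry; apply (cev_one (φ := ψ)); apply (ok_l' X Y).
- intros k; cbn beta. rewrite FSR. exact (f_equal (@tv _ _ _) (ah_l1 M Y k)).
Qed.

Lemma kll_2 X : is_inv_modif (fun Y => pll KP X Y)
    (compn (kn3 I X) (pren (KL X) knl))
    (kcl (cf_kl X)).
Proof.
eapply (modif_can axK axK) with (l := fun Y => [kA I X Y; kl (X ⊗ Y)]) (l' := fun Y => [kiR Y X (kl X)]).
- exact (fn_comp axK axK (kn3_fn I X) (fn_pre knl_fn (ff_map (KL_ff X)) axK (LH_ax M X))).
- exact (kcl_fn (cf_kl X)).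
- intros Y; exact (proj2_sig (kll X Y)).
- intros Y; apply (ok_l X Y).
- intros Y; apply (cev_two axK (ok_l X Y)).
- intros Y; symmetry; apply (cev_one (φ := ψ)); apply (ok_l' X Y).
- intros k; cbn beta. rewrite lft_kl. exact (f_equal (@tv _ _ _) (ah_l2 M X k)).
Qed.

Lemma krr_1 Y : is_inv_modif (fun X => prr KP X Y)
    (compn (kn1 Y I) (kcr (cf_kr Y)))
    (pren (KR Y) knr).
Proof.
eapply (modif_can axK axK) with (l := fun X => [kA X Y I; kiL X Y (kr Y)]) (l' := fun X => [kr (X ⊗ Y)]).
- exact (fn_comp axK axK (kn1_fn Y I) (kcr_fn (cf_kr Y))).
- exact (fn_pre knr_fn (ff_map (KR_ff Y)) axK (RH_ax M Y)).
- intros X; exact (proj2_sig (krr X Y)).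
- intros X; apply (ok_r X Y).
- intros X; apply (cev_two axK (ok_r X Y)).
- intros X; symmetry; apply (cev_one (φ := ψ)); apply (ok_r' X Y).
- intros k; cbn beta. rewrite lft_kr. exact (f_equal (@tv _ _ _) (ah_r1 M Y k)).
Qed.

Lemma krr_2 X : is_inv_modif (fun Y => prr KP X Y)
    (compn (kn2 X I) (postn knr (KL X)))
    (pren (KL X) knr).
Proof.
eapply (modif_can axK axK) with (l := fun Y => [kA X Y I; kiL X Y (kr Y)]) (l' := fun Y => [kr (X ⊗ Y)]).
- exact (fn_comp axK axK (kn2_fn X I) (fn_post axK axK axK knr_fn (KL_ff X))).
- exact (fn_pre knr_fn (ff_map (KL_ff X)) axK (LH_ax M X)).
- intros Y; exact (proj2_sig (krr X Y)).
- intros Y; apply (ok_r X Y).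
- intros Y; apply (cev_two axK (ok_r X Y)).
- intros Y; symmetry; apply (cev_one (φ := ψ)); apply (ok_r' X Y).
- intros k; cbn beta. rewrite FSL. exact (f_equal (@tv _ _ _) (ah_r2 M X k)).
Qed.

Context (la' : inverse_liftable (dalpha M)) (ll' : inverse_liftable (dlambda M)) (lr' : inverse_liftable (drho M)).

(** As in [hat_equiv], with the companion of the vertical inverse followed by [η] as weak inverse;
    [cf_J] preserves left sides, so they still cancel. *)
Lemma J_equiv {C : double_category} {F G : pdfun C D} (a : vtrans F G) (i : invertible a)
  (j : inverse_liftable a) (A : dob C) (f : @hom K (F A) (G A)) e : cf f e -> lft e = a A -> is_equivalence f.
Proof.
intros h l. destruct (va_iso i A) as (v & v1 & v2 & v3 & v4).
rewrite va_cod in v1, v4; rewrite va_dom in v2, v3.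
destruct (j A v v1 v2 v3 v4) as [c].
assert (k1 : hdom (cmp c) = G A) by (rewrite cmp_dom; auto).
assert (k2 : hcod (cmp c) = F A) by (rewrite cmp_cod; auto).
assert (W : viso v) by (exists (a A); rewrite va_dom, va_cod, v1, v2; auto).
assert (h' : Submission.cf (φ := φ1) ({| hval := cmp c; hval_dom := k1; hval_cod := k2 |} : @hom HD (G A) (F A)) (eps c)).
{ split.
  - apply frH; auto; [apply eps_top|]. rewrite eps_rgt, v2; auto.
  - rewrite eps_bot, v2; auto.
  - apply visoS_eps, W. }
destruct (cf_J imu ieta lmu leta h') as [q q'].
apply (can_equiv axK h q); rewrite l, q', eps_lft; auto.
Qed.

Definition KP_premonoidal : is_premonoidal KP.
Proof.
refine (@Build_is_premonoidal K (ten0 HM) (uni0 HM) KP (framed_bicat axK)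
  (fun X => framed_psfun axK axK (KL_ff X)) (fun X => framed_psfun axK axK (KR_ff X))
  (fun Y Z => framed_psnat axK axK (KRR Y Z) (KR_ff (Y ⊗ Z)) (kn1_fn Y Z) (vt_vnat (A1_strict M Y Z)))
  (fun X Z => framed_psnat axK axK (KLR X Z) (KRL X Z) (kn2_fn X Z) (vt_vnat (A2_strict M X Z)))
  (fun X Y => framed_psnat axK axK (KL_ff (X ⊗ Y)) (KLL X Y) (kn3_fn X Y) (vt_vnat (A3_strict M X Y)))
  (framed_psnat axK axK (KL_ff I) (idf_ff axK) knl_fn (vt_vnat (L_strict M)))
  (framed_psnat axK axK (KR_ff I) (idf_ff axK) knr_fn (vt_vnat (R_strict M)))
  _ _ _
  (fun X Y Z => kcentral (cf_ka X Y Z)) (fun X => kcentral (cf_kl X)) (fun X => kcentral (cf_kr X))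
  kp1 kp2 kp3 kp4 km1 km2 kll_1 kll_2 krr_1 krr_2
  (canon_cocycle axK canon_KP) (canon_norm_l axK canon_KP) (canon_norm_r axK canon_KP)).
- intros X Y Z; exact (J_equiv (C := dprodD (dprodD D D) D) (dalpha_inv M) la' (A := (X, Y, Z)) (cf_ka X Y Z) (lft_kA X Y Z)).
- intros X; exact (J_equiv (dlambda_inv M) ll' (A := X) (cf_kl X) (lft_kl X)).
- intros X; exact (J_equiv (drho_inv M) lr' (A := X) (cf_kr X) (lft_kr X)).
Qed.
End KleisliPremonoidal.

(** * The bistrong pseudomonad and its premonoidal Kleisli bicategory *)

Theorem corollary10p34 (D : double_category) (M : monoidal_double D) (T : vertical_monad D)
  (t : left_vstrength M T) (s : right_vstrength M T) (ts : vertically_bistrong t s)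
  (la : liftable (dalpha M)) (ll : liftable (dlambda M)) (lr : liftable (drho M))
  (la' : inverse_liftable (dalpha M)) (ll' : inverse_liftable (dlambda M))
  (lr' : inverse_liftable (drho M))
  (it : invertible t) (lt : liftable t)
  (is : invertible s) (ls : liftable s)
  (imu : invertible (dmu T)) (lmu : liftable (dmu T))
  (ieta : invertible (deta T)) (leta : liftable (deta T)) :
  let HM := Hmonoidal la ll lr in
  let HT := Hmonad imu ieta lmu leta in
  let t' := Hlstr la ll lr imu ieta lmu leta it lt in
  let s' := Hrstr la ll lr imu ieta lmu leta is ls in
  (is_monoidal HM /\ is_pseudomonad HT /\ inhabited (bistrong t' s')) /\
  kleisli_agree imu ieta lmu leta /\
  exists P : premonoidal_data (B := kleisli HT) (ten0 HM) (uni0 HM),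
    inhabited (is_premonoidal P) /\
    (forall (X Y Z : Horiz D) (f : hom Y (S0 HT Z)),
       pL P X # (f : @hom (kleisli HT) Y Z)
       = peval ⟪ten HM # ⟨id1 X, f⟩; Hlstr1 lt X Z⟫) /\
    (forall (X Y Z : Horiz D) (f : hom X (S0 HT Z)),
       pR P Y # (f : @hom (kleisli HT) X Z)
       = peval ⟪ten HM # ⟨f, id1 Y⟩; Hrstr1 ls Z Y⟫).
Proof.
intros HM HT t' s'.
split; [split; [|split]|split].
- exact (Hmonoidal_ax la ll lr la' ll' lr').
- apply Hmonad_ax.
- exact (bistrong_ex la ll lr imu ieta lmu leta it lt is ls ts).
- apply kleisli_agree_holds.
- exists (KP la ll lr imu ieta lmu leta it lt is ls).
  (* [KL] and [KR] are built on [kext], so both formulas for the action on 1-cells hold by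
     reduction. *)
  split; [|split; reflexivity].
  exact (inhabits (KP_premonoidal la ll lr imu ieta lmu leta it lt is ls la' ll' lr')).
Qed.
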